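(* Let $\kappa$ be a non-zero positive Radon measure on $\mathbb R$, let $G(x,y)=u_\uparrow(x\wedge y)u_\downarrow(x\vee y)$ be the Green's function of $\frac12\frac{d^2}{dx^2}-\kappa$ on $\mathbb R$, and let $\mathcal Y_\infty$ be the random set of killing points produced by Wilson's algorithm (described in the context) applied to the Brownian motion on $\mathbb R$ with killing measure $\kappa$. If $\int_{(0,+\infty)}x\,\kappa(dx)<+\infty$, then almost surely $\#(\mathcal Y_\infty\cap(0,+\infty))$ is finite; moreover $$\mathbb E[\#(\mathcal Y_\infty\cap(0,+\infty))]=\int_{(0,+\infty)}G(x,x)\kappa(dx)<+\infty .$$ If $\int_{(0,+\infty)}x\,\kappa(dx)=+\infty$, then almost surely $\#(\mathcal Y_\infty\cap(0,+\infty))=+\infty$. In general, for all $a\in\mathbb R$, $$\mathbb P(\mathcal Y_\infty\cap(a,+\infty)=\emptyset)=u_\downarrow(+\infty)\int_{(-\infty,a]}u_\uparrow(x)\kappa(dx).$$ Similarly, if $\int_{\mathbb R}|x|\kappa(dx)<+\infty$, then a.s. $\#\mathcal Y_\infty$ is finite and $\mathbb E[\#\mathcal Y_\infty]=\int_{\mathbb R}G(x,x)\kappa(dx)<+\infty$. If $\int_{\mathbb R}|x|\kappa(dx)=+\infty$, then a.s. $\#\mathcal Y_\infty=+\infty$.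
   Context: Brownian motion with killing measure $\kappa$: a standard Brownian motion $B$ killed at the time $\zeta$ when $\int_{\mathbb R}\ell^x_t(B)\kappa(dx)$ ($\ell^x_t$ local times relative to Lebesgue measure) reaches an independent exponential variable of parameter $1$. $G(x,y)=\mathbb E_x[\ell^y_\zeta(B)]$; $u_\uparrow$ (non-decreasing) and $u_\downarrow$ (non-increasing) are positive solutions of $\frac12\frac{d^2u}{dx^2}-u\kappa=0$ normalized so that $u_\downarrow\frac{du_\uparrow}{dx}-u_\uparrow\frac{du_\downarrow}{dx}=2$; $u_\downarrow(+\infty)=\lim_{x\to+\infty}u_\downarrow(x)$. Wilson's algorithm. Let $(x_n)_{n\ge1}$ be a dense sequence of pairwise distinct points of $\mathbb R$ (the law of the output does not depend on its choice). $(B^{(x_n)}_t)_{0\le t<\zeta_n}$, $n\ge1$, are independent Brownian motions with killing measure $\kappa$ started from $x_n$; $[a,b]$ denotes the closed interval between $a$ and $b$ in either order. Set $T_1=\zeta_1$, $\mathcal Y_1=\{B^{(x_1)}_{T_1^-}\}$, $\mathcal J_1=\{[x_1,B^{(x_1)}_{T_1^-}]\}$. Given $(\mathcal Y_n,\mathcal J_n)$: if $x_{n+1}\in\bigcup_{J\in\mathcal J_n}J$, set $\mathcal Y_{n+1}=\mathcal Y_n$, $\mathcal J_{n+1}=\mathcal J_n$. Otherwise let $T_{n+1}=\min\big(\zeta_{n+1},\inf\{t\ge0:B^{(x_{n+1})}_t\in\bigcup_{J\in\mathcal J_n}J\}\big)$ and $p=B^{(x_{n+1})}_{T_{n+1}^-}$.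 If $p\in J$ for a (unique) $J\in\mathcal J_n$, set $\mathcal Y_{n+1}=\mathcal Y_n$ and $\mathcal J_{n+1}=(\mathcal J_n\setminus\{J\})\cup\{J\cup[x_{n+1},p]\}$; otherwise set $\mathcal Y_{n+1}=\mathcal Y_n\cup\{p\}$, $\mathcal J_{n+1}=\mathcal J_n\cup\{[x_{n+1},p]\}$. Finally $\mathcal Y_\infty=\bigcup_{n\ge1}\mathcal Y_n$. *)

(* Defs.v *)
From HB Require Import structures.
From mathcomp Require Import all_boot all_order all_algebra.
From mathcomp Require Import all_classical all_reals all_analysis.
From mathcomp Require Import measurable_realfun.

Set Implicit Arguments.
Unset Strict Implicit.
Unset Printing Implicit Defensive.

Import Order.TTheory GRing.Theory Num.Theory.
Import numFieldNormedType.Exports.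

Local Open Scope classical_set_scope.
Local Open Scope ring_scope.

Section probability.
Context {R : realType} {d : measure_display} {Om : measurableType d}.
Variable P : probability Om R.

(* Countably many almost sure properties enter the construction of the random
   set, so its events and functionals are measurable only with respect to the
   P-completion of the sigma-algebra of Om. The two definitions below say that
   an event (resp. a functional) belongs to that completion, and has
   probability (resp. expectation) v there. *)
Definition completed_probability (E : set Om) (v : \bar R) :=
  exists2 F : set Om, measurable F &
    {ae P, forall w, E w <-> F w} /\ P F = v.

Definition completed_expectation (f : Om -> \bar R) (v : \bar R) :=
  exists2 g : Om -> \bar R, measurable_fun setT g &
    {ae P, forall w, f w = g w} /\ (\int[P]_w g w)%E = v.

Definition sigma_rv (X : Om -> R) : set (set Om) :=
  preimage_set_system setT X measurable.

Definition sigma_process (X : R -> Om -> R) (D : set R) : set (set Om) :=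
  <<s \bigcup_(t in D) sigma_rv (X t) >>.

Definition mutually_independent (I : choiceType) (F : I -> set (set Om)) :=
  forall (s : seq I) (E : I -> set Om), uniq s ->
    (forall i, i \in s -> F i (E i)) ->
    P (\bigcap_(i in [set` s]) E i) = (\prod_(i <- s) P (E i))%E.

(* Processes are indexed by R, but only times t >= 0 are constrained. *)
Definition brownian_motion (x : R) (B : R -> Om -> R) :=
  [/\ forall t, 0 <= t -> measurable_fun setT (B t),
      {ae P, forall w, B 0 w = x},
      {ae P, forall w, {within `[0, +oo[, continuous (fun t => B t w)}},
      (* normal_prob takes the standard deviation *)
      forall s t : R, 0 <= s -> s < t -> forall A : set R, measurable A ->
        P [set w | A (B t w - B s w)] = normal_prob 0 (Num.sqrt (t - s)) A &
      forall s t : R, 0 <= s -> s < t -> forall (E : set Om) (A : set R),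
        sigma_process B `[0, s] E -> measurable A ->
        let F := [set w | A (B t w - B s w)] in
        P (E `&` F) = (P E * P F)%E].

(* L t y is the local time at level y up to time t: the jointly continuous
   density of the occupation measure with respect to Lebesgue measure. *)
Definition local_time (B : R -> Om -> R) (L : R -> R -> Om -> R) :=
  [/\ forall t y, 0 <= t -> measurable_fun setT (L t y),
      {ae P, forall w, {within [set z : R * R | 0 <= z.1],
                          continuous (fun z : R * R => L z.1 z.2 w)}},
      {ae P, forall w t y, 0 <= t -> 0 <= L t y w} &
      {ae P, forall w (t : R) (A : set R), 0 <= t -> measurable A ->
        lebesgue_measure [set s | 0 <= s <= t /\ A (B s w)] =
        (\int[lebesgue_measure]_(y in A) (L t y w)%:E)%E}].

Definition exponential_rv (rate : R) (e : Om -> R) :=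
  measurable_fun setT e /\
  forall A : set R, measurable A -> P (e @^-1` A) = exponential_prob rate A.

End probability.

Section killing.
Context {R : realType}.
Variable kappa : {measure set (measurableTypeR R) -> \bar R}.

Definition radon := forall K : set R, compact K -> (kappa K < +oo)%E.

(* l t y is the local time of one path, e the exponential threshold. *)
Definition killing_time (l : R -> R -> R) (e : R) : \bar R :=
  ereal_inf [set t%:E | t in
    [set t | 0 <= t /\ (e%:E <= \int[kappa]_y (l t y)%:E)%E]].

Definition rderive (u : R -> R) (x : R) : R :=
  lim (h^-1 * (u (x + h) - u x) @[h --> 0^'+]).

(* (1/2) u'' - u kappa = 0, as an equality of measures: u is continuous, has a
   right derivative at every point, and u'' is the Stieltjes measure of the
   right-continuous function rderive u. *)
Definition killed_ode (u : R -> R) :=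
  [/\ continuous u,
      forall x, cvg (h^-1 * (u (x + h) - u x) @[h --> 0^'+]) &
      forall a b, a <= b ->
        (2^-1 * (rderive u b - rderive u a))%:E =
        (\int[kappa]_(y in `]a, b]) (u y)%:E)%E].

End killing.

Definition green {R : realType} (u_up u_down : R -> R) (x y : R) : R :=
  u_up (Num.min x y) * u_down (Num.max x y).

Section wilson.
Context {R : realType}.

Definition seg (x y : R) : set R := `[Num.min x y, Num.max x y].

Definition hitting_time (b : R -> R) (U : set R) : \bar R :=
  ereal_inf [set t%:E | t in [set t | 0 <= t /\ U (b t)]].

(* One step, from the state (Y_n, J_n), with a path b started from x and killed
   at time zeta. Since b is continuous on [0, +oo), its left limit at T is
   b T. When T = +oo, a null event, p is b 0. *)
Definition wilson_step (x : R) (b : R -> R) (zeta : \bar R)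
    (st : set R * set (set R)) : set R * set (set R) :=
  let: (Y, Js) := st in
  let U := \bigcup_(J in Js) J in
  if x \in U then (Y, Js) else
  let T := mine zeta (hitting_time b U) in
  let p := b (fine T) in
  if p \in U then
    let J := xget set0 [set J | Js J /\ J p] in
    (Y, (Js `\ J) `|` [set J `|` seg x p])
  else (Y `|` [set p], Js `|` [set seg x p]).

(* The state after n walks. From the empty state hitting_time is +oo, so the
   first step gives ({b (zeta)}, {[x 0, b (zeta)]}). *)
Fixpoint wilson (x : nat -> R) (b : nat -> R -> R) (zeta : nat -> \bar R)
    (n : nat) : set R * set (set R) :=
  if n is m.+1 then wilson_step (x m) (b m) (zeta m) (wilson x b zeta m)
  else (set0, set0).

Definition wilson_points (x : nat -> R) (b : nat -> R -> R)
    (zeta : nat -> \bar R) : set R :=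
  \bigcup_n (wilson x b zeta n).1.

End wilson.

(* The random set of killing points, the n-th walk having local time L n and
   exponential threshold e n. *)
Definition killing_points {R : realType} {Om : Type}
    (kappa : {measure set (measurableTypeR R) -> \bar R}) (x : nat -> R)
    (B : nat -> R -> Om -> R) (L : nat -> R -> R -> Om -> R)
    (e : nat -> Om -> R) (w : Om) : set R :=
  wilson_points x (fun n t => B n t w)
    (fun n => killing_time kappa (fun t y => L n t y w) (e n w)).

(* Main.v *)
(* Almost surely, Wilson's algorithm only sees the union of the intervals built
   so far. If this union leaves the gap ]a, c[ around x_n, then the n-th walk is
   killed in dy with probability g(x_n, y) kappa(dy), where g is the Green
   function of the gap with zero boundary values; this comes from a Dynkin
   formula for the killed walk, proved by discretising its path. For fixed y, the
   value at (y, y) of the Green function of the gap around y (0 once y is covered)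
   plus the densities at y of the killing points found so far is a martingale.
   It starts from G(y, y), and its first term tends to 0 because the starting
   points are dense, so the intensity of the killing points is G(y, y) kappa(dy).
   Likewise the event that ]t, +oo[ contains no killing point is followed by a
   martingale started from u_up'(t) / 2, the integral of u_up over ]-oo, t]; it is
   the inverse of u_down at the right end of the union, on the event, as soon as
   this end exceeds t. Hence the probability of the event, which is zero for all t
   exactly when u_down(+oo) = 0, as is the case when the first moment of kappa on
   ]0, +oo[ is infinite. *)
Require Import Defs.
From HB Require Import structures.
From mathcomp Require Import all_boot all_order all_algebra.
From mathcomp Require Import all_classical all_reals all_analysis.
From mathcomp Require Import measurable_realfun ring lra.

Set Implicit Arguments.
Unset Strict Implicit.
Unset Printing Implicit Defensive.

Import Order.TTheory GRing.Theory Num.Theory.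
Import numFieldNormedType.Exports.

Local Open Scope classical_set_scope.
Local Open Scope ring_scope.

(** The increments of a walk enter only through their independence and normality. The test functions
    satisfy (1/2) f'' = r kappa, so f'' is a measure: they are mollified by a triangle kernel before
    the Taylor expansion, and the same kernel turns time integrals along the path into local times.
    Three limits result, in this order: the fine mesh, the kernel width, then the coarse mesh of the
    clock. The ranks depend on the path, so they are exchanged with the expectation through iterated
    upper limits.

    For f z = (y - z)^+ + G(z, y) / 2 one has f - r = (y - z)^+, so Dynkin's formula gives the
    expectation of (y - p)^+ for the final position p, and its right derivative in y is the
    distribution function of p. Unbounded gaps are limits of bounded ones, which also shows that the
    killing time is finite.

    The final position is a measurable upper limit of explicit sums, equal to the true one on almost
    every path. To the left of the union only a probability 0 is wanted, and a supermartingale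
    suffices. *)

Local Notation borel_measure R := {measure set (measurableTypeR R) -> \bar R}.
Local Notation mfun := (measurable_fun setT).

(** * Expectations of real functions and integrals against a density *)

Section integrable_real.
Context d (T : measurableType d) (R : realType) (mu : {measure set T -> \bar R}).
Variables (D : set T) (mD : measurable D).
Implicit Types f g : T -> R.

Lemma integrableMl_real f (c : R) : mu.-integrable D (EFin \o f) ->
  mu.-integrable D (EFin \o (fun x => c * f x)).
Proof. exact: integrableZl. Qed.

Lemma integrableD_real f g : mu.-integrable D (EFin \o f) ->
  mu.-integrable D (EFin \o g) ->
  mu.-integrable D (EFin \o (fun x => f x + g x)).
Proof. exact: integrableD. Qed.

Lemma integrableB_real f g : mu.-integrable D (EFin \o f) ->
  mu.-integrable D (EFin \o g) ->
  mu.-integrable D (EFin \o (fun x => f x - g x)).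
Proof. exact: integrableB. Qed.

Lemma integrable_sum_real (I : eqType) (s : seq I) (f : I -> T -> R) :
  (forall i, i \in s -> mu.-integrable D (EFin \o f i)) ->
  mu.-integrable D (EFin \o (fun x => \sum_(i <- s) f i x)).
Proof.
elim: s => [|i s IH] h.
  rewrite (_ : _ \o _ = cst 0%E); first exact: integrable0.
  by apply/funext => x; rewrite /= big_nil.
rewrite (_ : _ \o _ = EFin \o (fun x => f i x + \sum_(j <- s) f j x)).
  apply: integrableD_real; first by apply: h; rewrite mem_head.
  by apply: IH => j js; apply: h; rewrite inE js orbT.
by apply/funext => x; rewrite /= big_cons.
Qed.

Lemma Rintegral_sum_real (I : eqType) (s : seq I) (f : I -> T -> R) :
  (forall i, i \in s -> mu.-integrable D (EFin \o f i)) ->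
  \int[mu]_(x in D) (\sum_(i <- s) f i x) = \sum_(i <- s) \int[mu]_(x in D) f i x.
Proof.
elim: s => [|i s IH] h.
  rewrite big_nil (@eq_Rintegral _ _ _ _ _ (cst 0)) ?Rintegral_cst ?mul0r//.
  by move=> x _; rewrite big_nil.
rewrite big_cons -IH; last by move=> j js; apply: h; rewrite inE js orbT.
rewrite -RintegralD//; last 2 first.
- by apply: h; rewrite mem_head.
- by apply: integrable_sum_real => j js; apply: h; rewrite inE js orbT.
by apply: eq_Rintegral => x _; rewrite big_cons.
Qed.

End integrable_real.

Lemma integral_cst_prob d (T : measurableType d) (R : realType) (P : probability T R) (k : R) :
  (\int[P]_x k%:E = k%:E)%E.
Proof. by rewrite integral_cst// [X in (_ * X)%E](probability_setT P : _ = _) mule1. Qed.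

Lemma Rintegral_cst_prob d (T : measurableType d) (R : realType)
  (P : probability T R) (r : R) : \int[P]_x r = r.
Proof. by rewrite /Rintegral integral_cst_prob. Qed.

Section density.
Context d (T : measurableType d) (R : realType).
Variables (mu nu : {measure set T -> \bar R}) (g : T -> R).
Hypotheses (mg : mfun g) (g0 : forall x, 0 <= g x)
  (nuE : forall A, measurable A -> nu A = (\int[mu]_(x in A) (g x)%:E)%E).

Import HBNNSimple.

(** For an indicator the identity is [nuE]; linearity gives it for simple functions and monotone
    convergence for the others. *)
Lemma ge0_integral_density (f : T -> \bar R) : mfun f ->
  (forall x, 0 <= f x)%E ->
  (\int[nu]_x f x = \int[mu]_x (f x * (g x)%:E))%E.
Proof.
move=> mf f0; pose f_ := nnsfun_approx measurableT mf.
transitivity (limn (fun n => \int[nu]_x (f_ n x)%:E)%E).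
  rewrite -monotone_convergence//=.
  - apply: eq_integral => ? /[!inE] xD; apply/esym/cvg_lim => //=.
    exact: cvg_nnsfun_approx.
  - by move=> n; exact/measurable_EFinP/measurable_funTS.
  - by move=> n ? _; rewrite lee_fin.
  - by move=> ? _ ? ? mn; rewrite lee_fin; exact/lefP/nd_nnsfun_approx.
transitivity (limn (fun n => \int[mu]_x ((f_ n x)%:E * (g x)%:E))%E); last first.
  rewrite -monotone_convergence//=.
  - apply: eq_integral => x _; apply/cvg_lim => //=.
    by apply: cvgeZr => //; exact: cvg_nnsfun_approx.
  - move=> n; apply: emeasurable_funM => //;
      exact/measurable_EFinP/measurable_funTS.
  - by move=> n x _; rewrite mule_ge0// lee_fin.
  - move=> x _ ? ? mn; rewrite lee_wpmul2r ?lee_fin//.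
    exact/lefP/nd_nnsfun_approx.
apply: congr_lim; apply/funext => n.
have fE x : (f_ n x)%:E =
    (\sum_(y \in range (f_ n)) (y * \1_(f_ n @^-1` [set y]) x)%:E)%E.
  by rewrite fsumEFin// -fimfunE.
under eq_integral do rewrite fE.
under [RHS]eq_integral do rewrite fE.
have mi y : measurable_fun [set: T] (fun x => y * \1_(f_ n @^-1` [set y]) x).
  by apply: measurable_funM => //; exact: measurable_indic.
rewrite ge0_integral_fsum//; last 2 first.
  - by move=> y; exact/measurable_EFinP.
  - by move=> y x _; rewrite EFinM nnfun_muleindic_ge0.
under [RHS]eq_integral => x _.
  rewrite ge0_mule_fsuml//; last first.
    by move=> *; rewrite EFinM nnfun_muleindic_ge0.
  over.
rewrite ge0_integral_fsum//; last 2 first.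
  - by move=> y; apply: emeasurable_funM; apply/measurable_EFinP.
  - by move=> y x _; rewrite mule_ge0 ?lee_fin//= -lee_fin EFinM nnfun_muleindic_ge0.
apply: eq_fsbigr => y yf.
have y0 : 0 <= y by move: yf; rewrite inE => -[z _ <-].
under eq_integral do rewrite EFinM.
under [RHS]eq_integral do rewrite EFinM -muleA.
have mI : measurable_fun [set: T] (fun x => (\1_(f_ n @^-1` [set y]) x : R)%:E).
  by apply/measurable_EFinP; exact: measurable_indic.
rewrite ge0_integralZl//.
rewrite ge0_integralZl//; last 2 first.
  - by apply: emeasurable_funM => //; apply/measurable_EFinP.
  - by move=> *; rewrite mule_ge0 ?lee_fin.
congr (_ * _)%E.
rewrite integral_indic// setIT nuE// [LHS]integral_mkcond/=.
apply: eq_integral => x _; rewrite patchE indicE.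
by case: ifPn => _; rewrite ?mul1e ?mul0e.
Qed.

End density.

(** * Moments of the centred normal law *)

Section gaussian.
Context {R : realType}.
Implicit Types s : R.

Lemma integral_normal_probE s (f : R -> R) : 0 < s -> mfun f ->
  (forall x, 0 <= f x) ->
  (\int[normal_prob 0 s]_x (f x)%:E =
   \int[lebesgue_measure]_x (f x * normal_pdf 0 s x)%:E)%E.
Proof.
move=> s0 mf f0.
rewrite (@ge0_integral_density _ _ _ lebesgue_measure _ (normal_pdf 0 s))//.
- exact: measurable_normal_pdf.
- exact: normal_pdf_ge0.
- exact/measurable_EFinP.
Qed.

(** The factor changes the standard deviation from s to s / q. For q < 1 it is the exponential of a
    positive multiple of x ^ 2, which is how exponential moments are reached. *)
Lemma normal_pdf_scale s (q x : R) : 0 < s -> 0 < q ->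
  expR (- (q ^+ 2 - 1) * (2 * s ^+ 2)^-1 * x ^+ 2) * normal_pdf 0 s x =
  q^-1 * normal_pdf 0 (s / q) x.
Proof.
move=> s0 q0; have sq0 : s / q != 0 by rewrite gt_eqF// divr_gt0.
have [s1 q1] : s != 0 /\ q != 0 by rewrite !gt_eqF.
rewrite !normal_pdfE ?(gt_eqF s0)// /normal_peak /normal_fun !subr0.
rewrite mulrCA -expRD [RHS]mulrA; congr (_ * expR _); last first.
  by field; rewrite q1 s1.
rewrite expr_div_n.
rewrite (_ : s ^+ 2 / q ^+ 2 * pi *+ 2 = (s ^+ 2 * pi *+ 2) / q ^+ 2); last first.
  by rewrite mulrAC mulrnAl.
have -> : Num.sqrt (s ^+ 2 * pi *+ 2 / q ^+ 2) = Num.sqrt (s ^+ 2 * pi *+ 2) / q.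
  rewrite sqrtrM; last by rewrite mulrn_wge0// mulr_ge0 ?sqr_ge0// pi_ge0.
  by rewrite -exprVn sqrtr_sqr ger0_norm ?invr_ge0 ?(ltW q0).
by rewrite invfM invrK mulrCA mulVf// mulr1.
Qed.

Lemma integral_normal_expR s (q : R) : 0 < s -> 0 < q ->
  (\int[normal_prob 0 s]_x
     (expR (- (q ^+ 2 - 1) * (2 * s ^+ 2)^-1 * x ^+ 2))%:E = (q^-1)%:E)%E.
Proof.
move=> s0 q0; rewrite integral_normal_probE//.
- under eq_integral do rewrite normal_pdf_scale// EFinM.
  rewrite ge0_integralZl//.
  + by rewrite integral_normal_pdf mule1.
  + by apply/measurable_EFinP; exact: measurable_normal_pdf.
  + by move=> x _; rewrite lee_fin normal_pdf_ge0.
  + by rewrite lee_fin invr_ge0 ltW.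
- apply: measurableT_comp => //; apply: measurable_funM => //.
Qed.

(** Completing the square: the exponential factor moves the mean from 0 to c s ^ 2, so its
    expectation is 1. *)
Lemma normal_pdf_tilt s (c x : R) : 0 < s ->
  expR (c * x - c ^+ 2 * s ^+ 2 / 2) * normal_pdf 0 s x =
  normal_pdf (c * s ^+ 2) s x.
Proof.
move=> s0; have s1 : s != 0 by rewrite gt_eqF.
rewrite !normal_pdfE ?s1//= /normal_peak /normal_fun.
rewrite mulrCA -expRD; congr (_ * expR _).
by field.
Qed.

Lemma integral_normal_tilt s (c : R) : 0 < s ->
  (\int[normal_prob 0 s]_x (expR (c * x - c ^+ 2 * s ^+ 2 / 2))%:E = 1)%E.
Proof.
move=> s0; rewrite integral_normal_probE//.
- by under eq_integral do rewrite normal_pdf_tilt//; rewrite integral_normal_pdf.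
- by apply: measurableT_comp => //; apply: measurable_funB => //; exact: measurable_funM.
Qed.

(** The case q = 1/2 of [normal_pdf_scale], that is exp (3 x ^ 2 / (8 s ^ 2)), of expectation 2. It
    dominates the first three powers of |x|, and so bounds their moments without computing them. *)
Let K s x : R := expR (- (2^-1 ^+ 2 - 1) * (2 * s ^+ 2)^-1 * x ^+ 2).

Let mK s : mfun (K s).
Proof. by apply: measurableT_comp => //; exact: measurable_funM. Qed.

Let integral_K s : 0 < s -> (\int[normal_prob 0 s]_x (K s x)%:E = 2%:E)%E.
Proof. by move=> s0; rewrite integral_normal_expR ?invr_gt0// invrK. Qed.

Let K_ub s x : 0 < s ->
  [/\ `|x| <= 4 * s * K s x, x ^+ 2 <= 3 * s ^+ 2 * K s x &
      `|x| ^+ 3 <= 32 * s ^+ 3 * K s x].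
Proof.
move=> s0; pose v := `|x| / s; have v0 : 0 <= v by rewrite divr_ge0// ltW.
have xE : `|x| = v * s by rewrite /v divfK// gt_eqF.
have -> : x ^+ 2 = `|x| ^+ 2 by rewrite real_normK// num_real.
(* u is the exponent of [K]; expR u is at least 1 + u and, as the square of expR (u / 2), at least
   (1 + u / 2) ^ 2. The powers of v = |x| / s reduce to these. *)
pose u := 3 / 8 * v ^+ 2.
have -> : K s x = expR u.
  rewrite /K /u /v; congr expR.
  by rewrite -(real_normK (num_real x)); field; rewrite gt_eqF.
rewrite xE.
have u0 : 0 <= u by rewrite mulr_ge0// sqr_ge0.
have e1 : 1 + u <= expR u := expR_ge1Dx u.
have e2 : (u / 2 + 1) ^+ 2 <= expR u.
  rewrite {2}(_ : u = u / 2 + u / 2); last by lra.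
  rewrite expRD expr2 ler_pM//; try lra; rewrite addrC; exact: expR_ge1Dx.
have uE : v ^+ 2 = 8 / 3 * u by rewrite /u; lra.
have v3 : v ^+ 3 <= v ^+ 2 + v ^+ 4 by nra.
have v4 : v ^+ 4 = 64 / 9 * u ^+ 2 by rewrite (_ : v ^+ 4 = (v ^+ 2) ^+ 2) -?exprM// exprM uE; field.
have hv1 : v <= 4 * expR u by nra.
have hv2 : v ^+ 2 <= 3 * expR u by rewrite uE; lra.
have hv3 : v ^+ 3 <= 32 * expR u by rewrite (le_trans v3)// v4 uE; nra.
split.
- by rewrite [leRHS]mulrAC ler_pM2r// .
- by rewrite exprMn [leRHS]mulrAC ler_pM2r// exprn_gt0.
- by rewrite exprMn [leRHS]mulrAC ler_pM2r// exprn_gt0.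
Qed.

Let integrable_K s : 0 < s -> (normal_prob 0 s).-integrable setT (EFin \o K s).
Proof.
move=> s0; apply/integrableP; split; first by apply/measurable_EFinP; exact: mK.
under eq_integral do rewrite /= ger0_norm ?expR_ge0//.
by rewrite integral_K// ltry.
Qed.

Let le_K s (f : R -> R) (c : R) : 0 < s -> mfun f -> 0 <= c ->
  (forall x, `|f x| <= c * K s x) ->
  (normal_prob 0 s).-integrable setT (EFin \o f) /\
  \int[normal_prob 0 s]_x `|f x| <= 2 * c.
Proof.
move=> s0 mf c0 fK.
have iK : (normal_prob 0 s).-integrable setT (EFin \o (fun x => c * K s x)).
  by apply: integrableMl_real => //; exact: integrable_K.
have if_ : (normal_prob 0 s).-integrable setT (EFin \o f).
  apply: le_integrable iK => //; first exact/measurable_EFinP.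
  move=> x _ /=; rewrite lee_fin (le_trans (fK x))//.
  by rewrite ger0_norm// mulr_ge0// expR_ge0.
split=> //; apply: (@le_trans _ _ (\int[normal_prob 0 s]_x (c * K s x))).
  by apply: le_Rintegral => //; exact: (integrable_norm if_).
rewrite RintegralZl//; last exact: integrable_K.
by rewrite /Rintegral integral_K//= mulrC.
Qed.

Lemma normal_integrable_id s : 0 < s ->
  (normal_prob 0 s).-integrable setT (fun x : R => x%:E).
Proof.
move=> s0; have := @le_K s id (4 * s) s0; case => //.
- by rewrite mulr_ge0// ltW.
- by move=> x; have [] := K_ub x s0.
Qed.

Lemma normal_integrable_sqr s : 0 < s ->
  (normal_prob 0 s).-integrable setT (fun x : R => (x ^+ 2)%:E).
Proof.
move=> s0; have := @le_K s (fun x => x ^+ 2) (3 * s ^+ 2) s0; case => //.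
- by rewrite mulr_ge0// sqr_ge0.
- by move=> x; rewrite ger0_norm ?sqr_ge0//; have [] := K_ub x s0.
Qed.

Lemma normal_abs_moment3 s : 0 < s ->
  (normal_prob 0 s).-integrable setT (fun x : R => (`|x| ^+ 3)%:E) /\
  \int[normal_prob 0 s]_x (`|x| ^+ 3) <= 64 * s ^+ 3.
Proof.
move=> s0; have := @le_K s (fun x => `|x| ^+ 3) (32 * s ^+ 3) s0; case => //.
- by apply: measurable_funX; exact: normr_measurable.
- by rewrite mulr_ge0// exprn_ge0// ltW.
- by move=> x; rewrite ger0_norm ?exprn_ge0//; have [] := K_ub x s0.
- move=> h1 h2; split=> //; rewrite (_ : 64 * _ = 2 * (32 * s ^+ 3)); last by ring.
  apply: le_trans h2; rewrite le_eqVlt; apply/orP; left; apply/eqP.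
  by apply: eq_Rintegral => x _; rewrite [RHS]ger0_norm ?exprn_ge0.
Qed.

Let integrable_expR s (f : R -> R) (r : R) : mfun f ->
  (\int[normal_prob 0 s]_x (expR (f x))%:E = r%:E)%E ->
  (normal_prob 0 s).-integrable setT (EFin \o (fun x => expR (f x))).
Proof.
move=> mf fr; apply/integrableP; split.
  by apply/measurable_EFinP; exact: measurableT_comp.
under eq_integral do rewrite /= ger0_norm ?expR_ge0//.
by rewrite fr ltry.
Qed.

Let Rintegral_1 s : \int[normal_prob 0 s]_x (1 : R) = 1.
Proof. by rewrite (Rintegral_cst_prob (normal_prob 0 s)). Qed.

(** The tilted exponential has expectation 1 and lies above 1 + (c x - c ^ 2 s ^ 2 / 2), so c m <= c
    ^ 2 s ^ 2 / 2 for every c; the choice c = m / s ^ 2 forces m = 0. *)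
Lemma normal_mean s : 0 < s -> \int[normal_prob 0 s]_x (x : R) = 0.
Proof.
move=> s0; set m := Rintegral _ _ _.
have icst (r : R) : (normal_prob 0 s).-integrable setT (EFin \o cst r).
  exact: finite_measure_integrable_cst.
have ub c : 1 + (c * m - c ^+ 2 * s ^+ 2 / 2) <= 1.
  pose f (x : R) := c * x - c ^+ 2 * s ^+ 2 / 2.
  have mf : mfun f by apply: measurable_funB => //; exact: measurable_funM.
  have h1 := integral_normal_tilt c s0.
  have icx : (normal_prob 0 s).-integrable setT (EFin \o (fun x => c * x)).
    by apply: integrableMl_real => //; exact: normal_integrable_id.
  have if_ : (normal_prob 0 s).-integrable setT (EFin \o f).
    by apply: integrableB_real => //; exact: icst.
  have -> : 1 + (c * m - c ^+ 2 * s ^+ 2 / 2) = \int[normal_prob 0 s]_x (1 + f x).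
    rewrite RintegralD//; last exact: icst.
    rewrite Rintegral_1 RintegralB//; last exact: icst.
    rewrite RintegralZl//; last exact: normal_integrable_id.
    by rewrite (Rintegral_cst_prob (normal_prob 0 s)).
  have e1 : \int[normal_prob 0 s]_x expR (f x) = 1 :> R by rewrite /Rintegral h1.
  rewrite -[leRHS]e1.
  apply: le_Rintegral => //.
  - by apply: integrableD_real => //; exact: icst.
  - exact: (@integrable_expR s f 1).
  - by move=> x _; exact: expR_ge1Dx.
apply/eqP; apply/negPn/negP => m0.
have mm : m * m / s ^+ 2 > 0 by rewrite divr_gt0 ?exprn_gt0// -expr2 exprn_even_gt0.
have := ub (m / s ^+ 2).
rewrite (_ : (m / s ^+ 2) ^+ 2 * s ^+ 2 = m * m / s ^+ 2); first by lra.
by field; rewrite gt_eqF.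
Qed.

(** By [integral_normal_expR] and exp t >= 1 + t, the bound 1 + a q * M <= 1 / q holds for every q >
    0, with equality at q = 1. Comparing the slopes at q = 1 from both sides gives M = s ^ 2. *)
Lemma normal_variance s : 0 < s -> \int[normal_prob 0 s]_x (x ^+ 2 : R) = s ^+ 2.
Proof.
move=> s0; set M := Rintegral _ _ _.
have icst (r : R) : (normal_prob 0 s).-integrable setT (EFin \o cst r).
  exact: finite_measure_integrable_cst.
have s20 : 0 < s ^+ 2 by rewrite exprn_gt0.
have M0 : 0 <= M by apply: Rintegral_ge0 => x _; exact: sqr_ge0.
pose a q := - (q ^+ 2 - 1) * (2 * s ^+ 2)^-1.
have key q : 0 < q -> 1 + a q * M <= q^-1.
  move=> q0; pose f x := a q * x ^+ 2.
  have mf : mfun f by exact: measurable_funM.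
  have h1 := integral_normal_expR s0 q0.
  have if_ : (normal_prob 0 s).-integrable setT (EFin \o f).
    by apply: integrableMl_real => //; exact: normal_integrable_sqr.
  have -> : 1 + a q * M = \int[normal_prob 0 s]_x (1 + f x).
    rewrite RintegralD//; last exact: icst.
    by rewrite Rintegral_1 RintegralZl//; exact: normal_integrable_sqr.
  have -> : q^-1 = \int[normal_prob 0 s]_x expR (f x) :> R by rewrite /Rintegral h1.
  apply: le_Rintegral => //.
  - by apply: integrableD_real => //; exact: icst.
  - exact: (@integrable_expR s f q^-1).
  - by move=> x _; exact: expR_ge1Dx.
(* The previous bound times 2 q s ^ 2; the factor 1 - q is kept apart because its sign depends on
   the side of 1. *)
have key2 q : 0 < q -> (1 - q) * (q * (1 + q)) * M <= (1 - q) * (2 * s ^+ 2).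
  move=> q0; have := key _ q0.
  rewrite -(ler_pM2r (mulr_gt0 (mulr_gt0 q0 s20) (@ltr0n R 2))) => h.
  rewrite -subr_ge0; rewrite -subr_ge0 in h; apply: le_trans h _.
  rewrite le_eqVlt; apply/orP; left; apply/eqP; rewrite /a; field.
  by rewrite !gt_eqF.
apply/eqP; rewrite eq_le; apply/andP; split; rewrite leNgt; apply/negP => h.
- pose e := (M - s ^+ 2) / (4 * M).
  have Mp : 0 < M by lra.
  have e0 : 0 < e by rewrite divr_gt0//; lra.
  have eM : e * M = (M - s ^+ 2) / 4 by rewrite /e; field; rewrite gt_eqF.
  have e1 : e < 1 by rewrite -(ltr_pM2r Mp) eM; lra.
  have := key2 (1 - e); rewrite subr_gt0 e1 => /(_ isT).
  rewrite (_ : 1 - (1 - e) = e); last by ring.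
  rewrite -mulrA ler_pM2l// => hh; nra.
- pose e := (s ^+ 2 - M) / (4 * s ^+ 2).
  have e0 : 0 < e by rewrite divr_gt0//; lra.
  have eM : e * s ^+ 2 = (s ^+ 2 - M) / 4 by rewrite /e; field; rewrite gt_eqF.
  have e1 : e <= 4^-1 by rewrite -(ler_pM2r s20) eM; lra.
  have := key2 (1 + e); rewrite addr_gt0// => /(_ isT).
  rewrite (_ : 1 - (1 + e) = - e); last by ring.
  rewrite -mulrA !mulNr lerN2 ler_pM2l// => hh; nra.
Qed.

End gaussian.

(** * Expectations under independence *)

Section independence.
Local Open Scope ereal_scope.
Context d (Om : measurableType d) (R : realType) (P : probability Om R).

(** By uniqueness of the product measure the joint law of X and Y is the product of their laws, and
    Tonelli's theorem applies. It is the means of drawing Y from a separate sample w'. *)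
Lemma indep_integral d1 d2 (T1 : measurableType d1) (T2 : measurableType d2)
    (X : Om -> T1) (Y : Om -> T2) (h : T1 * T2 -> \bar R) :
  mfun X -> mfun Y ->
  (forall A B, measurable A -> measurable B ->
    P (X @^-1` A `&` Y @^-1` B) = P (X @^-1` A) * P (Y @^-1` B)) ->
  mfun h -> (forall z, 0 <= h z) ->
  \int[P]_w h (X w, Y w) = \int[P]_w \int[P]_w' h (X w, Y w').
Proof.
move=> mX mY XY mh h0.
pose X' : {RV P >-> T1} := mfun_Sub (mem_set mX).
pose Y' : {RV P >-> T2} := mfun_Sub (mem_set mY).
have mZ : mfun (fun w => (X w, Y w)).
  exact: measurable_fun_pair.
pose Z' : {RV P >-> (T1 * T2)%type} := mfun_Sub (mem_set mZ).
transitivity (\int[distribution P Z']_z h z).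
  by rewrite ge0_integral_distribution.
transitivity (\int[distribution P X' \x distribution P Y']_z h z).
  apply: eq_measure_integral => A mA _; apply/esym.
  by apply: product_measure_unique => // A1 B1 mA1 mB1; exact: XY.
rewrite fubini_tonelli1// /fubini_F ge0_integral_distribution//; last 2 first.
- exact: measurable_fun_fubini_tonelli_F.
- by move=> y; exact: integral_ge0.
apply: eq_integral => w _ /=.
rewrite ge0_integral_distribution//.
by apply: measurableT_comp => //; exact: measurable_pair1.
Qed.

Lemma indep_expectationM (X Y : Om -> R) :
  P.-integrable setT (EFin \o X) -> P.-integrable setT (EFin \o Y) ->
  (forall A B, measurable A -> measurable B ->
    P (X @^-1` A `&` Y @^-1` B) = P (X @^-1` A) * P (Y @^-1` B)) ->
  P.-integrable setT (EFin \o (fun w => X w * Y w)%R) /\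
  (\int[P]_w (X w * Y w) = \int[P]_w X w * \int[P]_w Y w)%R.
Proof.
move=> iX iY XY.
have mX : mfun X by apply/measurable_EFinP; exact: measurable_int iX.
have mY : mfun Y by apply/measurable_EFinP; exact: measurable_int iY.
pose X' : {RV P >-> R} := mfun_Sub (mem_set mX).
pose Y' : {RV P >-> R} := mfun_Sub (mem_set mY).
have mZ : mfun (fun w => (X w, Y w)).
  exact: measurable_fun_pair.
pose Z' : {RV P >-> (R * R)%type} := mfun_Sub (mem_set mZ).
pose m12 := distribution P X' \x distribution P Y'.
have m12E A : measurable A -> m12 A = distribution P Z' A.
  by apply: product_measure_unique => // A1 B1 mA1 mB1; exact: XY.
pose h (z : R * R) : \bar R := (z.1 * z.2)%:E.
have mh : mfun h.
  by apply/measurable_EFinP; apply: measurable_funM.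
have iXY : P.-integrable setT (EFin \o (fun w => X w * Y w)%R).
  apply/integrableP; split.
    by apply/measurable_EFinP; exact: measurable_funM.
  have := @indep_integral _ _ _ _ X Y (fun z => `|z.1 * z.2|%:E) mX mY XY.
  move=> /= ->; last 2 first.
  - apply/measurable_EFinP; apply: measurableT_comp => //.
    exact: measurable_funM.
  - by move=> z; rewrite lee_fin.
  under eq_integral.
    move=> w _; under eq_integral do rewrite normrM EFinM.
    rewrite ge0_integralZl//; last first.
      by apply/measurable_EFinP; exact: measurableT_comp.
    over.
  move/integrableP : iX => [_ iX]; move/integrableP : iY => [_ iY].
  rewrite ge0_integralZr//; last 2 first.
  - by apply/measurable_EFinP; exact: measurableT_comp.
  - exact: integral_ge0.
  by rewrite lte_mul_pinfty// ?integral_ge0// ge0_fin_numE ?integral_ge0.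
split=> //.
have ih : m12.-integrable setT h.
  apply/integrableP; split => //.
  rewrite (eq_measure_integral (distribution P Z')); last first.
    by move=> A mA _; exact: m12E.
  rewrite ge0_integral_distribution//; last exact: measurableT_comp.
  by move/integrableP : iXY => [].
have iX2 : \int[P]_w (X w)%:E \is a fin_num by exact: integrable_fin_num iX.
have iY2 : \int[P]_w (Y w)%:E \is a fin_num by exact: integrable_fin_num iY.
rewrite /Rintegral -fineM//; congr fine.
transitivity (\int[distribution P Z']_z h z).
  by rewrite integral_distribution.
rewrite (eq_measure_integral m12); last first.
  by move=> A mA _; apply/esym; exact: m12E.
rewrite -integral12_prod_meas1//.
have FE x : fubini_F (distribution P Y') h x = x%:E * \int[P]_w (Y w)%:E.
  rewrite /fubini_F /h/=.
  under eq_integral do rewrite EFinM.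
  rewrite integralZl//.
    by rewrite integral_distribution.
  by apply/integrableP; split => //; rewrite ge0_integral_distribution//;
    [move/integrableP : iY => []|exact: measurableT_comp].
transitivity (\int[distribution P X']_x (x%:E * \int[P]_w (Y w)%:E)).
  by apply: eq_integral => y _; exact: FE.
rewrite (@integral_distribution _ _ _ _ _ P X')//; last 2 first.
- by apply: emeasurable_funM.
- rewrite (_ : _ \o _ = EFin \o (fun w => fine (\int[P]_w (Y w)%:E) * X w)%R).
    exact: integrableMl_real.
  by apply/funext => w /=; rewrite muleC EFinM fineK.
rewrite -(fineK iY2).
transitivity (\int[P]_w ((X w)%:E * (fine (\int[P]_w (Y w)%:E))%:E)).
  by apply: eq_integral => w _; rewrite /= fineK.
by rewrite integralZr.
Qed.

End independence.

(** * One-sided calculus *)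

Section right_derivative.
Context {R : realType}.
Implicit Types f g u v : R -> R.

Lemma exists_mul_le (C e : R) : 0 <= C -> 0 < e -> exists2 d, 0 < d & d * C <= e.
Proof.
move=> C0 e0; have C1 : 0 < C + 1 by rewrite ltr_wpDl.
exists (e / (C + 1)); first exact: divr_gt0.
by rewrite mulrAC ler_pdivrMr// ler_pM2l// lerDl.
Qed.

(** The right derivative as a first-order expansion with error h e: in this form it adds and
    multiplies without quotients or limits. *)
Definition rder u u' := forall x e, 0 < e -> exists2 d, 0 < d &
  forall h, 0 < h < d -> `|u (x + h) - u x - h * u' x| <= h * e.

(* The supremum of the points up to which [f y <= f a + e (y - a)] must be b. *)
Lemma nonincreasing_of_rder (a b : R) f : a <= b ->
  (forall x e, a <= x <= b -> 0 < e -> exists2 d, 0 < d &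
     forall y, a <= y <= b -> `|y - x| < d -> `|f y - f x| <= e) ->
  (forall x e, a <= x < b -> 0 < e -> exists2 d, 0 < d &
     forall h, 0 < h < d -> f (x + h) - f x <= h * e) ->
  f b <= f a.
Proof.
move=> ab cf df; apply/ler_addgt0Pr => e0 e00.
have [e e1 ee0] : exists2 e, 0 < e & e * (b - a) <= e0.
  by apply: exists_mul_le => //; rewrite subr_ge0.
pose S := [set z | a <= z <= b /\ forall y, a <= y <= z -> f y <= f a + e * (y - a)].
have Sa : S a.
  split; first by rewrite lexx.
  move=> y /andP[ay ya]; have -> : y = a by apply/eqP; rewrite eq_le ya ay.
  by rewrite subrr mulr0 addr0.
have hS : has_sup S.
  by split; [exists a | exists b => z [/andP[]]].
pose c := sup S.
have ac : a <= c by apply: sup_upper_bound.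
have cb : c <= b by apply: ge_sup; [exists a| move=> z [/andP[]]].
have below y : a <= y < c -> f y <= f a + e * (y - a).
  move=> /andP[ay yc]; have cy : 0 < c - y by rewrite subr_gt0.
  have [z Sz yz] := sup_adherent cy hS.
  by case: Sz => _; apply; rewrite ay ltW//; move: yz; rewrite -/c; lra.
have Sc : S c.
  split; first by rewrite ac.
  move=> y /andP[ay]; rewrite le_eqVlt => /predU1P[->|yc]; last first.
    by apply: below; rewrite ay.
  have [<-|ac'] := eqVneq a c; first by rewrite subrr mulr0 addr0.
  apply/ler_addgt0Pr => e' e'0.
  have acb : a <= c <= b by rewrite ac.
  have [d d0 hd] := cf c e' acb e'0.
  pose z := Num.max a (c - d / 2).
  have acs : a < c by rewrite lt_neqAle ac'.
  have zc : z < c by rewrite gt_max acs ltrBlDr ltrDl divr_gt0.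
  have az : a <= z by rewrite le_max lexx.
  have dz : c - d / 2 <= z by rewrite le_max lexx orbT.
  have := below z; rewrite az zc => /(_ isT) h1.
  have := hd z; rewrite az (ltW (lt_le_trans zc cb)) => /(_ isT).
  rewrite ler0_norm ?subr_le0 ?(ltW zc)// => hz.
  have /hz : - (z - c) < d by lra.
  rewrite ler_norml => /andP[h2 h3].
  have : e * (z - a) <= e * (c - a) by rewrite ler_pM2l//; lra.
  lra.
have bc : c = b.
  apply/eqP; rewrite eq_le cb /= leNgt; apply/negP => clb.
  have acb : a <= c < b by rewrite ac.
  have [d d0 hd] := df c e acb e1.
  pose h := Num.min (d / 2) (b - c).
  have h0 : 0 < h by rewrite lt_min divr_gt0// subr_gt0.
  have hd2 : h < d by rewrite gt_min; apply/orP; left; lra.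
  have hb : h <= b - c by rewrite ge_min lexx orbT.
  suff : S (c + h) by move=> /(sup_upper_bound hS); rewrite -/c; lra.
  split; first by apply/andP; lra.
  move=> y /andP[ay yc]; have [yc'|cy] := leP y c.
    by case: Sc => _; apply; rewrite ay.
  have fc : f c <= f a + e * (c - a) by case: Sc => _; apply; rewrite ac lexx.
  have := hd (y - c); rewrite subr_gt0 cy (subrKC c y) => hh.
  have /hh : true && (y - c < d) by rewrite /=; lra.
  have -> : e * (y - a) = (y - c) * e + e * (c - a) by ring.
  lra.
case: Sc => _ /(_ b); rewrite bc ab lexx => /(_ isT) h; lra.
Qed.

Lemma rder_lin u u' v v' (c : R) : rder u u' -> rder v v' ->
  rder (fun x => u x + c * v x) (fun x => u' x + c * v' x).
Proof.
move=> du dv x e e0.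
have e2 : 0 < e / 2 by rewrite divr_gt0.
have [e' e3 e'c] := exists_mul_le (normr_ge0 c) e2.
have [d1 d10 h1] := du x _ e2; have [d2 d20 h2] := dv x _ e3.
exists (Num.min d1 d2); first by rewrite lt_min d10.
move=> h /andP[h0]; rewrite lt_min => /andP[hd1 hd2].
have := h1 h; rewrite h0 hd1 => /(_ isT) k1.
have := h2 h; rewrite h0 hd2 => /(_ isT) k2.
have -> : u (x + h) + c * v (x + h) - (u x + c * v x) - h * (u' x + c * v' x) =
  (u (x + h) - u x - h * u' x) + c * (v (x + h) - v x - h * v' x) by ring.
rewrite (le_trans (ler_normD _ _))// normrM.
have : `|c| * `|v (x + h) - v x - h * v' x| <= h * (e / 2).
  rewrite (le_trans (ler_wpM2l (normr_ge0 c) k2))//.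
  by rewrite mulrCA ler_pM2l// mulrC.
lra.
Qed.

Lemma rder_cts u u' : rder u u' -> forall x e, 0 < e -> exists2 d, 0 < d &
  forall h, 0 < h < d -> `|u (x + h) - u x| <= e.
Proof.
move=> du x e e0; have [d d0 hd] := du x 1 ltr01.
exists (Num.min d (e / (`|u' x| + 1))); first by rewrite lt_min d0 divr_gt0.
move=> h /andP[h0]; rewrite lt_min => /andP[hd1]; rewrite ltr_pdivlMr// => hd2.
have := hd h; rewrite h0 hd1 => /(_ isT) k.
have -> : u (x + h) - u x = (u (x + h) - u x - h * u' x) + h * u' x by ring.
rewrite (le_trans (ler_normD _ _))// normrM (gtr0_norm h0); lra.
Qed.

Lemma rder_mul u u' v v' : rder u u' -> rder v v' ->
  rder (fun x => u x * v x) (fun x => u' x * v x + u x * v' x).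
Proof.
move=> du dv x e e0.
(* [M] dominates |u x|, |u' x| and, since the increment of v is at most m <= 1, also |v (x + h)|;
   each of the three terms of the expansion below is then at most h m M. *)
pose M := `|u x| + `|v x| + `|u' x| + 1.
have M0 : 0 < M by rewrite /M ltr_wpDl// !addr_ge0.
have [m0 m00 m0M] := exists_mul_le (ltW M0) (divr_gt0 e0 (@ltr0n R 3)).
have eM : 0 < Num.min 1 m0 by rewrite lt_min ltr01.
have [d1 d10 h1] := du x _ eM; have [d2 d20 h2] := dv x _ eM.
have [d3 d30 h3] := rder_cts dv x eM.
exists (Num.min d1 (Num.min d2 d3)); first by rewrite !lt_min d10 d20.
move=> h /andP[h0]; rewrite !lt_min => /and3P[hd1 hd2 hd3].
have := h1 h; rewrite h0 hd1 => /(_ isT) k1.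
have := h2 h; rewrite h0 hd2 => /(_ isT) k2.
have := h3 h; rewrite h0 hd3 => /(_ isT) k3.
set m := Num.min _ _ in k1 k2 k3.
have m1 : m <= 1 by rewrite ge_min lexx.
have mM : m * M <= e / 3.
  have : m <= m0 by rewrite ge_min lexx orbT.
  by rewrite -(ler_pM2r M0) => ?; lra.
have -> : u (x + h) * v (x + h) - u x * v x - h * (u' x * v x + u x * v' x) =
  (u (x + h) - u x - h * u' x) * v (x + h) + u x * (v (x + h) - v x - h * v' x)
  + h * u' x * (v (x + h) - v x) by ring.
have vb : `|v (x + h)| <= M.
  have -> : v (x + h) = v x + (v (x + h) - v x) by ring.
  rewrite (le_trans (ler_normD _ _))// /M.
  have := normr_ge0 (u x); have := normr_ge0 (u' x); lra.
have uM : `|u x| <= M.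
  rewrite /M; have := normr_ge0 (v x); have := normr_ge0 (u' x); lra.
have u'M : `|u' x| <= M.
  rewrite /M; have := normr_ge0 (v x); have := normr_ge0 (u x); lra.
have t1 : `|(u (x + h) - u x - h * u' x) * v (x + h)| <= h * m * M.
  by rewrite normrM ler_pM.
have t2 : `|u x * (v (x + h) - v x - h * v' x)| <= h * m * M.
  by rewrite normrM mulrC ler_pM.
have t3 : `|h * u' x * (v (x + h) - v x)| <= h * m * M.
  by rewrite !normrM (gtr0_norm h0) -!mulrA ler_pM2l// mulrC ler_pM.
rewrite (le_trans (ler_normD _ _))//.
have := ler_normD ((u (x + h) - u x - h * u' x) * v (x + h)) (u x * (v (x + h) - v x - h * v' x)).
have : h * (m * M) <= h * (e / 3) by rewrite ler_pM2l.
rewrite !mulrA; lra.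
Qed.

End right_derivative.

(** * Integrals over half-open intervals *)

Section bounded_interval_measure.
Context {R : realType} (kappa : borel_measure R) (kR : radon kappa).
Implicit Types (a b c z : R) (f g : R -> R).

Lemma radon_itv (a b : R) : (kappa `]a, b]%classic < +oo)%E.
Proof.
apply: le_lt_trans (kR (@segment_compact R a b)).
by apply: le_measure; rewrite ?inE// => x /=; rewrite !in_itv/= => /andP[/ltW -> ->].
Qed.

Lemma continuous_bounded_itv g a b : continuous g ->
  exists2 C, 0 <= C & forall x, a <= x <= b -> `|g x| <= C.
Proof.
move=> cg; have : compact (g @` `[a, b]).
  by apply: continuous_compact (@segment_compact R a b); exact: continuous_subspaceT.
move=> /compact_bounded[M [_ hM]]; exists (`|M| + 1); first by rewrite addr_ge0.
move=> x xab; apply: hM; first by rewrite ltr_pwDr// ler_norm.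
by exists x => //=; rewrite in_itv.
Qed.

Lemma continuous_measurable_R g : continuous g -> mfun g.
Proof. by move=> cg; exact: continuous_measurable_fun. Qed.

Lemma integrable_itv g a b : continuous g ->
  kappa.-integrable `]a, b] (EFin \o g).
Proof.
move=> cg; have [C C0 hC] := continuous_bounded_itv a b cg.
apply: measurable_bounded_integrable => //.
- exact: radon_itv.
- by apply: measurable_funTS; exact: continuous_measurable_R.
- exists C; split; first exact: num_real.
  move=> M CM x /=; rewrite in_itv/= => /andP[ax xb].
  by apply: le_trans (ltW CM); apply: hC; rewrite (ltW ax).
Qed.

(** Half-open intervals as in [killed_ode]: they concatenate without counting an atom of kappa
    twice. *)
Definition itg a b g : R := \int[kappa]_(y in `]a, b]) g y.

Lemma itgD a b f g : continuous f -> continuous g ->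
  itg a b (fun y => f y + g y) = itg a b f + itg a b g.
Proof. by move=> cf cg; rewrite /itg RintegralD//; exact: integrable_itv. Qed.

Lemma itgB a b f g : continuous f -> continuous g ->
  itg a b (fun y => f y - g y) = itg a b f - itg a b g.
Proof. by move=> cf cg; rewrite /itg RintegralB//; exact: integrable_itv. Qed.

Lemma itgZ a b k g : continuous g ->
  itg a b (fun y => k * g y) = k * itg a b g.
Proof. by move=> cg; rewrite /itg RintegralZl//; exact: integrable_itv. Qed.

Lemma eq_itg a b f g : (forall y, a < y <= b -> f y = g y) ->
  itg a b f = itg a b g.
Proof.
by move=> fg; apply: eq_Rintegral => y; rewrite inE/= in_itv/= => /fg.
Qed.

Lemma itg_ge0 a b g : (forall y, a < y <= b -> 0 <= g y) -> 0 <= itg a b g.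
Proof. by move=> g0; apply: Rintegral_ge0 => y/=; rewrite in_itv/= => /g0. Qed.

Lemma le_itg a b f g : continuous f -> continuous g ->
  (forall y, a < y <= b -> f y <= g y) -> itg a b f <= itg a b g.
Proof.
move=> cf cg fg; apply: le_Rintegral => //.
- exact: integrable_itv.
- exact: integrable_itv.
Qed.

Lemma itg_split a b c g : continuous g -> a <= b -> b <= c ->
  itg a c g = itg a b g + itg b c g.
Proof.
move=> cg ab bc.
have e : `]a, c]%classic = `]a, b] `|` `]b, c] :> set R.
  by rewrite -itv_bndbnd_setU.
rewrite /itg e Rintegral_setU//; first by rewrite -e; exact: integrable_itv.
apply/disj_setPS => y /= []; rewrite !in_itv/= => /andP[_ yb] /andP[by_ _].
by move: (lt_le_trans by_ yb); rewrite ltxx.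
Qed.

Lemma itg0 a g : itg a a g = 0.
Proof. by rewrite /itg set_itv_ge ?bnd_simp// Rintegral_set0. Qed.

Lemma EFin_itg a b g : continuous g ->
  (itg a b g)%:E = (\int[kappa]_(y in `]a, b]) (g y)%:E)%E.
Proof.
by move=> cg; rewrite /itg /Rintegral fineK//; apply: integrable_fin_num => //;
  exact: integrable_itv.
Qed.

Lemma normr_itg_le a b g (C : R) : continuous g ->
  (forall y, a < y <= b -> `|g y| <= C) ->
  `|itg a b g| <= C * fine (kappa `]a, b]%classic).
Proof.
move=> cg gC; rewrite -(Rintegral_cst kappa) //.
rewrite (le_trans (le_normr_Rintegral _ _))//; first exact: integrable_itv.
apply: le_Rintegral => //.
- by apply: (@integrable_itv (fun y => `|g y|)) => y; apply: cvg_norm; exact: cg.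
- by apply: (@integrable_itv (cst C)) => y; exact: cvg_cst.
Qed.

(** The intervals ]z, z + h] decrease to the empty set, so their mass tends to 0 even if kappa has
    an atom at z. *)
Lemma itg_right0 z g e : continuous g -> 0 < e -> exists2 d, 0 < d &
  forall h, 0 < h < d -> `|itg z (z + h) g| <= e.
Proof.
move=> cg e0; have [C C0 hC] := continuous_bounded_itv z (z + 1) cg.
have [e' e'0 e'C] := exists_mul_le C0 e0.
pose F n : set R := `]z, z + n.+1%:R^-1]%classic.
have F0 : \bigcap_n F n = set0.
  apply/seteqP; split => // y /= Fy.
  have zy : z < y by have := Fy 0%N I; rewrite /F/= in_itv/= => /andP[].
  have yz : 0 < y - z by rewrite subr_gt0.
  have [n _ hn] := near_infty_natSinv_lt (PosNum yz).
  have /= k1 := hn n (leqnn n); have := Fy n I; rewrite /F/= in_itv/= => /andP[_ k2].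
  by set q := n.+1%:R^-1 in k1 k2; lra.
have : kappa \o F @ \oo --> kappa (\bigcap_n F n).
  apply: nonincreasing_cvg_mu => //.
  - exact: radon_itv.
  - by move=> n; exact: measurable_itv.
  - by apply: bigcap_measurable => // n _; exact: measurable_itv.
  - move=> m n mn; apply/subsetPset => y; rewrite /F/= !in_itv/= => /andP[-> yn]/=.
    by rewrite (le_trans yn)// lerD2l lef_pV2 ?posrE// ler_nat.
rewrite F0 measure0 => /fine_cvgP[_ /cvgrPdist_lt /(_ e' e'0)[n _ hn]].
have := hn n (leqnn n); rewrite /= sub0r normrN => hF.
exists (n.+1%:R^-1) => [|h /andP[h0 hd]]; first by rewrite invr_gt0.
have h1 : h <= 1 by rewrite (le_trans (ltW hd))// invf_le1// ler1n.
apply: le_trans (normr_itg_le cg _) _.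
  by move=> y /andP[zy yh]; apply: hC; rewrite (ltW zy)/= (le_trans yh)// lerD2l.
rewrite mulrC (le_trans _ e'C)// ler_wpM2r//.
apply: le_trans (ltW hF); rewrite ger0_norm ?fine_ge0//.
rewrite fine_le ?ge0_fin_numE ?radon_itv//.
apply: le_measure; rewrite ?inE//; first exact: measurable_itv.
by move=> y; rewrite /F/= !in_itv/= => /andP[-> yh]/=; rewrite (le_trans yh)// lerD2l ltW.
Qed.

End bounded_interval_measure.

(** * The killed equation in integrated form *)

Section ode.
Context {R : realType} (kappa : borel_measure R) (kR : radon kappa).
Implicit Types (a b c z : R) (u v : R -> R).
Local Notation itg := (itg kappa).

(** The last clause is the equation integrated twice. Unlike positive solutions, these are closed
    under linear combinations, as is required for the combinations of u_up and u_down that vanish at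
    the end of a gap. *)
Definition sol u u' := [/\ continuous u, rder u u',
  forall a z, a <= z -> u' z - u' a = 2 * itg a z u &
  forall a z, a <= z ->
    u z = u a + (z - a) * u' a + 2 * itg a z (fun y => (z - y) * u y)].

Lemma continuous_affM z u : continuous u -> continuous (fun y => (z - y) * u y).
Proof.
move=> cu y; apply: cvgM; last exact: cu.
by apply: cvgB; [exact: cvg_cst|exact: cvg_id].
Qed.

(** On ]a, z] the weight w - y is split as (z - y) + (w - z). *)
Lemma itg_affE a z w u : continuous u -> a <= z -> z <= w ->
  itg a w (fun y => (w - y) * u y) = itg a z (fun y => (z - y) * u y) +
    (w - z) * itg a z u + itg z w (fun y => (w - y) * u y).
Proof.
move=> cu az zw; rewrite (itg_split kR (@continuous_affM w u cu) az zw).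
congr (_ + _); rewrite -itgZ// -itgD//; last 2 first.
- exact: continuous_affM.
- by move=> y; apply: cvgM; [exact: cvg_cst|exact: cu].
by apply: eq_itg => y _; ring.
Qed.

Lemma itg_aff_bound z w u : continuous u -> z <= w -> (forall y, 0 <= u y) ->
  0 <= itg z w (fun y => (w - y) * u y) <= (w - z) * itg z w u.
Proof.
move=> cu zw u0; rewrite itg_ge0/=; last first.
  by move=> y /andP[_ yw]; rewrite mulr_ge0// subr_ge0.
rewrite -itgZ//; apply: le_itg => //.
- exact: continuous_affM.
- by move=> y; apply: cvgM; [exact: cvg_cst|exact: cu].
- by move=> y /andP[zy yw]; rewrite ler_wpM2r//; lra.
Qed.

(** The equation integrated once is part of [killed_ode]. For the second integration, u minus the
    expected right-hand side is continuous with zero right derivative; by [nonincreasing_of_rder],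
    applied to it and to its opposite, it is constant. *)
Lemma sol_of_ode u : (forall y, 0 < u y) -> killed_ode kappa u ->
  sol u (rderive u).
Proof.
move=> u0 [cu du hu]; set u' := rderive u.
have ru : rder u u'.
  move=> x e e0; have /cvgrPdist_le /(_ e e0)[d /= d0 hd] := du x.
  exists d => // h /andP[h0 hdd].
  have := hd h; rewrite /ball_/= sub0r normrN gtr0_norm// => /(_ hdd h0).
  rewrite -/(rderive u x) -/u' distrC => k.
  have -> : u (x + h) - u x - h * u' x = h * (h^-1 * (u (x + h) - u x) - u' x).
    by rewrite mulrBr mulrA divff ?mul1r ?gt_eqF.
  by rewrite normrM (gtr0_norm h0) ler_pM2l.
have u'E a z : a <= z -> u' z - u' a = 2 * itg a z u.
  move=> az; have := hu a z az; rewrite -EFin_itg// => -[<-].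
  by rewrite mulrA divff ?mul1r.
split => // a b ab.
pose J z := itg a z (fun y => (z - y) * u y).
have u0' y : 0 <= u y by exact/ltW.
have JE z w : a <= z -> z <= w ->
    J w - J z = (w - z) * itg a z u + itg z w (fun y => (w - y) * u y).
  by move=> az zw; rewrite /J (itg_affE cu az zw); ring.
(* Positivity of u makes [J] nondecreasing and Lipschitz on [a, b], whence its continuity. *)
have JB z w : a <= z -> z <= w -> w <= b -> 0 <= J w - J z <= (w - z) * itg a b u.
  move=> az zw wb; have := itg_aff_bound cu zw u0'.
  rewrite (JE _ _ az zw) => /andP[h1 h2].
  have k1 := itg_split kR cu az (le_trans zw wb).
  have k2 := itg_split kR cu zw wb.
  have k3 : 0 <= itg a z u by apply: itg_ge0.
  have k4 : 0 <= itg w b u by apply: itg_ge0.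
  have wz : 0 <= w - z by rewrite subr_ge0.
  apply/andP; split; first by rewrite addr_ge0// mulr_ge0.
  rewrite k1 k2; have : 0 <= (w - z) * itg w b u by rewrite mulr_ge0.
  rewrite !mulrDr; lra.
pose f z := u z - (z - a) * u' a - 2 * J z.
have Jc x e : a <= x <= b -> 0 < e -> exists2 d, 0 < d &
    forall y, a <= y <= b -> `|y - x| < d -> `|J y - J x| <= e.
  move=> /andP[ax xb] e0.
  have I0 : 0 <= itg a b u by apply: itg_ge0.
  have [d d0 dI] := exists_mul_le I0 e0; exists d => // y /andP[ay yb] yx.
  apply: le_trans dI; have [xy|yx'] := leP x y.
    have /andP[k1 k2] := JB x y ax xy yb.
    rewrite ger0_norm//; apply: le_trans k2 _; rewrite ler_wpM2r//.
    by move: yx; rewrite ger0_norm ?subr_ge0// => /ltW.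
  have /andP[k1 k2] := JB y x ay (ltW yx') xb.
  rewrite distrC ger0_norm//; apply: le_trans k2 _; rewrite ler_wpM2r//.
  by move: yx; rewrite distrC ger0_norm ?subr_ge0 ?(ltW yx')// => /ltW.
have fc x e : a <= x <= b -> 0 < e -> exists2 d, 0 < d &
    forall y, a <= y <= b -> `|y - x| < d -> `|f y - f x| <= e.
  move=> axb e0; have e4 : 0 < e / 4 by rewrite divr_gt0.
  have [d1 d10 h1] := Jc x _ axb e4.
  have [d2 d20 h2] := exists_mul_le (normr_ge0 (u' a)) e4.
  have /cvgrPdist_le /(_ _ e4)[d3 /= d30 h3] := cu x.
  exists (Num.min d1 (Num.min d2 d3)); first by rewrite !lt_min d10 d20.
  move=> y ayb; rewrite !lt_min => /and3P[y1 y2 y3].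
  have -> : f y - f x = (u y - u x) - (y - x) * u' a - 2 * (J y - J x).
    by rewrite /f; ring.
  have k1 := h1 y ayb y1.
  have k3 : `|u y - u x| <= e / 4 by rewrite distrC; apply: h3; rewrite /ball_/= distrC.
  have k2 : `|(y - x) * u' a| <= e / 4.
    by rewrite normrM (le_trans _ h2)// ler_wpM2r// ltW.
  rewrite (le_trans (ler_normB _ _))// normrM (@ger0_norm _ 2)//.
  have := ler_normB (u y - u x) ((y - x) * u' a); lra.
have fd x e : a <= x < b -> 0 < e -> exists2 d, 0 < d &
    forall h, 0 < h < d -> `|f (x + h) - f x| <= h * e.
  move=> /andP[ax xb] e0; have e4 : 0 < e / 4 by rewrite divr_gt0.
  have [d1 d10 h1] := ru x _ e4.
  have [d2 d20 h2] := itg_right0 kR x cu e4.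
  exists (Num.min d1 d2); first by rewrite lt_min d10.
  move=> h /andP[h0]; rewrite lt_min => /andP[hd1 hd2].
  have := h1 h; rewrite h0 hd1 => /(_ isT) k1.
  have := h2 h; rewrite h0 hd2 => /(_ isT) k2.
  have xh : x <= x + h by rewrite lerDl ltW.
  have -> : f (x + h) - f x = (u (x + h) - u x - h * u' x)
      - 2 * itg x (x + h) (fun y => (x + h - y) * u y).
    have := JE x (x + h) ax xh; have := u'E a x ax; rewrite /f.
    move=> q1 q2.
    have -> : u (x + h) - (x + h - a) * u' a - 2 * J (x + h) -
      (u x - (x - a) * u' a - 2 * J x) = u (x + h) - u x - h * u' a - 2 * (J (x + h) - J x).
      by ring.
    rewrite q2; have -> : u' x = u' a + 2 * itg a x u by lra.
    by ring.
  have /andP[q1 q2] := itg_aff_bound cu xh u0'.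
  rewrite (le_trans (ler_normB _ _))// normrM (@ger0_norm _ 2)// (ger0_norm q1).
  have : h * itg x (x + h) u <= h * (e / 4).
    by rewrite ler_pM2l// (le_trans (ler_norm _)).
  move: q2; rewrite (_ : x + h - x = h); last by ring.
  lra.
have fab : f b = f a.
  apply/eqP; rewrite eq_le; apply/andP; split.
    apply: nonincreasing_of_rder => // x e ax e0.
    have [d d0 hd] := fd x e ax e0; exists d => // h /hd.
    by rewrite ler_norml => /andP[].
  rewrite -lerN2; apply: (@nonincreasing_of_rder _ a b (fun x => - f x)) => // x e ax e0.
    have [d d0 hd] := fc x e ax e0; exists d => // y ay yx.
    by rewrite -opprD normrN; exact: hd.
  have [d d0 hd] := fd x e ax e0; exists d => // h /hd.
  by rewrite ler_norml -opprD => /andP[? ?]; lra.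
by move: fab; rewrite /f /J itg0; lra.
Qed.

Lemma sol_lin u u' v v' (c : R) : sol u u' -> sol v v' ->
  sol (fun x => u x + c * v x) (fun x => u' x + c * v' x).
Proof.
move=> [cu ru eu iu] [cv rv ev iv].
have ccv : continuous (fun x => c * v x).
  by move=> y; apply: cvgM; [exact: cvg_cst|exact: cv].
split.
- by move=> y; apply: cvgD; [exact: cu|exact: ccv].
- exact: rder_lin.
- by move=> a z az; rewrite itgD// itgZ// mulrDr -eu// mulrCA -ev//; ring.
- move=> a z az.
  have -> : itg a z (fun y => (z - y) * (u y + c * v y)) =
      itg a z (fun y => (z - y) * u y) + c * itg a z (fun y => (z - y) * v y).
    rewrite -itgZ//; last exact: continuous_affM.
    rewrite -itgD//; last 2 first.
    + exact: continuous_affM.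
    + by move=> y; apply: cvgM; [exact: cvg_cst|exact: continuous_affM].
    by apply: eq_itg => y _; ring.
  by rewrite [in LHS](iu a z)// [in LHS](iv a z)//; ring.
Qed.

(** The Taylor formula read from the right end: the slope at z is eliminated in favour of the slope
    at a through the once integrated equation. *)
Lemma sol_backward u u' a z : sol u u' -> z <= a ->
  u z = u a - (a - z) * u' a + 2 * itg z a (fun y => (y - z) * u y).
Proof.
move=> [cu ru eu iu] za; have h1 := iu z a za; have h2 := eu z a za.
have -> : itg z a (fun y => (y - z) * u y) =
    (a - z) * itg z a u - itg z a (fun y => (a - y) * u y).
  rewrite -itgZ// -itgB//; last 2 first.
  + by move=> y; apply: cvgM; [exact: cvg_cst|exact: cu].
  + exact: continuous_affM.
  by apply: eq_itg => y _; ring.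
have -> : u' a = u' z + 2 * itg z a u by lra.
by rewrite h1; ring.
Qed.

End ode.

(** * Shape and growth of u_up and u_down *)

Section killed_solutions.
Context {R : realType} (kappa : borel_measure R) (kR : radon kappa).
Implicit Types (u : R -> R) (x y z M e : R).
Variables U D : R -> R.
Hypotheses (U0 : forall y, 0 < U y) (D0 : forall y, 0 < D y)
  (U_nd : forall y z, y <= z -> U y <= U z) (D_ni : forall y z, y <= z -> D z <= D y)
  (U_ode : killed_ode kappa U) (D_ode : killed_ode kappa D).
Local Notation U' := (rderive U).
Local Notation D' := (rderive D).
Hypothesis W : forall y, D y * U' y - U y * D' y = 2.
Local Notation itg := (itg kappa).

Let solU : sol kappa U U'. Proof. exact: sol_of_ode. Qed.
Let solD : sol kappa D D'. Proof. exact: sol_of_ode. Qed.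
Let cU : continuous U. Proof. by case: solU. Qed.
Let cD : continuous D. Proof. by case: solD. Qed.

Let rder_ge0 u u' x : rder u u' -> (forall y, x <= y -> u x <= u y) -> 0 <= u' x.
Proof.
move=> ru nu; rewrite leNgt; apply/negP => ux.
have e0 : 0 < - u' x / 2 by lra.
have [d d0 hd] := ru x _ e0.
have := hd (d / 2); have -> : 0 < d / 2 < d by lra.
move=> /(_ isT); rewrite ler_norml => /andP[_ k].
have k2 : u x <= u (x + d / 2) by apply: nu; lra.
have k3 : 0 < d * - u' x by rewrite mulr_gt0// oppr_gt0.
lra.
Qed.

Lemma U'_ge0 x : 0 <= U' x.
Proof. by case: solU => _ r _ _; apply: rder_ge0 r _ => y; exact: U_nd. Qed.

Lemma D'_le0 x : D' x <= 0.
Proof.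
case: solD => _ r _ _; rewrite -oppr_ge0.
have r0 : rder (cst (0 : R)) (cst 0).
  move=> y e e0; exists 1 => // h /andP[h0 _] /=.
  by rewrite subrr mulr0 subrr normr0 mulr_ge0 ?ltW.
have := rder_lin (-1) r0 r => rN.
rewrite (_ : - D' x = cst (0 : R) x + -1 * D' x); last by rewrite /= add0r mulN1r.
by apply: (rder_ge0 rN) => y xy /=; rewrite !add0r; have := D_ni xy; lra.
Qed.

Lemma D'_nd x y : x <= y -> D' x <= D' y.
Proof.
move=> xy; case: solD => _ _ /(_ x y xy) h _.
suff : 0 <= itg x y D by lra.
by apply: itg_ge0 => z _; exact/ltW.
Qed.

Lemma U_convex x y : x <= y -> U x + (y - x) * U' x <= U y.
Proof.
move=> xy; case: solU => _ _ _ /(_ x y xy) ->.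
rewrite lerDl mulr_ge0//; apply: itg_ge0 => z /andP[_ zy].
by rewrite mulr_ge0 ?subr_ge0// ltW.
Qed.

Lemma D_convex x y : x <= y -> D y - (y - x) * D' y <= D x.
Proof.
move=> xy; rewrite (sol_backward kR solD xy).
rewrite lerDl mulr_ge0//; apply: itg_ge0 => z /andP[xz _].
by rewrite mulr_ge0 ?subr_ge0// ltW.
Qed.

(** If U' vanished everywhere, U would be constant on [0, +oo[ and the Wronskian identity would give
    D' = - 2 / U 0 there, so the positive function D would be negative at the point U 0 * D 0. *)
Lemma U'_gt0_ex : exists z, 0 < U' z.
Proof.
apply: contrapT => hn; have U'0 z : U' z = 0.
  apply/eqP; rewrite eq_le U'_ge0 andbT leNgt; apply/negP => h.
  by apply: hn; exists z.
have UU z : 0 <= z -> U z = U 0.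
  move=> z0; case: solU => _ _ hU /(_ 0 z z0) ->.
  rewrite U'0 mulr0 addr0 -[RHS]addr0; congr (_ + _); apply/eqP.
  rewrite mulf_eq0 pnatr_eq0/= eq_le; apply/andP; split; last first.
    apply: itg_ge0 => y /andP[_ yz].
    by rewrite mulr_ge0 ?subr_ge0// ltW.
  apply: (@le_trans _ _ (itg 0 z (fun y => z * U y))).
    apply: le_itg => //; first exact: continuous_affM.
      by move=> y; apply: cvgM; [exact: cvg_cst|exact: cU].
    by move=> y /andP[y0 _]; rewrite ler_wpM2r ?ltW//; lra.
  rewrite itgZ//; have := hU 0 z z0; rewrite !U'0 subrr => h.
  have -> : itg 0 z U = 0 by lra.
  by rewrite mulr0.
have D'E z : 0 <= z -> U 0 * D' z = - 2.
  by move=> z0; have := W z; rewrite U'0 mulr0 sub0r UU// => <-; rewrite opprK.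
pose z := U 0 * D 0.
have z0 : 0 <= z by rewrite mulr_ge0 ?ltW.
have := D_convex z0; have := D0 z; rewrite subr0.
rewrite /z -(ltr_pM2l (U0 0)) mulr0 => k1.
rewrite -(ler_pM2l (U0 0)) mulrBr -[z in D' z]/z.
have k3 := D'E z z0; rewrite -/z in k1 *.
rewrite mulrCA k3; have : 0 < U 0 * D 0 by exact: mulr_gt0.
rewrite -/z; lra.
Qed.

(** The argument of [U'_gt0_ex] on the other half-line: D would be constant on ]-oo, 0], and U would
    be negative at - (D 0 * U 0). *)
Lemma D'_lt0_ex : exists z, D' z < 0.
Proof.
apply: contrapT => hn; have D'0 z : D' z = 0.
  apply/eqP; rewrite eq_le D'_le0/= leNgt; apply/negP => h.
  by apply: hn; exists z.
have DD z : z <= 0 -> D z = D 0.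
  move=> z0; rewrite (sol_backward kR solD z0) D'0 mulr0 subr0.
  rewrite -[RHS]addr0; congr (_ + _); apply/eqP.
  rewrite mulf_eq0 pnatr_eq0/= eq_le; apply/andP; split; last first.
    apply: itg_ge0 => y /andP[yz _].
    by rewrite mulr_ge0 ?subr_ge0// ltW.
  apply: (@le_trans _ _ (itg z 0 (fun y => - z * D y))).
    apply: le_itg => //.
    - by move=> y; apply: cvgM; [apply: cvgB; [exact: cvg_id|exact: cvg_cst]|exact: cD].
    - by move=> y; apply: cvgM; [exact: cvg_cst|exact: cD].
    - by move=> y /andP[_ y0]; rewrite (ler_wpM2r (ltW (D0 y)))//; lra.
  rewrite itgZ//; case: solD => _ _ /(_ z 0 z0); rewrite !D'0 subrr => h _.
  have -> : itg z 0 D = 0 by lra.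
  by rewrite mulr0.
have U'E z : z <= 0 -> D 0 * U' z = 2.
  by move=> z0; have := W z; rewrite D'0 mulr0 subr0 DD.
pose z := - (D 0 * U 0).
have z0 : z <= 0 by rewrite oppr_le0 mulr_ge0 ?ltW.
have := U_convex z0; have := U0 z.
rewrite -(ltr_pM2l (D0 0)) mulr0 => k1.
rewrite -(ler_pM2l (D0 0)) mulrDr mulrCA U'E// sub0r.
have : 0 < D 0 * U 0 by exact: mulr_gt0.
rewrite /z opprK in k1 *; lra.
Qed.

(** U is convex and has a positive slope somewhere. *)
Lemma U_unbounded M : exists2 z, 0 <= z & forall y, z <= y -> M <= U y.
Proof.
have [z0 hz] := U'_gt0_ex.
exists (Num.max 0 (z0 + `|M| / U' z0)); first by rewrite le_max lexx.
move=> y; rewrite ge_max => /andP[_ hy].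
have zy : z0 <= y by rewrite (le_trans _ hy)// lerDl divr_ge0 ?(ltW hz).
apply: le_trans (U_convex zy).
have : `|M| <= (y - z0) * U' z0 by rewrite -ler_pdivrMr//; lra.
have := ler_norm M; have := U0 z0; lra.
Qed.

Lemma D_unbounded M : exists2 z, z <= 0 & forall y, y <= z -> M <= D y.
Proof.
have [z0 hz] := D'_lt0_ex; have hz' : 0 < - D' z0 by rewrite oppr_gt0.
exists (Num.min 0 (z0 - `|M| / - D' z0)); first by rewrite ge_min lexx.
move=> y; rewrite le_min => /andP[_ hy].
have zy : y <= z0 by rewrite (le_trans hy)// gerBl divr_ge0// (ltW hz').
apply: le_trans (D_convex zy).
have : `|M| <= (z0 - y) * - D' z0 by rewrite -ler_pdivrMr//; lra.
have := ler_norm M; have := D0 z0; lra.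
Qed.

Let rder_const u u' x y : rder u u' -> x < y ->
  (forall z, x <= z <= y -> u z = u x) -> u' x = 0.
Proof.
move=> ru xy uc; apply/eqP; rewrite -normr_le0; apply/ler_addgt0Pr => e e0.
have [d d0 hd] := ru x e e0; pose h := Num.min (d / 2) (y - x).
have h0 : 0 < h by rewrite lt_min divr_gt0// subr_gt0.
have hy : h <= y - x by rewrite ge_min lexx orbT.
have hd' : h < d by rewrite gt_min; apply/orP; left; lra.
have := hd h; rewrite h0 hd' => /(_ isT).
rewrite uc ?subrr ?sub0r; last by apply/andP; lra.
by rewrite normrN normrM (gtr0_norm h0) ler_pM2l// add0r.
Qed.

(** By monotonicity, equality would make both functions constant on [x, y] and cancel both right
    derivatives at x, against the Wronskian identity. The strict inequality is what keeps the
    determinant 1 - rho * lam of a gap positive. *)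
Lemma UD_cross x y : x < y -> U x * D y < U y * D x.
Proof.
move=> xy; have h1 : U x <= U y by apply: U_nd; exact: ltW.
have h2 : D y <= D x by apply: D_ni; exact: ltW.
rewrite lt_neqAle; apply/andP; split; last by rewrite ler_pM// ltW.
apply/negP => /eqP e.
have Uxy : U x = U y.
  apply/eqP; rewrite eq_le h1 leNgt/=; apply/negP => k.
  have : U x * D y < U y * D y by rewrite ltr_pM2r.
  have : U y * D y <= U y * D x by rewrite ler_pM2l.
  lra.
have Dxy : D x = D y by move: e; rewrite Uxy => /(mulfI (lt0r_neq0 (U0 y))).
have [_ rU _ _] := solU; have [_ rD _ _] := solD.
have U'x : U' x = 0.
  apply: (rder_const rU xy) => z /andP[xz zy].
  by apply/eqP; rewrite eq_le (U_nd xz) andbT Uxy U_nd.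
have D'x : D' x = 0.
  apply: (rder_const rD xy) => z /andP[xz zy].
  by apply/eqP; rewrite eq_le (D_ni xz)/= Dxy D_ni.
by have := W x; rewrite U'x D'x !mulr0 subrr => /esym/eqP; rewrite pnatr_eq0.
Qed.

(** By convexity (a - y) U' y <= U a - U y < U a, and U a <= (a - y) e as soon as y <= a - U a /
    e. *)
Lemma U'_to0 a e : 0 < e -> exists2 z, z <= a & forall y, y <= z -> U' y <= e.
Proof.
move=> e0; exists (a - U a / e); first by rewrite gerBl divr_ge0 ?ltW.
move=> y hy.
have ya : y < a by rewrite (le_lt_trans hy)// gtrBl divr_gt0.
have := U_convex (ltW ya); have := U0 y => k1 k2.
have ay : 0 < a - y by rewrite subr_gt0.
rewrite -(ler_pM2l ay); have : U a <= (a - y) * e by rewrite -ler_pdivrMr//; lra.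
lra.
Qed.

(* The right derivative of [U D] lies in [-2, 2] by the Wronskian identity. *)
Lemma UD_growth y : U y * D y <= U 0 * D 0 + 2 * `|y|.
Proof.
have cUD : continuous (fun y => U y * D y).
  by move=> z; apply: cvgM; [exact: cU|exact: cD].
have [_ rU _ _] := solU; have [_ rD _ _] := solD.
have rUD := rder_mul rU rD.
have ctl (k : R) : forall x e, 0 < e -> exists2 d, 0 < d &
    forall z, `|z - x| < d -> `|(k * (U z * D z) - 2 * z) - (k * (U x * D x) - 2 * x)| <= e.
  move=> x e e0.
  have ck : continuous (fun z => k * (U z * D z) - 2 * z).
    by move=> z; apply: cvgB; (apply: cvgM; [exact: cvg_cst|]); [exact: cUD|exact: cvg_id].
  have /cvgrPdist_le /(_ e e0)[d /= d0 hd] := ck x.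
  exists d => // z zx; rewrite distrC; apply: hd; by rewrite /ball_/= distrC.
have rl (k : R) : forall x e, 0 < e -> k * (U' x * D x + U x * D' x) <= 2 ->
    exists2 d, 0 < d & forall h, 0 < h < d ->
    (k * (U (x + h) * D (x + h)) - 2 * (x + h)) - (k * (U x * D x) - 2 * x) <= h * e.
  move=> x e e0 hk.
  have [e' e'0 he'] := exists_mul_le (normr_ge0 k) e0.
  have [d d0 hd] := rUD x e' e'0; exists d => // h hh; have := hd h hh.
  have /andP[h0 _] := hh.
  set r := _ - _ - _ => hr.
  have kr : k * r <= h * e.
    rewrite (le_trans (ler_norm _))// normrM mulrC.
    apply: (@le_trans _ _ (h * e' * `|k|)); first by rewrite ler_wpM2r.
    by rewrite -mulrA ler_pM2l.
  have -> : k * (U (x + h) * D (x + h)) - 2 * (x + h) - (k * (U x * D x) - 2 * x) =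
    k * r + h * (k * (U' x * D x + U x * D' x) - 2) by rewrite /r; ring.
  have : h * (k * (U' x * D x + U x * D' x) - 2) <= 0.
    by rewrite pmulr_rle0//; lra.
  lra.
have b1 x : U' x * D x + U x * D' x <= 2.
  by have := W x; have : U x * D' x <= 0; [rewrite pmulr_rle0// D'_le0|lra].
have b2 x : - 1 * (U' x * D x + U x * D' x) <= 2.
  by have := W x; have : 0 <= U' x * D x; [rewrite pmulr_lge0// U'_ge0|lra].
have [y0|/ltW y0] := leP 0 y.
  have : 1 * (U y * D y) - 2 * y <= 1 * (U 0 * D 0) - 2 * 0.
    apply: (@nonincreasing_of_rder _ 0 y (fun z => 1 * (U z * D z) - 2 * z)) => // x e _ e0.
      by have [d d0 hd] := ctl 1 x e e0; exists d => // z _ /hd.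
    by apply: rl => //; rewrite mul1r.
  by rewrite !mul1r mulr0 subr0 ger0_norm//; lra.
have : - 1 * (U 0 * D 0) - 2 * 0 <= - 1 * (U y * D y) - 2 * y.
  apply: (@nonincreasing_of_rder _ y 0 (fun z => - 1 * (U z * D z) - 2 * z)) => // x e _ e0.
    by have [d d0 hd] := ctl (- 1) x e e0; exists d => // z _ /hd.
  by apply: rl.
by rewrite mulr0 ler0_norm//; lra.
Qed.

End killed_solutions.

(** * A spline mollifier of the positive part *)

Section spline.
Context {R : realType}.
Implicit Types x z u e : R.

Definition pp x : R := Num.max x 0.

Lemma pp_pos x : 0 <= x -> pp x = x.
Proof. by move=> x0; apply/max_idPl. Qed.

Lemma pp_neg x : x <= 0 -> pp x = 0.
Proof. by move=> x0; apply/max_idPr. Qed.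

Lemma pp_ge0 x : 0 <= pp x.
Proof. by rewrite le_max lexx orbT. Qed.

Lemma continuous_pp : continuous pp.
Proof. by move=> x; apply: (@continuous_max _ R id (cst 0)); [exact: cvg_id|exact: cvg_cst]. Qed.

Lemma pp_lip x z : `|pp x - pp z| <= `|x - z|.
Proof.
have [x0|x0] := leP 0 x; have [z0|z0] := leP 0 z.
- by rewrite !pp_pos.
- rewrite pp_pos// (pp_neg (ltW z0)) subr0 ger0_norm// ger0_norm; lra.
- rewrite (pp_neg (ltW x0)) pp_pos// sub0r normrN ger0_norm// ler0_norm; lra.
- by rewrite (pp_neg (ltW x0)) (pp_neg (ltW z0)) subrr normr0.
Qed.

(** The cube of the positive part is twice continuously differentiable with a Lipschitz second
    derivative, so the error is cubic everywhere, across the kink included. *)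
Lemma pp3_taylor x u :
  `|pp (x + u) ^+ 3 / 6 - pp x ^+ 3 / 6 - pp x ^+ 2 / 2 * u - pp x / 2 * u ^+ 2|
  <= `|u| ^+ 3.
Proof.
have u30 : 0 <= `|u| ^+ 3 by rewrite exprn_ge0.
have [x0|x0] := leP 0 x; have [xu0|xu0] := leP 0 (x + u).
- rewrite !pp_pos//.
  have -> : (x + u) ^+ 3 / 6 - x ^+ 3 / 6 - x ^+ 2 / 2 * u - x / 2 * u ^+ 2 = u ^+ 3 / 6.
    by field.
  by rewrite normrM normrX (@ger0_norm _ 6^-1)// ; lra.
- rewrite (pp_pos x0) (pp_neg (ltW xu0)).
  have u0 : u <= 0 by lra.
  rewrite ler0_norm in u30 *; last by [].
  have k3 : (- u) * x * (- u - x) >= 0 by rewrite mulr_ge0 ?mulr_ge0//; lra.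
  rewrite ler_norml; apply/andP; split; nra.
- rewrite (pp_neg (ltW x0)) (pp_pos xu0).
  rewrite [X in `|X|](_ : _ = (x + u) ^+ 3 / 6); last by field.
  have u0 : 0 <= u by lra.
  rewrite (ger0_norm u0) ger0_norm ?divr_ge0 ?exprn_ge0//.
  have : (x + u) ^+ 3 <= u ^+ 3 by rewrite lerXn2r ?nnegrE//; lra.
  have : 0 <= (x + u) ^+ 3 by rewrite exprn_ge0.
  lra.
- by rewrite (pp_neg (ltW x0)) (pp_neg (ltW xu0)) [X in `|X|](_ : _ = 0) ?normr0//; field.
Qed.

Lemma pp2_taylor x u : `|pp (x + u) ^+ 2 / 2 - pp x ^+ 2 / 2 - pp x * u| <= u ^+ 2.
Proof.
have [x0|x0] := leP 0 x; have [xu0|xu0] := leP 0 (x + u).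
- rewrite !pp_pos// [X in `|X|](_ : _ = u ^+ 2 / 2); last by field.
  by rewrite ger0_norm ?divr_ge0 ?sqr_ge0//; have := sqr_ge0 u; lra.
- rewrite (pp_pos x0) (pp_neg (ltW xu0)) ler_norml; apply/andP; split; nra.
- rewrite (pp_neg (ltW x0)) (pp_pos xu0) ler_norml; apply/andP; split; nra.
- by rewrite (pp_neg (ltW x0)) (pp_neg (ltW xu0)) [X in `|X|](_ : _ = 0) ?normr0 ?sqr_ge0//; field.
Qed.

(* Second differences of the cubic [pp^3 / 6] at step [e]: a C^2 approximation
   of [pp] whose second derivative [ker2] is the triangle kernel of width [e]. *)
Definition ker e z : R :=
  (pp (z + e) ^+ 3 / 6 - 2 * (pp z ^+ 3 / 6) + pp (z - e) ^+ 3 / 6) / e ^+ 2.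
Definition ker1 e z : R :=
  (pp (z + e) ^+ 2 / 2 - 2 * (pp z ^+ 2 / 2) + pp (z - e) ^+ 2 / 2) / e ^+ 2.
Definition ker2 e z : R := (pp (z + e) - 2 * pp z + pp (z - e)) / e ^+ 2.

Lemma ker_taylor e z u : 0 < e ->
  `|ker e (z + u) - ker e z - ker1 e z * u - ker2 e z / 2 * u ^+ 2|
  <= 4 / e ^+ 2 * `|u| ^+ 3.
Proof.
move=> e0; have e20 : 0 < e ^+ 2 by rewrite exprn_gt0.
have h1 := pp3_taylor (z + e) u; have h2 := pp3_taylor z u.
have h3 := pp3_taylor (z - e) u.
rewrite /ker /ker1 /ker2.
rewrite (_ : z + u + e = z + e + u); last by ring.
rewrite (_ : z + u - e = z - e + u); last by ring.
set a1 := _ - _ in h1; set a2 := _ - _ in h2; set a3 := _ - _ in h3.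
rewrite [X in `|X|](_ : _ = (a1 - 2 * a2 + a3) / e ^+ 2); last first.
  by rewrite /a1 /a2 /a3; field; rewrite gt_eqF.
rewrite normrM [`|_^-1|]ger0_norm ?invr_ge0 ?(ltW e20)// mulrAC ler_pM2r ?invr_gt0//.
have := ler_normD (a1 - 2 * a2) a3; have := ler_normB a1 (2 * a2).
by rewrite normrM (@ger0_norm _ 2)//; lra.
Qed.

Lemma ker1_taylor e z u : 0 < e ->
  `|ker1 e (z + u) - ker1 e z - ker2 e z * u| <= 4 / e ^+ 2 * u ^+ 2.
Proof.
move=> e0; have e20 : 0 < e ^+ 2 by rewrite exprn_gt0.
have h1 := pp2_taylor (z + e) u; have h2 := pp2_taylor z u.
have h3 := pp2_taylor (z - e) u.
rewrite /ker1 /ker2.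
rewrite (_ : z + u + e = z + e + u); last by ring.
rewrite (_ : z + u - e = z - e + u); last by ring.
set a1 := _ - _ in h1; set a2 := _ - _ in h2; set a3 := _ - _ in h3.
rewrite [X in `|X|](_ : _ = (a1 - 2 * a2 + a3) / e ^+ 2); last first.
  by rewrite /a1 /a2 /a3; field; rewrite gt_eqF.
rewrite normrM [`|_^-1|]ger0_norm ?invr_ge0 ?(ltW e20)// mulrAC ler_pM2r ?invr_gt0//.
have := ler_normD (a1 - 2 * a2) a3; have := ler_normB a1 (2 * a2).
by rewrite normrM (@ger0_norm _ 2)//; lra.
Qed.

Variant ker_spec e z : R -> R -> R -> Prop :=
| Ker_left of z <= - e : ker_spec e z 0 0 0
| Ker_midleft of - e <= z & z <= 0 :
    ker_spec e z ((z + e) ^+ 3 / (6 * e ^+ 2)) ((z + e) ^+ 2 / (2 * e ^+ 2)) ((z + e) / e ^+ 2)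
| Ker_midright of 0 <= z & z <= e :
    ker_spec e z (z + (e - z) ^+ 3 / (6 * e ^+ 2))
      (1 - (e - z) ^+ 2 / (2 * e ^+ 2)) ((e - z) / e ^+ 2)
| Ker_right of e <= z : ker_spec e z z 1 0.

Lemma kerP e z : 0 < e -> ker_spec e z (ker e z) (ker1 e z) (ker2 e z).
Proof.
move=> e0; have en : e != 0 by rewrite gt_eqF.
have [h1|h1] := leP z (- e).
  rewrite /ker /ker1 /ker2 !pp_neg; try lra.
  by rewrite !expr0n/= !mul0r mulr0 subrr addr0 !mul0r; exact: Ker_left.
have [h2|h2] := leP z 0.
  rewrite /ker /ker1 /ker2 (@pp_pos (z + e)) ?(@pp_neg z) ?(@pp_neg (z - e)); try lra.
  rewrite (_ : _ / e ^+ 2 = (z + e) ^+ 3 / (6 * e ^+ 2)); last by field.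
  rewrite [X in ker_spec _ _ _ X](_ : _ = (z + e) ^+ 2 / (2 * e ^+ 2)); last by field.
  rewrite [X in ker_spec _ _ _ _ X](_ : _ = (z + e) / e ^+ 2); last by field.
  by apply: Ker_midleft => //; exact: ltW.
have [h3|h3] := leP z e.
  rewrite /ker /ker1 /ker2 (@pp_pos (z + e)) ?(@pp_pos z) ?(@pp_neg (z - e)); try lra.
  rewrite [X in ker_spec _ _ X](_ : _ = z + (e - z) ^+ 3 / (6 * e ^+ 2)); last by field.
  rewrite [X in ker_spec _ _ _ X](_ : _ = 1 - (e - z) ^+ 2 / (2 * e ^+ 2)); last by field.
  rewrite [X in ker_spec _ _ _ _ X](_ : _ = (e - z) / e ^+ 2); last by field.
  by apply: Ker_midright => //; exact: ltW.
rewrite /ker /ker1 /ker2 !pp_pos; try lra.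
rewrite [X in ker_spec _ _ X](_ : _ = z); last by field.
rewrite [X in ker_spec _ _ _ X](_ : _ = 1); last by field.
rewrite [X in ker_spec _ _ _ _ X](_ : _ = 0); last by field.
by apply: Ker_right; exact: ltW.
Qed.

Lemma ker1_bound e z : 0 < e -> 0 <= ker1 e z <= 1.
Proof.
move=> e0; have e20 : 0 < 2 * e ^+ 2 by rewrite mulr_gt0// exprn_gt0.
case: (kerP z e0) => h1 *; rewrite ?lexx ?ler01//.
- by rewrite divr_ge0 ?sqr_ge0 ?(ltW e20)//= ler_pdivrMr// mul1r; nra.
- have : 0 <= (e - z) ^+ 2 / (2 * e ^+ 2) <= 1.
    by rewrite divr_ge0 ?sqr_ge0 ?(ltW e20)//= ler_pdivrMr// mul1r; nra.
  by move=> /andP[? ?]; apply/andP; split; lra.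
Qed.

Lemma ker2_ge0 e z : 0 < e -> 0 <= ker2 e z.
Proof.
move=> e0; have e20 : 0 < e ^+ 2 by rewrite exprn_gt0.
by case: (kerP z e0) => *; rewrite ?divr_ge0 ?(ltW e20)//; lra.
Qed.

Lemma ker2_le e z : 0 < e -> ker2 e z <= e^-1.
Proof.
move=> e0; have e20 : 0 < e ^+ 2 by rewrite exprn_gt0.
have ei : 0 <= e^-1 by rewrite invr_ge0 ltW.
have eE : e^-1 = e / e ^+ 2 by field; rewrite gt_eqF.
by case: (kerP z e0) => *; rewrite // eE ler_pM2r ?invr_gt0//; lra.
Qed.

Lemma ker2_eq0 e z : 0 < e -> e <= `|z| -> ker2 e z = 0.
Proof.
move=> e0; rewrite ler_normr => /orP[h|h]; case: (kerP z e0) => //.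
- by move=> ? ?; exfalso; lra.
- by move=> ? ?; rewrite (_ : z = e) ?subrr ?mul0r//; lra.
- by move=> ? ?; rewrite (_ : z = - e) ?addNr ?mul0r//; lra.
- by move=> ? ?; exfalso; lra.
Qed.

Lemma ker_pp e z : 0 < e -> 0 <= ker e z - pp z <= e.
Proof.
move=> e0; have e20 : 0 < 6 * e ^+ 2 by rewrite mulr_gt0// exprn_gt0.
case: (kerP z e0) => h1.
- by rewrite pp_neg ?subrr ?lexx ?(ltW e0)//; lra.
- move=> h2; rewrite pp_neg// subr0.
  have ze : 0 <= z + e by lra.
  rewrite divr_ge0 ?exprn_ge0 ?(ltW e20)//=.
  rewrite ler_pdivrMr//.
  have : (z + e) ^+ 3 <= e ^+ 3 by rewrite lerXn2r ?nnegrE//; lra.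
  have : 0 < e ^+ 3 by rewrite exprn_gt0.
  have -> : e * (6 * e ^+ 2) = 6 * e ^+ 3 by ring.
  by move=> k1 k2; lra.
- move=> h2; rewrite pp_pos// addrAC subrr add0r.
  have ze : 0 <= e - z by lra.
  rewrite divr_ge0 ?exprn_ge0 ?(ltW e20)//=.
  rewrite ler_pdivrMr//.
  have : (e - z) ^+ 3 <= e ^+ 3 by rewrite lerXn2r ?nnegrE//; lra.
  have : 0 < e ^+ 3 by rewrite exprn_gt0.
  have -> : e * (6 * e ^+ 2) = 6 * e ^+ 3 by ring.
  by move=> k1 k2; lra.
- by rewrite pp_pos ?subrr ?lexx ?(ltW e0)//; lra.
Qed.

Lemma continuous_ker2 e : continuous (ker2 e).
Proof.
have c (a : R) : continuous (fun z => pp (z + a)).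
  move=> z; apply: (@continuous_comp _ _ _ (fun z => z + a) pp); last exact: continuous_pp.
  by apply: cvgD; [exact: cvg_id|exact: cvg_cst].
move=> z; apply: cvgM; last exact: cvg_cst.
apply: cvgD; last exact: c.
apply: cvgB; first exact: c.
by apply: cvgM; [exact: cvg_cst|exact: continuous_pp].
Qed.

Lemma continuous_of_taylor (f f' : R -> R) (C : R) :
  (forall z u, `|f (z + u) - f z - f' z * u| <= C * u ^+ 2) -> continuous f.
Proof.
move=> h z; apply/cvgrPdist_le => e e0.
pose K := `|C| + `|f' z|.
have [d d0 dK] := exists_mul_le (addr_ge0 (normr_ge0 C) (normr_ge0 (f' z))) e0.
exists (Num.min 1 d) => /=; first by rewrite lt_min ltr01.
move=> y; rewrite /ball_/= lt_min => /andP[y1 yd].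
have := h z (y - z); rewrite subrKC => k.
rewrite distrC (_ : f y - f z = (f y - f z - f' z * (y - z)) + f' z * (y - z)); last by ring.
rewrite (le_trans (ler_normD _ _))//; apply: le_trans dK.
rewrite [leRHS]mulrDr; apply: lerD.
  apply: le_trans k _; rewrite -(real_normK (num_real (y - z))) distrC.
  apply: (@le_trans _ _ (`|C| * `|z - y|)); last by rewrite mulrC ler_wpM2r// ltW.
  rewrite (le_trans (ler_norm _))// normrM ler_wpM2l//.
  by rewrite normrX normr_id expr2 ler_piMr// ltW.
by rewrite normrM mulrC distrC ler_wpM2r// ltW.
Qed.

Lemma continuous_ker1 e : 0 < e -> continuous (ker1 e).
Proof.
by move=> e0; apply: (@continuous_of_taylor _ (ker2 e)) => z u; exact: ker1_taylor.
Qed.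

Lemma continuous_ker e : continuous (ker e).
Proof.
have c (a : R) : continuous (fun z => pp (z + a) ^+ 3 / 6).
  move=> z; apply: cvgM; last exact: cvg_cst.
  apply: (@continuous_comp _ _ _ (fun z => pp (z + a)) (fun x => x ^+ 3)); last exact: exprn_continuous.
  apply: (@continuous_comp _ _ _ (fun z => z + a) pp); last exact: continuous_pp.
  by apply: cvgD; [exact: cvg_id|exact: cvg_cst].
move=> z; apply: cvgM; last exact: cvg_cst.
apply: cvgD; last exact: c.
apply: cvgB; first exact: c.
apply: cvgM; first exact: cvg_cst.
by have := c 0 z; rewrite /continuous_at addr0; under [X in X @ _ --> _]eq_fun do rewrite addr0.
Qed.

Lemma is_derive_of_taylor (f f' : R -> R) (C : R) z :
  (forall u, `|f (z + u) - f z - f' z * u| <= C * u ^+ 2) -> is_derive z 1 f (f' z).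
Proof.
move=> h; have hc : h0^-1 *: (f (h0 *: 1 + z) - f z) @[h0 --> 0^'] --> f' z.
  apply/cvgrPdist_le => e e0.
  have [d d0 dC] := exists_mul_le (normr_ge0 C) e0.
  exists d => //= u; rewrite /ball_/= sub0r normrN => ud u0.
  have := h u; rewrite [u *: 1]mulr1 [u + z]addrC => k.
  rewrite distrC; have -> : u^-1 *: (f (z + u) - f z) - f' z =
    u^-1 * (f (z + u) - f z - f' z * u).
    by rewrite /GRing.scale/=; field.
  rewrite normrM normrV ?unitfE//.
  rewrite ler_pdivrMl ?normr_gt0//; apply: le_trans k _.
  rewrite (le_trans (ler_norm _))// normrM normrX expr2 mulrCA ler_wpM2l//.
  apply: le_trans dC; rewrite mulrC ler_wpM2r// ltW//.
split; first by apply/cvg_ex; exists (f' z).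
by apply/cvg_lim.
Qed.

(** [ker1] is a primitive of the kernel and climbs from 0 to 1 across its support. *)
Lemma integral_ker2 e (a : R) : 0 < e ->
  (\int[lebesgue_measure]_(y in `[(a - e)%R, (a + e)%R]) (ker2 e (y - a))%:E = 1)%E.
Proof.
move=> e0; have cc : continuous (fun y : R => y - a).
  by move=> y; apply: cvgB; [exact: cvg_id|exact: cvg_cst].
have dk (y : R) : is_derive y 1 (fun y => ker1 e (y - a)) (ker2 e (y - a)).
  apply: (@is_derive_of_taylor (fun y => ker1 e (y - a)) (fun y => ker2 e (y - a)) (4 / e ^+ 2)) => u.
  by rewrite (_ : y + u - a = y - a + u) ?ker1_taylor//; ring.
have ck1 : continuous (fun y : R => ker1 e (y - a)).
  move=> y; apply: (@continuous_comp _ _ _ (fun y : R => y - a) (ker1 e)); first exact: cc.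
  exact: continuous_ker1.
rewrite (@continuous_FTC2 _ (fun y => ker2 e (y - a)) (fun y => ker1 e (y - a))).
- rewrite -EFinB addrAC subrr add0r addrAC subrr add0r; congr (_%:E).
  have -> : ker1 e e = 1.
    by case: (kerP e e0) => //; lra.
  have -> : ker1 e (- e) = 0.
    by case: (kerP (- e) e0) => //; lra.
  by rewrite subr0.
- by lra.
- apply: continuous_subspaceT => y.
  apply: (@continuous_comp _ _ _ (fun y : R => y - a) (ker2 e)); first exact: cc.
  exact: continuous_ker2.
- split.
  + by move=> y _; exact: ex_derive.
  + by apply: cvg_at_right_filter; exact: ck1.
  + by apply: cvg_at_left_filter; exact: ck1.
- by move=> y _; rewrite derive1E; exact: derive_val.
Qed.

End spline.

(** * Summation along a discretised killed path *)

Section discrete_killing.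
Context {R : realType}.
Implicit Types (D G : nat -> R).

Lemma one_subr_expRN (u : R) : 0 <= u ->
  [/\ 0 <= 1 - expR (- u), 1 - expR (- u) <= u & u - (1 - expR (- u)) <= u ^+ 2].
Proof.
move=> u0; have h1 := expR_ge1Dx (- u); have h2 := expR_ge1Dx u.
have e1 : expR (- u) <= 1 by rewrite -expR0 ler_expR oppr_le0.
have e3 : expR (- u) * expR u = 1 by rewrite -expRD addNr expR0.
split; [lra|lra|].
have e0 := expR_gt0 (- u).
have : expR (- u) * (1 + u) <= expR (- u) * expR u by rewrite ler_pM2l.
rewrite e3; nra.
Qed.

Lemma sum_by_parts D G n :
  \sum_(0 <= i < n) D i * (G i.+1 - G i) =
  D n * G n - D 0%N * G 0%N + \sum_(0 <= i < n) (D i - D i.+1) * G i.+1.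
Proof.
elim: n => [|n IH]; first by rewrite !big_geq// subrr addr0.
by rewrite !big_nat_recr//= IH; ring.
Qed.

(** G changes only at multiples of m + 1, so the differences of D telescope inside each block; this
    passes from the fine mesh to the coarse one. *)
Lemma telescope_block D G m N :
  \sum_(0 <= i < N * m.+1) (D i - D i.+1) * G (i %/ m.+1)%N =
  \sum_(0 <= I < N) (D (I * m.+1)%N - D (I.+1 * m.+1)%N) * G I.
Proof.
elim: N => [|N IH]; first by rewrite mul0n !big_geq.
rewrite [RHS]big_nat_recr//= -IH mulSnr (@big_cat_nat _ _ _ (N * m.+1)%N)//= ?leq_addr//.
congr (_ + _).
have -> : \sum_(N * m.+1 <= i < N * m.+1 + m.+1) (D i - D i.+1) * G (i %/ m.+1)%N =
    \sum_(N * m.+1 <= i < N * m.+1 + m.+1) (D i - D i.+1) * G N.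
  apply: eq_big_nat => i /andP[h1 h2]; congr (_ * G _).
  apply/eqP; rewrite eqn_leq leq_divRL// h1 andbT -ltnS ltn_divLR//.
  by rewrite mulSnr.
rewrite -big_distrl/=; congr (_ * _).
rewrite (@telescope_sumr_eq _ _ _ (fun i => - D i)) ?leq_addr//; first by ring.
by move=> i _; ring.
Qed.

(* One step of the discrete Markov chain killed at rate [v] and stopped once
   [chi] fails; [G] is the reward at killing. *)
Variables (b : nat -> R) (chi : nat -> bool) (v F F2 f r : R -> R).
Variables (h Kv Rr E osc om : R) (G : nat -> R).
Hypotheses (chi_dec : forall i, chi i.+1 -> chi i) (h0 : 0 <= h)
  (v0 : forall z, 0 <= v z) (Kv0 : 0 <= Kv) (osc0 : 0 <= osc)
  (vK : forall i, chi i -> v (b i) <= Kv)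
  (F2E : forall i, chi i ->
  `|F2 (b i) / 2 - r (b i) * v (b i)| <= osc * v (b i)) (rR : forall z, `|r z| <= Rr)
  (FE : forall z, `|F z - f z| <= E).

(** The probability of not being killed before step i, the path being given, when v is the killing
    rate. *)
Definition damp i : R := expR (- (h * \sum_(0 <= j < i) v (b j))).

(** The move from j to j + 1 is made when [chi j] holds, so the path is frozen at the first index
    where [chi] fails, not at the last one where it holds. *)
Fixpoint stopped i : R :=
  if i is j.+1 then if chi j then b j.+1 else stopped j else b 0%N.

Lemma stopped_alive i : chi i -> stopped i = b i.
Proof. by case: i => //= i /chi_dec ->. Qed.

Lemma damp_gt0 i : 0 < damp i. Proof. exact: expR_gt0. Qed.

Lemma damp0 : damp 0 = 1.
Proof. by rewrite /damp big_geq// mulr0 oppr0 expR0. Qed.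

Lemma dampS i : damp i.+1 = damp i * expR (- (h * v (b i))).
Proof. by rewrite /damp big_nat_recr//= mulrDr opprD expRD. Qed.

Lemma damp_le i : damp i.+1 <= damp i.
Proof.
rewrite dampS ler_piMr ?(ltW (damp_gt0 i))//.
by rewrite -expR0 ler_expR oppr_le0 mulr_ge0.
Qed.

Lemma damp_le1 i : damp i <= 1.
Proof. by elim: i => [|i IH]; [rewrite damp0|exact: le_trans (damp_le i) IH]. Qed.

Lemma sum_damp n : \sum_(0 <= i < n) (damp i - damp i.+1) = 1 - damp n.
Proof.
rewrite (@telescope_sumr_eq _ _ _ (fun i => - damp i))// => [|i _]; last by ring.
by rewrite damp0; ring.
Qed.

(** A discrete Feynman-Kac formula. Summation by parts moves the differences from F to [damp]. The
    drop of [damp] over a step is [damp i] times h v up to the square of h v, and h F2 / 2 is h r v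
    up to [osc], so that the reward G at killing and the value f at the end remain. Replacing F by f
    costs E twice: in the rewards and in the final value. *)
Lemma killed_sum_estimate n : 0 <= om ->
  (forall i, (i < n)%N -> `|f (stopped i.+1) - (chi i)%:R * r (b i) - G i| <= om) ->
  `|\sum_(0 <= i < n) damp i * (chi i)%:R * (F (b i.+1) - F (b i) - h * (F2 (b i) / 2))
     + F (b 0%N)
     - (\sum_(0 <= i < n) (damp i - damp i.+1) * G i + damp n * f (stopped n))|
  <= 2 * E + om + osc + (osc + Rr) * (n%:R * (h * Kv) ^+ 2).
Proof.
move=> om0 hG.
have E0 : 0 <= E by apply: le_trans (FE 0).
have Rr0 : 0 <= Rr by apply: le_trans (rR 0).
pose Ph i := F (stopped i).
(* The stopped path absorbs the indicator [chi]: a frozen step contributes no increment. *)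
have s1 i : damp i * (chi i)%:R * (F (b i.+1) - F (b i) - h * (F2 (b i) / 2)) =
    damp i * (Ph i.+1 - Ph i) - damp i * (chi i)%:R * (h * (F2 (b i) / 2)).
  rewrite /Ph /=; case: (boolP (chi i)) => [ci|_].
    by rewrite stopped_alive// mulr1; ring.
  by rewrite subrr !mulr0 !mul0r subrr.
under eq_bigr do rewrite s1.
rewrite sumrB sum_by_parts damp0 mul1r.
(* [A] collects the errors in the reward, weighted by the drops of [damp], of total mass at most 1;
   [C] collects the mismatch between these drops times r and the second-order term. *)
pose A i := (damp i - damp i.+1) * (Ph i.+1 - (chi i)%:R * r (b i) - G i).
pose C i := (chi i)%:R * ((damp i - damp i.+1) * r (b i) - damp i * (h * (F2 (b i) / 2))).
rewrite [X in `|X|](_ : _ = damp n * (Ph n - f (stopped n)) +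
  (\sum_(0 <= i < n) A i + \sum_(0 <= i < n) C i)); last first.
  have -> : \sum_(0 <= i < n) A i + \sum_(0 <= i < n) C i =
     \sum_(0 <= i < n) (damp i - damp i.+1) * Ph i.+1
     - \sum_(0 <= i < n) damp i * (chi i)%:R * (h * (F2 (b i) / 2))
     - \sum_(0 <= i < n) (damp i - damp i.+1) * G i.
    by rewrite -!sumrB -big_split/=; apply: eq_bigr => i _; rewrite /A /C; ring.
  have -> : F (b 0%N) = Ph 0%N by [].
  by ring.
have dd i : 0 <= damp i - damp i.+1 by rewrite subr_ge0 damp_le.
have hA : `|\sum_(0 <= i < n) A i| <= E + om.
  apply: (le_trans (ler_norm_sum _ _ _)).
  apply: (@le_trans _ _ (\sum_(0 <= i < n) (damp i - damp i.+1) * (E + om))).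
    apply: ler_sum_nat => i /andP[_ ni]; rewrite /A normrM ger0_norm// ler_wpM2l//.
    rewrite /Ph (_ : _ - _ - _ = (F (stopped i.+1) - f (stopped i.+1)) +
      (f (stopped i.+1) - (chi i)%:R * r (b i) - G i)); last by ring.
    by rewrite (le_trans (ler_normD _ _))// lerD// hG.
  rewrite -big_distrl/= sum_damp ler_piMl//; last by have := damp_gt0 n; lra.
  by rewrite addr_ge0.
have hC : `|\sum_(0 <= i < n) C i| <= osc + (osc + Rr) * (n%:R * (h * Kv) ^+ 2).
  apply: (le_trans (ler_norm_sum _ _ _)).
  apply: (@le_trans _ _ (\sum_(0 <= i < n) (osc * (damp i - damp i.+1)
      + (osc + Rr) * (h * Kv) ^+ 2))).
    apply: ler_sum_nat => i _; rewrite /C.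
    case: (boolP (chi i)) => [ci|_]; last first.
      by rewrite mul0r normr0 addr_ge0 ?mulr_ge0// ?addr_ge0// sqr_ge0.
    rewrite mul1r; set u := h * v (b i).
    have u0 : 0 <= u by rewrite mulr_ge0.
    have uK : u <= h * Kv by rewrite ler_wpM2l// vK.
    have uK2 : u ^+ 2 <= (h * Kv) ^+ 2 by rewrite lerXn2r ?nnegrE// mulr_ge0.
    have [q1 q2 q3] := one_subr_expRN u0.
    have dE : damp i - damp i.+1 = damp i * (1 - expR (- u)).
      by rewrite dampS -/u; ring.
    have d0 := damp_gt0 i; have d1 := damp_le1 i.
    set w := F2 (b i) / 2 - r (b i) * v (b i).
    have hw : `|h * w| <= osc * u.
      rewrite normrM (ger0_norm h0) /u mulrCA ler_wpM2l//.
      exact: F2E.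
    have -> : (damp i - damp i.+1) * r (b i) - damp i * (h * (F2 (b i) / 2)) =
        - (damp i * (u - (1 - expR (- u)))) * r (b i) - damp i * (h * w).
      by rewrite dE /w /u; ring.
    rewrite (le_trans (ler_normB _ _))// normrM normrN !normrM (gtr0_norm d0).
    rewrite ger0_norm; last by lra.
    have t1 : damp i * (u - (1 - expR (- u))) * `|r (b i)| <= (h * Kv) ^+ 2 * Rr.
      apply: ler_pM => //; first by rewrite mulr_ge0 ?(ltW d0)//; lra.
      by rewrite -[leRHS]mul1r ler_pM// ?(ltW d0)//; [lra|lra].
    have t2 : damp i * `|h * w| <= osc * (damp i - damp i.+1) + osc * (h * Kv) ^+ 2.
      apply: (@le_trans _ _ (damp i * (osc * u))); first by rewrite ler_pM2l.
      rewrite dE -mulrDr mulrCA ler_wpM2l//.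
      have : damp i * (u - (1 - expR (- u))) <= 1 * (h * Kv) ^+ 2.
        by apply: ler_pM => //; [exact: ltW|lra|lra].
      by rewrite mulrBr; lra.
    by rewrite -normrM; lra.
  rewrite big_split/= -big_distrr/= sum_damp sumr_const_nat subn0.
  rewrite -mulrnAr -[(h * Kv) ^+ 2 *+ n]mulr_natl lerD2r -[leRHS]mulr1 ler_wpM2l//.
  by have := damp_gt0 n; lra.
have hB : `|damp n * (Ph n - f (stopped n))| <= E.
  rewrite normrM (gtr0_norm (damp_gt0 n)) -[leRHS]mul1r ler_pM ?damp_le1//.
    exact: (ltW (damp_gt0 n)).
  exact: FE.
rewrite (le_trans (ler_normD _ _))//.
have := ler_normD (\sum_(0 <= i < n) A i) (\sum_(0 <= i < n) C i); lra.
Qed.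

End discrete_killing.

(** * Bounded test functions with a prescribed second derivative *)

Section test_functions.
Context {R : realType} (kappa : borel_measure R) (kR : radon kappa).
Local Notation itg := (itg kappa).
Implicit Types x y z u e : R.

Lemma continuous_of_lip (f : R -> R) (C : R -> R) :
  (forall z u, `|u| <= 1 -> `|f (z + u) - f z| <= C z * `|u|) -> continuous f.
Proof.
move=> h z; apply/cvgrPdist_le => e e0.
have [d d0 dC] := exists_mul_le (normr_ge0 (C z)) e0.
exists (Num.min 1 d) => /=; first by rewrite lt_min ltr01.
move=> y; rewrite /ball_/= lt_min => /andP[y1 yd].
have := h z (y - z); rewrite subrKC distrC => /(_ (ltW y1)) k.
rewrite distrC; apply: le_trans k _; apply: le_trans dC.
by rewrite (le_trans (ler_norm _))// normrM normr_id mulrC ler_wpM2r// ltW.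
Qed.

Lemma continuous_subl (g : R -> R) z : continuous g -> continuous (fun y => g (z - y)).
Proof.
move=> cg y; apply: (@continuous_comp _ _ _ (fun y => z - y) g); last exact: cg.
by apply: cvgB; [exact: cvg_cst|exact: cvg_id].
Qed.

Lemma continuous_mul (f g : R -> R) : continuous f -> continuous g ->
  continuous (fun y => f y * g y).
Proof. by move=> cf cg y; apply: cvgM; [exact: cf|exact: cg]. Qed.

Lemma continuous_sub (f g : R -> R) : continuous f -> continuous g ->
  continuous (fun y => f y - g y).
Proof. by move=> cf cg y; apply: cvgB; [exact: cf|exact: cg]. Qed.

Lemma ker2_lip e z u : 0 < e -> `|ker2 e (z + u) - ker2 e z| <= 4 / e ^+ 2 * `|u|.
Proof.
move=> e0; have e20 : 0 < e ^+ 2 by rewrite exprn_gt0.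
rewrite /ker2 -mulrBl normrM [`|_^-1|]ger0_norm ?invr_ge0 ?(ltW e20)// mulrAC.
rewrite ler_pM2r ?invr_gt0//.
have h1 := pp_lip (z + u + e) (z + e); have h2 := pp_lip (z + u) z.
have h3 := pp_lip (z + u - e) (z - e).
rewrite (_ : z + u + e - (z + e) = u) in h1; last by ring.
rewrite (_ : z + u - z = u) in h2; last by ring.
rewrite (_ : z + u - e - (z - e) = u) in h3; last by ring.
rewrite (_ : _ - _ = (pp (z + u + e) - pp (z + e)) - 2 * (pp (z + u) - pp z)
  + (pp (z + u - e) - pp (z - e))); last by ring.
rewrite (le_trans (ler_normD _ _))//.
have := ler_normB (pp (z + u + e) - pp (z + e)) (2 * (pp (z + u) - pp z)).
by rewrite normrM (@ger0_norm _ 2)//; lra.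
Qed.

(** kappa convolved with the triangle kernel. As a killing rate it approximates kappa: its time
    integral along a path tends to the killing clock. *)
Definition kap e z : R := \int[kappa]_y ker2 e (z - y).

Lemma kapE e z M : 0 < e -> e <= 1 -> `|z| <= M - 1 ->
  kap e z = itg (- M) M (fun y => ker2 e (z - y)).
Proof.
move=> e0 e1 zM; rewrite /kap /itg [RHS]Rintegral_mkcond.
apply: eq_Rintegral => y _; rewrite patchE; case: ifPn => // /negP yM.
apply: ker2_eq0 => //; rewrite leNgt; apply/negP => h; apply: yM.
rewrite inE/= in_itv/=; move: zM h; rewrite ler_norml ltr_norml => /andP[? ?] /andP[? ?].
by apply/andP; split; [lra|apply: ltW; lra].
Qed.

Lemma kap_ge0 e z : 0 < e -> 0 <= kap e z.
Proof. by move=> e0; apply: Rintegral_ge0 => y _; exact: ker2_ge0. Qed.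

Let cker2 e z : continuous (fun y => ker2 e (z - y)).
Proof. by apply: continuous_subl; exact: continuous_ker2. Qed.

Lemma kap_bound e z M : 0 < e -> e <= 1 -> `|z| <= M - 1 ->
  kap e z <= e^-1 * fine (kappa `](- M), M]%classic).
Proof.
move=> e0 e1 zM; rewrite (kapE e0 e1 zM) (le_trans (ler_norm _))//.
apply: normr_itg_le => // y _.
by rewrite ger0_norm ?ker2_ge0// ker2_le.
Qed.

Lemma continuous_kap e : 0 < e -> e <= 1 -> continuous (kap e).
Proof.
move=> e0 e1.
apply: (@continuous_of_lip _ (fun z => 4 / e ^+ 2 * fine (kappa `](- (`|z| + 2)), (`|z| + 2)]%classic))).
move=> z u u1; rewrite !(@kapE _ _ (`|z| + 2))//; last 2 first.
- by rewrite -addrA (_ : 2 - 1 = 1 :> R) ?lerDl//; ring.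
- by rewrite (le_trans (ler_normD _ _))//; lra.
rewrite -itgB// mulrAC; apply: normr_itg_le => //.
  exact: continuous_sub.
move=> y _; have -> : z + u - y = (z - y) + u by ring.
exact: ker2_lip.
Qed.

Variables (a b s c0 Rr : R) (r : R -> R).
Hypotheses (ab : a < b) (cr : continuous r) (rR : forall z, `|r z| <= Rr)
  (r0 : forall z, (z <= a) || (b <= z) -> r z = 0).

Let s' : R := s + 2 * itg a b r.

(* The slope [s] at [a] and [s'] at [b] are undone at [a - 1] and [b + 1] so
   that the function is bounded. *)
Definition tfun (k : R -> R) z : R := s * k (z - (a - 1)) +
  2 * itg a b (fun y => k (z - y) * r y) - s' * k (z - (b + 1)).

(** On [a, b] this solves (1/2) f'' = r kappa, with value c0 + s and slope s at a; [tmol] is its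
    mollification. *)
Definition tlim z : R := c0 + tfun pp z.
Definition tmol e z : R := c0 + tfun (ker e) z.

(** A bound on the total variation of the second derivative of [tlim]; estimates on the kernel pass
    to [tfun] at the cost of this factor. *)
Definition tbd : R := `|s| + 2 * (Rr * fine (kappa `]a, b]%classic)) + `|s'|.

Let Rr0 : 0 <= Rr. Proof. exact: le_trans (rR 0). Qed.

Let k0 : 0 <= fine (kappa `]a, b]%classic). Proof. exact: fine_ge0. Qed.

Lemma tbd_ge0 : 0 <= tbd.
Proof. by rewrite !addr_ge0// mulr_ge0// mulr_ge0. Qed.

Lemma tfun_lin (k1 k2 : R -> R) (q : R) z w : continuous k1 -> continuous k2 ->
  tfun k1 z + q * tfun k2 w =
  s * (k1 (z - (a - 1)) + q * k2 (w - (a - 1))) +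
  2 * itg a b (fun y => (k1 (z - y) + q * k2 (w - y)) * r y)
  - s' * (k1 (z - (b + 1)) + q * k2 (w - (b + 1))).
Proof.
move=> c1 c2.
have -> : itg a b (fun y => (k1 (z - y) + q * k2 (w - y)) * r y) =
    itg a b (fun y => k1 (z - y) * r y) + q * itg a b (fun y => k2 (w - y) * r y).
  rewrite -itgZ//; last by apply: continuous_mul => //; exact: continuous_subl.
  rewrite -itgD//; last 2 first.
  - by apply: continuous_mul => //; exact: continuous_subl.
  - apply: continuous_mul; first by move=> y; exact: cvg_cst.
    by apply: continuous_mul => //; exact: continuous_subl.
  by apply: eq_itg => y _; ring.
by rewrite /tfun; ring.
Qed.

Lemma tcomb_bound (phi : R -> R) (A B C : R) : continuous phi -> 0 <= C ->
  `|A| <= C -> `|B| <= C -> (forall y, a < y <= b -> `|phi y| <= C) ->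
  `|s * A + 2 * itg a b (fun y => phi y * r y) - s' * B| <= tbd * C.
Proof.
move=> cphi C0 hA hB hphi.
have h : `|itg a b (fun y => phi y * r y)| <= C * Rr * fine (kappa `]a, b]%classic).
  apply: normr_itg_le => //; first exact: continuous_mul.
  by move=> y yab; rewrite normrM ler_pM// hphi.
rewrite (le_trans (ler_normB _ _))// (normrM s').
have h2 : `|s * A + 2 * itg a b (fun y => phi y * r y)| <=
    `|s| * C + 2 * (C * Rr * fine (kappa `]a, b]%classic)).
  rewrite (le_trans (ler_normD _ _))// !normrM (@ger0_norm _ 2)//.
  by rewrite lerD// ler_wpM2l.
have h3 : `|s'| * `|B| <= `|s'| * C by rewrite ler_wpM2l.
have -> : tbd * C = `|s| * C + 2 * (C * Rr * fine (kappa `]a, b]%classic)) + `|s'| * C.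
  by rewrite /tbd /s'; ring.
exact: lerD.
Qed.

Lemma tfun_bound (k : R -> R) (C : R) z : continuous k -> 0 <= C ->
  (forall y, `|k y| <= C) -> `|tfun k z| <= tbd * C.
Proof.
by move=> ck C0 hk; apply: tcomb_bound => //; exact: continuous_subl.
Qed.

Lemma tfun_diff_bound (k1 k2 : R -> R) (C : R) z w : continuous k1 -> continuous k2 ->
  0 <= C -> (forall y, `|k1 (z - y) - k2 (w - y)| <= C) ->
  `|tfun k1 z - tfun k2 w| <= tbd * C.
Proof.
move=> c1 c2 C0 h.
have -> : tfun k1 z - tfun k2 w = tfun k1 z + (- 1) * tfun k2 w by ring.
rewrite tfun_lin//; apply: tcomb_bound => //.
- move=> y; apply: cvgD; first exact: continuous_subl.
  by apply: cvgM; [exact: cvg_cst|exact: continuous_subl].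
- by rewrite mulN1r.
- by rewrite mulN1r.
- by move=> y _; rewrite mulN1r.
Qed.

Lemma tmol_tlim e z : 0 < e -> `|tmol e z - tlim z| <= tbd * e.
Proof.
move=> e0; rewrite /tmol /tlim (_ : _ - _ = tfun (ker e) z - tfun pp z); last by ring.
apply: tfun_diff_bound => //.
- exact: continuous_ker.
- exact: continuous_pp.
- exact: ltW.
- move=> y; have /andP[h1 h2] := ker_pp (z - y) e0.
  by rewrite ger0_norm.
Qed.

Lemma tlim_lip z w : `|tlim z - tlim w| <= tbd * `|z - w|.
Proof.
rewrite /tlim (_ : _ - _ = tfun pp z - tfun pp w); last by ring.
apply: tfun_diff_bound => //; [exact: continuous_pp|exact: continuous_pp|].
move=> y; apply: le_trans (pp_lip _ _) _.
by rewrite (_ : z - y - (w - y) = z - w)//; ring.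
Qed.

(** [tfun] is a convolution of the kernel with a finite signed measure; the Taylor error [phi] of
    the kernel is integrated against that measure. *)
Lemma tmol_taylor e z u : 0 < e ->
  `|tmol e (z + u) - tmol e z - tfun (ker1 e) z * u - tfun (ker2 e) z / 2 * u ^+ 2|
  <= tbd * (4 / e ^+ 2) * `|u| ^+ 3.
Proof.
move=> e0; rewrite /tmol.
have c0k := @continuous_ker R e; have c1k := continuous_ker1 e0; have c2k := @continuous_ker2 R e.
rewrite (_ : _ - _ = (tfun (ker e) (z + u) + (- 1) * tfun (ker e) z) +
   (- 1) * (u * tfun (ker1 e) z + (u ^+ 2 / 2) * tfun (ker2 e) z)); last by ring.
pose phi y := (ker e (z + u - y) + -1 * ker e (z - y)) +
   (- 1) * (u * ker1 e (z - y) + (u ^+ 2 / 2) * ker2 e (z - y)).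
have cphi : continuous phi.
  move=> y; apply: cvgD.
    apply: cvgD; first exact: continuous_subl.
    by apply: cvgM; [exact: cvg_cst|exact: continuous_subl].
  apply: cvgM; first exact: cvg_cst.
  by apply: cvgD; (apply: cvgM; [exact: cvg_cst|exact: continuous_subl]).
have phiB y : `|phi y| <= 4 / e ^+ 2 * `|u| ^+ 3.
  have := ker_taylor (z - y) u e0.
  rewrite /phi (_ : z + u - y = z - y + u); last by ring.
  congr (`|_| <= _); by field.
rewrite [X in `|X|](_ : _ = s * phi (a - 1) + 2 * itg a b (fun y => phi y * r y)
    - s' * phi (b + 1)); last first.
  have -> : itg a b (fun y => phi y * r y) =
      (itg a b (fun y => ker e (z + u - y) * r y) - itg a b (fun y => ker e (z - y) * r y))
      - (u * itg a b (fun y => ker1 e (z - y) * r y) +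
         u ^+ 2 / 2 * itg a b (fun y => ker2 e (z - y) * r y)).
    have cc (k : R -> R) w : continuous k -> continuous (fun y => k (w - y) * r y).
      by move=> ck; apply: continuous_mul => //; exact: continuous_subl.
    have cz (q : R) (k : R -> R) w : continuous k -> continuous (fun y => q * (k (w - y) * r y)).
      by move=> ck; apply: continuous_mul; [move=> y; exact: cvg_cst|exact: cc].
    rewrite -!itgZ//; try exact: cc.
    rewrite -itgB//; try exact: cc.
    rewrite -itgD//; try exact: cz.
    rewrite -itgB//; last 2 first.
    + by apply: continuous_sub; exact: cc.
    + by move=> y; apply: cvgD; exact: cz.
    by apply: eq_itg => y _; rewrite /phi; ring.
  by rewrite /tfun /phi; ring.
by rewrite -mulrA; apply: tcomb_bound => //; rewrite mulr_ge0// ?divr_ge0 ?sqr_ge0 ?exprn_ge0.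
Qed.

Lemma tfun1_bound e z : 0 < e -> `|tfun (ker1 e) z| <= tbd.
Proof.
move=> e0; rewrite -[leRHS]mulr1; apply: tfun_bound => //; first exact: continuous_ker1.
by move=> y; have /andP[? ?] := ker1_bound y e0; rewrite ger0_norm.
Qed.

Lemma tfun2_bound e z : 0 < e -> `|tfun (ker2 e) z| <= tbd * e^-1.
Proof.
move=> e0; apply: tfun_bound => //; [exact: continuous_ker2|by rewrite invr_ge0 ltW|].
by move=> y; rewrite ger0_norm ?ker2_ge0// ker2_le.
Qed.

Lemma continuous_tlim : continuous tlim.
Proof.
apply: (@continuous_of_lip _ (cst tbd)) => z u _.
by rewrite (le_trans (tlim_lip _ _))// (_ : z + u - z = u)//; ring.
Qed.

Lemma continuous_tfun2 e : 0 < e -> continuous (tfun (ker2 e)).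
Proof.
move=> e0; apply: (@continuous_of_lip _ (fun=> tbd * (4 / e ^+ 2))) => z u _.
rewrite -mulrA; apply: tfun_diff_bound; [exact: continuous_ker2|exact: continuous_ker2| |].
  by rewrite mulr_ge0// divr_ge0// sqr_ge0.
by move=> y; rewrite (_ : z + u - y = z - y + u) ?ker2_lip//; ring.
Qed.

Lemma continuous_tfun1 e : 0 < e -> continuous (tfun (ker1 e)).
Proof.
move=> e0; apply: (@continuous_of_lip _ (fun=> tbd * (4 / e ^+ 2 + e^-1))) => z u u1.
have e20 : 0 <= 4 / e ^+ 2 by rewrite divr_ge0// sqr_ge0.
have ei : 0 <= e^-1 by rewrite invr_ge0 ltW.
rewrite -mulrA; apply: tfun_diff_bound; [exact: continuous_ker1|exact: continuous_ker1| |].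
  by rewrite mulr_ge0// addr_ge0.
move=> y; have := ker1_taylor (z - y) u e0; rewrite (_ : z - y + u = z + u - y); last by ring.
move=> h; rewrite [X in `|X|](_ : _ = (ker1 e (z + u - y) - ker1 e (z - y) - ker2 e (z - y) * u)
  + ker2 e (z - y) * u); last by ring.
rewrite (le_trans (ler_normD _ _))// mulrDl lerD//.
  apply: le_trans h _; rewrite ler_wpM2l// -(real_normK (num_real u)).
  by rewrite expr2 ler_piMr.
by rewrite normrM ler_wpM2r// ger0_norm ?ker2_ge0// ker2_le.
Qed.

Lemma continuous_tmol e : 0 < e -> continuous (tmol e).
Proof.
move=> e0; apply: (@continuous_of_lip _ (fun=> tbd * (4 / e ^+ 2) + tbd + tbd * e^-1)) => z u u1.
have T0 := tbd_ge0; have e20 : 0 <= 4 / e ^+ 2 by rewrite divr_ge0// sqr_ge0.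
have h := tmol_taylor z u e0; have h1 := tfun1_bound z e0; have h2 := tfun2_bound z e0.
have u2 : `|u| ^+ 2 <= `|u| by rewrite expr2 ler_piMr.
have u3 : `|u| ^+ 3 <= `|u|.
  by rewrite exprS (le_trans _ u2)// expr2 ler_wpM2l// expr2 ler_piMr.
rewrite [X in `|X|](_ : _ = (tmol e (z + u) - tmol e z - tfun (ker1 e) z * u - tfun (ker2 e) z / 2 * u ^+ 2)
  + (tfun (ker1 e) z * u + tfun (ker2 e) z / 2 * u ^+ 2)); last by ring.
have -> : (tbd * (4 / e ^+ 2) + tbd + tbd * e^-1) * `|u| =
  tbd * (4 / e ^+ 2) * `|u| + (tbd * `|u| + tbd * e^-1 * `|u|) by ring.
apply: (le_trans (ler_normD _ _)); apply: lerD.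
  by apply: (le_trans h); rewrite ler_wpM2l// mulr_ge0.
apply: (le_trans (ler_normD _ _)); apply: lerD.
  by rewrite normrM ler_wpM2r.
rewrite normrM normrX; apply: ler_pM => //.
rewrite normrM [`|2^-1|]ger0_norm//; have := normr_ge0 (tfun (ker2 e) z); lra.
Qed.

(** Up to b + 1 every argument of [pp] is at most b - a + 2, the length of [a - 1, b + 1]; beyond b
    + 1 the function is constant. *)
Lemma tlim_bound z : `|tlim z| <= `|c0| + tbd * (b - a + 2).
Proof.
have L (w : R) : w <= b + 1 -> `|tlim w| <= `|c0| + tbd * (b - a + 2).
  move=> wb; rewrite /tlim (le_trans (ler_normD _ _))// lerD2l.
  have hp (y : R) : a - 1 <= y -> `|pp (w - y)| <= b - a + 2.
    move=> ay; rewrite ger0_norm ?pp_ge0// /pp ge_max; apply/andP; split.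
      lra.
    by rewrite addr_ge0// subr_ge0 ltW.
  apply: tcomb_bound.
  - by apply: continuous_subl; exact: continuous_pp.
  - by rewrite addr_ge0// subr_ge0 ltW.
  - exact: hp.
  - by apply: hp; have := ltW ab; lra.
  - by move=> y /andP[ay _]; apply: hp; have := ltW ay; lra.
have [|zb] := leP z (b + 1); first exact: L.
(* s' is the slope gathered at b, so the affine pieces cancel to the right of b + 1. *)
suff -> : tlim z = tlim (b + 1) by exact: L.
rewrite /tlim /tfun; congr (_ + _).
have lab := ltW ab.
rewrite !pp_pos; try lra.
have E (w : R) : b + 1 <= w -> itg a b (fun y => pp (w - y) * r y) =
    w * itg a b r - itg a b (fun y => y * r y).
  move=> bw; have ci : continuous (fun y : R => y * r y).
    by apply: continuous_mul => // y; exact: cvg_id.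
  rewrite -itgZ// -itgB//; last by apply: continuous_mul => // y; exact: cvg_cst.
  apply: eq_itg => y /andP[_ yb]; rewrite pp_pos; last by lra.
  by ring.
rewrite !E//; [rewrite /s'; ring|exact: ltW].
Qed.

(** Since e <= 1, a kernel centred in [a, b] does not see the corrections at a - 1 and b + 1; since
    r vanishes outside ]a, b[, the integral extends to the whole support of the kernel, where r
    differs from r z by at most osc. *)
Lemma tfun2_kap e z osc : 0 < e -> e <= 1 -> a <= z <= b ->
  (forall y, `|y - z| <= e -> `|r y - r z| <= osc) ->
  `|tfun (ker2 e) z / 2 - r z * kap e z| <= osc * kap e z.
Proof.
move=> e0 e1 /andP[az zb] ho.
rewrite /tfun (@ker2_eq0 _ _ (z - (a - 1)))//; last by rewrite ger0_norm; lra.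
rewrite (@ker2_eq0 _ _ (z - (b + 1)))//; last by rewrite ler0_norm; lra.
rewrite !mulr0 add0r subr0 mulrAC divff ?mul1r//.
pose M := `|a| + `|b| + 2.
have aM : - M <= a by rewrite /M; have := ler_norm (- a); rewrite normrN; have := normr_ge0 b; lra.
have bM : b <= M by rewrite /M; have := ler_norm b; have := normr_ge0 a; lra.
have zM : `|z| <= M - 1.
  rewrite ler_norml /M; have := ler_norm (- a); rewrite normrN; have := ler_norm b.
  by have := normr_ge0 a; have := normr_ge0 b; move=> *; apply/andP; split; lra.
have ck : continuous (fun y => ker2 e (z - y) * r y).
  by apply: continuous_mul => //; apply: continuous_subl; exact: continuous_ker2.
have z1 c d : (forall y, c < y <= d -> r y = 0) -> itg c d (fun y => ker2 e (z - y) * r y) = 0.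
  move=> rz; rewrite (@eq_itg _ _ _ _ _ (fun y => 0 * (0 : R))).
    by rewrite itgZ ?mul0r// => y; exact: cvg_cst.
  by move=> y ycd; rewrite rz// mulr0 mul0r.
have -> : itg a b (fun y => ker2 e (z - y) * r y) =
    itg (- M) M (fun y => ker2 e (z - y) * r y).
  rewrite (itg_split kR ck aM (le_trans (ltW ab) bM)).
  rewrite (itg_split kR ck (ltW ab) bM).
  rewrite (z1 (- M) a) ?(z1 b M) ?addr0 ?add0r//.
  - by move=> y /andP[yb _]; apply: r0; rewrite (ltW yb) orbT.
  - by move=> y /andP[_ ya]; apply: r0; rewrite ya.
rewrite (kapE e0 e1 zM).
rewrite -!itgZ// -itgB//; last by apply: continuous_mul => // y; exact: cvg_cst.
have cm (q : R) : continuous (fun y => q * ker2 e (z - y)).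
  by apply: continuous_mul => // y; exact: cvg_cst.
have hb y : `|ker2 e (z - y) * r y - r z * ker2 e (z - y)| <= osc * ker2 e (z - y).
  rewrite (_ : _ - _ = ker2 e (z - y) * (r y - r z)); last by ring.
  rewrite normrM (ger0_norm (ker2_ge0 _ e0)) mulrC.
  have [h|h] := leP `|y - z| e; first by rewrite ler_wpM2r ?ker2_ge0// ho.
  by rewrite ker2_eq0 ?mulr0// distrC ltW.
have cd : continuous (fun y => ker2 e (z - y) * r y - r z * ker2 e (z - y)).
  exact: continuous_sub.
rewrite ler_norml -[X in X <= _ <= _]mulN1r -itgZ//.
apply/andP; split; apply: le_itg => //.
- by apply: continuous_mul => // y; exact: cvg_cst.
- by move=> y _; have := hb y; rewrite ler_norml mulN1r => /andP[].
- by move=> y _; have := hb y; rewrite ler_norml => /andP[].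
Qed.

End test_functions.

(** * Compactness, Riemann sums and image measures *)

Section uniform.
Context {R : realType}.
Implicit Types (e r s t y z M eta : R).

(** The near-covering form of compactness, where the parameter is e tending to 0 from the right. *)
Lemma compact_unif (Q : R -> R -> Prop) (c d : R) :
  (forall y, c <= y <= d -> exists2 r, 0 < r &
     forall y' e, `|y' - y| < r -> 0 < e < r -> Q e y') ->
  exists2 r, 0 < r & forall y e, c <= y <= d -> 0 < e < r -> Q e y.
Proof.
move=> h.
have nc : near_covering `[c, d]%classic by apply/compact_near_coveringP; exact: segment_compact.
have := nc R (0^'+) Q _; move=> /(_ _)[].
  move=> y /=; rewrite in_itv/= => /h[r r0 hr].
  exists (ball y r, [set e | 0 < e < r]) => /=.
    split; first exact: nbhsx_ballx.
    exists r => //= e; rewrite /ball_/= sub0r normrN => er e0.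
    by rewrite e0/= (le_lt_trans (ler_norm _) er).
  move=> [y' e] /= [yy' er]; apply: hr => //.
  by move: yy'; rewrite /ball/= distrC.
move=> r /= r0 hr; exists r => // y e ycd /andP[e0 er].
have := hr e; rewrite /ball_/= sub0r normrN gtr0_norm// => /(_ er e0); apply.
by rewrite /= in_itv.
Qed.

Lemma unif_cont_itv (g : R -> R) (c d e : R) : continuous g -> 0 < e ->
  exists2 r, 0 < r & forall s s', c <= s <= d -> `|s - s'| < r -> `|g s - g s'| <= e.
Proof.
move=> cg e0.
have [] := @compact_unif (fun q s => forall s', `|s - s'| < q -> `|g s - g s'| <= e) c d.
  move=> y _; have e2 : 0 < e / 2 by rewrite divr_gt0.
  have /cvgrPdist_le /(_ _ e2)[r /= r0 hr] := cg y.
  exists (r / 2); first by rewrite divr_gt0.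
  move=> y' q yy' /andP[q0 qr] s' ys'.
  have k1 : `|g y - g y'| <= e / 2 by apply: hr; rewrite /ball_/= distrC; lra.
  have k2 : `|g y - g s'| <= e / 2.
    apply: hr; rewrite /ball_/= (_ : y - s' = - (y' - y) + (y' - s')); last by ring.
    by rewrite (le_lt_trans (ler_normD _ _))// normrN; lra.
  rewrite (_ : g y' - g s' = - (g y - g y') + (g y - g s')); last by ring.
  by rewrite (le_trans (ler_normD _ _))// normrN; lra.
move=> r r0 hr; exists (r / 2); first by rewrite divr_gt0.
by move=> s s' scd ss'; apply: (hr s (r / 2)) => //; lra.
Qed.

Lemma unif_cont_slab (l : R -> R -> R) (t c d e : R) :
  continuous (fun z : R * R => l z.1 z.2) -> 0 < e ->
  exists2 r, 0 < r & forall s y, c <= y <= d -> `|s - t| < r -> `|l s y - l t y| <= e.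
Proof.
move=> cl e0.
have [] := @compact_unif (fun q y => forall s, `|s - t| < q -> `|l s y - l t y| <= e) c d.
  move=> y _; have e2 : 0 < e / 2 by rewrite divr_gt0.
  have /cvgrPdist_le /(_ _ e2) := cl (t, y) => -[[A B] /= [[r1 /= r10 hA] [r2 /= r20 hB]] AB].
  exists (Num.min r1 r2); first by rewrite lt_min r10.
  move=> y' q; rewrite lt_min => /andP[y1 y2] /andP[q0]; rewrite lt_min => /andP[q1 q2] s st.
  have By' : B y' by apply: hB; rewrite /ball_/= distrC.
  have k1 : `|l t y - l s y'| <= e / 2.
    apply: (AB (s, y')); split => //; apply: hA; rewrite /ball_/= distrC.
    exact: lt_trans q1.
  have k2 : `|l t y - l t y'| <= e / 2.
    apply: (AB (t, y')); split => //; apply: hA; rewrite /ball_/= subrr normr0.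
    exact: r10.
  rewrite (_ : l s y' - l t y' = - (l t y - l s y') + (l t y - l t y')); last by ring.
  by rewrite (le_trans (ler_normD _ _))// normrN; lra.
move=> r r0 hr; exists (r / 2); first by rewrite divr_gt0.
by move=> s y ycd ss'; apply: (hr y (r / 2)) => //; lra.
Qed.

End uniform.

Section riemann.
Context {R : realType}.
Implicit Types (e r s t y z M eta : R).
Local Notation mu := (@lebesgue_measure R).
Local Notation ibs := (itg mu).

Lemma lebesgue_radon : radon mu.
Proof. by move=> K cK; exact: compact_finite_measure. Qed.

Lemma lebesgue_itv_oc (a b : R) : a <= b -> fine (mu `]a, b]%classic) = b - a.
Proof.
move=> ab; rewrite lebesgue_measure_itv/= lte_fin.
by case: ltgtP ab => //= ->; rewrite subrr.
Qed.

(** phi carries the restriction of mu1 to D to the measure of density g. The occupation formula and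
    the law of the killing position are both used in this form. *)
Lemma ge0_integral_pushforward_density (d1 d2 : measure_display)
  (T1 : measurableType d1) (T2 : measurableType d2) (mu1 : {measure set T1 -> \bar R})
  (mu2 : {measure set T2 -> \bar R}) (phi : T1 -> T2) (mphi : mfun phi)
  (D : set T1) (mD : measurable D) (g : T2 -> R) (mg : mfun g)
  (g0 : forall u, 0 <= g u)
  (gE : forall A, measurable A -> mu1 (D `&` phi @^-1` A) = (\int[mu2]_(u in A) (g u)%:E)%E)
  (f : T2 -> \bar R) : mfun f -> (forall u, 0 <= f u)%E ->
  (\int[mu1]_(v in D) f (phi v) = \int[mu2]_u (f u * (g u)%:E))%E.
Proof.
move=> mf f0.
pose nu0 : {measure set T1 -> \bar R} := mrestr mu1 mD.
pose nu' : {measure set T2 -> \bar R} := pushforward nu0 phi.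
pose nu := nu' mphi.
transitivity (\int[nu]_u f u)%E; last first.
  rewrite (@ge0_integral_density _ _ _ mu2 nu g)//.
  by move=> A mA; rewrite -gE// /nu /nu' /nu0 /= /pushforward /mrestr setIC.
rewrite [RHS](_ : _ = \int[nu0]_(v in phi @^-1` setT) (f \o phi) v)%E; last first.
  by rewrite -ge0_integral_pushforward.
rewrite preimage_setT.
rewrite (@ge0_integral_density _ _ _ mu1 nu0 \1_D)//.
- rewrite integral_mkcond; apply: eq_integral => s _.
  by rewrite patchE indicE/=; case: ifPn => _; rewrite ?mule1 ?mule0.
- by move=> A mA; rewrite integral_indic//= /nu0 /= /mrestr setIC.
- exact: measurableT_comp.
- by move=> v; exact: f0.
Qed.

Definition mesh n i : R := i%:R / n%:R.

Lemma riemann_sum (g : R -> R) (n k : nat) (w : R) : continuous g -> (0 < n)%N ->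
  (forall s s', 0 <= s <= mesh n k -> `|s - s'| <= n%:R^-1 -> `|g s - g s'| <= w) ->
  `|n%:R^-1 * \sum_(0 <= j < k) g (mesh n j) - ibs 0 (mesh n k) g| <= mesh n k * w.
Proof.
move=> cg n0; have n0' : 0 < n%:R^-1 :> R by rewrite invr_gt0 ltr0n.
have meshS i : mesh n i.+1 = mesh n i + n%:R^-1.
  by rewrite /mesh -natr1 mulrDl mul1r.
elim: k => [|k IH] hw.
  by rewrite /mesh mul0r itg0 big_geq// mulr0 subrr normr0 mul0r.
have mk0 : 0 <= mesh n k by rewrite /mesh divr_ge0.
have mkS : mesh n k <= mesh n k.+1 by rewrite meshS lerDl ltW.
rewrite big_nat_recr//= (itg_split lebesgue_radon cg mk0 mkS).
have {}IH : `|n%:R^-1 * \sum_(0 <= j < k) g (mesh n j) - ibs 0 (mesh n k) g| <= mesh n k * w.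
  by apply: IH => s s' /andP[s0 sk]; apply: hw; rewrite s0 (le_trans sk).
rewrite (_ : n%:R^-1 * _ - _ =
  (n%:R^-1 * \sum_(0 <= j < k) g (mesh n j) - ibs 0 (mesh n k) g) +
  (n%:R^-1 * g (mesh n k) - ibs (mesh n k) (mesh n k.+1) g)); last by ring.
have last_ : `|n%:R^-1 * g (mesh n k) - ibs (mesh n k) (mesh n k.+1) g| <= n%:R^-1 * w.
  have ccst : continuous (cst (g (mesh n k)) : R -> R) by move=> y; exact: cvg_cst.
  have -> : n%:R^-1 * g (mesh n k) = ibs (mesh n k) (mesh n k.+1) (cst (g (mesh n k))).
    rewrite /itg Rintegral_cst// lebesgue_itv_oc// meshS mulrC; congr (_ * _); ring.
  rewrite -itgB//; last exact: lebesgue_radon.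
  rewrite [leRHS]mulrC (_ : n%:R^-1 = fine (mu `](mesh n k), (mesh n k.+1)]%classic)); last first.
    by rewrite lebesgue_itv_oc// meshS; ring.
  apply: normr_itg_le; [exact: lebesgue_radon|exact: continuous_sub|].
  move=> y /andP[ky yk]; apply: hw; first by rewrite mk0.
  rewrite distrC ger0_norm ?subr_ge0 ?(ltW ky)//; move: yk; rewrite meshS; lra.
apply: (le_trans (ler_normD _ _)); rewrite [X in X * w]meshS mulrDl lerD//.
Qed.

End riemann.

(** * Local times and the killing clock of one path *)

Section path.
Context {R : realType}.
Implicit Types (e r s t y z M eta : R).
Local Notation mu := (@lebesgue_measure R).
Variable kappa : borel_measure R.
Hypothesis kR : radon kappa.
Variables (b : R -> R) (l : R -> R -> R).
Hypotheses (cb : continuous b) (cl : continuous (fun z : R * R => l z.1 z.2))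
  (l0 : forall t y, 0 <= t -> 0 <= l t y)
  (occ : forall t (A : set R), 0 <= t -> measurable A ->
  mu [set s | 0 <= s <= t /\ A (b s)] = (\int[mu]_(y in A) (l t y)%:E)%E).

Lemma continuous_local_time t : continuous (l t).
Proof.
move=> y.
have h : continuous_at y (fun y : R => (t, y) : R * R).
  exact: (@cvg_pair _ _ _ (nbhs y) (nbhs t) (nbhs y) _ _ _ (fun=> t) id (cvg_cst _) cvg_id).
exact: (cvg_comp _ _ h (@cl (t, y))).
Qed.

Lemma occupation_fun t (g : R -> R) : 0 <= t -> continuous g -> (forall y, 0 <= g y) ->
  (itg mu 0 t (g \o b))%:E = (\int[mu]_y (g y * l t y)%:E)%E.
Proof.
move=> t0 cg g0.
have mb : mfun b by exact: continuous_measurable_fun.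
have mg : mfun g by exact: continuous_measurable_fun.
have ml : mfun (l t).
  by apply: continuous_measurable_fun; exact: continuous_local_time.
have cgb : continuous (g \o b) by move=> y; apply: continuous_comp; [exact: cb|exact: cg].
rewrite EFin_itg; [|exact: lebesgue_radon|exact: cgb].
rewrite integral_itv_obnd_cbnd; last first.
  apply/measurable_EFinP; apply: measurable_funTS; exact: continuous_measurable_fun.
have gE A : measurable A -> mu (`[0, t]%classic `&` b @^-1` A) = (\int[mu]_(y in A) (l t y)%:E)%E.
  rewrite (_ : _ `&` _ = [set s | 0 <= s <= t /\ A (b s)]); first exact: occ.
  by apply/seteqP; split => s /=; rewrite in_itv/= => -[].
rewrite -(@ge0_integral_pushforward_density _ _ _ _ _ mu mu _ mb _ (measurable_itv `[0, t]) _ ml (fun y => l0 y t0) gE (EFin \o g))//.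
  exact/measurable_EFinP.
Qed.

Lemma local_time_approx t M eta : 0 <= t -> 0 < eta -> exists2 e0, 0 < e0 &
  forall e z, 0 < e < e0 -> `|z| <= M ->
    `|itg mu 0 t (fun s => ker2 e (b s - z)) - l t z| <= eta.
Proof.
move=> t0 eta0.
have [r r0 hr] := unif_cont_itv (- M) M (@continuous_local_time t) eta0.
exists r => // e z /andP[e0 er] zM.
have ck : continuous (fun y : R => ker2 e (y - z)).
  move=> y; apply: (@continuous_comp _ _ _ (fun y : R => y - z) (ker2 e)).
    by apply: cvgB; [exact: cvg_id|exact: cvg_cst].
  exact: continuous_ker2.
have ck0 y : 0 <= ker2 e (y - z) by exact: ker2_ge0.
have h1 := occupation_fun t0 ck ck0.
have -> : itg mu 0 t (fun s => ker2 e (b s - z)) =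
    \int[mu]_(y in `[(z - e)%R, (z + e)%R]) (ker2 e (y - z) * l t y).
  apply: EFin_inj; rewrite h1 /Rintegral fineK.
    rewrite [RHS]integral_mkcond; apply: eq_integral => y _.
    rewrite patchE; case: ifPn => // /negP yz.
    rewrite ker2_eq0 ?mul0r//; rewrite leNgt; apply/negP => h; apply: yz.
    move: h; rewrite ltr_norml inE/= in_itv/= => /andP[? ?].
    by apply/andP; split; apply: ltW; lra.
  apply: integrable_fin_num => //; apply: continuous_compact_integrable.
    exact: segment_compact.
  by apply: continuous_subspaceT; apply: continuous_mul => //; exact: continuous_local_time.
have cint (g : R -> R) : continuous g -> mu.-integrable `[(z - e)%R, (z + e)%R] (EFin \o g).
  move=> cg; apply: continuous_compact_integrable; first exact: segment_compact.
  exact: continuous_subspaceT.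
have i1 : \int[mu]_(y in `[(z - e)%R, (z + e)%R]) ker2 e (y - z) = 1.
  by rewrite /Rintegral integral_ker2.
have ckc (q : R) : continuous (fun y : R => ker2 e (y - z) * q).
  by apply: continuous_mul => // y; exact: cvg_cst.
have -> : l t z = \int[mu]_(y in `[(z - e)%R, (z + e)%R]) (ker2 e (y - z) * l t z).
  by rewrite RintegralZr// ?i1 ?mul1r//; exact: cint.
have ckl : continuous (fun y : R => ker2 e (y - z) * l t y).
  by apply: continuous_mul => //; exact: continuous_local_time.
rewrite -RintegralB//; [|exact: cint|exact: cint].
rewrite (le_trans (le_normr_Rintegral _ _))//.
  by apply: cint; exact: continuous_sub.
have -> : eta = \int[mu]_(y in `[(z - e)%R, (z + e)%R]) (ker2 e (y - z) * eta).
  by rewrite RintegralZr// ?i1 ?mul1r//; exact: cint.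
apply: le_Rintegral => //; [|exact: cint|].
  apply: (cint (fun y => `|ker2 e (y - z) * l t y - ker2 e (y - z) * l t z|)) => y.
  by apply: cvg_norm; exact: (continuous_sub ckl (ckc (l t z))).
move=> y /=; rewrite in_itv/= => /andP[y1 y2].
rewrite -mulrBr normrM ger0_norm// ler_wpM2l// distrC; apply: hr.
  by move: zM; rewrite ler_norml.
rewrite ltr_norml; apply/andP; split; lra.
Qed.

Definition range_bound t M := forall s, 0 <= s <= t -> `|b s| <= M.

(** A kernel of width at most |z| - M, centred at z, vanishes along the path. *)
Lemma local_time_eq0 t M z : 0 <= t -> range_bound t M -> M < `|z| -> l t z = 0.
Proof.
move=> t0 hM Mz; apply/eqP; rewrite -normr_le0; apply/ler_addgt0Pr => eta eta0.
have [e0 e00 he] := local_time_approx `|z| t0 eta0.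
pose e := Num.min (e0 / 2) (`|z| - M).
have ep : 0 < e by rewrite lt_min divr_gt0// subr_gt0.
have ee0 : e < e0 by rewrite gt_min; apply/orP; left; lra.
have ez : e <= `|z| - M by rewrite ge_min lexx orbT.
have := he e z; rewrite ep ee0 lexx => /(_ isT isT).
rewrite (@eq_itg _ _ _ _ _ (fun s => 0 * (0 : R))).
  by rewrite itgZ ?mul0r ?sub0r ?normrN ?add0r//; [exact: lebesgue_radon|move=> y; exact: cvg_cst].
move=> s /andP[s0 st]; rewrite mul0r ker2_eq0//.
have bM : `|b s| <= M by apply: hM; rewrite (ltW s0).
have := ler_normB (b s) (b s - z); rewrite (_ : b s - (b s - z) = z); last by ring.
lra.
Qed.

(** Local time is only given as a continuous occupation density; its monotonicity comes from the
    approximating time integrals of a nonnegative kernel. *)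
Lemma local_time_mono s t z : 0 <= s -> s <= t -> l s z <= l t z.
Proof.
move=> s0 st; apply/ler_addgt0Pr => eta eta0.
have t0 : 0 <= t by exact: le_trans st.
have eta2 : 0 < eta / 2 by rewrite divr_gt0.
have [e1 e10 h1] := local_time_approx `|z| s0 eta2.
have [e2 e20 h2] := local_time_approx `|z| t0 eta2.
pose e := Num.min (e1 / 2) (e2 / 2).
have ep : 0 < e by rewrite lt_min !divr_gt0.
have ee1 : e < e1 by rewrite gt_min; apply/orP; left; lra.
have ee2 : e < e2 by rewrite gt_min; apply/orP; right; lra.
have := h1 e z; rewrite ep ee1 lexx => /(_ isT isT) k1.
have := h2 e z; rewrite ep ee2 lexx => /(_ isT isT) k2.
have ck : continuous (fun s => ker2 e (b s - z)).
  move=> y; apply: (@continuous_comp _ _ _ (fun s => b s - z) (ker2 e)).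
    by apply: cvgB; [exact: cb|exact: cvg_cst].
  exact: continuous_ker2.
have := itg_split lebesgue_radon ck s0 st.
have : 0 <= itg mu s t (fun s => ker2 e (b s - z)).
  by apply: itg_ge0 => y _; exact: ker2_ge0.
move: k1 k2; rewrite !ler_norml => /andP[k1 k1'] /andP[k2 k2']; lra.
Qed.

Lemma range_boundP t : exists2 M, 0 < M & range_bound t M.
Proof.
have [C C0 hC] := @continuous_bounded_itv _ b 0 t cb.
by exists (C + 1); [rewrite ltr_wpDl|move=> s /hC; lra].
Qed.

(** On good paths the integral is finite, as local time vanishes off a bounded interval, so [fine]
    loses nothing. *)
Definition clock t : R := fine (\int[kappa]_y (l t y)%:E)%E.

Lemma clock_itg t M M' : 0 <= t -> range_bound t M -> M < M' ->
  (\int[kappa]_y (l t y)%:E = (itg kappa (- M') M' (l t))%:E)%E.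
Proof.
move=> t0 hM MM'; rewrite (EFin_itg kR); last exact: continuous_local_time.
rewrite [RHS]integral_mkcond; apply: eq_integral => y _.
rewrite patchE; case: ifPn => // /negP yM; rewrite (local_time_eq0 t0 hM)//.
rewrite ltNge; apply/negP; rewrite ler_norml => /andP[y1 y2]; apply: yM.
by rewrite inE/= in_itv/=; apply/andP; split; lra.
Qed.

Lemma clockE t M M' : 0 <= t -> range_bound t M -> M < M' ->
  clock t = itg kappa (- M') M' (l t).
Proof. by move=> t0 hM MM'; rewrite /clock (clock_itg t0 hM MM'). Qed.

Lemma EFin_clock t : 0 <= t -> (clock t)%:E = (\int[kappa]_y (l t y)%:E)%E.
Proof.
move=> t0; have [M M0 hM] := range_boundP t.
have MM : M < M + 1 by rewrite ltrDl.
by rewrite (clock_itg t0 hM MM) (clockE t0 hM MM).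
Qed.

Lemma clock_ge0 t : 0 <= t -> 0 <= clock t.
Proof. by move=> t0; apply: fine_ge0; apply: integral_ge0 => y _; rewrite lee_fin l0. Qed.

Lemma range_bound_le s t M : s <= t -> range_bound t M -> range_bound s M.
Proof. by move=> st hM q /andP[q0 qs]; apply: hM; rewrite q0 (le_trans qs). Qed.

Lemma clock_mono s t : 0 <= s -> s <= t -> clock s <= clock t.
Proof.
move=> s0 st; have t0 : 0 <= t by exact: le_trans st.
have [M M0 hM] := range_boundP t; have MM : M < M + 1 by rewrite ltrDl.
rewrite (clockE t0 hM MM) (clockE s0 (range_bound_le st hM) MM).
apply: (le_itg kR) => [||y _]; [exact: continuous_local_time..|].
exact: local_time_mono.
Qed.

Lemma clock0 : clock 0 = 0.
Proof.
rewrite /clock (_ : (fun y => (l 0 y)%:E) = cst 0%E) ?integral_cst// ?mul0e//.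
apply/funext => y; congr EFin; apply/eqP; rewrite eq_le l0// andbT.
apply/ler_addgt0Pr => eta eta0; rewrite add0r.
have [e0 e00 he] := local_time_approx `|y| (lexx 0) eta0.
have := he (e0 / 2) y; rewrite divr_gt0//= lexx (_ : e0 / 2 < e0); last by lra.
move=> /(_ isT isT); rewrite (_ : itg mu 0 0 _ = 0); last first.
  by rewrite /itg set_itvoc0 Rintegral_set0.
by rewrite sub0r normrN; apply: le_trans; exact: ler_norm.
Qed.

(** Local times up to t + 1 live on one bounded interval, of finite kappa-measure, on which they are
    continuous in time uniformly in the level. *)
Lemma clock_cont t eta : 0 <= t -> 0 < eta -> exists2 r, 0 < r &
  forall s, 0 <= s -> `|s - t| < r -> `|clock s - clock t| <= eta.
Proof.
move=> t0 eta0; have [M M0 hM] := range_boundP (t + 1).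
have MM : M < M + 1 by rewrite ltrDl.
have [k k0 hk] := @exists_mul_le _ (fine (kappa `](- (M + 1)), (M + 1)]%classic)) _
  (fine_ge0 (measure_ge0 _ _)) eta0.
have [r r0 hr] := unif_cont_slab t (- (M + 1)) (M + 1) cl k0.
exists (Num.min r 1); first by rewrite lt_min r0 ltr01.
move=> s s0; rewrite lt_min => /andP[sr s1].
have st : s <= t + 1 by move: s1; rewrite ltr_norml => /andP[]; lra.
have tt : t <= t + 1 by lra.
rewrite (clockE t0 (range_bound_le tt hM) MM) (clockE s0 (range_bound_le st hM) MM).
rewrite -(itgB kR); [|exact: continuous_local_time..].
apply: le_trans hk; apply: (normr_itg_le kR).
  by apply: continuous_sub; exact: continuous_local_time.
by move=> y /andP[y1 y2]; apply: hr => //; rewrite (ltW y1).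
Qed.

(** The clock is continuous and nondecreasing: if it is below q at t, it remains so for a while, and
    the infimum defining the killing time is strictly beyond t. *)
Lemma lt_killing_time t q : 0 <= t -> (t%:E < killing_time kappa l q)%E = (clock t < q).
Proof.
move=> t0; apply/idP/idP => [|tq].
  apply: contraTT; rewrite -!leNgt => qt; apply: ereal_inf_lbound; exists t => //=.
  by split => //; rewrite -EFin_clock// lee_fin.
have e0 : 0 < (q - clock t) / 2 by rewrite divr_gt0// subr_gt0.
have [r r0 hr] := clock_cont t0 e0.
apply: (@lt_le_trans _ _ (t + r / 2)%:E); first by rewrite lte_fin; lra.
apply: le_ereal_inf_tmp => _ /= [s [s0 hs] <-]; rewrite lee_fin leNgt; apply/negP => sr.
move: hs; rewrite -EFin_clock// lee_fin leNgt => /negP; apply.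
have trp : 0 <= t + r / 2 by lra.
apply: le_lt_trans (clock_mono s0 (ltW sr)) _.
have := hr (t + r / 2) trp; rewrite (_ : t + r / 2 - t = r / 2); last by ring.
by rewrite gtr0_norm ?divr_gt0// => /(_ ltac:(lra)); rewrite ler_norml => /andP[]; lra.
Qed.

Lemma continuous_sum k (g : nat -> R -> R) : (forall j, continuous (g j)) ->
  continuous (fun y => \sum_(0 <= j < k) g j y).
Proof.
move=> cg; elim: k => [|k IH].
  rewrite (_ : (fun _ => _) = cst 0); first by move=> y; exact: cvg_cst.
  by apply/funext => y; rewrite big_geq.
rewrite (_ : (fun _ => _) = (fun y => \sum_(0 <= j < k) g j y + g k y)).
  by move=> y; apply: cvgD; [exact: IH|exact: cg].
by apply/funext => y; rewrite big_nat_recr.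
Qed.

Lemma itg_sum (a c : R) k (g : nat -> R -> R) : (forall j, continuous (g j)) ->
  itg kappa a c (fun y => \sum_(0 <= j < k) g j y) = \sum_(0 <= j < k) itg kappa a c (g j).
Proof.
move=> cg; elim: k => [|k IH].
  rewrite big_geq// (@eq_itg _ _ _ _ _ (fun=> 0 * 0)).
    by rewrite (itgZ kR) ?mul0r// => y; exact: cvg_cst.
  by move=> y _; rewrite big_geq// mul0r.
rewrite big_nat_recr//= -IH -(itgD kR)//; last exact: continuous_sum.
by apply: eq_itg => y _; rewrite big_nat_recr.
Qed.

(** The kernel is first made narrow enough for [local_time_approx], uniformly over the range of the
    path; then the mesh is made fine enough for the Riemann sums of the kernel along the path, whose
    Lipschitz constant is of order 1 / e ^ 2. Integrating in kappa over a bounded interval turns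
    both errors into an error on the clock. *)
Lemma clock_riemann (N I : nat) eta : 0 < eta -> exists2 e0, 0 < e0 &
  forall e, 0 < e < e0 -> exists m0, forall m, (m0 <= m)%N ->
  `|(N.+1 * m.+1)%:R^-1 * \sum_(0 <= j < I * m.+1) kap kappa e (b (mesh (N.+1 * m.+1) j))
    - clock (mesh N.+1 I)| <= eta.
Proof.
move=> eta0; set t := mesh N.+1 I; have t0 : 0 <= t by rewrite divr_ge0.
have [M M0 hM] := range_boundP t.
pose M' := M + 1; have MM : M < M' by rewrite ltrDl.
pose kM := fine (kappa `](- M'), M']%classic).
have kM0 : 0 <= kM by apply: fine_ge0; exact: measure_ge0.
have eta2 : 0 < eta / 2 by rewrite divr_gt0.
have [k k0 hk] := exists_mul_le kM0 eta2.
have [e0 e00 he] := local_time_approx M' t0 k0.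
exists (Num.min e0 1); first by rewrite lt_min e00 ltr01.
move=> e /andP[ep]; rewrite lt_min => /andP[ee0 e1].
pose Lp := 4 / e ^+ 2; have Lp0 : 0 <= Lp by rewrite divr_ge0// exprn_ge0// ltW.
have [w w0 hw] := exists_mul_le t0 k0.
have [w' w'0 hw'] := exists_mul_le Lp0 w0.
have [q q0 hq] := unif_cont_itv 0 t cb w'0.
exists (Num.bound q^-1) => m mm.
set n := (N.+1 * m.+1)%N; have n0 : (0 < n)%N by rewrite muln_gt0.
have nq : n%:R^-1 < q.
  rewrite invf_plt ?posrE ?ltr0n//.
  apply: lt_le_trans (_ : (Num.bound q^-1)%:R <= _); last first.
    by rewrite ler_nat (leq_trans mm)// /n; apply: leq_trans (leqnSn _) _; rewrite leq_pmull.
  by apply: archi_boundP; rewrite invr_ge0 ltW.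
have tE : t = mesh n (I * m.+1).
  rewrite /t /mesh /n !natrM -mulf_div divff ?mulr1//.
have ck y : continuous (fun s => ker2 e (b s - y)).
  move=> s; apply: (@continuous_comp _ _ _ (fun s => b s - y) (ker2 e)).
    by apply: cvgB; [exact: cb|exact: cvg_cst].
  exact: continuous_ker2.
have cky z : continuous (fun y => ker2 e (z - y)).
  by apply: continuous_subl; exact: continuous_ker2.
have -> : n%:R^-1 * \sum_(0 <= j < I * m.+1) kap kappa e (b (mesh n j)) =
   itg kappa (- M') M' (fun y => n%:R^-1 * \sum_(0 <= j < I * m.+1) ker2 e (b (mesh n j) - y)).
  rewrite (itgZ kR); last first.
    exact: (@continuous_sum _ (fun j y => ker2 e (b (mesh n j) - y))).
  rewrite itg_sum//; congr (_ * _); apply: eq_big_nat => j /andP[_ jI].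
  apply: kapE => //; first exact: ltW.
  rewrite /M' addrK; apply: hM; rewrite divr_ge0//= tE ler_pM2r ?invr_gt0 ?ltr0n//.
  by rewrite ler_nat ltnW.
rewrite (clockE t0 hM MM) -(itgB kR); [|..|exact: continuous_local_time]; last first.
  apply: continuous_mul; first by move=> y; exact: cvg_cst.
  exact: (@continuous_sum _ (fun j y => ker2 e (b (mesh n j) - y))).
apply: (@le_trans _ _ ((k + k) * kM)); last by rewrite mulrDl; lra.
apply: (normr_itg_le kR).
  apply: continuous_sub; last exact: continuous_local_time.
  apply: continuous_mul; first by move=> y; exact: cvg_cst.
  exact: (@continuous_sum _ (fun j y => ker2 e (b (mesh n j) - y))).
move=> y /andP[y1 y2]; have yM : `|y| <= M' by rewrite ler_norml (ltW y1).
rewrite (_ : _ - _ = (n%:R^-1 * \sum_(0 <= j < I * m.+1) ker2 e (b (mesh n j) - y)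
  - itg mu 0 t (fun s => ker2 e (b s - y))) + (itg mu 0 t (fun s => ker2 e (b s - y)) - l t y)); last by ring.
apply: le_trans (ler_normD _ _) _; apply: lerD; last by apply: he => //; rewrite ep ee0.
apply: le_trans hw; rewrite [w * t]mulrC tE.
apply: (@riemann_sum _ (fun s => ker2 e (b s - y))) => //.
move=> s s'; rewrite -tE => st ss'; apply: le_trans hw'.
have := hq s s' st (le_lt_trans ss' nq) => bb.
rewrite (_ : b s - y = (b s' - y) + (b s - b s')); last by ring.
apply: le_trans (ker2_lip _ _ ep) _; rewrite -/Lp mulrC ler_wpM2r//.
Qed.

End path.

(** * Iterated upper limits under the expectation *)

Section nested_limsup.
Context {R : realType} {d : measure_display} {Om : measurableType d}.
Variable P : probability Om R.
Local Open Scope ereal_scope.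

Lemma limn_esup_le (u : (\bar R)^nat) q n0 :
  (forall n, (n0 <= n)%N -> u n <= q) -> limn_esup u <= q.
Proof.
move=> h; rewrite limn_esup_lim; apply: lime_le; first exact: is_cvg_esups.
exists n0 => // n /= n0n; apply: ge_ereal_sup => _ /= [k nk <-].
by apply: h; exact: leq_trans nk.
Qed.

Lemma limn_esup_ge (u : (\bar R)^nat) q n0 :
  (forall n, (n0 <= n)%N -> q <= u n) -> q <= limn_esup u.
Proof.
move=> h; rewrite limn_esup_lim; apply: lime_ge; first exact: is_cvg_esups.
exists n0 => // n /= n0n; apply: le_trans (h n n0n) _.
by apply: ereal_sup_ubound; exists n => /=.
Qed.

(** Dominated convergence for the suprema of the tails, which decrease to the upper limit. *)
Lemma integral_limn_esup_lt (f : nat -> Om -> \bar R) (C : R) (eta : \bar R) n0 :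
  (forall n, mfun (f n)) ->
  (forall n w, (n0 <= n)%N -> 0 <= f n w <= C%:E) ->
  \int[P]_w limn_esup (f ^~ w) < eta ->
  exists n1, forall n, (n1 <= n)%N -> \int[P]_w f n w < eta.
Proof.
move=> mf fC lt.
have mes n : mfun (fun w => esups (f ^~ w) n).
  by apply: measurable_fun_esups.
have fe n w : f n w <= esups (f ^~ w) n by apply: ereal_sup_ubound; exists n => /=.
have e0 n w : 0 <= esups (f ^~ w) (n + n0)%N.
  by apply: le_trans (fe _ w); have /andP[] := fC (n + n0)%N w (leq_addl _ _).
have eC n w : esups (f ^~ w) (n + n0)%N <= C%:E.
  apply: ge_ereal_sup => _ /= [k nk <-].
  by have /andP[] := fC k w (leq_trans (leq_addl _ _) nk).
have ic : P.-integrable setT (cst C%:E).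
  exact: finite_measure_integrable_cst.
have [_ _] := @dominated_convergence _ _ _ P setT measurableT
  (fun n w => esups (f ^~ w) (n + n0)%N) (fun w => limn_esup (f ^~ w)) (cst C%:E)
  (fun n => mes _) (measurable_fun_limn_esup mf)
  (ltac:(apply: aeW => w _; rewrite limn_esup_lim;
    have := @is_cvg_esups _ (f ^~ w); rewrite -(cvg_shiftn n0); exact)) ic
  (ltac:(apply: aeW => w n _; rewrite gee0_abs; [exact: eC|exact: e0])).
move=> cv; have : \forall n \near \oo, \int[P]_w esups (f ^~ w) (n + n0)%N < eta.
  apply: (cv [set y | y < eta]); apply: open_nbhs_nbhs; split => //.
  exact: open_ereal_lt_ereal.
move=> [n1 _ hn1]; exists (n1 + n0)%N => n n1n.
apply: le_lt_trans (hn1 (n - n0)%N _) => /=; last by rewrite leq_subRL ?(addnC n0)//; exact: leq_trans (leq_addl _ _) n1n.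
have n0n : (n0 <= n)%N by exact: leq_trans (leq_addl _ _) n1n.
rewrite subnK//; apply: ge0_le_integral => //.
- by move=> w _; have /andP[] := fC n w n0n.
Qed.

(** The ranks in the hypothesis depend on w, those in the conclusion do not. Upper limits in m, then
    k, then N are measurable without any measurable choice of ranks, and the last one vanishes
    almost surely. *)
Lemma nested_limit (T : nat -> nat -> nat -> Om -> R) (C eta : R) :
  (forall N k m, mfun (T N k m)) ->
  (forall N k, exists m0, forall m w, (m0 <= m)%N -> (`|T N k m w| <= C)%R) ->
  {ae P, forall w (q : R), (0 < q)%R -> exists N0, forall N, (N0 <= N)%N ->
    exists k0, forall k, (k0 <= k)%N -> exists m0, forall m, (m0 <= m)%N ->
    (`|T N k m w| <= q)%R} ->
  (0 < eta)%R ->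
  exists N0, forall N, (N0 <= N)%N -> exists k0, forall k, (k0 <= k)%N ->
    exists m0, forall m, (m0 <= m)%N -> \int[P]_w (`|T N k m w|)%:E < eta%:E.
Proof.
move=> mT bT cT eta0.
pose T1 N k m w := (`|T N k m w|)%:E.
pose T2 N k w := limn_esup (fun m => T1 N k m w).
pose T3 N w := limn_esup (fun k => T2 N k w).
have m1 N k m : mfun (T1 N k m).
  by apply/measurable_EFinP; exact: measurableT_comp.
have m2 N k : mfun (T2 N k) by exact: measurable_fun_limn_esup.
have m3 N : mfun (T3 N) by exact: measurable_fun_limn_esup.
have b2 N k w : 0 <= T2 N k w <= C%:E.
  have [m0 hm] := bT N k; apply/andP; split.
    by apply: (@limn_esup_ge _ _ 0%N) => m _; rewrite lee_fin.
  by apply: (@limn_esup_le _ _ m0) => m mm; rewrite lee_fin hm.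
have b3 N w : 0 <= T3 N w <= C%:E.
  apply/andP; split.
    by apply: (@limn_esup_ge _ _ 0%N) => k _; have /andP[] := b2 N k w.
  by apply: (@limn_esup_le _ _ 0%N) => k _; have /andP[] := b2 N k w.
have i0 : \int[P]_w limn_esup (fun N => T3 N w) < eta%:E.
  rewrite (ae_eq_integral (cst 0))//.
  - by rewrite integral_cst// mul0e lte_fin.
  - exact: measurable_fun_limn_esup.
  apply: filterS cT => w hw _ /=; apply/eqP; rewrite eq_le; apply/andP; split; last first.
    by apply: (@limn_esup_ge _ _ 0%N) => N _; have /andP[] := b3 N w.
  apply/lee_addgt0Pr => q q0; rewrite add0e.
  have [N0 hN] := hw q q0; apply: (@limn_esup_le _ _ N0) => N /hN[k0 hk].
  apply: (@limn_esup_le _ _ k0) => k /hk[m0 hm].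
  by apply: (@limn_esup_le _ _ m0) => m /hm; rewrite lee_fin.
have [N0 hN] := integral_limn_esup_lt m3 (fun N w (_ : (0 <= N)%N) => b3 N w) i0.
exists N0 => N /hN i1.
have [k0 hk] := integral_limn_esup_lt (m2 N) (fun k w (_ : (0 <= k)%N) => b2 N k w) i1.
exists k0 => k /hk i2; have [m0 hm] := bT N k.
apply: (@integral_limn_esup_lt _ C _ m0 (m1 N k)) i2 => m w mm.
by rewrite !lee_fin normr_ge0 hm.
Qed.

End nested_limsup.

(** * Histories and one Brownian step *)

Section laws.
Context {R : realType} {d : measure_display} {Om : measurableType d}.
Variable P : probability Om R.

Lemma integrable_bounded (X : Om -> R) (C : R) : mfun X ->
  (forall w, `|X w| <= C) -> P.-integrable setT (EFin \o X).
Proof.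
move=> mX XC; apply: (@le_integrable _ _ _ _ _ _ _ (EFin \o cst C)) => //.
- exact/measurable_EFinP.
- by move=> w _ /=; rewrite lee_fin (le_trans (XC w))// ler_norm.
- exact: finite_measure_integrable_cst.
Qed.

Lemma integrable_law d' (T : measurableType d') (X : Om -> T)
  (nu : {measure set T -> \bar R}) (h : T -> R) :
  mfun X -> (forall A, measurable A -> P (X @^-1` A) = nu A) ->
  mfun h -> nu.-integrable setT (EFin \o h) ->
  P.-integrable setT (EFin \o (h \o X)) /\
  \int[P]_w h (X w) = \int[nu]_y h y.
Proof.
move=> mX law mh /integrableP[_ ih].
pose X' : {RV P >-> T} := mfun_Sub (mem_set mX).
have lawE A : measurable A -> A `<=` setT -> distribution P X' A = nu A.
  by move=> mA _; exact: law.
have mh' : mfun (EFin \o h) by exact/measurable_EFinP.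
have ihX : P.-integrable setT (EFin \o (h \o X)).
  apply/integrableP; split; first by apply/measurable_EFinP; exact: measurableT_comp.
  have := @ge0_integral_distribution _ _ _ _ _ P X' (fun y => `|(h y)%:E|%E).
  move=> <-//; last exact: measurableT_comp.
  by rewrite (eq_measure_integral nu).
split=> //; rewrite /Rintegral; congr fine.
rewrite -(eq_measure_integral _ lawE) (@integral_distribution _ _ _ _ _ P X')//.
Qed.

End laws.

Section generated.
Context {d : measure_display} {Om : measurableType d}.

Lemma measurable_generated (G : set (set Om)) d' (T : measurableType d') (X : Om -> T) :
  G `<=` measurable -> measurable_fun (setT : set (g_sigma_algebraType G)) X ->
  mfun X.
Proof.
move=> GM mX _ A mA; have := mX measurableT A mA; rewrite setTI.
by apply: smallest_sub => //; exact: sigma_algebra_measurable.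
Qed.

Lemma sub_generated (G H : set (set Om)) d' (T : measurableType d') (X : Om -> T) :
  G `<=` H -> measurable_fun (setT : set (g_sigma_algebraType G)) X ->
  measurable_fun (setT : set (g_sigma_algebraType H)) X.
Proof.
move=> GH mX _ A mA; have := mX measurableT A mA; rewrite setTI.
by apply: sub_smallest2r.
Qed.

Context {R : realType}.

Definition history (B : R -> Om -> R) (D : set R) : set (set Om) :=
  \bigcup_(t in D) sigma_rv (B t).

Lemma measurable_history (B : R -> Om -> R) (D : set R) t : D t ->
  measurable_fun (setT : set (g_sigma_algebraType (history B D))) (B t).
Proof.
move=> Dt _ A mA; apply: sub_sigma_algebra; exists t => //.
by exists A.
Qed.

Lemma history_sub (B : R -> Om -> R) (D : set R) :
  (forall t, D t -> mfun (B t)) -> history B D `<=` measurable.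
Proof. by move=> mB A [t Dt [C mC <-]]; exact: mB. Qed.

End generated.

Section one_step.
Context {R : realType} {d : measure_display} {Om : measurableType d}.
Variable P : probability Om R.
Variables (x : R) (B : R -> Om -> R).
Hypothesis BB : brownian_motion P x B.

Let mB t : 0 <= t -> mfun (B t).
Proof. by case: BB => h _ _ _ _; exact: h. Qed.

Lemma brownian_increment_law s t A : 0 <= s -> s < t -> measurable A ->
  P [set w | A (B t w - B s w)] = normal_prob 0 (Num.sqrt (t - s)) A.
Proof. by case: BB => _ _ _ h _ s0 st; exact: h. Qed.

(** Ito's formula over one step, in mean. V depends on the past only, so the first-order term has
    expectation 0 and the second-order one is compensated by (t - s) F2 / 2. The remainder is
    bounded by the third absolute moment of the increment, whence the power 3 / 2 of t - s and the
    constant 64. *)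
Lemma brownian_step (s t K C : R) (V : Om -> R) (F F1 F2 : R -> R) :
  0 <= s -> s < t -> 0 <= C ->
  measurable_fun (setT : set (g_sigma_algebraType (history B `[0, s]))) V ->
  (forall w, `|V w| <= 1) ->
  continuous F -> continuous F1 -> continuous F2 ->
  (forall z, `|F z| <= K) -> (forall z, `|F1 z| <= K) -> (forall z, `|F2 z| <= K) ->
  (forall z u, `|F (z + u) - F z - F1 z * u - F2 z / 2 * u ^+ 2| <= C * `|u| ^+ 3) ->
  `|\int[P]_w (V w * (F (B t w) - F (B s w) - (t - s) * (F2 (B s w) / 2)))|
    <= C * (64 * Num.sqrt (t - s) ^+ 3).
Proof.
move=> s0 st C0 hV V1 cF cF1 cF2 FK F1K F2K taylor.
have t0 : 0 <= t by exact: le_trans (ltW st).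
have q0 : 0 < Num.sqrt (t - s) by rewrite sqrtr_gt0 subr_gt0.
set q := Num.sqrt (t - s) in q0 *.
have q2 : q ^+ 2 = t - s by rewrite sqr_sqrtr// subr_ge0 ltW.
pose Z w := B t w - B s w.
have mBs := mB s0; have mBt := mB t0.
have mZ : mfun Z by exact: measurable_funB.
have hsub : history B `[0, s] `<=` measurable.
  by apply: history_sub => r /=; rewrite in_itv/= => /andP[r0 _]; exact: mB.
have hBs : measurable_fun (setT : set (g_sigma_algebraType (history B `[0, s]))) (B s).
  by apply: measurable_history; rewrite /= in_itv/= s0 lexx.
have mV := measurable_generated hsub hV.
have law A : measurable A -> P (Z @^-1` A) = normal_prob 0 q A.
  by move=> mA; apply: brownian_increment_law.
have ind (X : Om -> R) (h : R -> R) :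
    measurable_fun (setT : set (g_sigma_algebraType (history B `[0, s]))) X ->
    mfun h ->
    forall A A', measurable A -> measurable A' ->
    P (X @^-1` A `&` (h \o Z) @^-1` A') = (P (X @^-1` A) * P ((h \o Z) @^-1` A'))%E.
  move=> hX mh A A' mA mA'; case: BB => _ _ _ _ indep.
  have := @indep s t s0 st (X @^-1` A) (h @^-1` A') _ _; apply.
    by have := hX measurableT A mA; rewrite setTI.
  by rewrite -[_ @^-1` _]setTI; exact: mh.
have m1 (g : R -> R) : continuous g ->
    measurable_fun (setT : set (g_sigma_algebraType (history B `[0, s]))) (fun w => V w * g (B s w)).
  move=> cg; apply: measurable_funM => //; apply: measurableT_comp => //.
  exact: continuous_measurable_fun.
have b1 (g : R -> R) : (forall z, `|g z| <= K) -> forall w, `|V w * g (B s w)| <= K.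
  by move=> gK w; rewrite normrM -[leRHS]mul1r ler_pM.
have i1 (g : R -> R) : continuous g -> (forall z, `|g z| <= K) ->
    P.-integrable setT (EFin \o (fun w => V w * g (B s w))).
  by move=> cg gK; apply: (@integrable_bounded _ _ _ _ _ K); [exact: measurable_generated (m1 _ cg)|exact: b1].
have [iZ1 eZ1] := @integrable_law _ _ _ P _ (measurableTypeR R) Z (normal_prob 0 q) _ mZ law (@measurable_id _ _ _) (normal_integrable_id q0).
have [iZ2 eZ2] := @integrable_law _ _ _ P _ (measurableTypeR R) Z (normal_prob 0 q) _ mZ law (measurable_funX 2 (@measurable_id _ _ _)) (normal_integrable_sqr q0).
have [n3 le3] := normal_abs_moment3 q0.
have mabs3 : mfun (fun y : R => `|y| ^+ 3).
  by apply: measurable_funX; exact: normr_measurable.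
have [iZ3 eZ3] := @integrable_law _ _ _ P _ (measurableTypeR R) Z (normal_prob 0 q) _ mZ law mabs3 n3.
have [iA eA] := indep_expectationM (i1 F1 cF1 F1K) iZ1 (ind _ id (m1 F1 cF1) (@measurable_id _ _ _)).
have [iD eD] := indep_expectationM (i1 F2 cF2 F2K) iZ2
  (ind _ (fun y => y ^+ 2) (m1 F2 cF2) (measurable_funX 2 (@measurable_id _ _ _))).
have zA : \int[P]_w (V w * F1 (B s w) * Z w) = 0.
  by rewrite eA /= eZ1 normal_mean// mulr0.
have zD : \int[P]_w (V w * F2 (B s w) * Z w ^+ 2) = q ^+ 2 * \int[P]_w (V w * F2 (B s w)).
  by rewrite eD /= eZ2 normal_variance// mulrC.
pose Rm w := F (B t w) - F (B s w) - F1 (B s w) * Z w - F2 (B s w) / 2 * Z w ^+ 2.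
have RmC w : `|V w * Rm w| <= C * `|Z w| ^+ 3.
  rewrite normrM -[leRHS]mul1r ler_pM// /Rm.
  by rewrite -[B t w](subrKC (B s w)) -/(Z w).
have mRm : mfun (fun w => V w * Rm w).
  have mc (g : R -> R) X : continuous g -> mfun X ->
      mfun (fun w : Om => g (X w)).
    by move=> cg mX; apply: measurableT_comp => //; exact: continuous_measurable_fun.
  apply: measurable_funM => //; apply: measurable_funB; last first.
    apply: measurable_funM; last exact: measurable_funX.
    by apply: measurable_funM => //; exact: mc.
  apply: measurable_funB; last by apply: measurable_funM => //; exact: mc.
  by apply: measurable_funB; exact: mc.
have iC3 : P.-integrable setT (EFin \o (fun w => C * `|Z w| ^+ 3)) by exact: integrableMl_real.
have iR : P.-integrable setT (EFin \o (fun w => V w * Rm w)).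
  apply: le_integrable iC3 => //; first exact/measurable_EFinP.
  move=> w _; rewrite /= lee_fin (le_trans (RmC w))// ler_norm//.
have -> : \int[P]_w (V w * (F (B t w) - F (B s w) - (t - s) * (F2 (B s w) / 2))) =
   \int[P]_w (V w * Rm w).
  pose g1 w := V w * F1 (B s w) * Z w.
  pose g2 w := 2^-1 * (V w * F2 (B s w) * Z w ^+ 2).
  pose g3 w := (- (q ^+ 2 / 2)) * (V w * F2 (B s w)).
  have ig2 : P.-integrable setT (EFin \o g2) by exact: integrableMl_real.
  have ig3 : P.-integrable setT (EFin \o g3) by apply: integrableMl_real => //; exact: i1.
  transitivity (\int[P]_w (((V w * Rm w + g1 w) + g2 w) + g3 w)).
    by apply: eq_Rintegral => w _; rewrite /Rm /g1 /g2 /g3 -q2; field.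
  rewrite RintegralD//; last by do 2 (apply: integrableD_real => //).
  rewrite RintegralD//; last by apply: integrableD_real.
  rewrite RintegralD// zA addr0 -addrA.
  (* The variance of the increment is q ^ 2 = t - s, so the second-order term and the compensator
     cancel in mean. *)
  rewrite (_ : \int[P]_w g2 w + \int[P]_w g3 w = 0) ?addr0//.
  rewrite /g2 RintegralZl// zD /g3 RintegralZl//; last exact: i1.
  by field.
apply: (le_trans (le_normr_Rintegral _ iR)) => //.
apply: (@le_trans _ _ (\int[P]_w (C * `|Z w| ^+ 3))).
  by apply: le_Rintegral => //; exact: (integrable_norm iR).
by rewrite RintegralZl//= eZ3 ler_wpM2l.
Qed.

End one_step.

(** * Exit from an interval, seen along a mesh *)

Section exit.
Context {R : realType}.
Implicit Types (s t u r y z : R).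
Variables (a c : R) (b : R -> R).

(* Staying in a compact part of ]a, c[ at the mesh points up to time [t] is a
   measurable condition, equivalent to [t < exit time] for continuous paths. *)
Definition alive t := exists k : nat, forall n j : nat, mesh n j <= t ->
  a + k.+1%:R^-1 <= b (mesh n j) <= c - k.+1%:R^-1.

Definition is_exit s := [/\ 0 < s, b s = a \/ b s = c &
  forall t, 0 <= t -> t < s -> a < b t < c].

Lemma alive_le s t : s <= t -> alive t -> alive s.
Proof. by move=> st [k hk]; exists k => n j js; apply: hk; exact: le_trans st. Qed.

Lemma mesh_ge0 n i : 0 <= @mesh R n i.
Proof. by rewrite divr_ge0. Qed.

Lemma alive_mesh n j : alive (mesh n j) -> a < b (mesh n j) < c.
Proof.
move=> [k /(_ n j (lexx _))]; have : 0 < k.+1%:R^-1 :> R by rewrite invr_gt0.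
by move: (_^-1) => q; lra.
Qed.

Lemma mesh_dense s r : 0 <= s -> 0 < r -> exists n j, s - r < mesh n j <= s.
Proof.
move=> s0 r0; pose n := (Num.bound r^-1).+1.
have n0 : 0 < n%:R :> R by rewrite ltr0n.
have nr : n%:R^-1 < r.
  rewrite invf_plt ?posrE//; apply: lt_le_trans (_ : (Num.bound r^-1)%:R <= _).
    by apply: archi_boundP; rewrite invr_ge0 ltW.
  by rewrite ler_nat.
exists n, (Num.trunc (s * n%:R)).
have /andP[k1 k2] := truncn_itv (mulr_ge0 s0 (ltW n0)).
rewrite /mesh ler_pdivrMr// k1 andbT ltrBlDr.
rewrite -(ltr_pM2r n0) mulrDl mulfVK ?gt_eqF// (lt_le_trans k2)// -natr1 lerD2l.
by rewrite -ler_pdivrMr// mul1r ltW.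
Qed.

Hypothesis cb : continuous b.

Let cvg_at t e : 0 < e -> exists2 r, 0 < r & forall s, `|s - t| < r -> `|b s - b t| < e.
Proof.
move=> e0; have /cvgrPdist_lt /(_ _ e0)[r /= r0 hr] := @cb t.
by exists r => // s st; rewrite distrC; apply: hr; rewrite /ball_/= distrC.
Qed.

(** The exit time is the infimum of the times spent outside ]a, c[; by continuity the path is there
    in [a, c] but no longer in ]a, c[. *)
Lemma exists_exit t0 : a < b 0 < c -> 0 <= t0 -> ~~ (a < b t0 < c) -> exists s, is_exit s.
Proof.
move=> b0 t00 bt0; pose S := [set t | 0 <= t /\ ~~ (a < b t < c)].
have S0 : S !=set0 by exists t0.
have lS : has_lbound S by exists 0 => t [].
have iS : has_inf S by split.
set s := inf S.
have s0 : 0 <= s by apply: lb_le_inf => // t [].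
have before t : 0 <= t -> t < s -> a < b t < c.
  move=> tp ts; apply: contraT => h; have : s <= t by apply: ge_inf.
  by rewrite leNgt ts.
have notin : ~~ (a < b s < c).
  apply/negP => /andP[as_ sc].
  have e0 : 0 < Num.min (b s - a) (c - b s) by rewrite lt_min !subr_gt0 as_.
  have [r r0 hr] := cvg_at s e0.
  have [t [tp ht] tr] := @inf_adherent _ S r r0 iS.
  have st : s <= t by apply: ge_inf.
  have := hr t; rewrite ger0_norm ?subr_ge0// => /(_ ltac:(move: tr; rewrite -/s; lra)).
  rewrite lt_min !ltr_norml => /andP[/andP[k1 _] /andP[_ k2]].
  by move: ht => /negP; apply; apply/andP; split; lra.
have sp : 0 < s.
  by rewrite lt_neqAle s0 andbT; apply: contraNneq notin => <-.
have lim_le (q : R) : 0 < q -> exists2 t, 0 <= t < s & `|b t - b s| < q.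
  move=> q0; have [r r0 hr] := cvg_at s q0.
  exists (Num.max 0 (s - r / 2)).
    rewrite le_max lexx gt_max sp /=; lra.
  apply: hr; rewrite ltr_norml; apply/andP; split; last first.
    by rewrite ltrBlDr gt_max; apply/andP; split; lra.
  by rewrite ltrBrDr lt_max; apply/orP; right; lra.
exists s; split => //.
have [sa|as_] := leP (b s) a; [left|right].
  apply/eqP; rewrite eq_le sa/= leNgt; apply/negP => lt.
  have [t /andP[tp ts]] := lim_le (a - b s) ltac:(by rewrite subr_gt0).
  by have /andP[k _] := before t tp ts; rewrite ltr_norml => /andP[_]; lra.
apply/eqP; rewrite eq_le; apply/andP; split.
  rewrite leNgt; apply/negP => lt.
  have [t /andP[tp ts]] := lim_le (b s - c) ltac:(by rewrite subr_gt0).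
  by have /andP[_ k] := before t tp ts; rewrite ltr_norml => /andP[+ _]; lra.
by move: notin; rewrite as_/= -leNgt.
Qed.

(** If s <= t, mesh times just before s violate the margin 1 / (k + 1), as the path tends to an end.
    If t < s, the path has a positive distance to both ends on the compact [0, t]. *)
Lemma aliveP s t : is_exit s -> 0 <= t -> alive t <-> t < s.
Proof.
move=> [s0 bs hs] t0; split=> [[k hk]|ts].
  rewrite ltNge; apply/negP => st.
  have k0 : 0 < k.+1%:R^-1 :> R by rewrite invr_gt0.
  have [r r0 hr] := cvg_at s k0.
  have [n [j /andP[j1 j2]]] := mesh_dense (ltW s0) r0.
  have /andP[h1 h2] := hk n j (le_trans j2 st).
  have := hr (mesh n j); rewrite ler0_norm ?subr_le0// opprB => /(_ ltac:(lra)).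
  by rewrite ltr_norml; move: (_^-1) k0 h1 h2 => q; case: bs => ->; lra.
have cw : {within `[0, t], continuous b} by exact: continuous_subspaceT.
have [u /andP[]] := EVT_max t0 cw; rewrite ?bnd_simp => u0 ut hu.
have [v /andP[]] := EVT_min t0 cw; rewrite ?bnd_simp => v0 vt hv.
have /andP[_ uc] := hs u u0 (le_lt_trans ut ts).
have /andP[av _] := hs v v0 (le_lt_trans vt ts).
pose m := Num.min (c - b u) (b v - a).
have m0 : 0 < m by rewrite lt_min !subr_gt0 uc.
exists (Num.bound m^-1) => n j jt.
have jin : mesh n j \in `[0, t] by rewrite in_itv/= mesh_ge0.
have : (Num.bound m^-1).+1%:R^-1 <= m.
  rewrite invf_ple ?posrE//; apply: le_trans (_ : (Num.bound m^-1)%:R <= _).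
    by apply: ltW; apply: archi_boundP; rewrite invr_ge0 ltW.
  by rewrite ler_nat.
rewrite le_min; move: (_^-1) => q /andP[m1 m2]; have := hu _ jin; have := hv _ jin; lra.
Qed.

(* [h] is the grid step. *)
Lemma stopped_near s n i : (0 < n)%N -> is_exit s ->
  let chi i := `[< alive (mesh n i) >] in
  exists t, [/\ stopped (fun i => b (mesh n i)) chi i = b t, 0 <= t &
    if chi i then t = mesh n i else (s <= t <= s + n%:R^-1) && (t <= mesh n i)].
Proof.
move=> n0 es chi; elim: i => [|i [t [st t0 ht]]].
  exists 0; rewrite /= /mesh mul0r; split => //.
  rewrite /chi asboolT// /mesh mul0r.
  by apply/(aliveP es) => //; case: es.
have meshS : @mesh R n i.+1 = mesh n i + n%:R^-1 by rewrite /mesh -natr1 mulrDl mul1r.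
have n0' : 0 < n%:R^-1 :> R by rewrite invr_gt0 ltr0n.
have aP j : chi j = (mesh n j < s).
  by apply/asboolP/idP => /(aliveP es (mesh_ge0 _ _)).
rewrite /= -/(stopped _ _ i); case: ifPn => ci.
  exists (mesh n i.+1); split => //; first exact: mesh_ge0.
  move: ci; rewrite !aP lexx andbT; case: ifPn => //; rewrite -leNgt meshS; move: (_^-1) n0' => q; lra.
exists t; split => //; move: ht; rewrite (negbTE ci).
move: ci; rewrite !aP meshS; move: (_^-1) n0' => q q0 ci.
by case: ifPn => ci'; lra.
Qed.

End exit.

(** * The position at the killing or exit time as a limit *)

Section killing_position.
Context {R : realType}.
Variable kappa : borel_measure R.
Implicit Types (b g f : R -> R) (a c q z t : R).

Definition clock_sum b N k m I : R := (N.+1 * m.+1)%:R^-1 *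
  \sum_(0 <= j < I * m.+1) kap kappa k.+1%:R^-1 (b (mesh (N.+1 * m.+1) j)).

(* A version of the clock measurable for the sigma-algebra of the path. *)
Definition clock_limit b N I : R :=
  fine (limn_esup (fun k => limn_esup (fun m => (clock_sum b N k m I)%:E))).

(** The running maximum makes the version nonnegative and nondecreasing on every path, exceptional
    ones included, so that the weights built from it are always those of a sub-probability. *)
Fixpoint clock_version b N I : R :=
  Num.max (if I is J.+1 then clock_version b N J else 0) (clock_limit b N I).

Arguments clock_version : simpl never.

Lemma clock_version0 b N : clock_version b N 0 = Num.max 0 (clock_limit b N 0).
Proof. by []. Qed.

Lemma clock_versionS b N I :
  clock_version b N I.+1 = Num.max (clock_version b N I) (clock_limit b N I.+1).
Proof. by []. Qed.

Definition coarse_stopped a c b N I : R :=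
  stopped (fun I => b (mesh N.+1 I)) (fun I => `[< alive a c b (mesh N.+1 I) >]) I.

(** The coarse step is 1 / (N + 1), so this number of steps covers the time N + 1, which tends to
    infinity with N. *)
Definition horizon N := (N.+1 * N.+1)%N.

(** The reward is g at the start of the coarse step in which the clock reaches q, and f at the
    horizon if it has not done so; the walk is frozen after its exit from ]a, c[. *)
Definition killed_sum a c b q N g f : R :=
  \sum_(0 <= I < horizon N)
    (clock_version b N I < q <= clock_version b N I.+1)%R%:R * g (coarse_stopped a c b N I)
  + (clock_version b N (horizon N) < q)%R%:R * f (coarse_stopped a c b N (horizon N)).

Definition position_version a c b q : R :=
  fine (limn_esup (fun N => (killed_sum a c b q N id id)%:E)).

Lemma clock_version_ge0 b N I : 0 <= clock_version b N I.
Proof. by elim: I => [|I IH]; rewrite ?clock_version0 ?clock_versionS le_max ?lexx// IH. Qed.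

Lemma clock_version_le b N I J : (I <= J)%N -> clock_version b N I <= clock_version b N J.
Proof.
have st K : clock_version b N K <= clock_version b N K.+1.
  by rewrite clock_versionS le_max lexx.
by elim: J => [|J IH]; [rewrite leqn0 => /eqP ->|
  rewrite leq_eqVlt => /orP[/eqP ->//|IJ]; apply: le_trans (IH IJ) (st _)].
Qed.

Hypothesis kR : radon kappa.
Variables (b : R -> R) (l : R -> R -> R).
Hypotheses (cb : continuous b) (cl : continuous (fun z : R * R => l z.1 z.2))
  (l0 : forall t y, 0 <= t -> 0 <= l t y)
  (occ : forall t (A : set R), 0 <= t -> measurable A ->
  lebesgue_measure [set s | 0 <= s <= t /\ A (b s)] = (\int[lebesgue_measure]_(y in A) (l t y)%:E)%E).

Let cmono := clock_mono kR cb cl l0 occ.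

Lemma clock_sum_cvg N I q : 0 < q -> exists k0, forall k, (k0 <= k)%N ->
  exists m0, forall m, (m0 <= m)%N ->
  `|clock_sum b N k m I - clock kappa l (mesh N.+1 I)| <= q.
Proof.
move=> q0; have [e0 e00 he] := clock_riemann kR cb cl l0 occ N I q0.
exists (Num.bound e0^-1) => k kk.
have [|m0 hm] := he k.+1%:R^-1.
  rewrite invr_gt0 ltr0n/= invf_plt ?posrE//.
  apply: lt_le_trans (_ : (Num.bound e0^-1)%:R <= _).
    by apply: archi_boundP; rewrite invr_ge0 ltW.
  by rewrite ler_nat (leq_trans kk).
by exists m0.
Qed.

Lemma clock_versionE N I : clock_version b N I = clock kappa l (mesh N.+1 I).
Proof.
have E J : clock_limit b N J = clock kappa l (mesh N.+1 J).
  rewrite /clock_limit (_ : limn_esup _ = (clock kappa l (mesh N.+1 J))%:E)//.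
  apply/eqP; rewrite eq_le; apply/andP; split.
    apply/lee_addgt0Pr => q q0; have [k0 hk] := clock_sum_cvg N J q0.
    apply: (@limn_esup_le _ _ _ k0) => k /hk[m0 hm].
    apply: (@limn_esup_le _ _ _ m0) => m /hm; rewrite -EFinD lee_fin ler_norml => /andP[_]; lra.
  apply/lee_subgt0Pr => q q0; have [k0 hk] := clock_sum_cvg N J q0.
  apply: (@limn_esup_ge _ _ _ k0) => k /hk[m0 hm].
  apply: (@limn_esup_ge _ _ _ m0) => m /hm; rewrite -EFinB lee_fin ler_norml => /andP[+ _]; lra.
elim: I => [|I IH].
  by rewrite clock_version0 E; apply/max_idPr; apply: (clock_ge0 _ l0); exact: mesh_ge0.
rewrite clock_versionS IH E; apply/max_idPr; apply: cmono; first exact: mesh_ge0.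
by rewrite ler_pM2r ?invr_gt0 ?ltr0n// ler_nat.
Qed.

(** The selected position is read within one coarse step of T, the minimum of the killing and exit
    times. When the exit comes first the path is already frozen near its exit point, whatever the
    step in which the clock crosses q; f can be selected only in that case. *)
Lemma killed_sum_position a c s q : is_exit a c b s -> 0 < q ->
  exists2 t, mine (killing_time kappa l q) s%:E = t%:E /\ 0 <= t <= s &
    forall N, t < N.+1%:R -> exists2 u, `|u - t| <= N.+1%:R^-1 /\ 0 <= u &
      (forall g f, killed_sum a c b q N g f = g (b u)) \/
      (t = s /\ forall g f, killed_sum a c b q N g f = f (b u)).
Proof.
move=> es q0; have s0 : 0 < s by case: es.
have k0 : (0%:E < killing_time kappa l q)%E.
  by rewrite (lt_killing_time kR cb cl l0 occ)// (clock0 _ cb cl l0 occ).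
have [t tE] : exists t, mine (killing_time kappa l q) s%:E = t%:E.
  exists (fine (mine (killing_time kappa l q) s%:E)); rewrite fineK//.
  rewrite fin_numE; apply/andP; split.
    by rewrite gt_eqF// lt_min ltNyr (lt_trans _ k0)// ltNyr.
  by rewrite lt_eqF// gt_min ltry orbT.
have ltT u : 0 <= u -> (u < t) = (clock kappa l u < q) && (u < s).
  move=> u0; rewrite -(lt_killing_time kR cb cl l0 occ)//.
  by rewrite -!lte_fin -tE lt_min.
have t0 : 0 < t by rewrite ltT// s0 (clock0 _ cb cl l0 occ) q0.
have ts : t <= s by rewrite -lee_fin -tE ge_min lexx orbT.
exists t; first by rewrite (ltW t0).
move=> N tN.
pose A I := clock kappa l (mesh N.+1 I).
have Amono I J : (I <= J)%N -> A I <= A J.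
  by move=> IJ; apply: cmono; [exact: mesh_ge0|rewrite ler_pM2r ?invr_gt0 ?ltr0n// ler_nat].
have AE I : clock_version b N I = A I by exact: clock_versionE.
have meshS I : @mesh R N.+1 I.+1 = mesh N.+1 I + N.+1%:R^-1.
  by rewrite /mesh -natr1 mulrDl mul1r.
have near I := stopped_near cb I (ltn0Sn N) es.
have aP I : `[< alive a c b (mesh N.+1 I) >] = (mesh N.+1 I < s).
  by apply/asboolP/idP => /(aliveP cb es (mesh_ge0 _ _)).
(* A clock still below q at a mesh time not before s means that the exit comes first. *)
have dead_eq I : A I < q -> s <= mesh N.+1 I -> t = s.
  move=> Aq sI; apply/eqP; rewrite eq_le ts leNgt; apply/negP => lt.
  have := ltT t (ltW t0); rewrite ltxx lt andbT => /esym/negbT/negP; apply.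
  apply: le_lt_trans Aq; apply: cmono; [exact: ltW|exact: le_trans (ltW lt) sI].
have [Ah|Ah] := ltP (A (horizon N)) q.
  have tl : ~~ (mesh N.+1 (horizon N) < t).
    rewrite -leNgt /mesh /horizon natrM mulfK// ltW//.
  have sI : s <= mesh N.+1 (horizon N).
    by move: tl; rewrite ltT ?mesh_ge0// Ah/= -leNgt.
  have tsE := dead_eq _ Ah sI.
  have [u [uE u0]] := near (horizon N).
  rewrite aP ltNge sI/= => /andP[/andP[u1 u2] _].
  exists u; first by split => //; rewrite tsE ger0_norm ?subr_ge0//; move: u2; move: (_^-1) => r; lra.
  right; split => // g f.
  rewrite /killed_sum AE Ah mul1r big1_seq ?add0r; last first.
    move=> I /=; rewrite mem_index_iota => /andP[_ Ih].
    by rewrite !AE [X in _ && X]leNgt (le_lt_trans (Amono _ _ Ih) Ah) andbF mul0r.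
  by rewrite /coarse_stopped uE.
have ex : exists I, q <= A I by exists (horizon N).
(* The clock crosses q in the coarse step that ends at the least such m; m is positive because the
   clock starts at 0 < q. *)
have [m qm mmin] := ex_minnP ex.
have m0 : (0 < m)%N.
  case: m qm {mmin} => //; rewrite /A /mesh mul0r (clock0 _ cb cl l0 occ); lra.
case: m m0 qm mmin => // I _ qI Imin.
have Ih : (I < horizon N)%N by exact: Imin.
have AI : A I < q by rewrite ltNge; apply/negP => /Imin; rewrite ltnn.
have sumE g f : killed_sum a c b q N g f = g (coarse_stopped a c b N I).
  rewrite /killed_sum AE ltNge (le_trans qI (Amono _ _ Ih))/= mul0r addr0.
  rewrite (bigD1_seq I) ?iota_uniq ?mem_index_iota//= !AE AI qI mul1r.
  rewrite big1 ?addr0// => J JI; rewrite !AE.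
  have [JI'|] := ltnP J I.
    by rewrite [X in _ && X]leNgt (le_lt_trans (Amono _ _ JI') AI) andbF mul0r.
  rewrite leq_eqVlt eq_sym (negbTE JI)/= => IJ.
  by rewrite ltNge (le_trans qI (Amono _ _ IJ))/= mul0r.
have [u [uE u0 hu]] := near I.
exists u; last by left => g f; rewrite sumE /coarse_stopped uE.
split => //; move: hu; rewrite aP; case: ifPn => [Is ->|].
  have It : mesh N.+1 I < t by rewrite ltT ?mesh_ge0// AI.
  have : ~~ (mesh N.+1 I.+1 < t) by rewrite ltT ?mesh_ge0// negb_and -leNgt qI.
  rewrite -leNgt meshS ler0_norm ?subr_le0 ?(ltW It)//; move: (_^-1) => r; lra.
rewrite -leNgt => sI /andP[/andP[u1 u2] _].
by rewrite (dead_eq _ AI sI) ger0_norm ?subr_ge0//; move: u2; move: (_^-1) => r; lra.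
Qed.

(** f can be read in place of g only at the exit, where the two agree. *)
Lemma killed_sum_cvg a c s q g f e : is_exit a c b s -> 0 < q ->
  continuous g -> continuous f -> f a = g a -> f c = g c -> 0 < e ->
  exists N0, forall N, (N0 <= N)%N ->
    `|killed_sum a c b q N g f - g (b (fine (mine (killing_time kappa l q) s%:E)))| <= e.
Proof.
move=> es q0 cg cf fa fc e0.
have [t [tE /andP[t0 ts]] ht] := killed_sum_position es q0.
rewrite tE /=.
have cgb : continuous (g \o b) by move=> u; apply: continuous_comp; [exact: cb|exact: cg].
have cfb : continuous (f \o b) by move=> u; apply: continuous_comp; [exact: cb|exact: cf].
have /cvgrPdist_le /(_ _ e0)[r1 /= r10 h1] := @cgb t.
have /cvgrPdist_le /(_ _ e0)[r2 /= r20 h2] := @cfb t.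
pose r := Num.min r1 r2; have r0 : 0 < r by rewrite lt_min r10.
exists (Num.bound (Num.max t r^-1)) => N NN.
have /andP[tN rN] : (t < N.+1%:R) && (r^-1 < N.+1%:R).
  rewrite -gt_max; apply: lt_le_trans (_ : (Num.bound (Num.max t r^-1))%:R <= _).
    by apply: archi_boundP; rewrite le_max t0.
  by rewrite ler_nat (leq_trans NN).
have Nr : N.+1%:R^-1 < r by rewrite invf_plt ?posrE.
have [u [ut u0] h] := ht N tN.
have /andP[ur1 ur2] : (`|u - t| < r1) && (`|u - t| < r2).
  by rewrite -lt_min (le_lt_trans ut).
case: h => [->|[tsE ->]].
  by rewrite distrC; apply: h1; rewrite /ball_/= distrC.
have <- : f (b t) = g (b t) by case: es => _ + _; rewrite tsE => -[] ->.
by rewrite distrC; apply: h2; rewrite /ball_/= distrC.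
Qed.

Lemma position_versionE a c s q : is_exit a c b s -> 0 < q ->
  position_version a c b q = b (fine (mine (killing_time kappa l q) s%:E)).
Proof.
move=> es q0; rewrite /position_version; set p := b _.
rewrite (_ : limn_esup _ = p%:E)//; apply/eqP; rewrite eq_le.
have cid : continuous (id : R -> R) by move=> u; exact: cvg_id.
have hN e (e0 : 0 < e) := killed_sum_cvg es q0 cid cid erefl erefl e0.
apply/andP; split.
  apply/lee_addgt0Pr => e /hN[N0 h]; apply: (@limn_esup_le _ _ _ N0) => N /h.
  by rewrite -EFinD lee_fin ler_norml => /andP[_]; rewrite -/p; lra.
apply/lee_subgt0Pr => e /hN[N0 h]; apply: (@limn_esup_ge _ _ _ N0) => N /h.
by rewrite -EFinB lee_fin ler_norml => /andP[+ _]; rewrite -/p; lra.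
Qed.

End killing_position.

(** * From the fine mesh to the coarse mesh *)

Section killed_path.
Context {R : realType} (kappa : borel_measure R) (kR : radon kappa).
Implicit Types (z q t u v e : R).
Variables (a c s c0 Rr : R) (r : R -> R).
Implicit Types (osc om : R) (b : R -> R).
Hypotheses (ac : a < c) (cr : continuous r) (rR : forall z, `|r z| <= Rr)
  (r0 : forall z, (z <= a) || (c <= z) -> r z = 0).
Local Notation f := (tlim kappa a c s c0 r).
Local Notation g := (fun z => f z - r z).
Local Notation Cb := (tbd kappa a c s Rr r).

(** A sum of one-step Ito errors weighted by survival and by being alive. The weights depend on the
    past only, so [brownian_step] makes the expectation small. *)
Definition step_sum (b : R -> R) N k m : R :=
  let n := (N.+1 * m.+1)%N in let e := k.+1%:R^-1 in
  let F := tmol kappa a c s c0 r e in let F2 := tfun kappa a c s r (ker2 e) in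
  \sum_(0 <= i < horizon N * m.+1)
    damp (fun i => b (mesh n i)) (kap kappa e) n%:R^-1 i * (`[< alive a c b (mesh n i) >])%:R *
    (F (b (mesh n i.+1)) - F (b (mesh n i)) - n%:R^-1 * (F2 (b (mesh n i)) / 2)).

(** [killed_sum] with the exponential threshold integrated out, the path being fixed. *)
Definition exp_sum (b : R -> R) N : R :=
  \sum_(0 <= I < horizon N)
    (expR (- clock_version kappa b N I) - expR (- clock_version kappa b N I.+1)) *
    g (coarse_stopped a c b N I)
  + expR (- clock_version kappa b N (horizon N)) * f (coarse_stopped a c b N (horizon N)).

Definition tlim_max : R := `|c0| + Cb * (c - a + 2).

Let Rr0 : 0 <= Rr. Proof. exact: le_trans (rR 0). Qed.
Let Cb0 : 0 <= Cb. Proof. exact: tbd_ge0. Qed.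
Let fM z : `|f z| <= tlim_max. Proof. exact: (tlim_bound kR). Qed.
Let gM z : `|g z| <= tlim_max + Rr.
Proof. by apply: le_trans (ler_normB _ _) _; exact: lerD. Qed.
Let fM0 : 0 <= tlim_max. Proof. exact: le_trans (fM 0). Qed.

Let k1 k : 0 < (k.+1%:R^-1 : R) <= 1.
Proof. by rewrite invr_gt0 ltr0n/= invf_le1// ler1n. Qed.

(** Bounds the mollified kappa on ]a, c[; the factor k + 1 is the inverse of the kernel width. *)
Definition kap_max k : R :=
  k.+1%:R * fine (kappa `](- (`|a| + `|c| + 1)), (`|a| + `|c| + 1)]%classic).

Let kap_max_ge0 k : 0 <= kap_max k.
Proof. by rewrite mulr_ge0// fine_ge0. Qed.

Lemma alive_kap_le k n i b : alive a c b (mesh n i) ->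
  kap kappa k.+1%:R^-1 (b (mesh n i)) <= kap_max k.
Proof.
move=> /alive_mesh/andP[az zc]; have /andP[e0 e1] := k1 k.
have := @kap_bound _ _ kR k.+1%:R^-1 (b (mesh n i)) (`|a| + `|c| + 1) e0 e1.
rewrite invrK; apply; rewrite addrK ler_norml.
have := ler_norm a; have := ler_norm (- a); have := ler_norm c; have := ler_norm (- c).
rewrite !normrN; lra.
Qed.

Lemma damp_clock_sum b N k m I :
  damp (fun i => b (mesh (N.+1 * m.+1) i)) (kap kappa k.+1%:R^-1) (N.+1 * m.+1)%:R^-1 (I * m.+1)
  = expR (- clock_sum kappa b N k m I).
Proof. by []. Qed.

(** [killed_sum_estimate] on the fine mesh with a reward constant on each coarse step, so that
    [telescope_block] leaves coarse differences only. Of the three mollification errors, two come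
    from that lemma and one from the starting value. *)
Lemma step_sum_estimate b N k m osc om : 0 <= osc -> 0 <= om ->
  (forall z, a <= z <= c -> forall y, `|y - z| <= k.+1%:R^-1 -> `|r y - r z| <= osc) ->
  let n := (N.+1 * m.+1)%N in
  let chi i := `[< alive a c b (mesh n i) >] in
  let st := stopped (fun i => b (mesh n i)) chi in
  (forall i, (i < horizon N * m.+1)%N ->
    `|f (st i.+1) - (chi i)%:R * r (b (mesh n i)) - g (coarse_stopped a c b N (i %/ m.+1))| <= om) ->
  `|step_sum b N k m + f (b 0) -
     (\sum_(0 <= I < horizon N)
       (expR (- clock_sum kappa b N k m I) - expR (- clock_sum kappa b N k m I.+1)) *
       g (coarse_stopped a c b N I)
      + expR (- clock_sum kappa b N k m (horizon N)) * f (st (horizon N * m.+1)%N))|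
  <= 3 * (Cb * k.+1%:R^-1) + om + osc + (osc + Rr) * (N.+1%:R * kap_max k ^+ 2 * n%:R^-1).
Proof.
move=> osc0 om0 hosc n chi st hom; have /andP[e0 e1] := k1 k.
set e := k.+1%:R^-1 in e0 e1 hosc *.
have chid i : chi i.+1 -> chi i.
  move=> /asboolP h; apply/asboolP; apply: alive_le h.
  by rewrite ler_pM2r ?invr_gt0// ler_nat.
have h0 : 0 <= n%:R^-1 :> R by rewrite invr_ge0 ltW.
have v0 z : 0 <= kap kappa e z by exact: kap_ge0.
have vK i : chi i -> kap kappa e (b (mesh n i)) <= kap_max k.
  by move=> /asboolP; exact: alive_kap_le.
have F2E i : chi i -> `|tfun kappa a c s r (ker2 e) (b (mesh n i)) / 2 -
    r (b (mesh n i)) * kap kappa e (b (mesh n i))| <= osc * kap kappa e (b (mesh n i)).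
  move=> /asboolP/alive_mesh/andP[az zc].
  by apply: (tfun2_kap kR) => //; [rewrite !ltW|apply: hosc; rewrite !ltW].
have FE z : `|tmol kappa a c s c0 r e z - f z| <= Cb * e by exact: tmol_tlim.
have := @killed_sum_estimate _ (fun i => b (mesh n i)) chi (kap kappa e)
  (tmol kappa a c s c0 r e) (tfun kappa a c s r (ker2 e)) f r n%:R^-1 (kap_max k) Rr (Cb * e)
  osc om (fun i => g (coarse_stopped a c b N (i %/ m.+1))) chid h0 v0 (kap_max_ge0 k) osc0 vK F2E rR FE
  (horizon N * m.+1)%N om0 hom.
rewrite (telescope_block (damp _ _ _) (fun I => g (coarse_stopped a c b N I))).
rewrite [X in (osc + Rr) * X](_ : _ = N.+1%:R * kap_max k ^+ 2 * n%:R^-1); last first.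
  rewrite (_ : (horizon N * m.+1)%N = (N.+1 * n)%N); last by rewrite /horizon /n mulnA.
  rewrite (natrM _ N.+1 n).
  by field; rewrite gt_eqF.
rewrite (_ : mesh n 0 = 0); last by rewrite /mesh mul0r.
move=> H.
set Q := (X in `|_ - X|); set S := step_sum _ _ _ _.
rewrite (_ : S + f (b 0) - Q = (S + tmol kappa a c s c0 r e (b 0) - Q) -
  (tmol kappa a c s c0 r e (b 0) - f (b 0))); last by ring.
apply: le_trans (ler_normB _ _) _; have := FE (b 0); move: H; rewrite -/S -/Q; lra.
Qed.

(** A crude bound valid on every path, from the trivial oscillations 2 * Rr of r and 2 * tlim_max +
    2 * Rr of the rewards: the domination asked by [nested_limit]. *)
Lemma step_sum_bounded N k : exists m0, forall m b, (m0 <= m)%N ->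
  `|step_sum b N k m + f (b 0) - exp_sum b N| <=
    3 * Cb + (2 * tlim_max + 2 * Rr) + 2 * Rr + (2 * Rr + Rr) + (4 * tlim_max + 2 * Rr).
Proof.
have K0 : 0 <= N.+1%:R * kap_max k ^+ 2 :> R by rewrite mulr_ge0// exprn_ge0.
have [d d0 hd] := exists_mul_le K0 (ltr01 : 0 < 1).
exists (Num.bound d^-1) => m b mm; set n := (N.+1 * m.+1)%N.
have nd : n%:R^-1 <= d.
  rewrite invf_ple ?posrE ?ltr0n ?muln_gt0//; apply: le_trans (_ : (Num.bound d^-1)%:R <= _).
    by apply/ltW/archi_boundP; rewrite invr_ge0 ltW.
  by rewrite ler_nat (leq_trans mm)// /n (leq_trans (leqnSn m))// leq_pmull.
have hosc z : a <= z <= c -> forall y, `|y - z| <= k.+1%:R^-1 -> `|r y - r z| <= 2 * Rr.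
  by move=> _ y _; rewrite (le_trans (ler_normB _ _))//; have := rR y; have := rR z; lra.
have om0 : 0 <= 2 * tlim_max + 2 * Rr by rewrite addr_ge0// mulr_ge0.
have osc0 : 0 <= 2 * Rr by rewrite mulr_ge0.
pose st := stopped (fun i => b (mesh n i)) (fun i => `[< alive a c b (mesh n i) >]).
have hom i : (i < horizon N * m.+1)%N ->
    `|f (st i.+1) - (`[< alive a c b (mesh n i) >])%:R * r (b (mesh n i))
      - g (coarse_stopped a c b N (i %/ m.+1))| <= 2 * tlim_max + 2 * Rr.
  move=> _; apply: le_trans (ler_normB _ _) _.
  have := ler_normB (f (st i.+1)) ((`[< alive a c b (mesh n i) >])%:R * r (b (mesh n i))).
  have := fM (st i.+1); have := gM (coarse_stopped a c b N (i %/ m.+1)).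
  have : `|(`[< alive a c b (mesh n i) >])%:R * r (b (mesh n i))| <= Rr.
    by case: `[< _ >]; rewrite ?mul1r ?mul0r ?normr0.
  lra.
have := @step_sum_estimate b N k m _ _ osc0 om0 hosc hom.
rewrite -/n -/st.
set Q := (X in `|_ - X|) => H.
have Qb : `|Q| <= 2 * tlim_max + Rr.
  apply: le_trans (ler_normD _ _) _.
  have t2 : `|expR (- clock_sum kappa b N k m (horizon N)) *
     f (st (horizon N * m.+1)%N)| <= tlim_max.
    rewrite -damp_clock_sum normrM -[leRHS]mul1r ler_pM// ger0_norm ?(ltW (damp_gt0 _ _ _ _))//.
    apply: damp_le1; first by rewrite invr_ge0.
    by move=> z; have /andP[e0 _] := k1 k; exact: kap_ge0.
  have t1 : `|\sum_(0 <= I < horizon N) (expR (- clock_sum kappa b N k m I) -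
      expR (- clock_sum kappa b N k m I.+1)) * g (coarse_stopped a c b N I)| <= tlim_max + Rr.
    rewrite -(telescope_block (damp (fun i => b (mesh n i)) (kap kappa k.+1%:R^-1) n%:R^-1)
      (fun I => g (coarse_stopped a c b N I))).
    have dl := @damp_le _ (fun i => b (mesh n i)) (kap kappa k.+1%:R^-1) n%:R^-1.
    have v0 z : 0 <= kap kappa k.+1%:R^-1 z by have /andP[e0 _] := k1 k; exact: kap_ge0.
    apply: le_trans (ler_norm_sum _ _ _) _.
    apply: (@le_trans _ _ (\sum_(0 <= i < horizon N * m.+1)
      (damp (fun i => b (mesh n i)) (kap kappa k.+1%:R^-1) n%:R^-1 i -
       damp (fun i => b (mesh n i)) (kap kappa k.+1%:R^-1) n%:R^-1 i.+1) * (tlim_max + Rr))).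
      apply: ler_sum => i _; rewrite normrM ger0_norm ?subr_ge0 ?dl//.
      by rewrite ler_wpM2l ?subr_ge0 ?dl.
    have MR0 : 0 <= tlim_max + Rr by exact: addr_ge0.
    rewrite -mulr_suml sum_damp// -[leRHS]mul1r ler_wpM2r//.
    by have := damp_gt0 (fun i => b (mesh n i)) (kap kappa k.+1%:R^-1) n%:R^-1 (horizon N * m.+1); lra.
  lra.
have Xb : `|exp_sum b N| <= 2 * tlim_max + Rr.
  apply: le_trans (ler_normD _ _) _.
  have e1 I : expR (- clock_version kappa b N I) <= 1.
    by rewrite -expR0 ler_expR oppr_le0 clock_version_ge0.
  have t2 : `|expR (- clock_version kappa b N (horizon N)) * f (coarse_stopped a c b N (horizon N))| <= tlim_max.
    by rewrite normrM -[leRHS]mul1r ler_pM// ger0_norm ?expR_ge0.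
  have t1 : `|\sum_(0 <= I < horizon N) (expR (- clock_version kappa b N I) -
      expR (- clock_version kappa b N I.+1)) * g (coarse_stopped a c b N I)| <= tlim_max + Rr.
    apply: le_trans (ler_norm_sum _ _ _) _.
    apply: (@le_trans _ _ (\sum_(0 <= I < horizon N) (expR (- clock_version kappa b N I) -
      expR (- clock_version kappa b N I.+1)) * (tlim_max + Rr))).
      apply: ler_sum => i _; have h : expR (- clock_version kappa b N i.+1) <= expR (- clock_version kappa b N i).
        by rewrite ler_expR lerN2 clock_version_le.
      by rewrite normrM ger0_norm ?subr_ge0// ler_wpM2l ?subr_ge0.
    have MR0 : 0 <= tlim_max + Rr by exact: addr_ge0.
    rewrite -mulr_suml -[leRHS]mul1r ler_wpM2r//.
    pose v I := - expR (- clock_version kappa b N I).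
    rewrite (eq_bigr (fun I => v I.+1 - v I)); last by move=> I _; rewrite /v; ring.
    rewrite telescope_sumr// /v.
    have := e1 0%N; have := expR_ge0 (- clock_version kappa b N (horizon N)); lra.
  lra.
rewrite (_ : _ - exp_sum b N = (step_sum b N k m + f (b 0) - Q) + (Q - exp_sum b N)); last by ring.
apply: le_trans (ler_normD _ _) _.
have := ler_normB Q (exp_sum b N).
have CE : Cb * k.+1%:R^-1 <= Cb.
  by rewrite -[leRHS]mulr1 ler_wpM2l//; have /andP[] := k1 k.
have KE : (2 * Rr + Rr) * (N.+1%:R * kap_max k ^+ 2 * n%:R^-1) <= 2 * Rr + Rr.
  rewrite -[leRHS]mulr1 ler_wpM2l ?addr_ge0 ?mulr_ge0//; apply: le_trans hd.
  by rewrite mulrC ler_wpM2r.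
move: H CE KE; rewrite -/n.
move: (N.+1%:R * kap_max k ^+ 2 / n%:R) (Cb / k.+1%:R) => y1 y2; lra.
Qed.

Lemma unif_lt (Q : nat -> nat -> Prop) h :
  (forall I, exists k0, forall k, (k0 <= k)%N -> Q I k) ->
  exists k0, forall k, (k0 <= k)%N -> forall I, (I <= h)%N -> Q I k.
Proof.
move=> hQ; elim: h => [|h [k0 hk]].
  by have [k0 hk] := hQ 0%N; exists k0 => k kk I; rewrite leqn0 => /eqP ->; exact: hk.
have [k1' hk1] := hQ h.+1; exists (maxn k0 k1') => k; rewrite geq_max => /andP[kk kk1] I.
by rewrite leq_eqVlt => /orP[/eqP ->|]; [exact: hk1|exact: hk].
Qed.

Lemma expRN_lip u v : 0 <= u -> 0 <= v -> `|expR (- u) - expR (- v)| <= `|u - v|.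
Proof.
wlog uv : u v / u <= v => [h u0 v0|u0 v0].
  by have [/h|/ltW/h] := leP u v; [exact|rewrite distrC (distrC u); exact].
have w0 : 0 <= v - u by rewrite subr_ge0.
have [d1 d2 _] := one_subr_expRN w0.
have e1 : expR (- u) <= 1 by rewrite -expR0 ler_expR oppr_le0.
rewrite (_ : expR (- v) = expR (- u) * expR (- (v - u))); last by rewrite -expRD; congr expR; ring.
rewrite -{1}[expR (- u)]mulr1 -mulrBr normrM (ger0_norm (expR_ge0 _)) (ger0_norm d1).
by rewrite distrC ger0_norm// (le_trans _ d2)// -[leRHS]mul1r ler_wpM2r.
Qed.

Section good_path.
Variables (b : R -> R) (l : R -> R -> R) (sg : R).
Hypotheses (cb : continuous b) (cl : continuous (fun z : R * R => l z.1 z.2))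
  (l0 : forall t y, 0 <= t -> 0 <= l t y)
  (occ : forall t (A : set R), 0 <= t -> measurable A ->
  lebesgue_measure [set s | 0 <= s <= t /\ A (b s)] = (\int[lebesgue_measure]_(y in A) (l t y)%:E)%E)
  (ex : is_exit a c b sg).

(** While alive, the fine and coarse positions are at most one coarse step apart in time; afterwards
    both are within mu of the exit point b sg, hence the factor 2. *)
Lemma coarse_near N n i I (mu nu : R) : (0 < n)%N -> 0 < nu ->
  (forall t t', 0 <= t <= sg + 2 -> `|t - t'| < nu -> `|b t - b t'| <= mu) ->
  n%:R^-1 <= N.+1%:R^-1 :> R -> N.+1%:R^-1 < nu -> N.+1%:R^-1 <= 1 :> R ->
  mesh N.+1 I <= mesh n i :> R -> mesh n i <= mesh N.+1 I + N.+1%:R^-1 :> R ->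
  let chi i := `[< alive a c b (mesh n i) >] in
  let st := stopped (fun i => b (mesh n i)) chi in
  `|st i - coarse_stopped a c b N I| <= 2 * mu /\
  if chi i then coarse_stopped a c b N I = b (mesh N.+1 I)
  else `|coarse_stopped a c b N I - b sg| <= mu.
Proof.
move=> n0 nu0 hmu nN Nnu N1 Ii iI chi st.
have sg0 : 0 < sg by case: ex.
have sg2 : sg <= sg + 2 by rewrite lerDl.
have mu0 : 0 <= mu.
  apply: le_trans (normr_ge0 _) (hmu 0 0 _ _); rewrite ?subrr ?normr0//.
  by rewrite lexx addr_ge0// ltW.
have aP m j : `[< alive a c b (mesh m j) >] = (mesh m j < sg).
  by apply/asboolP/idP => /(aliveP cb ex (mesh_ge0 _ _)).
have [u [uE u0 hu]] := stopped_near cb i n0 ex.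
have [v [vE v0 hv]] := stopped_near cb I (ltn0Sn N) ex.
rewrite /st /chi uE /coarse_stopped vE.
move: hu hv; rewrite !aP.
have bnd t : 0 <= t -> `|t - sg| <= N.+1%:R^-1 -> `|b t - b sg| <= mu.
  move=> t0 tsg; rewrite distrC; apply: hmu; first by rewrite (ltW sg0) sg2.
  by rewrite distrC (le_lt_trans tsg).
have tI0 : 0 <= mesh N.+1 I :> R by exact: mesh_ge0.
have ti0 : 0 <= mesh n i :> R by exact: mesh_ge0.
move: (mesh N.+1 I) (mesh n i) tI0 ti0 Ii iI => tI ti tI0 ti0 Ii iI.
move: (N.+1%:R^-1) (n%:R^-1) nN Nnu N1 bnd iI => d e nN Nnu N1 bnd iI.
case: ifPn => [isg ->|].
  rewrite (le_lt_trans Ii isg) => ->; split => //.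
  apply: le_trans (_ : mu <= _); last by lra.
  by apply: hmu; [rewrite ti0; lra|rewrite ger0_norm ?subr_ge0//; lra].
rewrite -leNgt => sgi /andP[/andP[u1 u2] u3] hv.
have kk1 : `|b u - b sg| <= mu by apply: bnd => //; rewrite ger0_norm ?subr_ge0//; lra.
have k2 : `|b v - b sg| <= mu.
  apply: bnd => //; move: hv; case: ifPn => [vs ->|_ /andP[/andP[w1 w2] _]].
    by rewrite ler0_norm ?subr_le0 ?(ltW vs)//; lra.
  by rewrite ger0_norm ?subr_ge0//; lra.
split => //; rewrite (_ : b u - b v = (b u - b sg) - (b v - b sg)); last by ring.
by rewrite (le_trans (ler_normB _ _))//; lra.
Qed.

(** N is fixed by the moduli of continuity of the path, of f and of r; k by the kernel error, the
    modulus of r and the convergence of the clock; m comes last because the quadratic error involves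
    [kap_max k]. *)
Lemma step_sum_limit q : 0 < q -> exists N0, forall N, (N0 <= N)%N ->
  exists k0, forall k, (k0 <= k)%N -> exists m0, forall m, (m0 <= m)%N ->
  `|step_sum b N k m + f (b 0) - exp_sum b N| <= q.
Proof.
(* The errors gathered in [lin4] amount to at most 12 q1. *)
move=> q0; pose q1 := q / 16; have q10 : 0 < q1 by rewrite divr_gt0.
have lin1 (u v : R) : u <= q1 -> v <= q1 -> u + v <= 4 * q1 by lra.
have lin2 (u v : R) : u <= 2 * q1 -> v <= q1 -> u + v <= 4 * q1 by lra.
have lin3 (w1 w2 x1 x2 x3 : R) : w1 + w2 <= q1 -> x1 <= w1 -> x2 <= 2 * q1 -> x3 <= w2 ->
  x1 + (x2 + x3) <= 3 * q1 by lra.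
have lin4 (w1 w2 x1 x2 : R) : x1 <= 3 * w2 + 4 * q1 + q1 + w1 -> x2 <= 3 * q1 ->
  w1 <= q1 -> w2 <= q1 -> x1 + x2 <= q by rewrite /q1; lra.
have lin5 (u v w : R) : u <= w -> v <= w -> u + v <= w * 2 by lra.
have [rho rho0 hrho] := unif_cont_itv a c cr q10.
have [mu1 mu10 hmu1] := exists_mul_le Cb0 q10.
pose mu := Num.min mu1 (rho / 2).
have mu0 : 0 < mu by rewrite lt_min mu10 divr_gt0.
have Cmu : Cb * mu <= q1.
  by apply: le_trans hmu1; rewrite [mu1 * _]mulrC ler_wpM2l// ge_min lexx.
have murho : mu < rho by rewrite gt_min; apply/orP; right; lra.
have [nu nu0 hnu] := unif_cont_itv 0 (sg + 2) cb mu0.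
have bsg : a <= b sg <= c by case: ex => _ [] -> _; rewrite lexx ltW.
(* r vanishes at both ends, so near the exit point a frozen walk has a reward within the modulus of
   r of the value f. *)
have rsg : r (b sg) = 0 by case: ex => _ [] -> _; apply: r0; rewrite lexx ?orbT.
exists (Num.bound nu^-1) => N NN.
have Nnu : N.+1%:R^-1 < nu.
  rewrite invf_plt ?posrE//; apply: lt_le_trans (_ : (Num.bound nu^-1)%:R <= _).
    by apply: archi_boundP; rewrite invr_ge0 ltW.
  by rewrite ler_nat (leq_trans NN).
have /andP[N0 N1] := k1 N.
(* Bounds the change of the coarse sum and of its final term, relative to dl, when every damping
   factor moves by at most dl. *)
have H0 : 0 <= (horizon N)%:R * (2 * (tlim_max + Rr)) + tlim_max by rewrite addr_ge0// !mulr_ge0// addr_ge0.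
have [dl dl0 hdl] := exists_mul_le H0 q10.
have [k2 hk2] := unif_lt (horizon N) (fun I => clock_sum_cvg kR cb cl l0 occ N I dl0).
have [e1 e10 he1] := exists_mul_le Cb0 q10.
pose e2 := Num.min e1 rho; have e20 : 0 < e2 by rewrite lt_min e10.
exists (maxn k2 (Num.bound e2^-1)) => k; rewrite geq_max => /andP[kk2 ke].
have ke2 : k.+1%:R^-1 < e2.
  rewrite invf_plt ?posrE//; apply: lt_le_trans (_ : (Num.bound e2^-1)%:R <= _).
    by apply: archi_boundP; rewrite invr_ge0 ltW.
  by rewrite ler_nat (leq_trans ke).
move: (ke2); rewrite lt_min => /andP[kee1 kerho].
have Cke : Cb * k.+1%:R^-1 <= q1.
  by apply: le_trans he1; rewrite [e1 * _]mulrC ler_wpM2l// ltW.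
have hk3 := hk2 k kk2.
have [m1 hm1] : exists m1, forall m, (m1 <= m)%N -> forall I, (I <= horizon N)%N ->
    `|clock_sum kappa b N k m I - clock kappa l (mesh N.+1 I)| <= dl.
  pose Q I m := (I <= horizon N)%N -> `|clock_sum kappa b N k m I - clock kappa l (mesh N.+1 I)| <= dl.
  have hQ I : exists m0, forall m, (m0 <= m)%N -> Q I m.
    have [/hk3[m0 h]|h] := leqP I (horizon N); first by exists m0 => m mm _; exact: h.
    by exists 0%N => m _ h'; move: h; rewrite ltnNge h'.
  have [m1 hm1] := unif_lt (horizon N) hQ.
  by exists m1 => m mm I Ih; exact: hm1.
(* The coefficient of the quadratic error for the chosen k; the fine mesh has to beat it. *)
have K0 : 0 <= (q1 + Rr) * (N.+1%:R * kap_max k ^+ 2) :> R.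
  by rewrite mulr_ge0 ?addr_ge0 ?(ltW q10)// mulr_ge0// exprn_ge0.
have [d d0 hd] := exists_mul_le K0 q10.
exists (maxn m1 (Num.bound d^-1)) => m; rewrite geq_max => /andP[mm1 md].
set n := (N.+1 * m.+1)%N.
have n0 : (0 < n)%N by rewrite muln_gt0.
have nd : n%:R^-1 <= d.
  rewrite invf_ple ?posrE ?ltr0n//; apply: le_trans (_ : (Num.bound d^-1)%:R <= _).
    by apply/ltW/archi_boundP; rewrite invr_ge0 ltW.
  by rewrite ler_nat (leq_trans md)// /n (leq_trans (leqnSn m))// leq_pmull.
have nN : n%:R^-1 <= N.+1%:R^-1 :> R.
  by rewrite lef_pV2 ?posrE ?ltr0n// ler_nat /n leq_pmulr.
pose chi i := `[< alive a c b (mesh n i) >].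
pose st := stopped (fun i => b (mesh n i)) chi.
have meshE I : mesh n (I * m.+1) = mesh N.+1 I :> R.
  by rewrite /mesh /n !natrM -mulf_div divff ?mulr1// pnatr_eq0.
have mesh_le i j : (i <= j)%N -> mesh n i <= mesh n j :> R.
  by move=> ij; rewrite ler_pM2r ?invr_gt0 ?ltr0n// ler_nat.
have meshS I : mesh N.+1 I.+1 = mesh N.+1 I + N.+1%:R^-1 :> R.
  by rewrite /mesh -natr1 mulrDl mul1r.
have flip z w : `|f z - f w| <= Cb * `|z - w| by exact: tlim_lip.
have osc0 : 0 <= q1 by exact: ltW.
have om0 : 0 <= 4 * q1 by rewrite mulr_ge0.
have hosc z : a <= z <= c -> forall y, `|y - z| <= k.+1%:R^-1 -> `|r y - r z| <= q1.
  by move=> zac y yz; rewrite distrC; apply: hrho => //; rewrite distrC (le_lt_trans yz).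
(* While the walk is alive, f and r move little within a coarse step; afterwards both meshes are
   frozen near the exit point, where r is small. *)
have hom i : (i < horizon N * m.+1)%N ->
    `|f (st i.+1) - (chi i)%:R * r (b (mesh n i)) - g (coarse_stopped a c b N (i %/ m.+1))| <= 4 * q1.
  move=> _; set I := (i %/ m.+1)%N.
  have Ii : (I * m.+1 <= i)%N by exact: leq_divM.
  have iI : (i.+1 <= I.+1 * m.+1)%N by rewrite ltn_ceil.
  have tIi : mesh N.+1 I <= mesh n i :> R by rewrite -meshE mesh_le.
  have tiI : mesh n i.+1 <= mesh N.+1 I + N.+1%:R^-1 :> R by rewrite -meshS -meshE mesh_le.
  have tii : mesh n i <= mesh n i.+1 :> R by exact: mesh_le.
  have [h1 h2] := coarse_near n0 nu0 hnu nN Nnu N1 tIi (le_trans tii tiI).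
  move: h2; rewrite -/(chi i) /st /= -/st; case: (boolP (chi i)) => ci h2.
    have at_ : alive a c b (mesh n i) by apply/asboolP.
    have tsg : mesh n i < sg by apply/(aliveP cb ex (mesh_ge0 _ _)).
    have /andP[ab1 ab2] := alive_mesh at_.
    rewrite h2 mul1r.
    have bnd t : mesh N.+1 I <= t -> t <= mesh N.+1 I + N.+1%:R^-1 -> `|b (mesh N.+1 I) - b t| <= mu.
      move=> t1 t2; apply: hnu.
        rewrite mesh_ge0/=; apply: le_trans tIi (le_trans (ltW tsg) _).
        by rewrite lerDl.
      rewrite distrC ger0_norm ?subr_ge0//; apply: le_lt_trans Nnu; move: t2.
      by move: (_^-1) => w; lra.
    have b1 := bnd _ tIi (le_trans tii tiI).
    have b2 := bnd _ (le_trans tIi tii) tiI.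
    have k3 : `|f (b (mesh n i.+1)) - f (b (mesh N.+1 I))| <= q1.
      apply: le_trans (flip _ _) (le_trans _ Cmu).
      by rewrite ler_wpM2l// distrC.
    have k4 : `|r (b (mesh n i)) - r (b (mesh N.+1 I))| <= q1.
      apply: hrho; first by rewrite !ltW.
      by rewrite distrC (le_lt_trans b1).
    rewrite (_ : _ - _ - _ = (f (b (mesh n i.+1)) - f (b (mesh N.+1 I))) - (r (b (mesh n i)) - r (b (mesh N.+1 I)))); last by ring.
    by apply: le_trans (ler_normB _ _) _; exact: lin1.
  rewrite mul0r subr0.
  have k3 : `|f (st i) - f (coarse_stopped a c b N I)| <= 2 * q1.
    apply: le_trans (flip _ _) _; apply: (@le_trans _ _ (Cb * (2 * mu))).
      by rewrite ler_wpM2l.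
    by rewrite mulrCA ler_wpM2l.
  have k4 : `|r (coarse_stopped a c b N I)| <= q1.
    have := hrho (b sg) (coarse_stopped a c b N I) bsg.
    by rewrite rsg sub0r normrN; apply; rewrite distrC (le_lt_trans h2).
  rewrite (_ : _ - _ = (f (st i) - f (coarse_stopped a c b N I)) + r (coarse_stopped a c b N I)); last by ring.
  by apply: le_trans (ler_normD _ _) _; exact: lin2.
have := @step_sum_estimate b N k m _ _ osc0 om0 hosc hom.
rewrite -/n -/st; set Q := (X in `|_ - X|) => H.
have hend : `|f (st (horizon N * m.+1)%N) - f (coarse_stopped a c b N (horizon N))| <= 2 * q1.
  have t1 : mesh N.+1 (horizon N) <= mesh n (horizon N * m.+1) :> R by rewrite meshE.
  have t2 : mesh n (horizon N * m.+1) <= mesh N.+1 (horizon N) + N.+1%:R^-1 :> R.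
    by rewrite meshE lerDl ltW.
  have [h1 _] := coarse_near n0 nu0 hnu nN Nnu N1 t1 t2.
  apply: le_trans (flip _ _) _; apply: (@le_trans _ _ (Cb * (2 * mu))).
    by rewrite ler_wpM2l.
  by rewrite mulrCA ler_wpM2l.
have eI I : (I <= horizon N)%N ->
    `|expR (- clock_sum kappa b N k m I) - expR (- clock_version kappa b N I)| <= dl.
  move=> Ih; apply: le_trans (expRN_lip _ _) _; last first.
  - by rewrite (clock_versionE kR cb cl l0 occ); exact: hm1.
  - exact: clock_version_ge0.
  rewrite mulr_ge0 ?invr_ge0//; apply: sumr_ge0 => j _.
  by have /andP[? _] := k1 k; exact: kap_ge0.
have QX : `|Q - exp_sum b N| <= 3 * q1.
  rewrite /Q /exp_sum.
  set S1 := \sum_(0 <= I < _) _; set S2 := \sum_(0 <= I < _) _.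
  set u1 := expR _; set u2 := expR _; set F1 := f _; set F2 := f _.
  have dS : `|S1 - S2| <= dl * ((horizon N)%:R * (2 * (tlim_max + Rr))).
    rewrite /S1 /S2 -sumrB; apply: le_trans (ler_norm_sum _ _ _) _.
    apply: (@le_trans _ _ (\sum_(0 <= I < horizon N) dl * (2 * (tlim_max + Rr)))).
      rewrite big_nat_cond [leRHS]big_nat_cond; apply: ler_sum => I /andP[/andP[_ Ih] _].
      rewrite -mulrBl normrM mulrA; apply: ler_pM => //.
      rewrite (_ : _ - _ - _ = (expR (- clock_sum kappa b N k m I) - expR (- clock_version kappa b N I)) -
       (expR (- clock_sum kappa b N k m I.+1) - expR (- clock_version kappa b N I.+1))); last by ring.
      apply: le_trans (ler_normB _ _) _.
      by apply: lin5; [exact: eI (ltnW Ih)|exact: eI Ih].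
    by rewrite sumr_const_nat subn0 -[(_ * _) *+ _]mulr_natr -mulrA [2 * _ * _]mulrC.
  have du : `|u1 - u2| <= dl by exact: eI.
  have u11 : `|u1| <= 1.
    rewrite ger0_norm ?expR_ge0// /u1 -damp_clock_sum damp_le1 ?invr_ge0//.
    by move=> z; have /andP[? _] := k1 k; exact: kap_ge0.
  rewrite (_ : _ - _ = (S1 - S2) + (u1 * (F1 - F2) + (u1 - u2) * F2)); last by ring.
  apply: le_trans (ler_normD _ _) _; apply: le_trans (lerD (lexx _) (ler_normD _ _)) _.
  have t1 : `|u1 * (F1 - F2)| <= 2 * q1 by rewrite normrM -[leRHS]mul1r ler_pM.
  have t2 : `|(u1 - u2) * F2| <= dl * tlim_max by rewrite normrM ler_pM// fM.
  have hdl' : dl * ((horizon N)%:R * (2 * (tlim_max + Rr))) + dl * tlim_max <= q1.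
    by rewrite -mulrDr.
  exact: lin3 hdl' dS t1 t2.
rewrite (_ : _ - exp_sum b N = (step_sum b N k m + f (b 0) - Q) + (Q - exp_sum b N)); last by ring.
apply: le_trans (ler_normD _ _) _.
have KE : (q1 + Rr) * (N.+1%:R * kap_max k ^+ 2 * n%:R^-1) <= q1.
  apply: le_trans hd; rewrite mulrA mulrC ler_wpM2r//.
exact: lin4 H QX KE Cke.
Qed.

End good_path.

End killed_path.

(** * Exponential thresholds and measurability along a path *)

Section exponential.
Context {R : realType} {d : measure_display} {Om : measurableType d}.
Variables (P : probability Om R) (e : Om -> R).
Hypothesis ee : exponential_rv P 1 e.
Local Open Scope ereal_scope.

Lemma exponential_le0 : P (e @^-1` `]-oo, 0%R]) = 0.
Proof.
case: ee => me ->//; rewrite /exponential_prob.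
rewrite -integral_itv_bndo_bndc; last first.
  by apply/measurable_EFinP; apply: measurable_funTS; exact: measurable_exponential_pdf.
by apply: integral0_eq => y /=; rewrite in_itv/= => y0; rewrite lt0_exponential_pdf.
Qed.

Lemma exponential_gt0 : {ae P, forall w, (0 < e w)%R}.
Proof.
case: ee => me _; exists (e @^-1` `]-oo, 0%R]); split; last 2 first.
- exact: exponential_le0.
- by move=> w /= h; rewrite in_itv/= leNgt; apply/negP.
by rewrite -[_ @^-1` _]setTI; apply: me.
Qed.

Lemma exponential_itv (u v : R) : (0 <= u)%R -> (u <= v)%R ->
  P [set w | (u < e w <= v)%R] = (expR (- u) - expR (- v))%:E.
Proof.
move=> u0 uv; case: (ee) => me law.
have m01 A : measurable A -> measurable (e @^-1` A) by move=> mA; rewrite -[_ @^-1` _]setTI; apply: me.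
have cdf (t : R) : (0 <= t)%R -> P (e @^-1` `]-oo, t]) = (1 - expR (- t))%:E.
  rewrite le_eqVlt => /predU1P[<-|t0]; first by rewrite exponential_le0 oppr0 expR0 subrr.
  have -> : `]-oo, t]%classic = `]-oo, 0%R[ `|` `[0%R, t] :> set R.
    apply/seteqP; split => y /=; rewrite !in_itv/=; last by case; lra.
    by move=> yt; have [y0|y0] := leP 0%R y; [right; apply/andP|left].
  rewrite preimage_setU measureU; last 3 first.
  - by apply: m01; exact: measurable_itv.
  - by apply: m01; exact: measurable_itv.
  - by apply/seteqP; split => w //= []; rewrite !in_itv/=; lra.
  have z0 : P (e @^-1` `]-oo, 0%R[) = 0.
    apply/eqP; rewrite eq_le measure_ge0 andbT -exponential_le0.
    apply: le_measure; rewrite ?inE; [exact: m01|exact: m01|].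
    by move=> w /=; rewrite !in_itv/= => /ltW.
  rewrite [X in X + _](z0 : _ = _) add0e.
  by apply: eq_trans (law _ _) _ => //; rewrite exponential_prob_itv0c// mulN1r.
have -> : [set w | (u < e w <= v)%R] = e @^-1` `]-oo, v] `\` e @^-1` `]-oo, u].
  apply/seteqP; split => w /=; rewrite !in_itv/=.
    by move=> /andP[uw ->]; split => //; apply/negP; rewrite -ltNge.
  by move=> [-> /negP]; rewrite -ltNge => ->.
have v0 : (0 <= v)%R by exact: le_trans uv.
have fv : P (e @^-1` `]-oo, v]) < +oo by rewrite cdf ?ltry.
rewrite measureD; [|exact: m01|exact: m01|exact: fv].
rewrite setIidr; last by move=> w /=; rewrite !in_itv/= => wu; exact: le_trans uv.
by rewrite [X in X - _](cdf v v0 : _ = _) [X in _ - X](cdf u u0 : _ = _) -EFinB; congr EFin; ring.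
Qed.

End exponential.

Lemma measurable_cts_comp {R : realType} d (T : measurableType d) (g : R -> R) (X : T -> R) :
  continuous g -> mfun X -> mfun (fun w => g (X w)).
Proof. by move=> cg mX; apply: measurableT_comp => //; exact: continuous_measurable_fun. Qed.

Section path_measurability.
Context {R : realType} {d : measure_display} {T : measurableType d} (kappa : borel_measure R) (kR : radon kappa).
Variables (a c : T -> R) (X : R -> T -> R).
Hypotheses (ma : mfun a) (mc : mfun c).
Implicit Types (t : R).

(** Countably many conditions at mesh points. The ends depend on the sample because a gap is left by
    the earlier walks. *)
Lemma measurable_alive t : (forall s, 0 <= s <= t -> mfun (X s)) ->
  measurable [set w | alive (a w) (c w) (X^~ w) t].
Proof.
move=> mX; rewrite (_ : [set w | _] = \bigcup_k \bigcap_n \bigcap_j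
   (if mesh n j <= t :> R then [set w | a w + k.+1%:R^-1 <= X (mesh n j) w <= c w - k.+1%:R^-1] else setT)).
  apply: bigcupT_measurable => k; apply: bigcapT_measurable => n; apply: bigcapT_measurable => j.
  case: ifPn => // jt; have mXj : mfun (X (mesh n j)) by apply: mX; rewrite mesh_ge0.
  rewrite -[X in measurable X]setTI; apply: (@measurable_and _ _ setT
    (fun w => a w + k.+1%:R^-1 <= X (mesh n j) w) (fun w => X (mesh n j) w <= c w - k.+1%:R^-1)) => //.
    by apply: measurable_fun_ler => //; exact: measurable_funD.
  by apply: measurable_fun_ler => //; exact: measurable_funB.
apply/seteqP; split => w /= [k].
  by move=> hk; exists k => // n _ j _; case: ifPn => // jt; exact: hk.
by move=> _ hk; exists k => n j jt; have := hk n I j I; rewrite jt.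
Qed.

Lemma measurable_alive_fun t : (forall s, 0 <= s <= t -> mfun (X s)) ->
  mfun (fun w => `[< alive (a w) (c w) (X^~ w) t >]).
Proof.
move=> mX; apply: (measurable_fun_bool true); rewrite setTI.
rewrite (_ : _ @^-1` _ = [set w | alive (a w) (c w) (X^~ w) t]); first exact: measurable_alive.
by apply/seteqP; split => w /= /asboolP.
Qed.

Hypothesis mX : forall s, 0 <= s -> mfun (X s).

Lemma measurable_stopped n i : mfun
  (fun w => stopped (fun i => X (mesh n i) w) (fun i => `[< alive (a w) (c w) (X^~ w) (mesh n i) >]) i).
Proof.
elim: i => [|i IH] /=; first by apply: mX; exact: mesh_ge0.
apply: measurable_fun_ifT => //; last by apply: mX; exact: mesh_ge0.
by apply: measurable_alive_fun => s /andP[s0 _]; exact: mX.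
Qed.

Lemma measurable_clock_version N I : mfun (fun w => clock_version kappa (X^~ w) N I).
Proof.
have m1 J : mfun (fun w => clock_limit kappa (X^~ w) N J).
  rewrite /clock_limit; apply: (@measurableT_comp _ _ _ _ _ _ fine) => //.
  apply: measurable_fun_limn_esup => k; apply: measurable_fun_limn_esup => m.
  apply/measurable_EFinP; apply: measurable_funM => //.
  apply: measurable_sum => j; apply: measurableT_comp; last by apply: mX; exact: mesh_ge0.
  apply: continuous_measurable_fun; apply: (continuous_kap kR).
    by rewrite invr_gt0.
  by rewrite invf_le1// ler1n.
elim: I => [|I IH].
  by rewrite (_ : (fun w => _) = (fun w => Num.max 0 (clock_limit kappa (X^~ w) N 0)))//; exact: measurable_maxr.
by rewrite (_ : (fun w => _) = (fun w => Num.max (clock_version kappa (X^~ w) N I) (clock_limit kappa (X^~ w) N I.+1)))//; exact: measurable_maxr.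
Qed.

Lemma measurable_killed_sum N (g f : R -> R) (q : T -> R) : continuous g -> continuous f ->
  mfun q ->
  mfun (fun w => killed_sum kappa (a w) (c w) (X^~ w) (q w) N g f).
Proof.
move=> cg cf mq; have mind (A : T -> bool) : mfun A ->
    mfun (fun w => (A w)%:R : R).
  move=> mA; rewrite (_ : (fun w => _) = (fun w => if A w then 1 else 0)).
    exact: measurable_fun_ifT.
  by apply/funext => w; case: (A w).
have mcv := measurable_clock_version; have mst := measurable_stopped.
apply: measurable_funD.
  apply: measurable_sum => I; apply: measurable_funM; last first.
    exact: (measurable_cts_comp cg (mst N.+1 I)).
  apply: mind; apply: measurable_and; first exact: measurable_fun_ltr.
  exact: measurable_fun_ler.
apply: measurable_funM; first by apply: mind; exact: measurable_fun_ltr.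
exact: (measurable_cts_comp cf (mst N.+1 (horizon N))).
Qed.

Lemma measurable_position_version (q : T -> R) : mfun q ->
  mfun (fun w => position_version kappa (a w) (c w) (X^~ w) (q w)).
Proof.
move=> mq; apply: (@measurableT_comp _ _ _ _ _ _ fine) => //.
apply: measurable_fun_limn_esup => N; apply/measurable_EFinP.
by apply: measurable_killed_sum => // y; exact: cvg_id.
Qed.

End path_measurability.

(** A map with values in A turns continuity within A into plain continuity; it is used for the
    extension of paths and local times to negative times. *)
Lemma continuous_retract (T U : topologicalType) (A : set T) (f : T -> U) (phi : T -> T) :
  {within A, continuous f} -> continuous phi -> (forall t, A (phi t)) -> continuous (f \o phi).
Proof.
move=> cf cphi Aphi t; have := cf (phi t).
rewrite /prop_for /continuous_at => h; apply: cvg_comp h.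
apply/(@subspace_cvgP T A) => // S; rewrite /within /= => hS.
have hS' : nbhs (phi t) [set y | A y -> S y] := hS.
have := cphi t _ hS'; rewrite /nbhs /=; apply: filterS => s /= h.
exact: (h (Aphi s)).
Qed.

Lemma le_measure_ae {R : realType} d (T : measurableType d) (mu : {measure set T -> \bar R})
  (E F : set T) : measurable E -> measurable F -> {ae mu, forall w, E w -> F w} ->
  (mu E <= mu F)%E.
Proof.
move=> mE mF [N [mN N0 hN]].
apply: (@le_trans _ _ (mu (F `|` N))).
  apply: le_measure; rewrite ?inE//; first exact: measurableU.
  move=> w Ew; have [Fw|nF] := pselect (F w); [by left|right].
  by apply: hN => /= h; apply: nF; exact: h.
apply: (@le_trans _ _ (mu F + mu N)%E); first exact: measureU2.
by rewrite [X in (_ + X)%E](N0 : _ = _) adde0.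
Qed.

(** The density is at most 1 / s because 2 pi >= 1. *)
Lemma normal_prob_small {R : realType} (s C : R) : 0 < s -> 0 <= C ->
  (normal_prob 0 s `[(- C)%R, C]%classic <= (2 * C / s)%:E)%E.
Proof.
move=> s0 C0; rewrite /normal_prob.
apply: (@le_trans _ _ (\int[lebesgue_measure]_(y in `[(- C)%R, C]) (s^-1)%:E)%E).
  apply: ge0_le_integral => //.
  - by move=> y _; rewrite lee_fin normal_pdf_ge0.
  - by apply/measurable_EFinP; apply: measurable_funTS; exact: measurable_normal_pdf.
  move=> y _; rewrite lee_fin; apply: le_trans (normal_pdf_ub _ _ _) _; first by rewrite gt_eqF.
  rewrite /normal_peak lef_pV2 ?posrE//; last first.
    by rewrite sqrtr_gt0 mulrn_wgt0// mulr_gt0 ?exprn_gt0// pi_gt0.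
  rewrite -[leLHS](ger0_norm (ltW s0)) -sqrtr_sqr ler_sqrt; last first.
    by rewrite mulrn_wge0// mulr_ge0 ?sqr_ge0// pi_ge0.
  rewrite -mulrnAr -[leLHS]mulr1 ler_wpM2l ?sqr_ge0//.
  by have := pi_ge2 R; rewrite mulr2n; lra.
rewrite integral_cst//= lebesgue_measure_itv/= lte_fin; case: ifPn => h.
  rewrite -EFinD -EFinM lee_fin opprK -mulr2n -[C *+ 2]mulr_natl mulrC.
  exact: lexx.
by rewrite mule0 lee_fin mulr_ge0 ?invr_ge0 ?(ltW s0)// mulr_ge0.
Qed.

(** * Almost sure properties of one walk *)

Section walk.
Context {R : realType} {d : measure_display} {Om : measurableType d} (kappa : borel_measure R) (kR : radon kappa).
Variable P : probability Om R.
Variables (x : R) (B : R -> Om -> R) (L : R -> R -> Om -> R) (e : Om -> R).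
Hypotheses (BB : brownian_motion P x B) (LL : local_time P B L)
  (ee : exponential_rv P 1 e)
  (Be : forall E A, sigma_process B `[0, +oo[ E -> measurable A ->
  P (E `&` e @^-1` A) = (P E * P (e @^-1` A))%E).

(* Processes are constrained at nonnegative times only, so paths are extended
   by constants to the left of 0. *)
Definition ext (t : R) : Om -> R := B (Num.max t 0).
Definition ext_time (t y : R) : Om -> R := L (Num.max t 0) y.

Lemma extE t : 0 <= t -> ext t = B t.
Proof. by move=> t0; rewrite /ext max_l. Qed.

Lemma measurable_ext t : mfun (ext t).
Proof. by case: BB => h _ _ _ _; apply: h; rewrite le_max lexx orbT. Qed.

Lemma walk_good : {ae P, forall w,
  [/\ continuous (ext^~ w), continuous (fun z : R * R => ext_time z.1 z.2 w),
    forall t y, 0 <= t -> 0 <= ext_time t y w,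
    forall t (A : set R), 0 <= t -> measurable A ->
      lebesgue_measure [set s | 0 <= s <= t /\ A (ext s w)] =
      (\int[lebesgue_measure]_(y in A) (ext_time t y w)%:E)%E & B 0 w = x]}.
Proof.
case: BB => _ h0 hc _ _; case: LL => _ hl hl0 hocc.
apply: filterS3 (filterI h0 hc) (filterI hl hl0) hocc => w [w0 wc] [wl wl0] wocc.
have cmax : continuous (fun t : R => Num.max t 0).
  by apply: continuous_of_lip (fun=> 1) _ => z u _; rewrite mul1r;
    rewrite /Num.max; case: ltP => ?; case: ltP => ?; rewrite ler_norml;
    have := ler_norm u; have := ler_norm (- u); rewrite normrN; lra.
split => //.
- apply: (continuous_retract wc cmax) => t.
  by rewrite /= in_itv/= le_max lexx orbT.
- pose phi (z : R * R) : R * R := (Num.max z.1 0, z.2).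
  apply: (@continuous_retract _ _ _ (fun z : R * R => L z.1 z.2 w) phi wl).
    move=> z; apply: (@cvg_pair _ _ _ (nbhs z) (nbhs (Num.max z.1 0)) (nbhs z.2)) => /=; last exact: cvg_snd.
    by apply: (@cvg_comp _ _ _ fst (fun t : R => Num.max t 0) _ (nbhs z.1)); [exact: cvg_fst|exact: cmax].
  by move=> z /=; rewrite le_max lexx orbT.
- by move=> t y t0; rewrite /ext_time; apply: wl0; rewrite le_max lexx orbT.
- move=> t A t0 mA; rewrite /ext_time (max_l t0) -(wocc t A t0 mA); congr (_ _).
  by apply/seteqP; split => s /= [/andP[s0 st]]; rewrite /ext (max_l s0) => As; split => //; rewrite s0.
Qed.

(** The walk is in [- K, K] at the integer time j with a probability of order 1 / sqrt j, so almost
    surely not at all integer times. *)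
Lemma walk_unbounded : {ae P, forall w, forall K : nat, exists2 t, 0 <= t & K%:R < `|ext t w|}.
Proof.
apply/ae_foralln => K.
case: (BB) => mB h0 _ law _.
pose A (j : nat) := [set w | `|B j%:R w| <= K%:R].
have mA j : measurable (A j).
  rewrite (_ : A j = B j%:R @^-1` `[- K%:R, K%:R]).
    by rewrite -[_ @^-1` _]setTI; apply: mB.
  by apply/seteqP; split => w; rewrite /A /= in_itv/= ler_norml.
exists (\bigcap_j A j); split; first exact: bigcapT_measurable.
  apply/eqP; rewrite eq_le measure_ge0 andbT; apply/lee_addgt0Pr => q q0; rewrite add0e.
  pose C := K%:R + `|x|; have C0 : 0 <= C by rewrite addr_ge0.
  have C20 : 0 <= 2 * C by rewrite mulr_ge0.
  have [r r0 hr] := exists_mul_le C20 q0.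
  pose j := (Num.bound (r^-1 ^+ 2)).
  have jr : r^-1 <= Num.sqrt j%:R.
    rewrite -[leLHS]ger0_norm ?invr_ge0 ?(ltW r0)// -sqrtr_sqr ler_wsqrtr//.
    by apply/ltW/archi_boundP; exact: sqr_ge0.
  have j0 : 0 < j%:R :> R.
    have : 0 < Num.sqrt j%:R :> R by apply: lt_le_trans jr; rewrite invr_gt0.
    by rewrite sqrtr_gt0.
  have sj0 : 0 < Num.sqrt j%:R :> R by rewrite sqrtr_gt0.
  apply: (@le_trans _ _ (P (A j))); first by apply: le_measure; rewrite ?inE//; [exact: bigcapT_measurable|exact: bigcap_inf].
  apply: (@le_trans _ _ (P [set w | `[- C, C]%classic (B j%:R w - B 0 w)])).
    apply: le_measure_ae => //.
    - rewrite (_ : [set w | _] = (fun w => B j%:R w - B 0 w) @^-1` `[- C, C])//.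
      by rewrite -[_ @^-1` _]setTI; apply: measurable_funB => //; exact: mB.
    apply: filterS h0 => w w0 /=; rewrite /A/= in_itv/= w0 -ler_norml => h.
    by rewrite (le_trans (ler_normB _ _))// lerD.
  rewrite law// subr0; apply: le_trans (normal_prob_small sj0 C0) _.
  rewrite lee_fin; apply: le_trans hr; rewrite mulrC ler_wpM2r//.
  by rewrite -[leRHS]invrK lef_pV2 ?posrE ?invr_gt0.
move=> w /= h j _; rewrite /A /= leNgt; apply/negP => lt; apply: h.
by exists j%:R => //; rewrite extE.
Qed.

End walk.

(** [indep_integral] applied to h + C, which is nonnegative. *)
Lemma indep_Rintegral_bounded {R : realType} d (Om : measurableType d) (P : probability Om R)
    d1 d2 (T1 : measurableType d1) (T2 : measurableType d2)
    (X : Om -> T1) (Y : Om -> T2) (h : T1 * T2 -> R) (C : R) :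
  mfun X -> mfun Y ->
  (forall A A', measurable A -> measurable A' ->
    P (X @^-1` A `&` Y @^-1` A') = (P (X @^-1` A) * P (Y @^-1` A'))%E) ->
  mfun h -> (forall z, `|h z| <= C) ->
  \int[P]_w h (X w, Y w) = \int[P]_w \int[P]_w' h (X w, Y w').
Proof.
move=> mX mY XY mh hC.
have h0 z : 0 <= h z + C by have := hC z; rewrite ler_norml -{1}[- C]add0r lerBlDr => /andP[].
have := @indep_integral _ _ _ P _ _ T1 T2 X Y (fun z => (h z + C)%:E) mX mY XY.
have mh1 : mfun (fun z => (h z + C)%:E) by apply/measurable_EFinP; exact: measurable_funD.
have h01 z : (0%:E <= (h z + C)%:E)%E by rewrite lee_fin.
move=> /(_ mh1 h01) E.
have mXY : mfun (fun w => h (X w, Y w)).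
  by apply: measurableT_comp mh _; exact: measurable_fun_pair.
have mhY w : mfun (fun w' => h (X w, Y w')).
  by apply: measurableT_comp mh _; apply: measurable_fun_pair => //; exact: measurable_cst.
have iXY : P.-integrable setT (EFin \o (fun w => h (X w, Y w))).
  by apply: (@integrable_bounded _ _ _ _ _ C) => // w; exact: hC.
have iY w : P.-integrable setT (EFin \o (fun w' => h (X w, Y w'))).
  by apply: (@integrable_bounded _ _ _ _ _ C) => // w'; exact: hC.
have ic : P.-integrable setT (EFin \o cst C).
  exact: finite_measure_integrable_cst.
have inE w : (\int[P]_w' (h (X w, Y w') + C)%:E)%E = (\int[P]_w' h (X w, Y w') + C)%:E.
  rewrite -[X in _ = (_ + X)%:E](Rintegral_cst_prob P C) -RintegralD// /Rintegral fineK//.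
  by apply: integrable_fin_num => //; exact: integrableD_real.
have mI : mfun (fun w => \int[P]_w' h (X w, Y w')).
  pose Y' : {RV P >-> T2} := mfun_Sub (mem_set mY).
  rewrite (_ : (fun w => _) = (fun w => fine (fubini_F (distribution P Y') (fun z => (h z + C)%:E) (X w)) - C)).
    apply: measurable_funB => //; apply: (@measurableT_comp _ _ _ _ _ _ fine) => //.
    apply: (@measurableT_comp _ _ _ _ _ _ (fubini_F (distribution P Y') (fun z => (h z + C)%:E)) _ X) => //.
    exact: measurable_fun_fubini_tonelli_F.
  apply/funext => w; have mw : mfun (fun y => (h (X w, y) + C)%:E).
    by apply: measurableT_comp mh1 _; apply: measurable_fun_pair => //; exact: measurable_cst.
  rewrite /fubini_F ge0_integral_distribution//.
  by rewrite (_ : integral _ _ _ = (\int[P]_w' (h (X w, Y w') + C)%:E)%E)// inE/= addrK.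
have iI : P.-integrable setT (EFin \o (fun w => \int[P]_w' h (X w, Y w'))).
  apply: (@integrable_bounded _ _ _ _ _ C) => // w.
  apply: le_trans (le_normr_Rintegral _ (iY w)) _ => //.
  rewrite -[leRHS](Rintegral_cst_prob P); apply: le_Rintegral => //.
  exact: (integrable_norm (iY w)).
apply: (addIr C); apply: EFin_inj.
rewrite -[in LHS](Rintegral_cst_prob P C) -[in RHS](Rintegral_cst_prob P C).
rewrite -RintegralD// -RintegralD//.
have finD (f1 : Om -> R) : P.-integrable setT (EFin \o f1) ->
    (\int[P]_w (f1 w + C))%:E = (\int[P]_w (f1 w + C)%:E)%E.
  by move=> if1; rewrite /Rintegral fineK//; apply: integrable_fin_num => //; exact: integrableD_real.
rewrite finD// finD//.
by rewrite E; apply: eq_integral => w _; rewrite inE.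
Qed.

Lemma exponential_survival {R : realType} d (Om : measurableType d) (P : probability Om R)
  (e : Om -> R) (u : R) : exponential_rv P 1 e -> 0 <= u ->
  P [set w | u < e w] = (expR (- u))%:E.
Proof.
move=> ee u0; case: (ee) => me _.
have m01 A : measurable A -> measurable (e @^-1` A) by move=> mA; rewrite -[_ @^-1` _]setTI; apply: me.
have m1 : measurable [set w | 0 < e w <= u].
  rewrite (_ : [set w | _] = e @^-1` `]0, u]); first exact: m01.
  by apply/seteqP; split => w /=; rewrite in_itv.
have -> : [set w | u < e w] = ~` (e @^-1` `]-oo, 0] `|` [set w | 0 < e w <= u]).
  apply/seteqP; split => w /=; rewrite in_itv/=; first by lra.
  by move=> h; rewrite ltNge; apply/negP => h'; apply: h; have [k|k] := leP (e w) 0; [left|right].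
rewrite probability_setC; last by apply: measurableU => //; exact: m01.
rewrite measureU//; [|exact: m01|by apply/seteqP; split => w //= []; rewrite in_itv/=; lra].
rewrite [X in (_ - (X + _))%E](exponential_le0 ee : _ = _) add0e.
by rewrite [X in (_ - X)%E](exponential_itv ee (lexx 0) u0 : _ = _) -EFinB; congr EFin; rewrite oppr0 expR0; ring.
Qed.

Lemma indic_boolE {R : pzRingType} (T : Type) (A : T -> bool) (w : T) :
  \1_[set w | A w] w = (A w)%:R :> R.
Proof. by rewrite indicE; congr (nat_of_bool _)%:R; apply/idP/idP; rewrite inE. Qed.

Lemma Rintegral_bool {R : realType} d (Om : measurableType d) (P : probability Om R)
  (A : Om -> bool) (v k : R) : measurable [set w | A w] -> P [set w | A w] = v%:E ->
  \int[P]_w ((A w)%:R * k) = v * k.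
Proof.
move=> mA PA.
have iA : P.-integrable setT (EFin \o (fun w => (A w)%:R : R)).
  apply: (@integrable_bounded _ _ _ _ _ 1) => [|w]; last by case: (A w); rewrite ?normr1 ?normr0.
  rewrite (_ : (fun w => _) = \1_[set w | A w]); first exact: measurable_indic.
  by apply/funext => w; rewrite indic_boolE.
rewrite RintegralZr//; congr (_ * _); rewrite /Rintegral.
rewrite (_ : (fun w => _) = (fun w => (\1_[set w | A w] w)%:E)).
  by rewrite integral_indic// setIT [X in fine X](PA : _ = _).
by apply/funext => w; rewrite indic_boolE.
Qed.

(** The weights are the drops of the nonincreasing indicator of a clock below q, together with its
    final value: they are nonnegative and their sum is at most 1. *)
Lemma killed_sum_bound {R : realType} (kappa : borel_measure R)
  (a c q M : R) (b g f : R -> R) N : (forall z, `|g z| <= M) -> (forall z, `|f z| <= M) ->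
  `|killed_sum kappa a c b q N g f| <= M.
Proof.
move=> gM fM; have M0 : 0 <= M by apply: le_trans (gM 0).
pose A I := clock_version kappa b N I.
have Ale I : A I <= A I.+1 by exact: clock_version_le.
pose v I : R := (A I < q)%R%:R.
have vE I : (A I < q <= A I.+1)%R%:R = v I - v I.+1 :> R.
  rewrite /v; have := Ale I; case: (ltP (A I) q) => h1; case: (ltP (A I.+1) q) => h2 //= h3; rewrite ?subrr ?subr0//.
  by move: (lt_le_trans h2 h1); rewrite ltNge h3.
have vle I : v I.+1 <= v I.
  rewrite /v ler_nat; case: (ltP (A I.+1) q) => // h; by rewrite (le_lt_trans (Ale I) h).
have v1 I : v I <= 1 by rewrite /v; case: (_ < _)%R.
rewrite /killed_sum; apply: le_trans (ler_normD _ _) _.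
apply: (@le_trans _ _ (\sum_(0 <= I < horizon N) (v I - v I.+1) * M + v (horizon N) * M)).
  apply: lerD; last by rewrite normrM ger0_norm// ler_wpM2l.
  apply: le_trans (ler_norm_sum _ _ _) _; apply: ler_sum => I _.
  by rewrite vE normrM ger0_norm ?subr_ge0// ler_wpM2l ?subr_ge0.
rewrite -mulr_suml (eq_bigr (fun I => - (v I.+1 - v I))); last by move=> I _; ring.
rewrite sumrN telescope_sumr// -mulrDl -[leRHS]mul1r ler_wpM2r//.
by have := v1 0%N; lra.
Qed.

(** * Dynkin's formula for the killed walk *)

Section dynkin.
Context {R : realType} {d : measure_display} {Om : measurableType d} (kappa : borel_measure R) (kR : radon kappa).
Variable P : probability Om R.
Variables (x : R) (B : R -> Om -> R) (L : R -> R -> Om -> R) (e : Om -> R).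
Hypotheses (BB : brownian_motion P x B) (LL : local_time P B L)
  (ee : exponential_rv P 1 e)
  (Be : forall E A, sigma_process B `[0, +oo[ E -> measurable A ->
  P (E `&` e @^-1` A) = (P E * P (e @^-1` A))%E).
Variables (a c s c0 Rr : R) (r : R -> R).
Hypotheses (ac : a < c) (cr : continuous r) (rR : forall z, `|r z| <= Rr)
  (r0 : forall z, (z <= a) || (c <= z) -> r z = 0).
Local Notation f := (tlim kappa a c s c0 r).
Local Notation g := (fun z => f z - r z).
Local Notation Cb := (tbd kappa a c s Rr r).
Local Notation S w := (step_sum kappa a c s c0 r ((ext B)^~ w)).
Local Notation Xs w := (exp_sum kappa a c s c0 r ((ext B)^~ w)).

Let mX t : mfun (ext B t). Proof. exact: measurable_ext BB t. Qed.

Let k1 k : 0 < (k.+1%:R^-1 : R) <= 1.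
Proof. by rewrite invr_gt0 ltr0n/= invf_le1// ler1n. Qed.

Let ck k : continuous (kap kappa k.+1%:R^-1).
Proof. by have /andP[] := k1 k => h1 h2; exact: (continuous_kap kR). Qed.

Let cF k : continuous (tmol kappa a c s c0 r k.+1%:R^-1).
Proof. by have /andP[h1 h2] := k1 k; exact: (continuous_tmol kR cr rR). Qed.

Let cF1 k : continuous (tfun kappa a c s r (ker1 k.+1%:R^-1)).
Proof. by have /andP[h1 h2] := k1 k; exact: (continuous_tfun1 kR cr rR). Qed.

Let cF2 k : continuous (tfun kappa a c s r (ker2 k.+1%:R^-1)).
Proof. by have /andP[h1 h2] := k1 k; exact: (continuous_tfun2 kR cr rR). Qed.

Definition step_weight (b : R -> R) n k i : R :=
  damp (fun i => b (mesh n i)) (kap kappa k.+1%:R^-1) n%:R^-1 i * (`[< alive a c b (mesh n i) >])%:R.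

Let step_weight_le1 b n k i : `|step_weight b n k i| <= 1.
Proof.
rewrite /step_weight normrM -[leRHS]mulr1 ler_pM//.
  rewrite ger0_norm ?(ltW (damp_gt0 _ _ _ _))// damp_le1 ?invr_ge0// => z.
  by apply: kap_ge0; have /andP[] := k1 k.
by case: `[< _ >]; rewrite ?normr1 ?normr0.
Qed.

Let measurable_step_weight d' (T : measurableType d') (X : R -> T -> R) n k i :
  (forall t, 0 <= t <= mesh n i -> mfun (X t)) ->
  mfun (fun w => step_weight (X^~ w) n k i).
Proof.
move=> mX'; apply: measurable_funM.
  rewrite /damp; apply: (@measurableT_comp _ _ _ _ _ _ expR) => //.
  apply: measurable_funN; apply: measurable_funM => //.
  rewrite (_ : (fun w => _) = (fun w => \sum_(j < i) kap kappa k.+1%:R^-1 (X (mesh n j) w))); last first.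
    by apply/funext => w; rewrite big_mkord.
  apply: measurable_sum => j; apply: measurable_cts_comp; first exact: ck.
  by apply: mX'; rewrite mesh_ge0 ler_wpM2r ?invr_ge0// ler_nat ltnW.
rewrite (_ : (fun w => _) = (fun w => if `[< alive a c (X^~ w) (mesh n i) >] then 1 else 0 : R)).
  by apply: measurable_fun_ifT => //; exact: measurable_alive_fun.
by apply/funext => w; case: `[< _ >].
Qed.

Let step_term (k n i : nat) w : R := step_weight ((ext B)^~ w) n k i *
  (tmol kappa a c s c0 r k.+1%:R^-1 (ext B (mesh n i.+1) w) -
   tmol kappa a c s c0 r k.+1%:R^-1 (ext B (mesh n i) w) -
   n%:R^-1 * (tfun kappa a c s r (ker2 k.+1%:R^-1) (ext B (mesh n i) w) / 2)).

Let measurable_step_term k n i : mfun (step_term k n i).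
Proof.
apply: measurable_funM.
  by apply: (@measurable_step_weight _ _ (ext B)) => t _; exact: mX.
have mc (h : R -> R) t : continuous h -> mfun (fun w => h (ext B t w)).
  by move=> ch; exact: measurable_cts_comp.
apply: measurable_funB; first by apply: measurable_funB; apply: mc; exact: cF.
apply: measurable_funM => //; apply: measurable_funM => //.
by apply: mc; exact: cF2.
Qed.

Let step_sumE w N k m : S w N k m =
  \sum_(0 <= i < horizon N * m.+1) step_term k (N.+1 * m.+1) i w.
Proof. by []. Qed.

Let Kb k : R := `|c0| + Cb * (c - a + 2) + Cb + Cb + Cb * k.+1%:R.

Let Fb k z : `|tmol kappa a c s c0 r k.+1%:R^-1 z| <= Kb k /\
  `|tfun kappa a c s r (ker1 k.+1%:R^-1) z| <= Kb k /\
  `|tfun kappa a c s r (ker2 k.+1%:R^-1) z| <= Kb k.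
Proof.
have /andP[h1 h2] := k1 k.
have C0 : 0 <= Cb by apply: tbd_ge0.
have b1 := tlim_bound kR s c0 ac cr rR z.
have b2 := tmol_tlim kR a c s c0 cr rR z h1.
have b3 := tfun1_bound kR a c s cr rR z h1.
have b4 := tfun2_bound kR a c s cr rR z h1.
rewrite invrK in b4.
have b5 : Cb * k.+1%:R^-1 <= Cb by rewrite -[leRHS]mulr1 ler_wpM2l.
have b6 : 0 <= Cb * k.+1%:R by rewrite mulr_ge0.
have b7 : 0 <= Cb * (c - a + 2) by rewrite mulr_ge0//; have := ltW ac; lra.
have b8 : 0 <= `|c0| by [].
have b9 : `|tmol kappa a c s c0 r k.+1%:R^-1 z| <= Cb + (`|c0| + Cb * (c - a + 2)).
  rewrite -[X in `|X|](subrK (tlim kappa a c s c0 r z)) (le_trans (ler_normD _ _))//.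
  by rewrite lerD// (le_trans b2).
rewrite /Kb; move: b3 b4 b6 b7 b8 b9; move: (Cb * k.+1%:R) (Cb * (c - a + 2)) => w1 w2.
by move=> b3 b4 b6 b7 b8 b9; repeat split; lra.
Qed.

Let integrable_step_term k n i : P.-integrable setT (EFin \o step_term k n i).
Proof.
apply: (@integrable_bounded _ _ _ _ _ (Kb k + Kb k + n%:R^-1 * (Kb k / 2))) => // w.
have n0 : 0 <= n%:R^-1 :> R by rewrite invr_ge0.
rewrite normrM -[leRHS]mul1r ler_pM// (le_trans (ler_normB _ _))// lerD//.
  by rewrite (le_trans (ler_normB _ _))// lerD//; have [] := Fb k (ext B (mesh n i.+1) w); have [] := Fb k (ext B (mesh n i) w).
rewrite normrM (ger0_norm n0) ler_wpM2l// normrM [`|2^-1|]ger0_norm// ler_wpM2r//.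
by have [_ []] := Fb k (ext B (mesh n i) w).
Qed.

(** For a fixed kernel width, (N + 1) n terms of order n ^ (- 3 / 2), where n is the number of fine
    steps per unit of time. *)
Lemma step_sum_mean N k eta : 0 < eta -> exists m0, forall m, (m0 <= m)%N ->
  `|\int[P]_w S w N k m| <= eta.
Proof.
move=> eta0; have /andP[h1 h2] := k1 k; set ep := k.+1%:R^-1 in h1 h2.
have C0 : 0 <= Cb by apply: tbd_ge0.
pose C := Cb * (4 / ep ^+ 2).
have Cp : 0 <= C by rewrite mulr_ge0// divr_ge0// exprn_ge0// ltW.
have K0 : 0 <= N.+1%:R * (64 * C) by rewrite mulr_ge0// mulr_ge0.
have [r' r'0 hr] := exists_mul_le K0 eta0.
have r20 : 0 < r' ^+ 2 by rewrite exprn_gt0.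
exists (Num.bound (r' ^+ 2)^-1) => m mm; set n := (N.+1 * m.+1)%N.
have n'0 : 0 < n%:R^-1 :> R by rewrite invr_gt0.
have nr : Num.sqrt n%:R^-1 <= r'.
  rewrite -[leRHS]ger0_norm ?(ltW r'0)// -sqrtr_sqr ler_wsqrtr//.
  rewrite invf_ple ?posrE//; apply: le_trans (_ : (Num.bound (r' ^+ 2)^-1)%:R <= _).
    by apply/ltW/archi_boundP; rewrite invr_ge0 ltW.
  by rewrite ler_nat (leq_trans mm)// /n (leq_trans (leqnSn m))// leq_pmull.
have term i : `|\int[P]_w step_term k n i w| <= C * (64 * Num.sqrt n%:R^-1 ^+ 3).
  have s0 : 0 <= mesh n i :> R by exact: mesh_ge0.
  have meshS : mesh n i.+1 - mesh n i = n%:R^-1 :> R.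
    by rewrite /mesh -mulrBl -natr1 [_ + 1]addrC addrK mul1r.
  have st : mesh n i < mesh n i.+1 :> R by rewrite -subr_gt0 meshS.
  have := @brownian_step _ _ _ P x B BB (mesh n i) (mesh n i.+1) (Kb k) C
    (fun w => step_weight ((ext B)^~ w) n k i) _ _ _ s0 st Cp _ _ (@cF k) (@cF1 k) (@cF2 k)
    (fun z => (Fb k z).1) (fun z => (Fb k z).2.1) (fun z => (Fb k z).2.2)
    (fun z u => tmol_taylor kR a c s c0 cr rR z u h1).
  rewrite meshS => H.
  rewrite (_ : (fun w => step_term k n i w) = (fun w => step_weight ((ext B)^~ w) n k i *
    (tmol kappa a c s c0 r k.+1%:R^-1 (B (mesh n i.+1) w) -
     tmol kappa a c s c0 r k.+1%:R^-1 (B (mesh n i) w) -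
     n%:R^-1 * (tfun kappa a c s r (ker2 k.+1%:R^-1) (B (mesh n i) w) / 2)))).
    apply: H => //; apply: (@measurable_step_weight _ (g_sigma_algebraType (history B `[0, mesh n i])) (ext B)) => t /andP[t0 ti].
    by rewrite extE//; apply: measurable_history; rewrite /= in_itv/= t0.
  by apply/funext => w; rewrite /step_term !extE//; exact: mesh_ge0.
rewrite (@eq_Rintegral _ _ _ P _ (fun w => \sum_(0 <= i < horizon N * m.+1) step_term k n i w)) => [|w _]; last exact: step_sumE.
rewrite Rintegral_sum_real//.
apply: le_trans (ler_norm_sum _ _ _) _.
apply: le_trans (ler_sum _ (fun i _ => term i)) _.
rewrite sumr_const_nat subn0 -[_ *+ _]mulr_natr.
rewrite (_ : (horizon N * m.+1)%N = (N.+1 * n)%N); last by rewrite /horizon /n mulnA.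
have sq : Num.sqrt n%:R^-1 ^+ 2 = n%:R^-1 :> R by rewrite sqr_sqrtr// ltW.
rewrite natrM exprS sq (_ : C * _ * _ = Num.sqrt n%:R^-1 * (N.+1%:R * (64 * C))); last by field; rewrite gt_eqF.
by apply: le_trans hr; rewrite ler_wpM2r.
Qed.

Let fM z : `|f z| <= tlim_max kappa a c s c0 Rr r.
Proof. exact: (tlim_bound kR). Qed.

Let fM0 : 0 <= tlim_max kappa a c s c0 Rr r. Proof. exact: le_trans (fM 0). Qed.
Let Rr0 : 0 <= Rr. Proof. exact: le_trans (rR 0). Qed.

Let M := tlim_max kappa a c s c0 Rr r + Rr.

Let M0 : 0 <= M. Proof. exact: addr_ge0. Qed.

Let fM' z : `|f z| <= M.
Proof. by apply: le_trans (fM z) _; rewrite lerDl. Qed.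

Let gM z : `|g z| <= M.
Proof. by apply: le_trans (ler_normB _ _) _; exact: lerD. Qed.

Let cf : continuous f. Proof. exact: (continuous_tlim kR cr rR). Qed.

Let cg : continuous g. Proof. by apply: continuous_sub. Qed.

Let hist := g_sigma_algebraType (history B `[0, +oo[).

Let hist_sub : history B `[0, +oo[ `<=` measurable.
Proof. by case: BB => mB _ _ _ _; apply: history_sub => t; rewrite /= in_itv/= andbT; exact: mB. Qed.

Let mXh t : measurable_fun (setT : set hist) (ext B t).
Proof. by apply: measurable_history; rewrite /= in_itv/= andbT le_max lexx orbT. Qed.

Let me : mfun e. Proof. by case: ee. Qed.

(** The threshold is independent of the path and can be integrated first; its exponential law
    produces the differences of exponentials of the clock. *)
Lemma killed_sum_mean N :
  \int[P]_w killed_sum kappa a c ((ext B)^~ w) (e w) N g f = \int[P]_w Xs w N.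
Proof.
pose h (z : hist * R) : R := killed_sum kappa a c ((ext B)^~ z.1) z.2 N g f.
have mh : mfun h.
  apply: (@measurable_killed_sum _ _ (hist * R)%type kappa kR (fun=> a) (fun=> c) (fun t z => ext B t z.1)) => //.
  by move=> t _; apply: (measurableT_comp (mXh t)).
have mid : mfun (fun w : Om => (w : hist)).
  by apply: measurable_generated hist_sub _; exact: measurable_id.
have ind A A' : measurable (A : set hist) -> measurable A' ->
    P ((fun w : Om => (w : hist)) @^-1` A `&` e @^-1` A') =
    (P ((fun w : Om => (w : hist)) @^-1` A) * P (e @^-1` A'))%E.
  by move=> mA mA'; exact: Be.
have := indep_Rintegral_bounded mid me ind mh (fun z => killed_sum_bound kappa a c z.2 ((ext B)^~ z.1) N gM fM').
rewrite /h /= => ->; apply: eq_Rintegral => w _.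
set b := (ext B)^~ w.
pose A I := clock_version kappa b N I.
have mitv u v : measurable [set w | u < e w <= v].
  rewrite (_ : [set w | _] = e @^-1` `]u, v]); first by rewrite -[_ @^-1` _]setTI; apply: me.
  by apply/seteqP; split => w' /=; rewrite in_itv.
have mray u : measurable [set w | u < e w].
  rewrite (_ : [set w | _] = e @^-1` `]u, +oo[); first by rewrite -[_ @^-1` _]setTI; apply: me.
  by apply/seteqP; split => w' /=; rewrite in_itv/= andbT.
have mbool (Q : Om -> bool) k : measurable [set w | Q w] ->
    P.-integrable setT (EFin \o (fun w => (Q w)%:R * k : R)).
  move=> mQ; apply: (@integrable_bounded _ _ _ _ _ `|k|) => [|w']; last first.
    by case: (Q w'); rewrite ?mul1r ?mul0r// normr0.
  apply: measurable_funM => //; rewrite (_ : (fun w => _) = \1_[set w | Q w]); first exact: measurable_indic.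
  by apply/funext => w'; rewrite indic_boolE.
rewrite /killed_sum RintegralD//; last 2 first.
- by apply: integrable_sum_real => // I _; exact: mbool.
- exact: mbool.
rewrite Rintegral_sum_real//; last by move=> I _; exact: mbool.
rewrite /exp_sum; congr (_ + _).
  apply: eq_bigr => I _; apply: Rintegral_bool => //.
  by apply: exponential_itv => //; [exact: clock_version_ge0|exact: clock_version_le].
by apply: Rintegral_bool => //; apply: exponential_survival => //; exact: clock_version_ge0.
Qed.

Hypothesis axc : a < x < c.

Lemma walk_exit : {ae P, forall w, exists sg, is_exit a c ((ext B)^~ w) sg}.
Proof.
apply: filterS2 (walk_good BB LL) (walk_unbounded BB) => w [cb _ _ _ w0] ub.
have [t t0 ht] := ub (Num.bound (Num.max `|a| `|c|)).
apply: (exists_exit cb _ t0).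
  by rewrite extE// w0.
apply/negP => /andP[h1 h2]; move: ht; rewrite ltNge => /negP; apply.
apply: le_trans (_ : Num.max `|a| `|c| <= _); last first.
  by apply/ltW/archi_boundP; rewrite le_max normr_ge0.
rewrite le_max !ler_norml; have [k|k] := leP 0 (ext B t w); apply/orP.
  by right; rewrite (le_trans (ltW h2) (ler_norm _)) andbT (le_trans _ k)// oppr_le0.
left; rewrite (le_trans (ltW k))// andbT; apply: le_trans (ltW h1).
by rewrite lerNl -normrN ler_norm.
Qed.

Let S_meas N k m : mfun (fun w => S w N k m).
Proof.
rewrite (_ : (fun w => _) = (fun w => \sum_(0 <= i < horizon N * m.+1) step_term k (N.+1 * m.+1) i w)).
  by apply: measurable_sum.
by apply/funext => w; exact: step_sumE.
Qed.

Let X_meas N : mfun (fun w => Xs w N).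
Proof.
have mcv I : mfun (fun w => expR (- clock_version kappa ((ext B)^~ w) N I)).
  apply: (@measurableT_comp _ _ _ _ _ _ expR) => //; apply: measurable_funN.
  exact: measurable_clock_version.
have mst i (h : R -> R) : continuous h ->
    mfun (fun w => h (coarse_stopped a c ((ext B)^~ w) N i)).
  move=> ch; apply: measurable_cts_comp => //.
  by apply: (@measurable_stopped _ _ _ (fun=> a) (fun=> c) (ext B)) => // t _; exact: mX.
apply: measurable_funD; last by apply: measurable_funM => //; exact: mst.
apply: measurable_sum => I; apply: measurable_funM; last exact: (mst I g).
by apply: measurable_funB.
Qed.

Let X_bound w N : `|Xs w N| <= M.
Proof.
have cl I := @clock_version_le _ kappa ((ext B)^~ w) N I I.+1 (leqnSn I).
pose v I := expR (- clock_version kappa ((ext B)^~ w) N I).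
have vle I : v I.+1 <= v I by rewrite /v ler_expR lerN2.
have v1 I : v I <= 1 by rewrite -expR0 ler_expR oppr_le0 clock_version_ge0.
rewrite /exp_sum; apply: le_trans (ler_normD _ _) _.
apply: (@le_trans _ _ (\sum_(0 <= I < horizon N) (v I - v I.+1) * M + v (horizon N) * M)).
  apply: lerD; last by rewrite normrM ger0_norm// ler_wpM2l.
  apply: le_trans (ler_norm_sum _ _ _) _; apply: ler_sum => I _.
  by rewrite normrM ger0_norm ?subr_ge0 ?vle// ler_wpM2l ?subr_ge0 ?vle.
rewrite -mulr_suml (eq_bigr (fun I => - (v I.+1 - v I))); last by move=> I _; ring.
rewrite sumrN telescope_sumr// -mulrDl -[leRHS]mul1r ler_wpM2r//.
by have := v1 0%N; lra.
Qed.

(** By [step_sum_limit] the sum S + f x - X is small along almost every path, and S has a small mean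
    once m is large; [nested_limit] provides one pair k, m for which both are true in mean. *)
Lemma exp_sum_mean eta : 0 < eta -> exists N0, forall N, (N0 <= N)%N ->
  `|\int[P]_w Xs w N - f x| <= eta.
Proof.
move=> eta0; have eta2 : 0 < eta / 2 by rewrite divr_gt0.
pose T N k m w := S w N k m + f x - Xs w N.
pose C := 3 * Cb + (2 * tlim_max kappa a c s c0 Rr r + 2 * Rr) + 2 * Rr + (2 * Rr + Rr)
   + (4 * tlim_max kappa a c s c0 Rr r + 2 * Rr) + 2 * tlim_max kappa a c s c0 Rr r.
have mT N k m : mfun (T N k m).
  by apply: measurable_funB => //; apply: measurable_funD.
have bT N k : exists m0, forall m w, (m0 <= m)%N -> `|T N k m w| <= C.
  have [m0 hm] := step_sum_bounded kR s c0 ac cr rR r0 N k.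
  exists m0 => m w mm; have := hm m ((ext B)^~ w) mm.
  rewrite /T (_ : S w N k m + f x - Xs w N =
    (S w N k m + f (ext B 0 w) - Xs w N) + (f x - f (ext B 0 w))); last by ring.
  move=> h; apply: le_trans (ler_normD _ _) _; rewrite /C lerD//.
  by rewrite (le_trans (ler_normB _ _))// mulr2n mulrDl mul1r lerD.
have cT : {ae P, forall w (q : R), 0 < q -> exists N0, forall N, (N0 <= N)%N ->
    exists k0, forall k, (k0 <= k)%N -> exists m0, forall m, (m0 <= m)%N -> `|T N k m w| <= q}.
  apply: filterS2 (walk_good BB LL) walk_exit => w [cb cl l0 occ w0] [sg ex] q q0.
  have := step_sum_limit kR s c0 ac cr rR r0 cb cl l0 occ ex q0.
  by rewrite /T extE// w0.
have [N0 hN] := nested_limit mT bT cT eta2.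
exists N0 => N /hN[k0 hk]; have [m0 hm] := hk k0 (leqnn _).
have [m1 hm1] := step_sum_mean N k0 eta2.
pose m := maxn m0 m1.
have iX : P.-integrable setT (EFin \o (fun w => Xs w N)).
  by apply: (@integrable_bounded _ _ _ _ _ M).
have iS : P.-integrable setT (EFin \o (fun w => S w N k0 m)).
  rewrite (_ : _ \o _ = EFin \o (fun w => \sum_(0 <= i < horizon N * m.+1) step_term k0 (N.+1 * m.+1) i w)).
    by apply: integrable_sum_real => // i _; exact: integrable_step_term.
  by apply/funext => w /=; congr EFin; exact: step_sumE.
have ic : P.-integrable setT (EFin \o cst (f x)).
  exact: finite_measure_integrable_cst.
have iSf := integrableD_real measurableT iS ic.
have iT : P.-integrable setT (EFin \o T N k0 m) by exact: integrableB_real.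
have e1 : `|\int[P]_w T N k0 m w| <= eta / 2.
  apply: le_trans (le_normr_Rintegral _ iT) _ => //.
  rewrite -lee_fin /Rintegral fineK; last by apply: integrable_fin_num => //; exact: (integrable_norm iT).
  by apply: ltW; apply: hm; exact: leq_maxl.
have e2 : `|\int[P]_w S w N k0 m| <= eta / 2 by apply: hm1; exact: leq_maxr.
have : \int[P]_w T N k0 m w = \int[P]_w S w N k0 m + f x - \int[P]_w Xs w N.
  by rewrite /T RintegralB// RintegralD// Rintegral_cst_prob.
move=> E; rewrite (_ : \int[P]_w Xs w N - f x = \int[P]_w S w N k0 m - \int[P]_w T N k0 m w); last by rewrite E; ring.
by rewrite (le_trans (ler_normB _ _))//; lra.
Qed.

(** As (1/2) f'' = r kappa, the generator (1/2) f'' - f kappa gives - (f - r) kappa, so that being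
    killed pays g = f - r. At the ends of the gap r = 0, and the exit pays f = g as well. *)
Lemma dynkin : \int[P]_w g (position_version kappa a c ((ext B)^~ w) (e w)) = f x.
Proof.
pose K N w := killed_sum kappa a c ((ext B)^~ w) (e w) N g f.
pose p w := position_version kappa a c ((ext B)^~ w) (e w).
have mK N : mfun (K N).
  by apply: measurable_killed_sum => // t _; exact: mX.
have mgp : mfun (fun w => g (p w)).
  have mp : mfun p.
    by apply: measurable_position_version => // t _; exact: mX.
  exact: (@measurable_cts_comp _ _ _ g p cg mp).
have fa : f a = g a by rewrite r0 ?lexx// subr0.
have fc : f c = g c by rewrite r0 ?lexx ?orbT// subr0.
have cvK : {ae P, forall w, setT w -> (fun N => (K N w)%:E) @ \oo --> (g (p w))%:E}.
  apply: filterS3 (walk_good BB LL) walk_exit (exponential_gt0 ee) => w [cb cl l0 occ w0] [sg ex] q0 _.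
  apply: cvg_EFin; first by apply: nearW.
  apply/cvgrPdist_le => q qp.
  have [N0 hN] := killed_sum_cvg kR cb cl l0 occ ex q0 cg cf fa fc qp.
  exists N0 => // N /= /hN; rewrite distrC /p (position_versionE kR cb cl l0 occ ex q0).
  by [].
have ic : P.-integrable setT (cst M%:E).
  exact: finite_measure_integrable_cst.
have [_ _ cv] := @dominated_convergence _ _ _ P setT measurableT (fun N w => (K N w)%:E)
  (fun w => (g (p w))%:E) (cst M%:E) (fun N => ltac:(exact/measurable_EFinP)) (ltac:(exact/measurable_EFinP)) cvK ic
  (ltac:(apply: aeW => w N _; rewrite lee_fin; exact: killed_sum_bound)).
apply: EFin_inj.
have iK N : P.-integrable setT (EFin \o K N).
  by apply: (@integrable_bounded _ _ _ _ _ M) => // w; exact: killed_sum_bound.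
have igp : P.-integrable setT (EFin \o (fun w => g (p w))).
  by apply: (@integrable_bounded _ _ _ _ _ M).
rewrite -[LHS]/((\int[P]_w g (p w))%:E) [in LHS]/Rintegral fineK; last exact: integrable_fin_num.
rewrite -(cvg_lim (@ereal_hausdorff R) cv); apply/cvg_lim; first exact: ereal_hausdorff.
rewrite (_ : (fun N => _) = (fun N => (\int[P]_w K N w)%:E)); last first.
  apply/funext => N; rewrite /Rintegral fineK//.
  by have := integrable_fin_num measurableT (iK N).
apply: cvg_EFin; first by apply: nearW.
apply/cvgrPdist_le => q qp; have [N0 hN] := exp_sum_mean qp.
by exists N0 => // N /= /hN; rewrite distrC /K killed_sum_mean.
Qed.

End dynkin.

(** * Green's function of a gap as a test function *)

Section gap_green.
Context {R : realType} (kappa : borel_measure R) (kR : radon kappa).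
Variables U D : R -> R.
Hypotheses (U0 : forall y, 0 < U y) (D0 : forall y, 0 < D y)
  (U_nd : forall y z, y <= z -> U y <= U z) (D_ni : forall y z, y <= z -> D z <= D y)
  (U_ode : killed_ode kappa U) (D_ode : killed_ode kappa D).
Local Notation U' := (rderive U).
Local Notation D' := (rderive D).
Hypothesis W : forall y, D y * U' y - U y * D' y = 2.
Implicit Types (x y z a c rho lam : R).

(* For the gap ]a, c[, [rho] = U a / D a and [lam] = D c / U c, and these are 0
   when a = -oo and c = +oo; [up rho] vanishes at a and [down lam] at c. *)
Definition up rho z := U z - rho * D z.
Definition down lam z := D z - lam * U z.
Definition up' rho z := U' z - rho * D' z.
Definition down' lam z := D' z - lam * U' z.
Definition gap_green rho lam x y : R :=
  up rho (Num.min x y) * down lam (Num.max x y) / (1 - rho * lam).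

Lemma sol_U : sol kappa U U'. Proof. exact: sol_of_ode. Qed.
Lemma sol_D : sol kappa D D'. Proof. exact: sol_of_ode. Qed.

Lemma sol_up rho : sol kappa (up rho) (up' rho).
Proof.
have := sol_lin kR (- rho) sol_U sol_D.
rewrite (_ : (fun x => U x + - rho * D x) = up rho); last by apply/funext => z; rewrite /up mulNr.
by rewrite (_ : (fun x => U' x + - rho * D' x) = up' rho)//; apply/funext => z; rewrite /up' mulNr.
Qed.

Lemma sol_down lam : sol kappa (down lam) (down' lam).
Proof.
have := sol_lin kR (- lam) sol_D sol_U.
rewrite (_ : (fun x => D x + - lam * U x) = down lam); last by apply/funext => z; rewrite /down mulNr.
by rewrite (_ : (fun x => D' x + - lam * U' x) = down' lam)//; apply/funext => z; rewrite /down' mulNr.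
Qed.

Lemma continuous_U : continuous U. Proof. by case: sol_U. Qed.
Lemma continuous_D : continuous D. Proof. by case: sol_D. Qed.
Lemma continuous_up rho : continuous (up rho). Proof. by case: (sol_up rho). Qed.
Lemma continuous_down lam : continuous (down lam). Proof. by case: (sol_down lam). Qed.

Lemma gap_wronskian rho lam z :
  down lam z * up' rho z - up rho z * down' lam z = 2 * (1 - rho * lam).
Proof. by rewrite -(W z) /down /up' /up /down'; ring. Qed.

Lemma up_le rho y z : 0 <= rho -> y <= z -> up rho y <= up rho z.
Proof. by move=> r0 yz; rewrite lerB ?U_nd// ler_wpM2l ?D_ni. Qed.

Lemma down_le lam y z : 0 <= lam -> y <= z -> down lam z <= down lam y.
Proof. by move=> r0 yz; rewrite lerB ?D_ni// ler_wpM2l ?U_nd. Qed.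

Lemma continuous_gap_green rho lam y : continuous (fun z => gap_green rho lam z y).
Proof.
have cid : continuous (fun z : R => z) by move=> z; exact: cvg_id.
have ccst (q : R) : continuous (fun _ : R => q) by move=> z; exact: cvg_cst.
have cm : continuous (fun z => Num.min z y).
  by move=> z; apply: continuous_min; [exact: cid|exact: ccst].
have cM : continuous (fun z => Num.max z y).
  by move=> z; apply: continuous_max; [exact: cid|exact: ccst].
apply: continuous_mul; last exact: ccst.
apply: continuous_mul => z.
  by apply: (@continuous_comp _ _ _ (fun z => Num.min z y) (up rho)); [exact: cm|exact: continuous_up].
by apply: (@continuous_comp _ _ _ (fun z => Num.max z y) (down lam)); [exact: cM|exact: continuous_down].
Qed.

Lemma gap_greenC rho lam x y : gap_green rho lam x y = gap_green rho lam y x.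
Proof. by rewrite /gap_green minC maxC. Qed.

Lemma gap_green_le rho lam x y : x <= y ->
  gap_green rho lam x y = up rho x * down lam y / (1 - rho * lam).
Proof. by move=> xy; rewrite /gap_green min_l// max_r. Qed.

Lemma gap_green_ge rho lam x y : y <= x ->
  gap_green rho lam x y = up rho y * down lam x / (1 - rho * lam).
Proof. by move=> xy; rewrite gap_greenC gap_green_le. Qed.

Section real_gap.
Variables a c : R.
Hypothesis ac : a < c.
Let rho := U a / D a.
Let lam := D c / U c.

(** This is [UD_cross]: U a * D c < U c * D a. *)
Lemma gap_det_gt0 : 0 < 1 - rho * lam.
Proof.
rewrite subr_gt0 /rho /lam mulrACA -invfM mulrC ltr_pdivrMl ?mulr_gt0// mulr1.
by rewrite [ltRHS]mulrC; exact: (UD_cross kR U0 D0 U_nd D_ni U_ode D_ode W ac).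
Qed.

Lemma up_left : up rho a = 0.
Proof. by rewrite /up /rho divfK ?subrr// gt_eqF. Qed.

Lemma down_right : down lam c = 0.
Proof. by rewrite /down /lam divfK ?subrr// gt_eqF. Qed.

Variable y : R.
Hypothesis ayc : a < y < c.

Let clamp z := Num.min (Num.max z a) c.
(** Half of Green's function with pole y, continued by 0 outside the gap. Then f z = (y - z)^+ + r z
    satisfies (1/2) f'' = r kappa across y too, as the kink of the positive part cancels the kink of
    r, and f - r is (y - z)^+. *)
Let r z : R := gap_green rho lam (clamp z) y / 2.
(** The slope of (y - z)^+ + r z at a; [c0] adjusts its value there to y - a. *)
Let sl : R := up' rho a * down lam y / (2 * (1 - rho * lam)) - 1.
Let c0 : R := (y - a) - sl.

Let clampE z : a <= z <= c -> clamp z = z.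
Proof. by move=> /andP[az zc]; rewrite /clamp max_l// min_l. Qed.

Let ay : a < y. Proof. by case/andP: ayc. Qed.
Let yc : y < c. Proof. by case/andP: ayc. Qed.

Lemma gap_test_continuous : continuous r.
Proof.
have cc : continuous clamp.
  move=> z; apply: (@continuous_min _ R (fun z => Num.max z a) (fun=> c)); last exact: cvg_cst.
  by apply: (@continuous_max _ R id (fun=> a)); [exact: cvg_id|exact: cvg_cst].
apply: continuous_mul; last by move=> z; exact: cvg_cst.
by move=> z; apply: (@continuous_comp _ _ _ clamp (fun z => gap_green rho lam z y)); [exact: cc|exact: continuous_gap_green].
Qed.

Lemma gap_test_bounded : exists Rr, forall z, `|r z| <= Rr.
Proof.
have [C C0 hC] := @continuous_bounded_itv _ r a c gap_test_continuous.
exists C => z; have cz : a <= clamp z <= c.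
  by rewrite le_min ge_min lexx orbT le_max lexx orbT ltW.
by have := hC (clamp z) cz; rewrite /r clampE.
Qed.

Lemma gap_test_out z : (z <= a) || (c <= z) -> r z = 0.
Proof.
move=> /orP[za|cz]; rewrite /r /clamp.
  by rewrite max_r// min_l ?ltW// gap_green_le ?ltW// up_left !mul0r.
rewrite max_l ?(le_trans (ltW ac))// min_r// gap_green_ge ?ltW// down_right mulr0 !mul0r//.
Qed.

Lemma gap_test_left z : a <= z <= y ->
  (y - z) + r z = (y - a) + sl * (z - a) + 2 * itg kappa a z (fun u => (z - u) * r u).
Proof.
move=> /andP[az zy]; have zc : z <= c by exact: le_trans (ltW yc).
have [cu _ _ hu] := sol_up rho.
pose q := down lam y / (2 * (1 - rho * lam)).
have q0 : 1 - rho * lam != 0 by rewrite gt_eqF// gap_det_gt0.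
have -> : itg kappa a z (fun u => (z - u) * r u) = q * itg kappa a z (fun u => (z - u) * up rho u).
  rewrite -(itgZ kR); last exact: continuous_affM.
  apply: eq_itg => u /andP[au uz].
  rewrite /r clampE ?(ltW au) ?(le_trans uz)// gap_green_le ?(le_trans uz)// /q.
  by field.
rewrite /r clampE ?az// gap_green_le//.
have := hu a z az; rewrite up_left add0r => ->.
by rewrite /sl /q; field.
Qed.

(** Each branch of r is expanded by [sol]. At y the slope of r drops by 1, according to
    [gap_wronskian], which offsets the rise of the slope of (y - z)^+ from - 1 to 0. *)
Lemma gap_test_right z : y <= z <= c ->
  r z = (y - a) + sl * (z - a) + 2 * itg kappa a z (fun u => (z - u) * r u).
Proof.
move=> /andP[yz zc]; have az : a <= z by exact: le_trans (ltW ay) yz.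
have [cu _ hu' hu] := sol_up rho; have [cd _ _ hd] := sol_down lam.
have q0 : 1 - rho * lam != 0 by rewrite gt_eqF// gap_det_gt0.
rewrite (itg_affE kR gap_test_continuous (ltW ay) yz).
pose q := down lam y / (2 * (1 - rho * lam)).
pose q' := up rho y / (2 * (1 - rho * lam)).
have -> : itg kappa y z (fun u => (z - u) * r u) = q' * itg kappa y z (fun u => (z - u) * down lam u).
  rewrite -(itgZ kR); last exact: continuous_affM.
  apply: eq_itg => u /andP[yu uz].
  rewrite /r clampE ?(le_trans uz zc) ?(le_trans (ltW ay) (ltW yu))// gap_green_ge ?ltW// /q'.
  by field.
have -> : itg kappa a y r = q * itg kappa a y (up rho).
  rewrite -(itgZ kR)//; apply: eq_itg => u /andP[au uy].
  rewrite /r clampE ?(ltW au) ?(le_trans uy (ltW yc))// gap_green_le// /q.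
  by field.
have yy : a <= y <= y by rewrite ltW//= lexx.
have := gap_test_left yy; rewrite subrr add0r => E.
have := hu' a y (ltW ay); have := hd y z yz; have := gap_wronskian rho lam y.
rewrite {1}/r clampE ?az// gap_green_ge//.
have rE : r y = q * up rho y.
  by rewrite /r clampE ?(ltW ay) ?(ltW yc)// gap_green_le// /q; field.
move: E; rewrite rE /sl; set I1 := itg _ _ _ (fun u => (y - u) * r u); set I3 := itg _ a y _; set I2 := itg _ y z _.
move=> E Wy dz uy.
have I3E : I3 = (up' rho y - up' rho a) / 2 by rewrite uy; field.
have I2E : 2 * I2 = down lam z - down lam y - (z - y) * down' lam y by rewrite dz; ring.
have WE : down' lam y * up rho y = down lam y * up' rho y - 2 * (1 - rho * lam) by rewrite -Wy; ring.
have -> : y - a + (up' rho a * down lam y / (2 * (1 - rho * lam)) - 1) * (z - a) +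
  2 * (I1 + (z - y) * (q * I3) + q' * I2) =
  (y - a + (up' rho a * down lam y / (2 * (1 - rho * lam)) - 1) * (y - a) + 2 * I1) +
  (up' rho a * down lam y / (2 * (1 - rho * lam)) - 1) * (z - y) +
  2 * (z - y) * (q * I3) + q' * (2 * I2) by ring.
rewrite -E I2E I3E /q'.
have -> : up rho y / (2 * (1 - rho * lam)) * (down lam z - down lam y - (z - y) * down' lam y) =
  (up rho y * (down lam z - down lam y) - (z - y) * (down' lam y * up rho y)) / (2 * (1 - rho * lam)) by ring.
by rewrite WE /q; field.
Qed.

Lemma gap_test_tlim z : a <= z <= c ->
  tlim kappa a c sl c0 r z = pp (y - z) + r z.
Proof.
move=> /andP[az zc]; rewrite /tlim /tfun.
rewrite (pp_pos (_ : 0 <= z - (a - 1))); last by lra.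
rewrite (pp_neg (_ : z - (c + 1) <= 0)); last by lra.
have cp : continuous (fun u => pp (z - u)) by apply: continuous_subl; exact: continuous_pp.
have cr := gap_test_continuous.
have -> : itg kappa a c (fun u => pp (z - u) * r u) = itg kappa a z (fun u => (z - u) * r u).
  rewrite (itg_split kR (continuous_mul cp cr) az zc).
  rewrite [X in _ + X](_ : _ = 0) ?addr0; last first.
    rewrite (@eq_itg _ _ _ _ _ (fun u => 0 * r u)); first by rewrite (itgZ kR)// mul0r.
    by move=> u /andP[zu _]; rewrite pp_neg// subr_le0 ltW.
  by apply: eq_itg => u /andP[_ uz]; rewrite pp_pos// subr_ge0.
have [zy|yz] := leP z y.
  rewrite pp_pos ?subr_ge0//; have := @gap_test_left z; rewrite az zy => /(_ isT) ->.
  by rewrite /c0; ring.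
rewrite pp_neg ?subr_le0 ?(ltW yz)// add0r; have := @gap_test_right z.
by rewrite (ltW yz) zc => /(_ isT) ->; rewrite /c0; ring.
Qed.

End real_gap.

End gap_green.

(** * The final position in a gap with possibly infinite ends *)

Section position.
Context {R : realType}.
Variable kappa : borel_measure R.
Implicit Types (b : R -> R) (l : R -> R -> R) (q t u z : R) (a c : \bar R).

(** A relation rather than an infimum: it makes sense for infinite ends, which are never attained,
    and it is directly comparable with the stopping time of [wilson_step]. *)
Definition position_time a c b l q t :=
  [/\ 0 <= t,
      forall u, 0 <= u -> u < t -> (a < (b u)%:E < c)%E /\ (u%:E < killing_time kappa l q)%E &
      [\/ (killing_time kappa l q <= t%:E)%E, (b t)%:E = a | (b t)%:E = c]].

Definition trunc_lo a (K : nat) : R := if a is u%:E then u else - K%:R.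
Definition trunc_hi c (K : nat) : R := if c is u%:E then u else K%:R.

(** On a good path the truncated positions are constant in K once the path stays in ]- K, K[ up to
    its final time, so the upper limit is that position. *)
Definition gap_position a c b q : R :=
  fine (limn_esup (fun K => (position_version kappa (trunc_lo a K) (trunc_hi c K) b q)%:E)).

Hypothesis kR : radon kappa.
Variables (b : R -> R) (l : R -> R -> R).
Hypotheses (cb : continuous b) (cl : continuous (fun z : R * R => l z.1 z.2))
  (l0 : forall t y, 0 <= t -> 0 <= l t y)
  (occ : forall t (A : set R), 0 <= t -> measurable A ->
  lebesgue_measure [set s | 0 <= s <= t /\ A (b s)] = (\int[lebesgue_measure]_(y in A) (l t y)%:E)%E)
  (ub : forall K : nat, exists2 t, 0 <= t & K%:R < `|b t|).

Lemma unbounded_exit (a c : R) : a < b 0 < c -> exists s, is_exit a c b s.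
Proof.
move=> b0; have [t t0 ht] := ub (Num.bound (Num.max `|a| `|c|)).
apply: (exists_exit cb b0 t0); apply/negP => /andP[h1 h2].
move: ht; rewrite ltNge => /negP; apply.
apply: le_trans (_ : Num.max `|a| `|c| <= _); last first.
  by apply/ltW/archi_boundP; rewrite le_max normr_ge0.
rewrite le_max !ler_norml; have [k|k] := leP 0 (b t); apply/orP.
  by right; rewrite (le_trans (ltW h2) (ler_norm _)) andbT (le_trans _ k)// oppr_le0.
left; rewrite (le_trans (ltW k))// andbT; apply: le_trans (ltW h1).
by rewrite lerNl -normrN ler_norm.
Qed.

Lemma position_version_at (a c q t : R) : a < b 0 < c -> 0 < q ->
  position_time a%:E c%:E b l q t -> position_version kappa a c b q = b t.
Proof.
move=> b0 q0 [t0 before at_t]; have [s es] := unbounded_exit b0.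
rewrite (position_versionE kR cb cl l0 occ es q0).
have [v [vE /andP[v0 vs]] _] := killed_sum_position kR cb cl l0 occ es q0.
rewrite vE/=; congr b; case: (es) => s0 bs hs.
apply/eqP; rewrite eq_le; apply/andP; split; rewrite leNgt; apply/negP => h.
  have tk : (t%:E < killing_time kappa l q)%E.
    by apply: lt_le_trans (_ : (v%:E <= _)%E); rewrite ?lte_fin// -vE ge_min lexx.
  have /andP[h1 h2] := hs t t0 (lt_le_trans h vs).
  by case: at_t => [|[E]|[E]]; [rewrite leNgt tk|move: h1; rewrite E ltxx|move: h2; rewrite E ltxx].
have [h1 h2] := before v v0 h.
have /orP[/eqP E|/eqP E] : (v%:E == killing_time kappa l q) || (v%:E == s%:E).
  by rewrite -vE /mine; case: ifPn => _; rewrite eqxx ?orbT.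
  by move: h2; rewrite -E ltxx.
move: E => [E]; move: h1; rewrite !lte_fin E => /andP[k1 k2].
by case: bs => Eb; [move: k1|move: k2]; rewrite Eb ltxx.
Qed.

Lemma trunc_position_at a c q t K : (a < (b 0)%:E < c)%E -> 0 < q ->
  position_time a c b l q t -> (forall u, 0 <= u <= t -> `|b u| < K%:R) ->
  position_version kappa (trunc_lo a K) (trunc_hi c K) b q = b t.
Proof.
move=> b0 q0 [t0 before at_t] bK.
have loK u : 0 <= u <= t -> (a < (b u)%:E)%E -> trunc_lo a K < b u.
  by move=> ut; rewrite /trunc_lo; case: (a) => [r|_|_]; rewrite ?lte_fin//; have := bK u ut; rewrite ltr_norml => /andP[].
have hiK u : 0 <= u <= t -> ((b u)%:E < c)%E -> b u < trunc_hi c K.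
  by move=> ut; rewrite /trunc_hi; case: (c) => [r|_|_]; rewrite ?lte_fin//; have := bK u ut; rewrite ltr_norml => /andP[].
have t00 : 0 <= (0 : R) <= t by rewrite lexx t0.
apply: position_version_at => //.
  by move/andP: b0 => [b1 b2]; rewrite loK// hiK.
split => //.
  move=> u u0 ut; have [/andP[h1 h2] h3] := before u u0 ut; split => //.
  have utt : 0 <= u <= t by rewrite u0 ltW.
  by rewrite !lte_fin loK// hiK.
by case: at_t => [h|h|h]; [constructor 1|constructor 2; rewrite -h|constructor 3; rewrite -h].
Qed.

Lemma path_bound_nat t : exists K0 : nat, forall K, (K0 <= K)%N -> forall u, 0 <= u <= t -> `|b u| < K%:R.
Proof.
have [C C0 hC] := @continuous_bounded_itv _ b 0 t cb.
exists (Num.bound C) => K hK u ut; apply: le_lt_trans (hC u ut) _.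
by apply: lt_le_trans (archi_boundP C0) _; rewrite ler_nat.
Qed.

Lemma gap_position_at a c q t : (a < (b 0)%:E < c)%E -> 0 < q ->
  position_time a c b l q t -> gap_position a c b q = b t.
Proof.
move=> b0 q0 pt; have [K0 hK] := path_bound_nat t.
rewrite /gap_position (_ : limn_esup _ = (b t)%:E)//; apply/eqP; rewrite eq_le.
have h K : (K0 <= K)%N -> (position_version kappa (trunc_lo a K) (trunc_hi c K) b q)%:E = (b t)%:E.
  by move=> /hK hK'; congr EFin; exact: trunc_position_at.
apply/andP; split; [apply: (@limn_esup_le _ _ _ K0)|apply: (@limn_esup_ge _ _ _ K0)] => K /h -> //.
Qed.

(** Up to the killing time the path is bounded by C, so an infinite end can be replaced by one at
    distance C + 1 from 0, which is not reached before killing. *)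
Lemma position_time_ex a c q : (a < (b 0)%:E < c)%E -> (killing_time kappa l q < +oo)%E -> 0 < q ->
  exists t, position_time a c b l q t.
Proof.
move=> /andP[ab0 b0c] zfin q0.
have z0 : (0 <= killing_time kappa l q)%E.
  by apply: le_ereal_inf_tmp => _ /= [t [t0 _] <-]; rewrite lee_fin.
pose z := fine (killing_time kappa l q).
have zE : killing_time kappa l q = z%:E by rewrite fineK// ge0_fin_numE.
have zp : 0 <= z by rewrite -lee_fin -zE.
have [C C0 hC] := @continuous_bounded_itv _ b 0 z cb.
pose lo := if a is u%:E then u else - C - 1.
pose hi := if c is u%:E then u else C + 1.
have b0C : - C <= b 0 <= C by rewrite -ler_norml hC// lexx.
have lo0 : lo < b 0 < hi.
  rewrite /lo /hi; move: ab0 b0c; case: (a) => [u||]//; case: (c) => [v||]//; rewrite ?lte_fin; lra.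
have [s [s0 bs hs]] := unbounded_exit lo0.
have before u : 0 <= u -> u <= z -> u < s -> (a < (b u)%:E < c)%E.
  move=> u0 uz us; have := hs u u0 us; rewrite /lo /hi; move: ab0 b0c.
  case: (a) => [v||]//; case: (c) => [v'||]//; rewrite ?lte_fin ?ltry ?ltNyr ?andbT//= => _ _ /andP[h1 h2];
    by rewrite ?h1 ?h2.
have [zs|sz] := leP z s.
  exists z; split => //; last by constructor 1; rewrite zE.
  by move=> u u0 uz; split; [apply: before; rewrite ?(ltW uz)// (lt_le_trans uz)|rewrite zE lte_fin].
have bsz : - C <= b s <= C by rewrite -ler_norml hC// !ltW.
exists s; split; first exact: ltW.
  move=> u u0 us; split; first by apply: before => //; rewrite ltW// (lt_trans us).
  by rewrite zE lte_fin (lt_trans us).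
case: bs => bs; rewrite bs.
  by constructor 2; move: ab0 bsz; rewrite bs /lo; case: (a) => [v||]// _ /andP[+ _]; rewrite lerDl oppr_ge0 ler10.
by constructor 3; move: b0c bsz; rewrite bs /hi; case: (c) => [v||]// _ /andP[_]; rewrite gerDl ler10.
Qed.

Lemma position_in_gap a c q t : position_time a c b l q t -> (a < (b 0)%:E < c)%E ->
  (a <= (b t)%:E <= c)%E.
Proof.
move=> [t0 before at_t] b0; move: t0; rewrite le_eqVlt => /predU1P[<-|tp].
  by case/andP: b0 => h1 h2; rewrite !ltW.
have near_ e : 0 < e -> exists2 u, 0 <= u < t & `|b u - b t| < e.
  move=> e0; have /cvgrPdist_lt /(_ _ e0)[r /= r0 hr] := @cb t.
  exists (Num.max 0 (t - r / 2)); first by rewrite le_max lexx gt_max tp /=; lra.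
  rewrite distrC; apply: hr; rewrite /ball_/= ltr_norml; apply/andP; split; last first.
    by rewrite ltrBlDr -ltrBlDl lt_max; apply/orP; right; lra.
  by rewrite ltrBrDr addrC -ltrBrDr opprK gt_max; apply/andP; split; lra.
apply/andP; split; rewrite leNgt; apply/negP => h.
  have [r aE] : exists r, a = r%:E.
    move: h; have [] := before 0 (lexx 0) tp; case: (a) => [r|//|]; first by exists r.
    by move=> _ _; rewrite ltNge leNye.
  move: h; rewrite aE lte_fin => h; have [u /andP[u0 ut] hu] := near_ (r - b t) ltac:(by rewrite subr_gt0).
  have [/andP[k _] _] := before u u0 ut; move: k hu; rewrite aE lte_fin ltr_norml; lra.
have [r cE] : exists r, c = r%:E.
  move: h; have [] := before 0 (lexx 0) tp; case: (c) => [r||]; first by exists r.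
    by move=> _ _; rewrite ltNge leey.
  by move=> /andP[_].
move: h; rewrite cE lte_fin => h; have [u /andP[u0 ut] hu] := near_ (b t - r) ltac:(by rewrite subr_gt0).
have [/andP[_ k] _] := before u u0 ut; move: k hu; rewrite cE lte_fin ltr_norml; lra.
Qed.

End position.

Section random_gap_position.
Context {R : realType} {d : measure_display} {T : measurableType d} (kappa : borel_measure R) (kR : radon kappa).

Lemma measurable_real_case (f : T -> \bar R) (g : R -> R) (r : R) : mfun f ->
  mfun g -> mfun (fun w => if f w is u%:E then g u else r).
Proof.
move=> mf mg; have -> : (fun w => if f w is u%:E then g u else r) =
    (fun w => if f w \is a fin_num then g (fine (f w)) else r) by apply/funext => w; case: (f w).
apply: measurable_fun_ifT => //.
  by apply: (measurable_fun_bool true); rewrite setTI; have := emeasurable_fin_num measurableT mf; rewrite setTI.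
by apply: measurableT_comp => //; apply: (@measurableT_comp _ _ _ _ _ _ fine).
Qed.

Lemma measurable_gap_position (a c : T -> \bar R) (X : R -> T -> R) (q : T -> R) :
  mfun a -> mfun c ->
  (forall s, 0 <= s -> mfun (X s)) -> mfun q ->
  mfun (fun w => gap_position kappa (a w) (c w) (X^~ w) (q w)).
Proof.
move=> ma mc mX mq; apply: (@measurableT_comp _ _ _ _ _ _ fine) => //.
apply: measurable_fun_limn_esup => N; apply/measurable_EFinP.
apply: (@measurable_position_version _ _ _ _ kR (fun w => trunc_lo (a w) N) (fun w => trunc_hi (c w) N)) => //;
  exact: (measurable_real_case (g := fun u => u)).
Qed.

End random_gap_position.

(** * Law of the final position in a gap *)

Section gap_measure.
Context {R : realType} {d : measure_display} {Om : measurableType d} (kappa : borel_measure R) (kR : radon kappa).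
Variables U D : R -> R.
Hypotheses (U0 : forall y, 0 < U y) (D0 : forall y, 0 < D y)
  (U_nd : forall y z, y <= z -> U y <= U z) (D_ni : forall y z, y <= z -> D z <= D y)
  (U_ode : killed_ode kappa U) (D_ode : killed_ode kappa D)
  (W : forall y, D y * rderive U y - U y * rderive D y = 2).
Variable P : probability Om R.
Variables (x : R) (B : R -> Om -> R) (L : R -> R -> Om -> R) (e : Om -> R).
Hypotheses (BB : brownian_motion P x B) (LL : local_time P B L)
  (ee : exponential_rv P 1 e)
  (Be : forall E A, sigma_process B `[0, +oo[ E -> measurable A ->
  P (E `&` e @^-1` A) = (P E * P (e @^-1` A))%E).

Section bounded_gap.
Implicit Types (a c y z rho lam h : R).
Local Notation pv a c w := (position_version kappa a c ((ext B)^~ w) (e w)).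

Let mX t : mfun (ext B t). Proof. exact: measurable_ext BB t. Qed.
Let me : mfun e. Proof. by case: ee. Qed.

Lemma measurable_pv a c : mfun (fun w => pv a c w).
Proof. by apply: measurable_position_version => // t _; exact: mX. Qed.

Let clamp a c z := Num.min (Num.max z a) c.

Let clamp_itv a c z : a <= c -> a <= clamp a c z <= c.
Proof. by move=> ac; rewrite /clamp le_min ge_min lexx orbT le_max lexx orbT ac. Qed.

Let clampE a c z : a <= z <= c -> clamp a c z = z.
Proof. by move=> /andP[az zc]; rewrite /clamp max_l// min_l. Qed.

Lemma walk_good_unbounded : {ae P, forall w,
  [/\ continuous ((ext B)^~ w), continuous (fun z : R * R => ext_time L z.1 z.2 w),
    forall t y, 0 <= t -> 0 <= ext_time L t y w,
    forall t (A : set R), 0 <= t -> measurable A ->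
      lebesgue_measure [set s | 0 <= s <= t /\ A (ext B s w)] =
      (\int[lebesgue_measure]_(y in A) (ext_time L t y w)%:E)%E & B 0 w = x] /\
  [/\ forall K : nat, exists2 t, 0 <= t & K%:R < `|ext B t w| & 0 < e w]}.
Proof.
by apply: filterS3 (walk_good BB LL) (walk_unbounded BB) (exponential_gt0 ee) => w h1 h2 h3.
Qed.

Lemma pv_itv a c : a < x < c -> {ae P, forall w, a <= pv a c w <= c}.
Proof.
move=> axc; apply: filterS walk_good_unbounded => w [[cb cl l0 occ w0] [ub q0]].
have b0 : a < ext B 0 w < c by rewrite extE// w0.
have [s es] := unbounded_exit cb ub b0.
rewrite (position_versionE kR cb cl l0 occ es q0).
have [v [vE /andP[v0 vs]] _] := killed_sum_position kR cb cl l0 occ es q0.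
rewrite vE/=; case: es => s0 bs hs; move: vs; rewrite le_eqVlt => /predU1P[->|vs].
  by have /andP[h1 h2] := hs 0 (lexx 0) s0; case: bs => ->; rewrite lexx ltW// (lt_trans h1).
by have /andP[h1 h2] := hs v v0 vs; rewrite !ltW.
Qed.

Section real_gap.
Variables a c : R.
Hypothesis axc : a < x < c.
Let ac : a < c. Proof. by case/andP: axc => h1 h2; exact: lt_trans h2. Qed.
Let rho := U a / D a.
Let lam := D c / U c.
(** Clamped so as to be bounded on every sample; almost surely it is the position itself. *)
Let p w := clamp a c (pv a c w).

Let mp : mfun p.
Proof. by apply: measurable_minr => //; apply: measurable_maxr => //; exact: measurable_pv. Qed.

Let pE : {ae P, forall w, pv a c w = p w}.
Proof. by apply: filterS (pv_itv axc) => w h; rewrite /p clampE. Qed.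

(** Dynkin's formula for the test function of the gap. *)
Lemma position_test y : a < y < c ->
  \int[P]_w pp (y - p w) = pp (y - x) + gap_green U D rho lam x y / 2.
Proof.
move=> ayc; have [Rr rR] := gap_test_bounded kR U0 D0 U_ode D_ode ac y.
have cr := @gap_test_continuous _ _ kR U D U0 D0 U_ode D_ode a c y.
have r0 := @gap_test_out _ U D U0 D0 a c ac y ayc.
pose sl := up' U D rho a * down U D lam y / (2 * (1 - rho * lam)) - 1.
have tE := @gap_test_tlim _ _ kR U D U0 D0 U_nd D_ni U_ode D_ode W a c ac y ayc.
have := dynkin kR BB LL ee Be sl (y - a - sl) ac cr rR r0 axc.
rewrite tE; last by case/andP: axc => *; rewrite !ltW.
rewrite -/rho -/lam -/(clamp _ _ _) clampE; last by case/andP: axc => *; rewrite !ltW.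
move=> <-; rewrite /Rintegral; congr fine; apply: ae_eq_integral => //.
- apply/measurable_EFinP; apply: (@measurable_cts_comp _ _ _ pp); first exact: continuous_pp.
  exact: measurable_funB.
- apply/measurable_EFinP; apply: measurable_funB.
    apply: measurable_cts_comp; last exact: measurable_pv.
    exact: (continuous_tlim kR cr rR).
  exact: (@measurable_cts_comp _ _ _ (fun z => gap_green U D rho lam (Num.min (Num.max z a) c) y / 2) _ cr (measurable_pv a c)).
apply: filterS (pv_itv axc) => w hw _ /=; congr EFin.
by rewrite tE// addrK /p clampE.
Qed.

(** The right derivative in z of the right-hand side (z - x)^+ + G(x, z) / 2 of [position_test]. *)
Definition gap_cdf rho lam z := if z < x then up' U D rho z * down U D lam x / (2 * (1 - rho * lam))
  else 1 + up U D rho x * down' U D lam z / (2 * (1 - rho * lam)).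

Let V y := pp (y - x) + gap_green U D rho lam x y / 2.
Let F z := fine (P [set w | p w <= z]).

Let mle z : measurable [set w | p w <= z].
Proof.
rewrite (_ : [set w | _] = p @^-1` `]-oo, z]); first by rewrite -[_ @^-1` _]setTI; apply: mp.
by apply/seteqP; split => w /=; rewrite in_itv.
Qed.

Let PF z : P [set w | p w <= z] = (F z)%:E.
Proof. by rewrite /F fineK// fin_num_measure. Qed.

Let ipp y : P.-integrable setT (EFin \o (fun w => pp (y - p w))).
Proof.
have [C C0 hC] := @continuous_bounded_itv _ (fun z => pp (y - z)) a c (@continuous_subl _ pp y (@continuous_pp R)).
apply: (@integrable_bounded _ _ _ _ _ C) => [|w]; last by apply: hC; apply: clamp_itv; exact: ltW.
apply: (@measurable_cts_comp _ _ _ pp); first exact: continuous_pp.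
exact: measurable_funB.
Qed.

Let ibool z k : P.-integrable setT (EFin \o (fun w => (p w <= z)%R%:R * k)).
Proof.
apply: (@integrable_bounded _ _ _ _ _ `|k|) => [|w].
  apply: measurable_funM => //; rewrite (_ : (fun w => _) = \1_[set w | p w <= z]); first exact: measurable_indic.
  by apply/funext => w; rewrite indic_boolE.
by case: (p w <= z)%R; rewrite ?mul1r ?mul0r ?normr0.
Qed.

(** V z is the expectation of (z - p)^+, that is the integral of the nondecreasing function F up to
    z. *)
Let cdf_incr z z' : a < z -> z < z' -> z' < c ->
  F z * (z' - z) <= V z' - V z /\ V z' - V z <= F z' * (z' - z).
Proof.
move=> az zz' z'c.
have az' : a < z' < c by rewrite (lt_trans az).
have azc : a < z < c by rewrite az (lt_trans zz').
rewrite /V -(position_test az') -(position_test azc) -RintegralB//.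
rewrite -(Rintegral_bool (z' - z) (mle z) (PF z)) -(Rintegral_bool (z' - z) (mle z') (PF z')).
split; apply: le_Rintegral => //; try by apply: integrableB_real.
  move=> w _; case: (leP (p w) z) => h; rewrite ?mul1r ?mul0r.
    by rewrite !pp_pos//; lra.
  by rewrite [pp (z - _)]pp_neg ?subr0 ?pp_ge0//; lra.
move=> w _; case: (leP (p w) z') => h; rewrite ?mul1r ?mul0r.
  have := pp_lip (z' - p w) (z - p w); rewrite (_ : z' - p w - (z - p w) = z' - z); last by ring.
  by rewrite (ger0_norm (_ : 0 <= z' - z)) ?subr_ge0 ?(ltW zz')//; apply: le_trans; exact: ler_norm.
by rewrite !pp_neg ?subrr//; lra.
Qed.

Let V_rder z eps : a < z < c -> 0 < eps -> exists2 r, 0 < r & forall h, 0 < h < r ->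
  `|V (z + h) - V z - h * gap_cdf rho lam z| <= h * eps.
Proof.
move=> /andP[az zc] eps0.
have Dl0 : 0 < 1 - rho * lam by exact: (gap_det_gt0 kR U0 D0 U_nd D_ni U_ode D_ode W ac).
have Dl1 : 1 - rho * lam != 0 by rewrite gt_eqF.
rewrite /gap_cdf; have [zx|xz] := ltP z x.
  pose q := down U D lam x / (2 * (1 - rho * lam)).
  have [k k0 hk] := exists_mul_le (normr_ge0 q) eps0.
  have [_ /(_ z k k0)[r r0 hr] _ _] := sol_up kR U0 D0 U_ode D_ode rho.
  exists (Num.min r (x - z)); first by rewrite lt_min r0 subr_gt0.
  move=> h /andP[h0]; rewrite lt_min => /andP[hr' hx].
  have zhx : z + h <= x by lra.
  rewrite /V !pp_neg ?subr_le0 ?(ltW zx)// !add0r ![gap_green _ _ _ _ x _]gap_green_ge ?(ltW zx)//.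
  rewrite (_ : _ - _ - _ = (up U D rho (z + h) - up U D rho z - h * up' U D rho z) * q); last by rewrite /q; field.
  rewrite normrM; apply: (@le_trans _ _ (h * k * `|q|)); last by rewrite -mulrA ler_wpM2l// ltW.
  by rewrite ler_wpM2r// hr// h0.
pose q := up U D rho x / (2 * (1 - rho * lam)).
have [k k0 hk] := exists_mul_le (normr_ge0 q) eps0.
have [_ /(_ z k k0)[r r0 hr] _ _] := sol_down kR U0 D0 U_ode D_ode lam.
exists r => // h /andP[h0 hr'].
have xzh : x <= z + h by lra.
rewrite /V !pp_pos ?subr_ge0// ![gap_green _ _ _ _ x _]gap_green_le//.
rewrite (_ : _ - _ - _ = (down U D lam (z + h) - down U D lam z - h * down' U D lam z) * q); last by rewrite /q; field.
rewrite normrM; apply: (@le_trans _ _ (h * k * `|q|)); last by rewrite -mulrA ler_wpM2l// ltW.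
by rewrite ler_wpM2r// hr// h0.
Qed.

Let F_rcont z eps : 0 < eps -> exists2 r, 0 < r & F (z + r) <= F z + eps.
Proof.
move=> eps0.
pose A (n : nat) := [set w | p w <= z + n.+1%:R^-1].
have mA n : measurable (A n) by exact: mle.
have capA : \bigcap_n A n = [set w | p w <= z].
  apply/seteqP; split => w /=.
    move=> h; apply/ler_addgt0Pr => q q0.
    have := h (Num.bound q^-1) I; rewrite /A /=; move=> /le_trans; apply.
    rewrite lerD2l; apply/ltW; rewrite invf_plt ?posrE//.
    apply: lt_le_trans (_ : (Num.bound q^-1)%:R <= _); last by rewrite ler_nat.
    by apply: archi_boundP; rewrite invr_ge0 ltW.
  by move=> h n _; rewrite /A /= (le_trans h)// lerDl.
have cv : P \o A @ \oo --> P (\bigcap_n A n).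
  apply: nonincreasing_cvg_mu => //.
  - by rewrite -ge0_fin_numE// fin_num_measure.
  - exact: bigcapT_measurable.
  apply/nonincreasing_seqP => n; apply/subsetPset => w; rewrite /A /= => /le_trans; apply.
  by rewrite lerD2l lef_pV2 ?posrE// ler_nat.
rewrite capA PF in cv.
have : \forall n \near \oo, ((P \o A) n < (F z + eps)%:E)%E.
  apply: (cv [set y | (y < (F z + eps)%:E)%E]); apply: open_nbhs_nbhs; split.
    exact: open_ereal_lt_ereal.
  by rewrite /= lte_fin ltrDl.
move=> [n _ hn]; exists n.+1%:R^-1; first by rewrite invr_gt0.
by have := hn n (leqnn n); rewrite /A /= PF lte_fin => /ltW.
Qed.

(** A right-continuous function is the right derivative of its primitive: F is identified through
    V. *)
Lemma gap_law_real z : a < z < c -> P [set w | pv a c w <= z] = (gap_cdf rho lam z)%:E.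
Proof.
move=> azc; have /andP[az zc] := azc.
have -> : P [set w | pv a c w <= z] = P [set w | p w <= z].
  have mpv : measurable [set w | pv a c w <= z].
    rewrite (_ : [set w | _] = (fun w => pv a c w) @^-1` `]-oo, z]); first by rewrite -[_ @^-1` _]setTI; apply: measurable_pv.
    by apply/seteqP; split => w /=; rewrite in_itv.
  by apply/eqP; rewrite eq_le; apply/andP; split; apply: le_measure_ae => //; apply: filterS pE => w /= ->.
(* F z is at most the slope of V on the right of z, by monotonicity; the reverse inequality also
   calls for the right continuity of F. *)
rewrite PF; congr EFin; apply/eqP; rewrite eq_le; apply/andP; split; apply/ler_addgt0Pr => eps eps0.
  have [r r0 hr] := V_rder azc eps0.
  pose h := Num.min (r / 2) ((c - z) / 2).
  have h0 : 0 < h by rewrite lt_min !divr_gt0// subr_gt0.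
  have hr' : h < r by rewrite gt_min; apply/orP; left; lra.
  have hc : z + h < c by rewrite -ltrBrDl gt_min; apply/orP; right; lra.
  have zh : z < z + h by rewrite ltrDl.
  have [k1 _] := cdf_incr az zh hc.
  have := hr h; rewrite h0 hr' => /(_ isT); rewrite ler_norml => /andP[_ k2].
  rewrite -(ler_pM2l h0); move: k1; rewrite addrAC subrr add0r mulrC; nra.
have eps2 : 0 < eps / 2 by rewrite divr_gt0.
have [r r0 hr] := V_rder azc eps2.
have [r1 r10 hr1] := F_rcont z eps2.
pose h := Num.min r1 (Num.min (r / 2) ((c - z) / 2)).
have h0 : 0 < h by rewrite !lt_min r10 !divr_gt0// subr_gt0.
have hr' : h < r by rewrite !gt_min; apply/orP; right; apply/orP; left; lra.
have hc : z + h < c by rewrite -ltrBrDl !gt_min; apply/orP; right; apply/orP; right; lra.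
have zh : z < z + h by rewrite ltrDl.
have [_ k1] := cdf_incr az zh hc.
have Fh : F (z + h) <= F z + eps / 2.
  apply: le_trans hr1; rewrite -lee_fin -!PF; apply: le_measure; rewrite ?inE//.
  by move=> w /= /le_trans; apply; rewrite lerD2l ge_min lexx.
have := hr h; rewrite h0 hr' => /(_ isT); rewrite ler_norml => /andP[k2 _].
rewrite -(ler_pM2l h0).
have : F (z + h) * h <= (F z + eps / 2) * h by rewrite ler_pM2r.
move: k1; rewrite [z + h - z]addrAC subrr add0r; nra.
Qed.

End real_gap.

End bounded_gap.

Section extended_gap.
Implicit Types (y z u v rho lam h eps : R) (a c : \bar R).
Local Notation pv a c w := (position_version kappa a c ((ext B)^~ w) (e w)).
Local Notation gp a c w := (gap_position kappa a c ((ext B)^~ w) (e w)).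

Definition rho_of a : R := if a is r%:E then U r / D r else 0.
Definition lam_of c : R := if c is r%:E then D r / U r else 0.

Lemma rho_of_ge0 a : 0 <= rho_of a.
Proof. by rewrite /rho_of; case: a => // r; rewrite divr_ge0 ?ltW. Qed.

Lemma lam_of_ge0 c : 0 <= lam_of c.
Proof. by rewrite /lam_of; case: c => // r; rewrite divr_ge0 ?ltW. Qed.

Lemma ext_det_gt0 a c y : (a < y%:E < c)%E -> 0 < 1 - rho_of a * lam_of c.
Proof.
case: a => [r| |] /andP[ay yc]; rewrite /rho_of ?mul0r ?subr0//.
case: c yc => [r'| |] yc; rewrite /lam_of ?mulr0 ?subr0//.
apply: (gap_det_gt0 kR U0 D0 U_nd D_ni U_ode D_ode W).
by move: ay yc; rewrite !lte_fin; exact: lt_trans.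
Qed.

(** The convexity argument of [U'_to0] towards +oo, with the witness a0 + D a0 / eps. *)
Lemma D'_to0 (a0 : R) eps : 0 < eps -> exists2 z, a0 <= z & forall y, z <= y -> - eps <= rderive D y.
Proof.
move=> eps0; pose y := a0 + D a0 / eps.
have ay : a0 <= y by rewrite lerDl divr_ge0 ?ltW.
exists y => // z yz; apply: le_trans (D'_nd kR D0 D_ode yz).
rewrite leNgt; apply/negP => h.
have := D_convex kR D0 D_ode ay; rewrite leNgt => /negP; apply.
have k : D a0 / eps * (- rderive D y) > D a0.
  rewrite -mulrA [_^-1 * _]mulrC mulrA ltr_pdivlMr// ltr_pM2l//; lra.
by rewrite /y [a0 + _ - _]addrAC subrr add0r; have := D0 y; lra.
Qed.

(** D is unbounded at -oo while U stays below U 0 there, so U / D tends to 0. *)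
Lemma rho_cvg a : (fun K => rho_of (trunc_lo a K)%:E) @ \oo --> rho_of a.
Proof.
have inf_ : (fun K : nat => U (- K%:R) / D (- K%:R)) @ \oo --> (0 : R).
  apply/cvgrPdist_le => eps eps0; rewrite /=.
  have [z z0 hz] := D_unbounded kR U0 D0 D_ni U_ode D_ode W (U 0 / eps).
  exists (Num.bound `|z|) => // K /= hK.
  have zK : - K%:R <= z.
    rewrite lerNl; apply: le_trans (ler_norm _) _; rewrite normrN.
    by apply: le_trans (ltW (archi_boundP (normr_ge0 z))) _; rewrite ler_nat.
  have h0 : 0 <= U (- K%:R) / D (- K%:R) by apply: divr_ge0; exact: ltW.
  rewrite sub0r normrN (ger0_norm h0) ler_pdivrMr// mulrC.
  have := hz _ zK; rewrite ler_pdivrMr//; apply: le_trans.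
  by apply: U_nd; rewrite oppr_le0.
by case: a => [r| |] //=; exact: cvg_cst.
Qed.

Lemma lam_cvg c : (fun K => lam_of (trunc_hi c K)%:E) @ \oo --> lam_of c.
Proof.
have inf_ : (fun K : nat => D K%:R / U K%:R) @ \oo --> (0 : R).
  apply/cvgrPdist_le => eps eps0; rewrite /=.
  have [z z0 hz] := U_unbounded kR U0 D0 U_nd U_ode D_ode W (D 0 / eps).
  exists (Num.bound `|z|) => // K /= hK.
  have zK : z <= K%:R.
    apply: le_trans (ler_norm _) _.
    by apply: le_trans (ltW (archi_boundP (normr_ge0 z))) _; rewrite ler_nat.
  have h0 : 0 <= D K%:R / U K%:R by apply: divr_ge0; exact: ltW.
  rewrite sub0r normrN (ger0_norm h0) ler_pdivrMr// mulrC.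
  have := hz _ zK; rewrite ler_pdivrMr//; apply: le_trans.
  exact: D_ni.
by case: c => [r| |] //=; exact: cvg_cst.
Qed.

Lemma gap_cdf_cvg (r l : nat -> R) rho lam z : r @ \oo --> rho -> l @ \oo --> lam ->
  1 - rho * lam != 0 -> (fun K => gap_cdf (r K) (l K) z) @ \oo --> gap_cdf rho lam z.
Proof.
move=> cr cl nz; have ccst (q : R) : (fun _ : nat => q) @ \oo --> q by exact: cvg_cst.
have cu q : (fun K => up U D (r K) q) @ \oo --> up U D rho q.
  by apply: cvgB => //; apply: cvgM.
have cu' q : (fun K => up' U D (r K) q) @ \oo --> up' U D rho q.
  by apply: cvgB => //; apply: cvgM.
have cd q : (fun K => down U D (l K) q) @ \oo --> down U D lam q.
  by apply: cvgB => //; apply: cvgM.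
have cd' q : (fun K => down' U D (l K) q) @ \oo --> down' U D lam q.
  by apply: cvgB => //; apply: cvgM.
have ci : (fun K => (2 * (1 - r K * l K))^-1) @ \oo --> (2 * (1 - rho * lam))^-1.
  by apply: cvgV; [rewrite mulf_neq0|apply: cvgM => //; apply: cvgB => //; apply: cvgM].
rewrite /gap_cdf; case: ifPn => _; first by apply: cvgM => //; apply: cvgM.
by apply: cvgD => //; apply: cvgM => //; apply: cvgM.
Qed.

Let ltK y : exists K0 : nat, forall K, (K0 <= K)%N -> `|y| < K%:R.
Proof.
exists (Num.bound `|y|) => K hK; apply: lt_le_trans (archi_boundP (normr_ge0 y)) _.
by rewrite ler_nat.
Qed.

Let trunc_lt a c y K : (a < y%:E < c)%E -> `|y| < K%:R -> trunc_lo a K < y < trunc_hi c K.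
Proof.
rewrite ltr_norml => + /andP[h1 h2].
by case: a => [r| |]; case: c => [r'| |]; rewrite ?lte_fin /trunc_lo /trunc_hi => /andP[k1 k2] //; apply/andP.
Qed.

Lemma trunc_law_cvg a c z : (a < x%:E < c)%E -> (a < z%:E < c)%E ->
  (fun K => P [set w | pv (trunc_lo a K) (trunc_hi c K) w <= z]) @ \oo -->
  (gap_cdf (rho_of a) (lam_of c) z)%:E.
Proof.
move=> axc azc; have [K1 h1] := ltK x; have [K2 h2] := ltK z.
have := @gap_cdf_cvg _ _ _ _ z (@rho_cvg a) (@lam_cvg c) (lt0r_neq0 (ext_det_gt0 axc)).
set F := (X in X @ _ --> _ -> _) => cv0.
have cv : (fun K => (F K)%:E) @ \oo --> (gap_cdf (rho_of a) (lam_of c) z)%:E by apply: cvg_EFin => //; exact: nearW.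
apply: cvg_trans cv; apply: near_eq_cvg; exists (maxn K1 K2) => // K /=; rewrite geq_max => /andP[/h1 k1 /h2 k2].
rewrite (gap_law_real (trunc_lt axc k1) (trunc_lt azc k2)).
by [].
Qed.

Lemma killing_time_ext w : killing_time kappa (fun t y => ext_time L t y w) (e w) =
  killing_time kappa (fun t y => L t y w) (e w).
Proof.
rewrite /killing_time; congr ereal_inf; apply/seteqP; split => _ /= [t [t0 ht] <-]; exists t => //; split => //;
  by move: ht; rewrite /ext_time max_l.
Qed.

Let good := walk_good_unbounded.

(** A walk that is never killed leaves ]- K, K[ at one of its ends, where its truncated position
    then lies. Since U' tends to 0 at -oo and D' at +oo, the limiting distribution function goes
    from 0 to 1, so for suitable K this has arbitrarily small probability. *)
Lemma killing_time_fin : {ae P, forall w, (killing_time kappa (fun t y => L t y w) (e w) < +oo)%E}.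
Proof.
pose E z1 z2 K := [set w | pv (- K%:R) K%:R w <= z1] `|` ~` [set w | pv (- K%:R) K%:R w <= z2].
have mle K z : measurable [set w | pv (- K%:R) K%:R w <= z].
  rewrite (_ : [set w | _] = (fun w => pv (- K%:R) K%:R w) @^-1` `]-oo, z]).
    by rewrite -[_ @^-1` _]setTI; apply: (measurable_pv).
  by apply/seteqP; split => w /=; rewrite in_itv.
have mE z1 z2 K : measurable (E z1 z2 K) by apply: measurableU => //; exact: measurableC.
have Esmall eta : 0 < eta -> exists z1 z2 K, [/\ - K%:R < z1, z2 < K%:R, `|x| < K%:R & (P (E z1 z2 K) <= eta%:E)%E].
  move=> eta0; have eta4 : 0 < eta / 4 by rewrite divr_gt0.
  have [q1 q10 hq1] := exists_mul_le (ltW (D0 x)) eta4.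
  have [q2 q20 hq2] := exists_mul_le (ltW (U0 x)) eta4.
  have [z1' z1x hz1] := U'_to0 kR U0 U_ode (x - 1) q10.
  have [z2 z2x hz2] := D'_to0 x q20.
  pose z1 := z1'; have z1lt : z1 < x by rewrite /z1; lra.
  have oo1 z : (-oo < z%:E < +oo)%E by rewrite ltNyr ltry.
  have c1 := trunc_law_cvg (oo1 x) (oo1 z1); have c2 := trunc_law_cvg (oo1 x) (oo1 z2).
  have l1 : gap_cdf (rho_of -oo%E) (lam_of +oo%E) z1 <= eta / 8.
    rewrite /gap_cdf z1lt /up' /down /= !mul0r !subr0 mulr1.
    by have := hz1 z1 (lexx _); have := ler_wpM2r (ltW (D0 x)) (hz1 z1 (lexx _)); lra.
  have l2 : 1 - eta / 8 <= gap_cdf (rho_of -oo%E) (lam_of +oo%E) z2.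
    rewrite /gap_cdf ltNge z2x/= /up /down' /= !mul0r !subr0 mulr1.
    by have := ler_wpM2l (ltW (U0 x)) (hz2 z2 (lexx _)); lra.
  have n1 : \forall K \near \oo, (P [set w | (pv (trunc_lo -oo K) (trunc_hi +oo K) w <= z1)%R] < (eta / 4)%:E)%E.
    apply: (c1 [set y | (y < (eta / 4)%:E)%E]); apply: open_nbhs_nbhs; split; first exact: open_ereal_lt_ereal.
    by rewrite /= lte_fin; lra.
  have n2 : \forall K \near \oo, ((1 - eta / 4)%:E < P [set w | (pv (trunc_lo -oo K) (trunc_hi +oo K) w <= z2)%R])%E.
    apply: (c2 [set y | ((1 - eta / 4)%:E < y)%E]); apply: open_nbhs_nbhs; split; first exact: open_ereal_gt_ereal.
    by rewrite /= lte_fin; lra.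
  have [K1 _ hK1] := n1; have [K2 _ hK2] := n2; have [K3 hK3] := ltK x.
  have [K4 hK4] := ltK z1; have [K5 hK5] := ltK z2.
  pose K := maxn (maxn K1 K2) (maxn K3 (maxn K4 K5)).
  have /andP[k1 k2] : (K1 <= K)%N && (K2 <= K)%N by rewrite -geq_max leq_maxl.
  have /andP[k3 /andP[k4 k5]] : (K3 <= K)%N && ((K4 <= K)%N && (K5 <= K)%N) by rewrite -!geq_max leq_maxr.
  exists z1, z2, K; split; [by have := hK4 K k4; rewrite ltr_norml => /andP[]|
    by have := hK5 K k5; rewrite ltr_norml => /andP[]|exact: hK3|].
  apply: le_trans (measureU2 _ (mle K z1) (measurableC (mle K z2))) _.
  rewrite [X in (_ + X)%E](probability_setC P (mle K z2)).
  have := hK1 K k1; have := hK2 K k2; rewrite /trunc_lo /trunc_hi /=.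
  have f1 : P [set w | pv (- K%:R) K%:R w <= z1] \is a fin_num by rewrite fin_num_measure.
  have f2 : P [set w | pv (- K%:R) K%:R w <= z2] \is a fin_num by rewrite fin_num_measure.
  rewrite -(fineK f1) -(fineK f2) !lte_fin -EFinB -EFinD lee_fin; lra.
have negl eta : 0 < eta -> exists2 F, measurable F /\ (P F <= eta%:E)%E &
    {ae P, forall w, killing_time kappa (fun t y => L t y w) (e w) = +oo%E -> F w}.
  move=> /Esmall[z1 [z2 [K [Kz1 z2K xK PE]]]]; exists (E z1 z2 K) => //.
  apply: filterS good => w [[cb cl l0 occ w0] [ub q0]] zoo.
  have b0 : - K%:R < ext B 0 w < K%:R by rewrite extE// w0 -ltr_norml.
  have [s es] := unbounded_exit cb ub b0.
  rewrite /E /= (position_versionE kR cb cl l0 occ es q0) killing_time_ext zoo.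
  rewrite (_ : mine _ _ = s%:E); last by rewrite /mine ltNge leey.
  by case: es => _ [] -> _; [left; exact: ltW|right; apply/negP; rewrite -ltNge].
have h n : exists F, [/\ measurable F, (P F <= (n.+1%:R^-1)%:E)%E &
    {ae P, forall w, killing_time kappa (fun t y => L t y w) (e w) = +oo%E -> F w}].
  by have [|F [mF PF] hF] := negl n.+1%:R^-1; [rewrite invr_gt0|exists F].
have [F hF] := choice h.
have /ae_foralln : forall n, {ae P, forall w, killing_time kappa (fun t y => L t y w) (e w) = +oo%E -> F n w}.
  by move=> n; have [] := hF n.
have mcap : measurable (\bigcap_n F n) by apply: bigcapT_measurable => n; have [] := hF n.
have P0 : P (\bigcap_n F n) = 0%E.
  apply/eqP; rewrite eq_le measure_ge0 andbT; apply/lee_addgt0Pr => eps eps0; rewrite add0e.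
  apply: (@le_trans _ _ (P (F (Num.bound eps^-1)))).
    by apply: le_measure; rewrite ?inE//; [have [] := hF (Num.bound eps^-1)|exact: bigcap_inf].
  have [_ + _] := hF (Num.bound eps^-1); move/le_trans; apply; rewrite lee_fin ltW// invf_plt ?posrE//.
  by apply: lt_trans (archi_boundP _) _; rewrite ?invr_ge0 ?ltW// ltr_nat.
move=> [N' [mN' N'0 hN']]; exists (N' `|` \bigcap_n F n); split.
- exact: measurableU.
- by apply/eqP; rewrite eq_le measure_ge0 andbT; apply: le_trans (measureU2 _ mN' mcap) _; rewrite [X in (X + _)%E](N'0 : _ = _) [X in (_ + X)%E](P0 : _ = _) adde0.
move=> w /= hw; have [/hN'|nN'] := pselect ((~` [set x0 | forall i : nat, killing_time kappa (fun t y : R => L t y x0) (e x0) = +oo%E -> F i x0]) w); first by left.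
right => n _; apply: contrapT => nF; apply: nN' => /(_ n) hh; apply: nF; apply: hh.
by apply/eqP; rewrite eq_le leey/= leNgt; apply/negP.
Qed.

End extended_gap.

Section gap.
Variables a c : \bar R.
Hypothesis axc : (a < x%:E < c)%E.
Implicit Types (y z u v h : R).
Local Notation rho := (rho_of a).
Local Notation lam := (lam_of c).
Local Notation G := (gap_green U D rho lam).
Local Notation gp w := (gap_position kappa a c ((ext B)^~ w) (e w)).
Local Notation cdf := (gap_cdf rho lam).

Lemma measurable_gp : mfun (fun w => gp w).
Proof.
apply: measurable_gap_position => //; last by case: ee.
by move=> s _; exact: (measurable_ext BB).
Qed.

Lemma measurable_le_set (f : Om -> R) z : mfun f -> measurable [set w | f w <= z].
Proof.
move=> mf; rewrite (_ : [set w | _] = f @^-1` `]-oo, z]); first by rewrite -[_ @^-1` _]setTI; apply: mf.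
by apply/seteqP; split => w /=; rewrite in_itv.
Qed.

(** On almost every sample the truncated positions are eventually equal to the position in the gap;
    dominated convergence transfers this to the probabilities. *)
Lemma gap_position_cdf z : (a < z%:E < c)%E -> P [set w | gp w <= z] = (cdf z)%:E.
Proof.
move=> azc; apply: (cvg_unique _ _ (trunc_law_cvg axc azc)) => //.
pose pvK K w := position_version kappa (trunc_lo a K) (trunc_hi c K) ((ext B)^~ w) (e w).
have mK K : measurable [set w | pvK K w <= z].
  by apply: measurable_le_set; exact: (measurable_pv).
have mg : measurable [set w | gp w <= z] by apply: measurable_le_set; exact: measurable_gp.
have m1 K : mfun (fun w => (\1_[set w | pvK K w <= z] w : R)%:E) by apply/measurable_EFinP.
have m2 : mfun (fun w => (\1_[set w | gp w <= z] w : R)%:E) by apply/measurable_EFinP.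
have cvae : {ae P, forall w, setT w -> (\1_[set w | pvK K w <= z] w : R)%:E @[K --> \oo] --> (\1_[set w | gp w <= z] w : R)%:E}.
  apply: filterS2 (walk_good_unbounded) (killing_time_fin).
  move=> w [[cb cl l0 occ w0] [ub q0]] zf _.
  have b0 : (a < (ext B 0 w)%:E < c)%E by rewrite extE// w0.
  rewrite -killing_time_ext in zf.
  have [t ht] := position_time_ex cb ub b0 zf q0.
  have [K0 hK0] := path_bound_nat cb t.
  apply: cvg_near_cst; exists K0 => // K hK; rewrite /= !indicE.
  have E1 : pvK K w = gp w.
    by rewrite /pvK (trunc_position_at kR cb cl l0 occ ub b0 q0 ht (hK0 K hK))
      (gap_position_at kR cb cl l0 occ ub b0 q0 ht).
  by congr ((nat_of_bool _)%:R%:E); apply/idP/idP => /[!inE] /=; rewrite E1.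
have dom : {ae P, forall w K, setT w -> (`|(\1_[set w | pvK K w <= z] w : R)%:E| <= cst 1 w)%E}.
  by apply: nearW => w K _; rewrite abse_EFin lee_fin ger0_norm// indicE; case: (_ \in _).
have [_ _] := dominated_convergence measurableT m1 m2 cvae (finite_measure_integrable_cst P 1 measurableT) dom.
by rewrite integral_indic// setIT; under eq_fun do rewrite integral_indic// setIT.
Qed.

Let Delta0 : 0 < 1 - rho * lam := ext_det_gt0 axc.

Lemma up_rho_ge0 y : (a < y%:E)%E -> 0 <= up U D rho y.
Proof.
case: (a) => [r ry| |_]; [|by rewrite ltNge leey|by rewrite /up/= mul0r subr0 ltW].
rewrite /up/=; move: ry; rewrite lte_fin => ry.
rewrite subr_ge0 mulrAC ler_pdivrMr//; exact: (ltW (UD_cross kR U0 D0 U_nd D_ni U_ode D_ode W ry)).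
Qed.

Lemma down_lam_ge0 y : (y%:E < c)%E -> 0 <= down U D lam y.
Proof.
case: (c) => [r yr|_|]; [|by rewrite /down/= mul0r subr0 ltW|by rewrite ltNge leNye].
rewrite /down/=; move: yr; rewrite lte_fin => yr.
rewrite subr_ge0 mulrAC ler_pdivrMr// mulrC.
by rewrite [leRHS]mulrC; exact: (ltW (UD_cross kR U0 D0 U_nd D_ni U_ode D_ode W yr)).
Qed.

Lemma green_ge0 y z : (a < y%:E < c)%E -> (a < z%:E < c)%E -> 0 <= G y z.
Proof.
move=> /andP[h1 h2] /andP[h3 h4]; apply: divr_ge0; last exact: ltW.
apply: mulr_ge0; [apply: up_rho_ge0|apply: down_lam_ge0].
  by rewrite /Num.min; case: ifP.
by rewrite /Num.max; case: ifP.
Qed.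

Let cG y : continuous (G y).
Proof.
rewrite (_ : G y = fun z => G z y); first exact: (continuous_gap_green kR U0 D0 U_ode D_ode).
by apply/funext => z; rewrite gap_greenC.
Qed.

Let solu := sol_up kR U0 D0 U_ode D_ode rho.
Let solv := sol_down kR U0 D0 U_ode D_ode lam.
Let wr z := gap_wronskian W rho lam z.

Let up_itg z1 z2 : z1 <= z2 -> itg kappa z1 z2 (up U D rho) = (up' U D rho z2 - up' U D rho z1) / 2.
Proof. by case: solu => _ _ h _ /h ->; rewrite [2 * _]mulrC mulfK. Qed.

Let down_itg z1 z2 : z1 <= z2 -> itg kappa z1 z2 (down U D lam) = (down' U D lam z2 - down' U D lam z1) / 2.
Proof. by case: solv => _ _ h _ /h ->; rewrite [2 * _]mulrC mulfK. Qed.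

Let cu : continuous (up U D rho). Proof. by case: solu. Qed.
Let cv : continuous (down U D lam). Proof. by case: solv. Qed.

Let G_left z1 z2 : z1 <= z2 <= x -> itg kappa z1 z2 (G x) =
  (up' U D rho z2 - up' U D rho z1) / 2 * down U D lam x / (1 - rho * lam).
Proof.
move=> /andP[z12 z2x]; rewrite (@eq_itg _ _ _ _ _ (fun z => down U D lam x / (1 - rho * lam) * up U D rho z)).
  by rewrite (itgZ kR _ _ _ cu) up_itg//; ring.
by move=> y /andP[_ y2]; rewrite gap_green_ge ?(le_trans y2)//; ring.
Qed.

Let G_right z1 z2 : x <= z1 <= z2 -> itg kappa z1 z2 (G x) =
  up U D rho x * ((down' U D lam z2 - down' U D lam z1) / 2) / (1 - rho * lam).
Proof.
move=> /andP[xz1 z12]; rewrite (@eq_itg _ _ _ _ _ (fun z => up U D rho x / (1 - rho * lam) * down U D lam z)).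
  by rewrite (itgZ kR _ _ _ cv) down_itg//; ring.
by move=> y /andP[y1 _]; rewrite gap_green_le ?(ltW (le_lt_trans xz1 y1))//; ring.
Qed.

(** At z = x the two branches of [gap_cdf] agree, by the Wronskian identity. *)
Lemma cdf_left z : z <= x -> cdf z = up' U D rho z * down U D lam x / (2 * (1 - rho * lam)).
Proof.
rewrite le_eqVlt => /predU1P[->|zx]; last by rewrite /gap_cdf zx.
rewrite /gap_cdf ltxx; have := wr x; move: Delta0; move: (1 - _) => q q0 h.
have -> : up U D rho x * down' U D lam x = down U D lam x * up' U D rho x - 2 * q by rewrite -h; ring.
by field; rewrite gt_eqF.
Qed.

Lemma cdf_right z : x <= z -> cdf z = 1 + up U D rho x * down' U D lam z / (2 * (1 - rho * lam)).
Proof. by move=> xz; rewrite /gap_cdf ltNge xz. Qed.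

(** The equation turns increments of up' and down' into kappa-integrals of up and down, that is of
    Green's function on either side of x. *)
Lemma cdf_itg z1 z2 : z1 <= z2 -> cdf z2 - cdf z1 = itg kappa z1 z2 (G x).
Proof.
move=> z12; have i2 : (2 * (1 - rho * lam))^-1 = (1 - rho * lam)^-1 / 2 by rewrite invfM mulrC.
have l u v : u <= v <= x -> cdf v - cdf u = itg kappa u v (G x).
  by move=> /andP[uv vx]; rewrite G_left ?uv// !cdf_left// ?(le_trans uv)// i2; ring.
have r u v : x <= u <= v -> cdf v - cdf u = itg kappa u v (G x).
  by move=> /andP[xu uv]; rewrite G_right ?xu// !cdf_right// ?(le_trans xu)// i2; ring.
have [z2x|xz2] := leP z2 x; first by rewrite l ?z12.
have [xz1|z1x] := leP x z1; first by rewrite r ?xz1.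
by rewrite (itg_split kR (@cG x) (ltW z1x) (ltW xz2)) -l ?(ltW z1x) ?lexx// -r ?(ltW xz2) ?lexx//; ring.
Qed.

Let meas_gp A : measurable A -> measurable [set w | A (gp w)].
Proof. by move=> mA; rewrite -[X in measurable X]setTI; exact: measurable_gp. Qed.

Let interval_law z1 z2 : (a < z1%:E)%E -> (z2%:E < c)%E -> z1 <= z2 ->
  P [set w | z1 < gp w <= z2] = (itg kappa z1 z2 (G x))%:E.
Proof.
move=> az1 z2c z12; rewrite -cdf_itg// EFinB -!gap_position_cdf; last 2 first.
- by rewrite az1 (le_lt_trans _ z2c).
- by rewrite z2c andbT (lt_le_trans az1).
have -> : [set w | z1 < gp w <= z2] = [set w | gp w <= z2] `\` [set w | gp w <= z1].
  apply/seteqP; split => w /=; first by move=> /andP[h ->]; split => //; apply/negP; rewrite -ltNge.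
  by move=> [-> /negP]; rewrite -ltNge => ->.
have m1 z : measurable [set w | gp w <= z] by apply: measurable_le_set; exact: measurable_gp.
rewrite measureD ?setIidr//; last by rewrite ltey_eq fin_num_measure.
by move=> w /= /le_trans; apply.
Qed.

Let G0 y : (a < y%:E < c)%E -> 0 <= G x y. Proof. exact: green_ge0. Qed.

Let mG A : measurable_fun A (fun y => (G x y)%:E).
Proof. by apply/measurable_EFinP; apply: measurable_funTS; exact: continuous_measurable_fun. Qed.

(** Dynkin's lemma for the half-open intervals: inside ]z1, z2] the total mass is finite, so the
    identity passes to complements by subtraction. *)
Let interval_law_set z1 z2 (A : set (measurableTypeR R)) : (a < z1%:E)%E -> (z2%:E < c)%E ->
  measurable A ->
  P [set w | (A `&` `]z1, z2]) (gp w)] = (\int[kappa]_(y in A `&` `]z1, z2]) (G x y)%:E)%E.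
Proof.
move=> az1 z2c; have in_ y : `]z1, z2]%classic y -> (a < y%:E < c)%E.
  by rewrite /= in_itv/= => /andP[h1 h2]; rewrite (lt_trans az1)?lte_fin// (le_lt_trans _ z2c)// lee_fin.
have mJ : measurable (`]z1, z2]%classic : set (measurableTypeR R)) by exact: measurable_itv.
have total : P [set w | `]z1, z2]%classic (gp w)] = (\int[kappa]_(y in `]z1, z2]) (G x y)%:E)%E.
  have [z12|z21] := leP z1 z2; last first.
    have E0 : `]z1, z2]%classic = set0 :> set R by rewrite set_itv_ge// bnd_simp -leNgt ltW.
    by rewrite E0 integral_set0 (_ : [set w | _] = set0) ?measure0.
  rewrite -EFin_itg// -interval_law//; congr (P _); apply/seteqP; split => w /=; rewrite in_itv//.
move: A; have := @dynkin_induction _ (measurableTypeR R) (@ocitv R) (fun A => P [set w | (A `&` `]z1, z2]) (gp w)] = (\int[kappa]_(y in A `&` `]z1, z2]) (G x y)%:E)%E).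
move=> /(_ erefl) dk A mA; apply: (dk _ _ _ _ _ A mA) => {A mA dk}.
- by move=> A1 B1 h1 h2; exact: ocitvI.
- by rewrite setTI.
- move=> A /ocitvP[->|[[u v]/= uv ->]].
    by rewrite set0I integral_set0 (_ : [set w | _] = set0) ?measure0//; apply/seteqP; split => w //= [].
  have E1 : `]u, v]%classic `&` `]z1, z2] = `]Num.max u z1, Num.min v z2]%classic :> set R.
    apply/seteqP; split => y /=; rewrite !in_itv/= gt_max le_min.
      by case=> /andP[-> ->] /andP[-> ->].
    by move=> /andP[/andP[-> ->] /andP[-> ->]].
  rewrite (_ : [set w | _] = [set w | `]Num.max u z1, Num.min v z2]%classic (gp w)]) ?E1; last by rewrite -E1.
  have [h|h] := leP (Num.max u z1) (Num.min v z2); last first.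
    have E0 : `]Num.max u z1, Num.min v z2]%classic = set0 :> set R by rewrite set_itv_ge// bnd_simp -leNgt ltW.
    by rewrite E0 integral_set0 (_ : [set w | _] = set0) ?measure0.
  rewrite -EFin_itg// -interval_law//; last 2 first.
  + by apply: lt_le_trans az1 _; rewrite lee_fin le_max lexx orbT.
  + by apply: le_lt_trans z2c; rewrite lee_fin ge_min lexx orbT.
- move=> A mA IH; have mAJ := measurableI _ _ mA mJ.
  have fA : P [set w | (A `&` `]z1, z2]) (gp w)] \is a fin_num by rewrite fin_num_measure//; exact: meas_gp.
  have e1 : (P [set w | (A `&` `]z1, z2]) (gp w)] + P [set w | (~` A `&` `]z1, z2]) (gp w)] = P [set w | `]z1, z2]%classic (gp w)])%E.
    rewrite -measureU; [|exact: meas_gp|apply: meas_gp; apply: measurableI => //; exact: measurableC|]; last first.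
      by apply/seteqP; split => w //= [[? _] [? _]].
    congr (P _); apply/seteqP; split => w /=; first by move=> [[]|[]].
    by move=> h; have [?|?] := pselect (A (gp w)); [left|right].
  have e2 : (\int[kappa]_(y in A `&` `]z1, z2]) (G x y)%:E + \int[kappa]_(y in ~` A `&` `]z1, z2]) (G x y)%:E = \int[kappa]_(y in `]z1, z2]) (G x y)%:E)%E.
    rewrite -ge0_integral_setU//; [|by apply: measurableI => //; exact: measurableC| | |]; last 3 first.
    + exact: mG.
    + by move=> y; rewrite -setIUl setUCr setTI => /in_/G0; rewrite lee_fin.
    + by rewrite /disj_set; apply/eqP/seteqP; split => w //= [[? _] [? _]].
    by rewrite -setIUl setUCr setTI.
  have := total; rewrite -e1 -e2 -IH => /(congr1 (fun z : \bar R => z - P [set w | (A `&` `]z1, z2]) (gp w)])%E).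
  by rewrite ![(P [set w | (A `&` `]z1, z2]) (gp w)] + _)%E]addeC !addeK.
move=> F mF tF IH; have mFJ i : measurable (F i `&` `]z1, z2]) by exact: measurableI.
rewrite setI_bigcupl ge0_integral_bigcup//; last 3 first.
- exact: mG.
- by move=> y [i _ [_ /in_/G0]]; rewrite lee_fin.
- by apply: trivIset_setIr.
rewrite (_ : [set w | _] = \bigcup_i [set w | (F i `&` `]z1, z2]) (gp w)]); last by apply/seteqP; split => w.
rewrite measure_bigcup//; last 2 first.
- by move=> i _; exact: (meas_gp (mFJ i)).
- move=> i j _ _ [w [[h1 _] [h2 _]]]; apply: (tF i j I I); by exists (gp w).
by congr (limn _); apply/funext => n; apply: eq_big => [i|i _]; [rewrite in_setT|exact: IH].
Qed.

Let inv (n : nat) : R := n.+1%:R^-1.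
Let num (n : nat) : R := n.+1%:R.
(** Intervals at a positive distance from the ends, or bounded where an end is infinite, that
    increase to the gap. *)
Let inner (n : nat) : set R :=
  `](if a is r%:E then r + inv n else - num n), (if c is r%:E then r - inv n else num n)].

Lemma gap_law (A : set (measurableTypeR R)) : measurable A ->
  P [set w | A (gp w) /\ (a < (gp w)%:E < c)%E] =
  (\int[kappa]_(y in A `&` [set y | (a < y%:E < c)%E]) (G x y)%:E)%E.
Proof.
move=> mA; have mJ n : measurable (inner n : set (measurableTypeR R)) by exact: measurable_itv.
have inv_lt (k : R) : 0 < k -> \forall n \near \oo, inv n < k by move=> k0; exact: near_infty_natSinv_lt (PosNum k0).
have inE_ n y : inner n y -> (a < y%:E < c)%E.
  have n0 : 0 < inv n by rewrite invr_gt0.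
  rewrite /inner /= in_itv/= => /andP[]; move: n0; move: (inv n) => k k0.
  case/andP: axc => ax xc h1 h2; apply/andP; split; [move: ax h1|move: xc h2].
    by case: (a) => [r| |]; rewrite ?lte_fin ?ltNyr => // _; lra.
  by case: (c) => [r| |]; rewrite ?lte_fin ?ltry => // _; lra.
have nd : nondecreasing_seq (fun n => A `&` inner n).
  apply/nondecreasing_seqP => n; apply/subsetPset => y [Ay h]; split => //; move: h.
  have n0 : inv n.+1 <= inv n by rewrite lef_pV2 ?posrE// ler_nat.
  have n1 : num n <= num n.+1 by rewrite ler_nat.
  rewrite /inner /= !in_itv/=; move: n0 n1; move: (inv n) (inv n.+1) (num n) (num n.+1) => k1 k2 k3 k4 ? ?.
  by case: (a) => [r| |]; case: (c) => [r'| |] => /andP[h1 h2]; apply/andP; split; lra.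
have cap : \bigcup_n (A `&` inner n) = A `&` [set y | (a < y%:E < c)%E].
  rewrite -setI_bigcupr; congr (_ `&` _); apply/seteqP; split => y /=; first by move=> [n _ /inE_].
  move=> /andP[ay yc].
  have n1 : \forall n \near \oo, (if a is r%:E then r + inv n else - num n) < y.
    case: (a) ay => [r ry|//|_]; first by have := inv_lt (y - r); rewrite subr_gt0 -lte_fin => /(_ ry); apply: filterS => n; lra.
    exists (Num.bound `|y|) => // n /= hn; rewrite ltrNl; apply: le_lt_trans (ler_norm _) _; rewrite normrN.
    by apply: lt_le_trans (archi_boundP (normr_ge0 y)) _; rewrite ler_nat (leq_trans hn).
  have n2 : \forall n \near \oo, y <= (if c is r%:E then r - inv n else num n).
    case: (c) yc => [r ry|_|//]; first by have := inv_lt (r - y); rewrite subr_gt0 -lte_fin => /(_ ry); apply: filterS => n; lra.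
    exists (Num.bound `|y|) => // n /= hn; apply: le_trans (ler_norm _) _.
    by apply: le_trans (ltW (archi_boundP (normr_ge0 y))) _; rewrite ler_nat (leq_trans hn).
  have [n hn] := filter_ex (filterI n1 n2); exists n => //.
  by rewrite /inner /= in_itv/=; apply/andP.
have f0 n y : (A `&` inner n) y -> (0 <= (G x y)%:E)%E by move=> [_ /inE_/G0]; rewrite lee_fin.
have := @ge0_nondecreasing_set_cvg_integral _ _ _ (fun n => A `&` inner n) (fun y => (G x y)%:E) kappa nd (fun n => measurableI _ _ mA (mJ n)) (fun n => @mG _) f0.
rewrite cap => h1; apply/esym; apply: (cvg_unique _ h1) => //.
have mE n : measurable [set w | (A `&` inner n) (gp w)] by apply: meas_gp; exact: (measurableI _ _ mA (mJ n)).
have -> : [set w | A (gp w) /\ (a < (gp w)%:E < c)%E] = \bigcup_n [set w | (A `&` inner n) (gp w)].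
  apply/seteqP; split => w; last first.
    move=> [n _ hn]; suff : (\bigcup_n (A `&` inner n)) (gp w) by rewrite cap.
    by exists n.
  by move=> h; have : (\bigcup_n (A `&` inner n)) (gp w) by rewrite cap.
have ndE : nondecreasing_seq (fun n => [set w | (A `&` inner n) (gp w)]).
  by move=> n m nm; apply/subsetPset => w; have /subsetPset := nd n m nm; exact.
have : (P \o (fun n => [set w | (A `&` inner n) (gp w)])) @ \oo --> P (\bigcup_n [set w | (A `&` inner n) (gp w)]).
  by apply: nondecreasing_cvg_mu => //; exact: bigcupT_measurable.
rewrite (_ : P \o _ = fun n => (\int[kappa]_(y in A `&` inner n) (G x y)%:E)%E)//.
apply/funext => n /=; rewrite /comp interval_law_set//.
  have n0 : 0 < inv n by rewrite invr_gt0.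
  by move: axc; case: (a) => [r| |] //= _; rewrite ?lte_fin ?ltrDl ?ltNyr.
have n0 : 0 < inv n by rewrite invr_gt0.
by move: axc => /andP[_]; case: (c) => [r| |] //= _; rewrite ?lte_fin ?gtrBl ?ltry.
Qed.

Let cM (f g : R -> R) : continuous f -> continuous g -> continuous (fun z => f z * g z).
Proof. by move=> cf cg z; apply: cvgM; [exact: cf|exact: cg]. Qed.

Let set_ae (A : set Om) (f : Om -> R) : measurable A -> mfun f ->
  (\int[P]_w (f w * \1_A w)%:E = \int[P]_(w in A) (f w)%:E)%E.
Proof.
move=> mA mf; rewrite [RHS]integral_mkcond; apply: eq_integral => w _.
by rewrite /patch /restrict indicE; case: ifPn => h; rewrite ?mulr1 ?mulr0.
Qed.

Lemma gap_itg z1 z2 (h : R -> R) : (a < z1%:E)%E -> (z2%:E < c)%E -> continuous h ->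
  (forall y, z1 < y <= z2 -> 0 <= h y) ->
  (\int[P]_(w in [set w | (z1 < gp w <= z2)%R]) (h (gp w))%:E)%E =
  (itg kappa z1 z2 (fun y => h y * G x y))%:E.
Proof.
(* h is nonnegative on ]z1, z2] only, while the transfer formula asks for it everywhere; [h1] agrees
   with h on that interval. *)
move=> az1 z2c ch h0; pose J : set R := `]z1, z2]%classic; pose h1 y := Num.max (h y) 0.
have in_ y : J y -> (a < y%:E < c)%E.
  by rewrite /J /= in_itv/= => /andP[k1 k2]; rewrite (lt_trans az1)?lte_fin// (le_lt_trans _ z2c)// lee_fin.
have mJ : measurable (J : set (measurableTypeR R)) by exact: measurable_itv.
have ch1 : continuous h1 by move=> y; apply: (@continuous_max _ R h (fun=> 0)); [exact: ch|exact: cvg_cst].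
have mD : measurable [set w | z1 < gp w <= z2].
  have -> : [set w | z1 < gp w <= z2] = [set w | J (gp w)] by apply/seteqP; split => w; rewrite /J /= in_itv.
  exact: meas_gp.
transitivity (\int[P]_(w in [set w | (z1 < gp w <= z2)%R]) (h1 (gp w))%:E)%E.
  by apply: eq_integral => w /[!inE] /h0 k; rewrite /h1 max_l.
pose g y : R := G x y * \1_J y.
have mg : mfun g.
  by apply: measurable_funM; [exact: continuous_measurable_fun|exact: measurable_indic].
have g0 y : 0 <= g y.
  by rewrite /g indicE; case: (boolP (y \in J)) => [/[!inE] /in_ /G0 k|_]; rewrite ?mulr0// mulr1.
have gE A : measurable A -> P ([set w | z1 < gp w <= z2] `&` (fun w => gp w) @^-1` A) = (\int[kappa]_(y in A) (g y)%:E)%E.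
  move=> mA; have := @gap_law (A `&` J) (measurableI _ _ mA mJ).
  rewrite (_ : A `&` J `&` _ = A `&` J); last by apply/setIidPl => y [_ /in_].
  rewrite (_ : [set w | (A `&` J) (gp w) /\ _] = [set w | z1 < gp w <= z2] `&` (fun w => gp w) @^-1` A); last first.
    apply/seteqP; split => w /=; rewrite /J /= in_itv/=; first by case=> [[? ->]].
    by move=> [h2 ?]; split => //; apply: in_; rewrite /J /= in_itv.
  move=> ->; rewrite [LHS]integral_mkcond [RHS]integral_mkcond; apply: eq_integral => y _.
  rewrite /patch /g indicE in_setI; case: (y \in A) => //=; case: (y \in J); by rewrite ?mulr1 ?mulr0.
have := @ge0_integral_pushforward_density _ _ _ _ (measurableTypeR R) P kappa (fun w => gp w) measurable_gp _ mD g mg g0 gE (fun y => (h1 y)%:E).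
move=> ->; last 2 first.
- by apply/measurable_EFinP; exact: continuous_measurable_fun.
- by move=> y; rewrite lee_fin le_max lexx orbT.
rewrite EFin_itg//; last exact: cM.
rewrite [RHS]integral_mkcond; apply: eq_integral => y _; rewrite /patch -EFinM /g indicE.
rewrite (_ : (y \in `]z1, z2]%classic) = (y \in J))//.
case: (boolP (y \in J)) => [/[!inE]|_]; last by rewrite !mulr0.
by rewrite mulr1 /J /= in_itv/= => /h0 k; rewrite /h1 max_l.
Qed.

Let mgt z1 z2 : measurable [set w | z1 < gp w <= z2].
Proof.
have -> : [set w | z1 < gp w <= z2] = [set w | `]z1, z2]%classic (gp w)] by apply/seteqP; split => w; rewrite /= in_itv.
by apply: meas_gp; exact: measurable_itv.
Qed.

Let split_integral (E : set Om) (z1 z2 k : R) (h : R -> R) : measurable E -> 0 <= k ->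
  (a < z1%:E)%E -> (z2%:E < c)%E -> continuous h ->
  (forall y, z1 < y <= z2 -> 0 <= h y) ->
  (\int[P]_w (k * \1_E w + h (gp w) * \1_[set w | (z1 < gp w <= z2)%R] w)%:E)%E =
  (k%:E * P E + (itg kappa z1 z2 (fun y => h y * G x y))%:E)%E.
Proof.
move=> mE k0 az1 z2c ch h0.
have mh : mfun (fun w => h (gp w)) by apply: (measurable_cts_comp ch measurable_gp).
under eq_integral do rewrite EFinD.
rewrite ge0_integralD//; last 4 first.
- by move=> w _; rewrite lee_fin mulr_ge0.
- by apply/measurable_EFinP; apply: measurable_funM.
- move=> w _; rewrite lee_fin indic_boolE; case: (boolP (_ < _ <= _)) => [/h0 q|_]; by rewrite ?mulr0// mulr1.
- by apply/measurable_EFinP; apply: measurable_funM => //; exact: measurable_indic.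
rewrite (set_ae (mgt z1 z2) mh) gap_itg//; congr (_ + _)%E.
under eq_integral do rewrite EFinM.
by rewrite ge0_integralZl//= ?integral_indic ?setIT//; apply/measurable_EFinP.
Qed.

(** On the left of x only the probability cdf x enters, which includes the walks that stop at the
    lower end; between x and y the law has density G x. *)
Lemma right_split (y k : R) (h : R -> R) : x <= y -> (y%:E < c)%E -> 0 <= k -> continuous h ->
  (forall z, x < z <= y -> 0 <= h z) ->
  (\int[P]_w (if gp w <= x then k else if gp w <= y then h (gp w) else 0)%:E)%E =
  (cdf x * k + itg kappa x y (fun z => h z * G x z))%:E.
Proof.
move=> xy yc k0 ch h0; have mE := measurable_le_set x measurable_gp.
rewrite EFinD EFinM -gap_position_cdf// muleC -split_integral//; last by case/andP: axc.
apply: eq_integral => w _; congr EFin; rewrite !indic_boolE; move: (gp w) => g.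
case: (leP g x) => hx; first by rewrite mulr1 mulr0 addr0.
by case: (leP g y) => hy; rewrite mulr0 add0r ?mulr1 ?mulr0.
Qed.

Lemma left_split (y k : R) (h : R -> R) : y <= x -> (a < y%:E)%E -> 0 <= k -> continuous h ->
  (forall z, y < z <= x -> 0 <= h z) ->
  (\int[P]_w (if x < gp w then k else if y < gp w then h (gp w) else 0)%:E)%E =
  ((1 - cdf x) * k + itg kappa y x (fun z => h z * G x z))%:E.
Proof.
move=> yx ay k0 ch h0; have EE : [set w | x < gp w] = ~` [set w | gp w <= x].
  by apply/seteqP; split => w /=; rewrite ltNge => /negP.
have mE : measurable [set w | x < gp w] by rewrite EE; exact: measurableC (measurable_le_set x measurable_gp).
have PE : P [set w | x < gp w] = (1 - cdf x)%:E.
  by rewrite EE probability_setC ?gap_position_cdf//; exact: measurable_le_set measurable_gp.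
rewrite EFinD EFinM -PE muleC -split_integral//; last by case/andP: axc.
apply: eq_integral => w _; congr EFin; rewrite !indic_boolE; move: (gp w) => g.
case: (ltP x g) => hx; first by rewrite andbF mulr1 mulr0 addr0.
by case: (ltP y g) => hy; rewrite mulr0 add0r ?mulr1 ?mulr0.
Qed.

Definition diag_green (a c : \bar R) y := gap_green U D (rho_of a) (lam_of c) y y.

Let up_gt0 y : (a < y%:E)%E -> 0 < up U D rho y.
Proof.
case: (a) => [r ry| |_]; [|by rewrite ltNge leey|by rewrite /up/= mul0r subr0].
by rewrite /up/= subr_gt0 mulrAC ltr_pdivrMr//; exact: (UD_cross kR U0 D0 U_nd D_ni U_ode D_ode W).
Qed.

Let down_gt0 y : (y%:E < c)%E -> 0 < down U D lam y.
Proof.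
case: (c) => [r yr|_|]; [|by rewrite /down/= mul0r subr0|by rewrite ltNge leNye].
rewrite /down/= subr_gt0 mulrAC ltr_pdivrMr// [ltLHS]mulrC [ltRHS]mulrC.
exact: (UD_cross kR U0 D0 U_nd D_ni U_ode D_ode W).
Qed.

Let Un0 z : U z != 0. Proof. by rewrite gt_eqF. Qed.
Let Dn0 z : D z != 0. Proof. by rewrite gt_eqF. Qed.

Let cmax (f : R -> R) k : continuous f -> continuous (fun z => Num.max (f z) k).
Proof. by move=> cf z; apply: (@continuous_max _ R f (fun=> k)); [exact: cf|exact: cvg_cst]. Qed.

Let cinv (f : R -> R) : continuous f -> (forall z, 0 < f z) -> continuous (fun z => (f z)^-1).
Proof. by move=> cf f0 z; apply: cvgV; [rewrite gt_eqF|exact: cf]. Qed.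

Let cZ (f : R -> R) k : continuous f -> continuous (fun z => k * f z).
Proof. by move=> cf; apply: cM => // z; exact: cvg_cst. Qed.

(** A walk that ends at g < y leaves y in the gap ]max x g, c[; otherwise y gets covered. As a
    function of z = max x g, the new value at (y, y) is a solution vanishing at y times down y /
    down z. The factor down z of the density G x z cancels this denominator, and the equation makes
    the integral explicit. *)
Lemma green_step_right y : x < y -> (y%:E < c)%E ->
  (\int[P]_w (if (gp w < y)%R then diag_green (Num.max x (gp w))%:E c y else 0)%:E)%E =
  (G y y - G x y)%:E.
Proof.
move=> xy yc; pose psi z := U y * down U D (D y / U y) z.
have psiE z : psi z = U y * D z - D y * U z.
  by rewrite /psi /down mulrBr mulrA [U y * (_ / _)]mulrCA mulfV// mulr1.
have psiy : psi y = 0 by rewrite psiE; ring.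
have v0 : 0 < down U D lam y by exact: down_gt0.
have vle z : z <= y -> down U D lam y <= down U D lam z.
  by move=> zy; apply: down_le => //; exact: lam_of_ge0.
(* On z <= y this is down z; the maximum keeps it positive beyond c, so that h is continuous on the
   whole line. *)
pose V z := Num.max (down U D lam z) (down U D lam y).
have VE z : z <= y -> V z = down U D lam z by move=> /vle h; rewrite /V max_l.
have V0 z : 0 < V z by rewrite lt_max v0 orbT.
pose h z := psi z * (down U D lam y * (V z)^-1).
have solp := sol_down kR U0 D0 U_ode D_ode (D y / U y).
have ch : continuous h.
  apply: cM; first by apply: cZ; case: solp.
  by apply: cZ; apply: cinv => //; exact: cmax.
have psi0 z : z <= y -> 0 <= psi z.
  move=> zy; rewrite psiE; have := D_ni zy; have := U_nd zy; have := U0 y; have := D0 y; nra.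
have h0 z : z <= y -> 0 <= h z by move=> /psi0 k; apply: mulr_ge0 => //; apply: divr_ge0; exact: ltW.
have diagE z : z <= y -> diag_green z%:E c y = h z.
  move=> zy; rewrite /diag_green gap_green_le// /up /= /h VE// psiE.
  have := lt_le_trans v0 (vle _ zy); rewrite /down => k.
  have -> : 1 - U z / D z * lam = (D z - lam * U z) / D z by field; exact: Dn0.
  by field; rewrite Dn0 gt_eqF.
transitivity (\int[P]_w (if gp w <= x then h x else if gp w <= y then h (gp w) else 0)%:E)%E.
  apply: eq_integral => w _; congr EFin; move: (gp w) => g; case: (leP g x) => h1.
    by rewrite (le_lt_trans h1 xy) diagE ?(ltW xy).
  case: ltgtP => h2 //; first by rewrite diagE// ltW.
  by rewrite /h h2 psiy mul0r.
rewrite right_split// ?(ltW xy)//; last 2 first.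
- by apply: h0; exact: ltW.
- by move=> z /andP[_]; exact: h0.
congr EFin; rewrite (@eq_itg _ _ _ _ _ (fun z => down U D lam y * up U D rho x / (1 - rho * lam) * psi z)); last first.
  move=> z /andP[xz zy]; rewrite /h VE// gap_green_le ?(ltW xz)//.
  have := lt_le_trans v0 (vle _ zy) => k; move: Delta0; move: (1 - _) => q q0.
  by field; rewrite !gt_eqF.
rewrite (itgZ kR); last by apply: cZ; case: solp.
rewrite (itgZ kR); last by case: solp.
have -> : itg kappa x y (down U D (D y / U y)) = (down' U D (D y / U y) y - down' U D (D y / U y) x) / 2.
  by case: solp => _ _ k _; rewrite (k _ _ (ltW xy)) [2 * _]mulrC mulfK.
rewrite cdf_left// /h VE ?(ltW xy)// gap_green_le// gap_green_le ?(ltW xy)// psiE.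
(* The constant terms of [e1] and [e2] come from the Wronskian identity at y and at x
   respectively. *)
have e1 : U y * ((down' U D (D y / U y) y - down' U D (D y / U y) x) / 2) =
    (- 2 - (U y * rderive D x - D y * rderive U x)) / 2.
  have k : forall l, U y * (l - D y / U y * rderive U y) = U y * l - D y * rderive U y by move=> l; field.
  have k' : U y * (rderive D x - D y / U y * rderive U x) = U y * rderive D x - D y * rderive U x by field.
  by rewrite mulrA mulrBr /down' k k' -(W y); congr (_ / _); ring.
have e2 : up' U D rho x * (U y * D x - D y * U x) - up U D rho x * (U y * rderive D x - D y * rderive U x) = 2 * up U D rho y.
  by rewrite -(W x) /up /up'; ring.
have vx : down U D lam x != 0 by rewrite gt_eqF// down_gt0//; case/andP: axc.
rewrite e1; move: e2 vx; move: (up' U D rho x) (up U D rho x) (up U D rho y) (down U D lam x) (down U D lam y).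
move: (U y * D x - D y * U x) (U y * rderive D x - D y * rderive U x) => p p' u' u uy v vy e2 vx.
have q0 : 1 - rho * lam != 0 by rewrite gt_eqF.
move: (1 - rho * lam) q0 => q q0.
have -> : u' * v / (2 * q) * (p * (vy / v)) + vy * u / q * ((- 2 - p') / 2) = vy / (2 * q) * (u' * p - u * p' - 2 * u).
  by field; rewrite q0 vx.
by rewrite e2; field.
Qed.

(** Mirror image of [green_step_right]: the new gap is ]a, min x g[, and up z takes the part of down
    z. *)
Lemma green_step_left y : y < x -> (a < y%:E)%E ->
  (\int[P]_w (if (y < gp w)%R then diag_green a (Num.min x (gp w))%:E y else 0)%:E)%E =
  (G y y - G x y)%:E.
Proof.
move=> yx ay; pose psi z := D y * up U D (U y / D y) z.
have psiE z : psi z = D y * U z - U y * D z.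
  by rewrite /psi /up mulrBr mulrA [D y * (_ / _)]mulrCA mulfV// mulr1.
have v0 : 0 < up U D rho y by exact: up_gt0.
have vle z : y <= z -> up U D rho y <= up U D rho z.
  by move=> zy; apply: up_le => //; exact: rho_of_ge0.
pose V z := Num.max (up U D rho z) (up U D rho y).
have VE z : y <= z -> V z = up U D rho z by move=> /vle h; rewrite /V max_l.
have V0 z : 0 < V z by rewrite lt_max v0 orbT.
pose h z := psi z * (up U D rho y * (V z)^-1).
have solp := sol_up kR U0 D0 U_ode D_ode (U y / D y).
have ch : continuous h.
  apply: cM; first by apply: cZ; case: solp.
  by apply: cZ; apply: cinv => //; exact: cmax.
have psi0 z : y <= z -> 0 <= psi z.
  move=> zy; rewrite psiE; have := D_ni zy; have := U_nd zy; have := U0 y; have := D0 y; nra.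
have h0 z : y <= z -> 0 <= h z by move=> /psi0 k; apply: mulr_ge0 => //; apply: divr_ge0; exact: ltW.
have diagE z : y <= z -> diag_green a z%:E y = h z.
  move=> zy; rewrite /diag_green gap_green_le// /down /= /h VE// psiE.
  have := lt_le_trans v0 (vle _ zy); rewrite /up => k.
  have -> : 1 - rho * (D z / U z) = (U z - rho * D z) / U z by field; exact: Un0.
  by field; rewrite Un0 gt_eqF.
transitivity (\int[P]_w (if (x < gp w)%R then h x else if (y < gp w)%R then h (gp w) else 0)%:E)%E.
  apply: eq_integral => w _; congr EFin; move: (gp w) => g; case: (ltP x g) => h1.
    by rewrite (lt_trans yx h1) diagE ?(ltW yx).
  by case: ltP => h2 //; rewrite diagE// ltW.
rewrite left_split// ?(ltW yx)//; last 2 first.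
- by apply: h0; exact: ltW.
- by move=> z /andP[k _]; apply: h0; exact: ltW.
congr EFin; rewrite (@eq_itg _ _ _ _ _ (fun z => up U D rho y * down U D lam x / (1 - rho * lam) * psi z)); last first.
  move=> z /andP[yz zx]; rewrite /h VE ?(ltW yz)// gap_green_ge//.
  have := lt_le_trans v0 (vle _ (ltW yz)) => k; move: Delta0; move: (1 - _) => q q0.
  by field; rewrite !gt_eqF.
rewrite (itgZ kR); last by apply: cZ; case: solp.
rewrite (itgZ kR); last by case: solp.
have -> : itg kappa y x (up U D (U y / D y)) = (up' U D (U y / D y) x - up' U D (U y / D y) y) / 2.
  by case: solp => _ _ k _; rewrite (k _ _ (ltW yx)) [2 * _]mulrC mulfK.
rewrite cdf_right// /h VE ?(ltW yx)// gap_green_le// gap_green_ge ?(ltW yx)// psiE.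
have e1 : D y * ((up' U D (U y / D y) x - up' U D (U y / D y) y) / 2) =
    (D y * rderive U x - U y * rderive D x - 2) / 2.
  have k : forall l, D y * (l - U y / D y * rderive D y) = D y * l - U y * rderive D y by move=> l; field.
  have k' : D y * (rderive U x - U y / D y * rderive D x) = D y * rderive U x - U y * rderive D x by field.
  by rewrite mulrA mulrBr /up' k k' -(W y); congr (_ / _); ring.
have e2 : down U D lam x * (D y * rderive U x - U y * rderive D x) - down' U D lam x * (D y * U x - U y * D x) = 2 * down U D lam y.
  by rewrite -(W x) /down /down'; ring.
have ux : up U D rho x != 0 by rewrite gt_eqF// up_gt0//; case/andP: axc.
rewrite e1; move: e2 ux; move: (down' U D lam x) (up U D rho x) (up U D rho y) (down U D lam x) (down U D lam y).
move: (D y * U x - U y * D x) (D y * rderive U x - U y * rderive D x) => p p' v' u uy v vy e2 ux.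
have q0 : 1 - rho * lam != 0 by rewrite gt_eqF.
move: (1 - rho * lam) q0 => q q0.
have -> : (1 - (1 + u * v' / (2 * q))) * (p * (uy / u)) + uy * v / q * ((p' - 2) / 2) = uy / (2 * q) * (v * p' - v' * p - 2 * v).
  by field; rewrite q0 ux.
by rewrite e2; field.
Qed.

(** The probability of reaching the lower end before being killed: the mass cdf x less the part with
    density on ]r, x]. *)
Lemma cdf_lower r : a = r%:E -> P [set w | gp w <= r] =
  (up' U D rho r * down U D lam x / (2 * (1 - rho * lam)))%:E.
Proof.
move=> ar; have rx : r < x by move: axc; rewrite ar lte_fin => /andP[].
have mJ : measurable (`]r, x]%classic : set (measurableTypeR R)) by exact: measurable_itv.
have h := gap_law mJ.
have m1 z : measurable [set w | gp w <= z] by apply: measurable_le_set; exact: measurable_gp.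
have e1 : (P [set w | (gp w <= r)%R] + P [set w | (r < gp w <= x)%R])%E = P [set w | gp w <= x].
  rewrite -measureU//; last first.
    by apply/seteqP; split => w //=; move: (gp w) => g [k1 /andP[k2 _]]; move: k2; rewrite ltNge k1.
  congr (P _); apply/seteqP; split => w /=; move: (gp w) => g; first by move=> [k|/andP[_]//]; rewrite (le_trans k)// ltW.
  by move=> k; have [k1|k1] := leP g r; [left|right].
have e2 : P [set w | r < gp w <= x] = (itg kappa r x (G x))%:E.
  rewrite EFin_itg//; have -> : [set w | r < gp w <= x] = [set w | `]r, x]%classic (gp w) /\ (a < (gp w)%:E < c)%E].
    apply/seteqP; split => w /=; rewrite in_itv/=; move: (gp w) => g; last by case.
    move=> k; split => //; move: k => /andP[k1 k2]; rewrite ar lte_fin k1 /=.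
    by case/andP: axc => _; apply: le_lt_trans.
  rewrite h; congr integral; apply/setIidPl => y /=; rewrite in_itv/= => /andP[k1 k2].
  by rewrite ar lte_fin k1 /=; case/andP: axc => _; apply: le_lt_trans.
have : (P [set w | (gp w <= r)%R] = P [set w | (gp w <= x)%R] - (itg kappa r x (G x))%:E)%E by rewrite -e1 e2 addeK.
rewrite (gap_position_cdf axc) cdf_left// G_left ?(ltW rx) ?lexx// => ->; rewrite -EFinB; congr EFin.
have q0 : 1 - rho * lam != 0 by rewrite gt_eqF.
by move: (1 - _) q0 => q q0; field.
Qed.

Lemma cdf_upper r : c = r%:E -> P [set w | r <= gp w] =
  (- (up U D rho x * down' U D lam r / (2 * (1 - rho * lam))))%:E.
Proof.
move=> cr; have xr : x < r by move: axc; rewrite cr lte_fin => /andP[].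
have mJ : measurable (`]x, r[%classic : set (measurableTypeR R)) by exact: measurable_itv.
have h := gap_law mJ.
have m1 z : measurable [set w | gp w <= z] by apply: measurable_le_set; exact: measurable_gp.
have m2 : measurable [set w | r <= gp w].
  have -> : [set w | r <= gp w] = [set w | `[r, +oo[%classic (gp w)] by apply/seteqP; split => w /=; rewrite in_itv/= andbT.
  by apply: meas_gp; exact: measurable_itv.
have m3 : measurable [set w | x < gp w < r].
  have -> : [set w | x < gp w < r] = [set w | `]x, r[%classic (gp w)] by apply/seteqP; split => w /=; rewrite in_itv.
  exact: meas_gp.
have e1 : (P [set w | (r <= gp w)%R] + P [set w | (x < gp w < r)%R] + P [set w | (gp w <= x)%R])%E = 1%E.
  rewrite -measureU//; last by apply/seteqP; split => w //=; move: (gp w) => g [k1 /andP[_]]; rewrite ltNge k1.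
  rewrite -measureU//; last 2 first.
  - exact: measurableU.
  - apply/seteqP; split => w //=; move: (gp w) => g [[k1|/andP[k1 _]] k2]; last by move: k1; rewrite ltNge k2.
    by have := le_lt_trans (le_trans k1 k2) xr; rewrite ltxx.
  rewrite -(probability_setT P); congr (P _); apply/seteqP; split => w //= _; move: (gp w) => g.
  have [k1|k1] := leP g x; first by right.
  by left; have [k2|k2] := leP r g; [left|right].
have e2 : P [set w | x < gp w < r] = (itg kappa x r (G x))%:E.
  rewrite EFin_itg//; have -> : [set w | x < gp w < r] = [set w | `]x, r[%classic (gp w) /\ (a < (gp w)%:E < c)%E].
    apply/seteqP; split => w /=; rewrite in_itv/=; move: (gp w) => g; last by case.
    move=> k; split => //; move: k => /andP[k1 k2]; rewrite cr lte_fin k2 andbT.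
    by case/andP: axc => k _; apply: lt_trans k _.
  rewrite h setIidl; last first.
    move=> y /=; rewrite in_itv/= => /andP[k1 k2]; rewrite cr lte_fin k2 andbT.
    by case/andP: axc => k _; apply: lt_trans k _.
  rewrite [LHS]integral_mkcond [RHS]integral_mkcond; apply: eq_integral => y _.
  have dr : down U D lam r = 0 by rewrite cr /down /= divfK ?subrr.
  rewrite /patch !mem_setE !in_itv/=; case: (ltgtP y r) => // yr; rewrite andbF.
  by case: ifP => // _; rewrite yr gap_green_le ?(ltW xr)// dr mulr0 mul0r.
have : (P [set w | (r <= gp w)%R] = 1 - (cdf x)%:E - (itg kappa x r (G x))%:E)%E.
  by rewrite -e1 e2 (gap_position_cdf axc) !addeK.
rewrite cdf_right// G_right ?(ltW xr) ?lexx// => ->; rewrite -!EFinB; congr EFin.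
have q0 : 1 - rho * lam != 0 by rewrite gt_eqF.
by move: (1 - _) q0 => q q0; field.
Qed.

(** With no lower end, the walk from x reaches r before being killed with probability U x / U r, the
    increasing solution normalised at r. *)
Lemma cdf_upper_total r : a = -oo%E -> c = r%:E -> P [set w | r <= gp w] = (U x / U r)%:E.
Proof.
move=> ainf cr; rewrite (cdf_upper cr) ainf cr /up /down' /=; congr EFin.
have h : rderive D r - D r / U r * rderive U r = - 2 / U r by rewrite -[in RHS](W r); field.
rewrite !mul0r !subr0 mulr1 h; field; exact: Un0.
Qed.

End gap.

Section void.
Variable t : R.
Implicit Types (y z u v : R).

(** The solution with value 1, by the Wronskian identity, and zero right derivative at t. *)
Definition void_fun z := (rderive U t * D z - rderive D t * U z) / 2.

(* The harmonic function, for the walk in a gap ]A, +oo[, of the event that no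
   killing point falls in ]t, +oo[. *)
Definition void_potential (A : \bar R) : R :=
  match A with
  | r%:E => if t <= r then (D r)^-1 else void_fun r / D r
  | _ => rderive U t / 2
  end.

(** The condition says that the walk stops on the union or is killed at most at t. If t <= x the new
    end is x, and the potential is 1 / D x times the probability of the condition. If x < t,
    [right_split] applies and the factor D of the density cancels the denominator of the
    potential. *)
Lemma void_step a : (a < x%:E)%E ->
  (\int[P]_w (if ((gap_position kappa a +oo ((ext B)^~ w) (e w))%:E <= maxe a t%:E)%E
     then void_potential (Num.max x (gap_position kappa a +oo ((ext B)^~ w) (e w)))%:E else 0)%:E)%E =
  (void_potential a)%:E.
Proof.
move=> ax; have axc : (a < x%:E < +oo)%E by rewrite ax ltry.
have mg := measurable_gp a +oo%E.
have Dn0 z : D z != 0 by rewrite gt_eqF.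
pose rho := rho_of a.
have const (E : set Om) (k pE : R) : measurable E -> 0 <= k -> P E = pE%:E -> (\int[P]_w (k * \1_E w)%:E = (k * pE)%:E)%E.
  move=> mE k0 PE; under eq_integral do rewrite EFinM.
  rewrite ge0_integralZl//=; last by apply/measurable_EFinP; exact: measurable_indic.
  by rewrite integral_indic// setIT [X in (_ * X)%E](PE : _ = _).
have Ule z : 0 <= rderive U z by exact: (U'_ge0 kR U0 U_nd U_ode).
have Dle z : rderive D z <= 0 by exact: (D'_le0 kR D0 D_ni D_ode).
have vf0 z : 0 <= void_fun z.
  by rewrite /void_fun divr_ge0// subr_ge0 (@le_trans _ _ 0)// ?mulr_ge0// ?mulr_le0_ge0// ?ltW// mulr_le0_ge0// ltW.
have vft : void_fun t = 1.
  by rewrite /void_fun [rderive U t * _]mulrC [rderive D t * _]mulrC W divff.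
have m1 z : measurable [set w | gap_position kappa a +oo ((ext B)^~ w) (e w) <= z] by exact: measurable_le_set mg.
have valE : (a < t%:E)%E -> void_potential a = (rderive U t - rho * rderive D t) / 2.
  rewrite /rho /void_potential /rho_of; case: (a) => [r| |]; rewrite ?lte_fin.
  - by move=> rt; rewrite leNgt rt /= /void_fun; field; exact: Dn0.
  - by rewrite ltNge leey.
  - by rewrite mul0r subr0.
have [tx|xt] := leP t x.
  have below (m pm : R) : m <= x -> maxe a t%:E = m%:E ->
      P [set w | gap_position kappa a +oo ((ext B)^~ w) (e w) <= m] = (pm * D x)%:E ->
      (\int[P]_w (if ((gap_position kappa a +oo ((ext B)^~ w) (e w))%:E <= maxe a t%:E)%E
       then void_potential (Num.max x (gap_position kappa a +oo ((ext B)^~ w) (e w)))%:E else 0)%:E)%E = pm%:E.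
    move=> mx -> Pm; rewrite (_ : pm = (D x)^-1 * (pm * D x)); last by field; exact: Dn0.
    rewrite -(const [set w | gap_position kappa a +oo ((ext B)^~ w) (e w) <= m])//; last by rewrite invr_ge0 ltW.
    apply: eq_integral => w _; congr EFin; rewrite indic_boolE lee_fin; move: (gap_position _ _ _ _ _) => g.
    by case: (leP g m) => gm; rewrite ?mulr0// mulr1 /= max_l ?(le_trans gm)// tx.
  have [at_|ta] : (a < t%:E)%E \/ (t%:E <= a)%E by case: (leP t%:E a) => ?; [right|left].
    rewrite (valE at_); apply: (below t) => //; first by rewrite max_r// ltW.
    rewrite (gap_position_cdf axc) ?at_ ?ltry//.
    rewrite (cdf_left axc)// /up' /down /= -/rho; congr EFin.
    by rewrite mulr0 subr0 mulr1 mul0r subr0; field.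
  have [r ar] : exists r, a = r%:E.
    by move: ta ax; case: (a) => [r| |]; [exists r| |]; rewrite ?leNgt ?ltNyr// ltNge leey.
  have tr : t <= r by rewrite -lee_fin -ar.
  have -> : void_potential a = (D r)^-1 by rewrite ar /= tr.
  apply: (below r).
  - by rewrite -lee_fin -ar ltW.
  - by rewrite max_l.
  rewrite (cdf_lower axc ar) /up' /down /=; congr EFin.
  rewrite mulr0 subr0 mulr1 mul0r subr0 /rho_of ar.
  have -> : rderive U r - U r / D r * rderive D r = 2 / D r by rewrite -[in RHS](W r); field.
  by field.
have at_ : (a < t%:E)%E by apply: lt_trans ax _; rewrite lte_fin.
have solU := sol_U kR U0 U_ode; have solD := sol_D kR D0 D_ode.
have cU : continuous U by case: solU.
have cD : continuous D by case: solD.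
have cst_ (k : R) : continuous (fun _ : R => k) by move=> z; exact: cvg_cst.
have cZ (k : R) (f : R -> R) : continuous f -> continuous (fun z => k * f z) by move=> cf z; apply: cvgM; [exact: cst_|exact: cf].
have cvf : continuous void_fun.
  move=> z; apply: cvgM; last exact: (cst_ 2^-1 z).
  by apply: cvgB; [exact: (cZ _ _ cD z)|exact: (cZ _ _ cU z)].
have ch : continuous (fun z => void_fun z / D z).
  by move=> z; apply: cvgM; [exact: cvf|apply: cvgV; [exact: Dn0|exact: cD]].
transitivity (\int[P]_w (if gap_position kappa a +oo ((ext B)^~ w) (e w) <= x then void_fun x / D x else
  if gap_position kappa a +oo ((ext B)^~ w) (e w) <= t then void_fun (gap_position kappa a +oo ((ext B)^~ w) (e w)) / D (gap_position kappa a +oo ((ext B)^~ w) (e w)) else 0)%:E)%E.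
  apply: eq_integral => w _; congr EFin; rewrite max_r ?(ltW at_)// lee_fin; move: (gap_position _ _ _ _ _) => g.
  case: (leP g x) => gx; first by rewrite (le_trans gx (ltW xt)) /= leNgt xt.
  case: (ltgtP g t) => gt_ //; first by rewrite /= leNgt gt_.
  by rewrite gt_ /= lexx vft div1r.
rewrite (right_split axc (y := t) (h := fun z => void_fun z / D z)) ?(ltW xt) ?ltry//; last 2 first.
- by rewrite divr_ge0// ltW.
- by move=> z _; rewrite divr_ge0// ltW.
rewrite (valE at_); congr EFin.
rewrite (cdf_left axc)//.
rewrite (@eq_itg _ _ _ _ _ (fun z => up U D rho x * (rderive U t / 2) * D z - up U D rho x * (rderive D t / 2) * U z)); last first.
  by move=> z /andP[xz zt]; rewrite gap_green_le ?(ltW xz)// /down /= -/rho /void_fun mulr0 !subr0 mul0r subr0 divr1; field; exact: Dn0.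
rewrite (itgB kR); try exact: cZ.
rewrite !(itgZ kR)//.
have -> : itg kappa x t D = (rderive D t - rderive D x) / 2.
  by case: solD => _ _ k _; rewrite (k _ _ (ltW xt)) [2 * _]mulrC mulfK.
have -> : itg kappa x t U = (rderive U t - rderive U x) / 2.
  by case: solU => _ _ k _; rewrite (k _ _ (ltW xt)) [2 * _]mulrC mulfK.
rewrite /up' /up /down /void_fun /= -/rho mulr0 !mul0r !subr0 mulr1.
(* The Wronskian identity at x eliminates U' x, after which the equality is algebraic. *)
have w2 : rderive U x = (2 + U x * rderive D x) / D x by rewrite -(W x); field; exact: Dn0.
by rewrite w2; field; exact: Dn0.
Qed.

End void.

End gap_measure.

(** * The union of the intervals and its gaps *)

Section gap_states.
Context {R : realType}.
Implicit Types (x p y z r t : R) (u v : \bar R).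

(* The union of the intervals J_n, together with the ends of the gap around a
   point; the ends are also defined at -oo and +oo, which makes [lo s +oo] the
   supremum and [hi s -oo] the infimum of the union. *)
Record gstate := GState { cov : R -> bool; lo : \bar R -> \bar R; hi : \bar R -> \bar R }.

Definition gstate0 := GState (fun=> false) (fun=> -oo%E) (fun=> +oo%E).

Definition gstep x p s := if cov s x then s else GState
  (fun z => cov s z || (Num.min x p <= z <= Num.max x p))
  (fun v => if ((Num.max x p)%:E <= v)%E then maxe (lo s v) (Num.max x p)%:E else lo s v)
  (fun v => if (v <= (Num.min x p)%:E)%E then mine (hi s v) (Num.min x p)%:E else hi s v).

Definition free (s : gstate) v := if v is z%:E then ~~ cov s z else true.

(** Finite ends are attained by covered points. Extremality is asked at free v only: [gstep] updates
    an end when the whole new interval is on the relevant side of v, which decides the matter for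
    free v but not inside an interval. *)
Definition gap_ends (s : gstate) :=
  [/\ forall v, lo s v = -oo%E \/ exists2 r, lo s v = r%:E & cov s r /\ (r%:E <= v)%E,
      forall v, hi s v = +oo%E \/ exists2 r, hi s v = r%:E & cov s r /\ (v <= r%:E)%E,
      forall v y, free s v -> cov s y -> (y%:E <= v)%E -> (y%:E <= lo s v)%E &
      forall v y, free s v -> cov s y -> (v <= y%:E)%E -> (hi s v <= y%:E)%E].

Lemma gap_ends0 : gap_ends gstate0.
Proof. by split=> // v; left. Qed.

Lemma cov_step x p s z : cov s z -> cov (gstep x p s) z.
Proof. by rewrite /gstep; case: ifP => //= _ ->. Qed.

Lemma cov_step_start x p s : cov (gstep x p s) x.
Proof. by rewrite /gstep; case: ifP => //= _; rewrite ge_min le_max !lexx orbT. Qed.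

Lemma gap_ends_step x p s : gap_ends s -> gap_ends (gstep x p s).
Proof.
case=> [hlo hhi mlo mhi]; rewrite /gstep; case: ifP => // xs.
set m := Num.min x p; set M := Num.max x p.
have mM : m <= M by rewrite /m /M ge_min le_max lexx.
split=> [v|v|v y|v y] /=.
- have cM : cov s M || (m <= M <= M) by rewrite mM lexx orbT.
  case: ifP => [Mv|_]; last by case: (hlo v) => [->|[r -> [rc rv]]]; [left|right; exists r => //; rewrite rc].
  right; case: (hlo v) => [->|[r -> [rc rv]]]; first by exists M; rewrite ?maxNye.
  case: (leP r M) => rM; first by exists M; rewrite // max_r// lee_fin.
  by exists r; [rewrite max_l// lee_fin ltW|rewrite rc].
- have cm : cov s m || (m <= m <= M) by rewrite mM lexx orbT.
  case: ifP => [vm|_]; last by case: (hhi v) => [->|[r -> [rc rv]]]; [left|right; exists r => //; rewrite rc].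
  right; case: (hhi v) => [->|[r -> [rc rv]]]; first by exists m; rewrite ?minye.
  case: (leP m r) => mr; first by exists m; rewrite // min_r// lee_fin.
  by exists r; [rewrite min_l// lee_fin ltW|rewrite rc].
- move=> fv; have fs : free s v by move: fv; case: (v) => //= r /norP[].
  move=> /orP[cy|/andP[my yM]] yv; first by have k := mlo v y fs cy yv; case: ifP => // _; rewrite le_max k.
  have -> : (M%:E <= v)%E.
    move: fv yv; case: (v) => [r| |]//=; rewrite ?leey// !lee_fin => /norP[_ k] yr.
    by rewrite leNgt; apply/negP => rM; move: k; rewrite (le_trans my yr) ltW.
  by rewrite le_max lee_fin yM orbT.
move=> fv; have fs : free s v by move: fv; case: (v) => //= r /norP[].
move=> /orP[cy|/andP[my yM]] yv; first by have k := mhi v y fs cy yv; case: ifP => // _; rewrite ge_min k.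
have -> : (v <= m%:E)%E.
  move: fv yv; case: (v) => [r| |]//=; rewrite ?leNye// !lee_fin => /norP[_ k] yr.
  by rewrite leNgt; apply/negP => rM; move: k; rewrite (le_trans yr yM) ltW.
by rewrite ge_min lee_fin my orbT.
Qed.

Section ends.
Variable s : gstate.
Hypothesis es : gap_ends s.

Lemma lo_lt z : ~~ cov s z -> (lo s z%:E < z%:E)%E.
Proof.
move=> fz; case: es => + _ _ _ => /(_ z%:E)[->|[r -> [rc]]]; first exact: ltNyr.
by rewrite lee_fin lte_fin le_eqVlt => /predU1P[rz|//]; move: fz; rewrite -rz rc.
Qed.

Lemma hi_gt z : ~~ cov s z -> (z%:E < hi s z%:E)%E.
Proof.
move=> fz; case: es => _ + _ _ => /(_ z%:E)[->|[r -> [rc]]]; first exact: ltry.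
by rewrite lee_fin lte_fin le_eqVlt => /predU1P[rz|//]; move: fz; rewrite rz rc.
Qed.

Lemma gap_itv z : ~~ cov s z -> (lo s z%:E < z%:E < hi s z%:E)%E.
Proof. by move=> fz; rewrite lo_lt// hi_gt. Qed.

Lemma gap_free x y : ~~ cov s x -> (lo s x%:E < y%:E < hi s x%:E)%E -> ~~ cov s y.
Proof.
move=> fx /andP[ly yh]; apply/negP => cy; case: es => _ _ h1 h2; have [xy|yx] := leP x y.
  by have := h2 x%:E y fx cy; rewrite lee_fin => /(_ xy); rewrite leNgt yh.
by have := h1 x%:E y fx cy; rewrite lee_fin => /(_ (ltW yx)); rewrite leNgt ly.
Qed.

Lemma lo_cov v r : lo s v = r%:E -> cov s r.
Proof. by case: es => /(_ v)[->//|[r' -> [rc _]] _ _ _ [<-]]. Qed.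

Lemma hi_cov v r : hi s v = r%:E -> cov s r.
Proof. by case: es => _ /(_ v)[->//|[r' -> [rc _]] _ _ [<-]]. Qed.

Lemma lo_same u v : free s u -> free s v -> (u <= v)%E ->
  (forall y, (u <= y%:E <= v)%E -> ~~ cov s y) -> lo s u = lo s v.
Proof.
move=> fu fv uv nc; case: (es) => h1 _ h3 _; apply/eqP; rewrite eq_le; apply/andP; split.
  by case: (h1 u) => [->|[r -> [rc ru]]]; [exact: leNye|apply: h3 => //; exact: le_trans uv].
case: (h1 v) => [->|[r -> [rc rv]]]; first exact: leNye.
apply: h3 => //; rewrite leNgt; apply/negP => ur.
by have := nc r; rewrite (ltW ur) rv rc => /(_ isT).
Qed.

Lemma hi_same u v : free s u -> free s v -> (u <= v)%E ->
  (forall y, (u <= y%:E <= v)%E -> ~~ cov s y) -> hi s u = hi s v.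
Proof.
move=> fu fv uv nc; case: (es) => _ h1 _ h3; apply/eqP; rewrite eq_le; apply/andP; split; last first.
  case: (h1 u) => [->|[r -> [rc ru]]]; first exact: leey.
  apply: h3 => //; rewrite leNgt; apply/negP => rv.
  by have := nc r; rewrite ru (ltW rv) rc => /(_ isT).
case: (h1 v) => [->|[r -> [rc rv]]]; first exact: leey.
by apply: h3 => //; exact: le_trans rv.
Qed.

Lemma lo_gap x y : ~~ cov s x -> (lo s x%:E < y%:E < hi s x%:E)%E -> lo s y%:E = lo s x%:E.
Proof.
move=> fx yg; have fy := gap_free fx yg; have /andP[xl xh] := gap_itv fx; case/andP: yg => yl yh.
have [xy|yx] := leP x y.
  apply/esym/lo_same => // z /andP[xz zy]; apply: (gap_free fx).
  by rewrite (lt_le_trans xl xz) (le_lt_trans zy yh).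
apply: lo_same => //; first by rewrite lee_fin ltW.
by move=> z /andP[yz zx]; apply: (gap_free fx); rewrite (lt_le_trans yl yz) (le_lt_trans zx xh).
Qed.

Lemma hi_gap x y : ~~ cov s x -> (lo s x%:E < y%:E < hi s x%:E)%E -> hi s y%:E = hi s x%:E.
Proof.
move=> fx yg; have fy := gap_free fx yg; have /andP[xl xh] := gap_itv fx; case/andP: yg => yl yh.
have [xy|yx] := leP x y.
  apply/esym/hi_same => // z /andP[xz zy]; apply: (gap_free fx).
  by rewrite (lt_le_trans xl xz) (le_lt_trans zy yh).
apply: hi_same => //; first by rewrite lee_fin ltW.
by move=> z /andP[yz zx]; apply: (gap_free fx); rewrite (lt_le_trans yl yz) (le_lt_trans zx xh).
Qed.

(** The new interval stays in the closed gap of x, so from y it is hidden behind an end of that gap,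
    which is covered. *)
Lemma gstep_other x p y : ~~ cov s x -> ~~ cov s y -> (lo s x%:E <= p%:E <= hi s x%:E)%E ->
  ~~ (lo s x%:E < y%:E < hi s x%:E)%E ->
  [/\ ~~ cov (gstep x p s) y, lo (gstep x p s) y%:E = lo s y%:E & hi (gstep x p s) y%:E = hi s y%:E].
Proof.
move=> fx fy /andP[lp ph] ny; have /andP[lx xh] := gap_itv fx.
rewrite /gstep (negbTE fx) /=; set m := Num.min x p; set M := Num.max x p.
have lm : (lo s x%:E <= m%:E)%E by rewrite /m /Num.min; case: ifP => // _; exact: ltW.
have Mh : (M%:E <= hi s x%:E)%E by rewrite /M /Num.max; case: ifP => // _; exact: ltW.
have mM : m <= M by rewrite /m /M ge_min le_max lexx.
have [h1 h2 h3 h4] := es.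
have [yl|hy] : (y%:E <= lo s x%:E)%E \/ (hi s x%:E <= y%:E)%E.
- by move: ny; rewrite negb_and -!leNgt => /orP[]; [left|right].
- case: (h1 x%:E) => [l|[r l [rc _]]]; first by move: yl; rewrite l leNgt ltNyr.
  have yr : y < r.
    by move: yl; rewrite l lee_fin le_eqVlt => /predU1P[yr|//]; move: fy; rewrite yr rc.
  have rm : r <= m by rewrite -lee_fin -l.
  have ym : y < m by exact: lt_le_trans rm.
  have yM : y < M by exact: lt_le_trans mM.
  rewrite (negbTE fy) /= !lee_fin [m <= y]leNgt ym [M <= y]leNgt yM (ltW ym) /=; split => //.
  by rewrite min_l//; apply: le_trans (_ : (r%:E <= _)%E); [apply: h4 => //; rewrite lee_fin ltW|rewrite lee_fin].
case: (h2 x%:E) => [l|[r l [rc _]]]; first by move: hy; rewrite l leNgt ltry.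
have yr : r < y.
  by move: hy; rewrite l lee_fin le_eqVlt => /predU1P[yr|//]; move: fy; rewrite -yr rc.
have Mr : M <= r by rewrite -lee_fin -l.
have My : M < y by exact: le_lt_trans yr.
have my : m < y by exact: le_lt_trans My.
rewrite (negbTE fy) /= !lee_fin [y <= M]leNgt My [y <= m]leNgt my (ltW My) andbF /=; split => //.
by rewrite max_l//; apply: le_trans (_ : (r%:E <= _)%E); [rewrite lee_fin|apply: h3 => //; rewrite lee_fin ltW].
Qed.

Lemma gstep_right x p y : ~~ cov s x -> x < y -> (y%:E < hi s x%:E)%E ->
  [/\ cov (gstep x p s) y = (y <= p),
      p < y -> lo (gstep x p s) y%:E = (Num.max x p)%:E &
      hi (gstep x p s) y%:E = hi s x%:E].
Proof.
move=> fx xy yh; have /andP[lx _] := gap_itv fx.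
have yg : (lo s x%:E < y%:E < hi s x%:E)%E by rewrite yh (lt_trans lx)// lte_fin.
have fy := gap_free fx yg; have ly := lo_gap fx yg; have hy := hi_gap fx yg.
rewrite /gstep (negbTE fx) /= (negbTE fy) ly hy /= !lee_fin; split.
- by rewrite ge_min le_max [y <= x]leNgt xy (ltW xy).
- by move=> py; rewrite ge_max (ltW py) (ltW xy) /= max_r// (le_trans (ltW lx))// lee_fin le_max lexx.
by rewrite le_min [y <= x]leNgt xy.
Qed.

Lemma gstep_left x p y : ~~ cov s x -> y < x -> (lo s x%:E < y%:E)%E ->
  [/\ cov (gstep x p s) y = (p <= y),
      y < p -> hi (gstep x p s) y%:E = (Num.min x p)%:E &
      lo (gstep x p s) y%:E = lo s x%:E].
Proof.
move=> fx yx ly; have /andP[_ xh] := gap_itv fx.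
have yg : (lo s x%:E < y%:E < hi s x%:E)%E by rewrite ly /= (lt_trans _ xh)// lte_fin.
have fy := gap_free fx yg; have loy := lo_gap fx yg; have hy := hi_gap fx yg.
rewrite /gstep (negbTE fx) /= (negbTE fy) loy hy /= !lee_fin; split.
- by rewrite ge_min le_max [x <= y]leNgt yx (ltW yx) /= andbT.
- by move=> py; rewrite le_min (ltW py) (ltW yx) /= min_r// (le_trans _ (ltW xh))// lee_fin ge_min lexx.
by rewrite ge_max [x <= y]leNgt yx.
Qed.

End ends.

End gap_states.

(** * Effect of one walk on the extremities of the union *)

Section void_steps.
Context {R : realType}.
Variables (s : @gstate R) (x p t : R).
Hypotheses (es : gap_ends s) (fx : ~~ cov s x) (px : (lo s x%:E <= p%:E <= hi s x%:E)%E).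
Local Notation new := ((lo s x%:E < p%:E < hi s x%:E)%E).
Let lx : (lo s x%:E < x%:E)%E. Proof. exact: lo_lt. Qed.
Let xh : (x%:E < hi s x%:E)%E. Proof. exact: hi_gt. Qed.

(** Only a walk in the last gap can make a point beyond t. By the hypothesis there is no hole
    between t and a covered point on its right, so a walk whose gap has a finite upper end can be
    killed only at or below t, and it leaves the supremum of the union unchanged. *)
Lemma right_void_step : (forall y z, cov s z -> t <= y <= z -> t < z -> cov s y) ->
  if hi s x%:E == +oo%E then
    [/\ lo s +oo%E = lo s x%:E,
      (new ==> (p <= t)) = (p%:E <= maxe (lo s x%:E) t%:E)%E &
      lo (gstep x p s) +oo%E = (Num.max x p)%:E]
  else (new ==> (p <= t)) /\ lo (gstep x p s) +oo%E = lo s +oo%E.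
Proof.
move=> vc; have /andP[lp ph] := px; case: ifPn => [/eqP hoo|hr].
  have loE : lo s x%:E = lo s +oo%E.
    apply: (lo_same es) => //; first exact: leey.
    move=> y /andP[xy _]; apply/negP => cy; case: es => _ _ _ /(_ x%:E y fx cy xy).
    by rewrite hoo leNgt ltry.
  split=> //.
    rewrite hoo ltry andbT le_max lee_fin.
    by case: (leP p%:E (lo s x%:E)) => h; rewrite ?implybT.
  rewrite /gstep (negbTE fx) /= leey -loE max_r//.
  by apply: le_trans (ltW lx) _; rewrite lee_fin le_max lexx.
have [h hE ch] : exists2 h, hi s x%:E = h%:E & cov s h.
  case: es => _ /(_ x%:E)[e|[r e [cr _]]] _ _; first by rewrite e eqxx in hr.
  by exists r.
have xh' : x < h by rewrite -lte_fin -hE.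
split.
  apply/implyP => nw; have fp := gap_free es fx nw; move: nw => /andP[lp']; rewrite hE lte_fin => ph'.
  have [ht|th] := leP h t; first exact: ltW (lt_le_trans ph' ht).
  rewrite leNgt; apply/negP => tp.
  by move: fp; rewrite (vc p h ch)// (ltW tp) ltW.
rewrite /gstep (negbTE fx) /= leey max_l//; case: (es) => _ _ /(_ +oo%E h isT ch (leey _)) k _.
apply: le_trans k; rewrite lee_fin ge_max (ltW xh') /=; by move: ph; rewrite hE.
Qed.

(** The infimum of the union being at most t, a walk started below the union that makes no point
    below t has to reach the union, and the new infimum is x. *)
Lemma left_void_step : (hi s -oo <= t%:E)%E ->
  if lo s x%:E == -oo%E then
    hi s -oo = hi s x%:E /\
    ((new ==> (t <= p)) -> (hi s x%:E <= p%:E)%E /\ hi (gstep x p s) -oo = x%:E)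
  else hi (gstep x p s) -oo = hi s -oo.
Proof.
move=> It; have /andP[lp ph] := px; case: ifPn => [/eqP loo|hr].
  have hiE : hi s -oo = hi s x%:E.
    apply: (hi_same es) => //; first exact: leNye.
    move=> y /andP[_ xy]; apply/negP => cy; case: es => _ _ /(_ x%:E y fx cy xy) + _.
    by rewrite loo leNgt ltNyr.
  split=> // hn; have hp : (hi s x%:E <= p%:E)%E.
    rewrite leNgt; apply/negP => k; move: hn; rewrite loo ltNyr k /= => tp.
    by move: k; rewrite ltNge -hiE => /negP; apply; apply: le_trans It _; rewrite lee_fin.
  split=> //; rewrite /gstep (negbTE fx) /= leNye hiE min_r.
    by rewrite min_l// -lee_fin; exact: le_trans (ltW xh) hp.
  by apply: le_trans (ltW xh); rewrite lee_fin ge_min lexx.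
have [h hE ch] : exists2 h, lo s x%:E = h%:E & cov s h.
  case: es => /(_ x%:E)[e|[r e [cr _]]] _ _ _; first by rewrite e eqxx in hr.
  by exists r.
rewrite /gstep (negbTE fx) /= leNye min_l//; case: (es) => _ _ _ /(_ -oo%E h isT ch (leNye _)) k.
have hx : h < x by rewrite -lte_fin -hE.
have hp : h <= p by rewrite -lee_fin -hE.
by apply: le_trans k _; rewrite lee_fin le_min hp (ltW hx).
Qed.

End void_steps.

(** * Wilson's algorithm run on states *)

Section wilson_run.
Context {R : realType}.
Implicit Types (y z r t : R) (u v : \bar R) (n k : nat).
Variables (x : nat -> R) (pos : nat -> \bar R -> \bar R -> R).

(** The final positions are an arbitrary function of the gap, which makes this part deterministic;
    probability enters when [pos] is instantiated. *)
Fixpoint gseq n : @gstate R := if n is m.+1 then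
  gstep (x m) (pos m (lo (gseq m) (x m)%:E) (hi (gseq m) (x m)%:E)) (gseq m) else gstate0.

Definition gpos n := pos n (lo (gseq n) (x n)%:E) (hi (gseq n) (x n)%:E).

Lemma gseqS n : gseq n.+1 = gstep (x n) (gpos n) (gseq n). Proof. by []. Qed.

(** Ending strictly inside the gap means being killed before reaching the union. *)
Definition is_new n := ~~ cov (gseq n) (x n) &&
  (lo (gseq n) (x n)%:E < (gpos n)%:E < hi (gseq n) (x n)%:E)%E.

Lemma gap_ends_seq n : gap_ends (gseq n).
Proof. by elim: n => [|n IH]; [exact: gap_ends0|exact: gap_ends_step]. Qed.

Lemma cov_le n k z : (k <= n)%N -> cov (gseq k) z -> cov (gseq n) z.
Proof.
move=> /subnK <-; elim: (n - k)%N => // m IH /IH h.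
by rewrite addSn gseqS; exact: cov_step.
Qed.

Lemma cov_start n k : (k < n)%N -> cov (gseq n) (x k).
Proof. by move=> /cov_le; apply; rewrite gseqS; exact: cov_step_start. Qed.

Lemma gseq_cov n : cov (gseq n) (x n) -> gseq n.+1 = gseq n.
Proof. by move=> h; rewrite gseqS /gstep h. Qed.

Lemma cov_gpos n : ~~ cov (gseq n) (x n) -> cov (gseq n.+1) (gpos n).
Proof. by move=> h; rewrite gseqS /gstep (negbTE h) /= ge_min le_max !lexx !orbT. Qed.

Lemma new_notin n : is_new n -> ~~ cov (gseq n) (gpos n).
Proof. by case/andP => fx; exact: (gap_free (gap_ends_seq n) fx). Qed.

(** A new point is uncovered when it is made and covered ever after. Hence killing points can be
    counted by the indices of their walks. *)
Lemma new_inj n k : is_new n -> is_new k -> gpos n = gpos k -> n = k.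
Proof.
wlog nk : n k / (n <= k)%N => [h|hn hk e].
  by have [/h//|/ltnW/h h' hn hk /esym /(h' hk hn)] := leqP n k.
apply/eqP; rewrite eqn_leq nk leqNgt; apply/negP => lt_nk.
have := new_notin hk; rewrite -e => /negP; apply; apply: (cov_le lt_nk).
by apply: cov_gpos; case/andP: hn.
Qed.

Hypothesis posP : forall n u v, (u < (x n)%:E < v)%E -> (u <= (pos n u v)%:E <= v)%E.

Lemma gposP n : ~~ cov (gseq n) (x n) ->
  (lo (gseq n) (x n)%:E <= (gpos n)%:E <= hi (gseq n) (x n)%:E)%E.
Proof. by move=> h; apply: posP; exact: (gap_itv (gap_ends_seq n)). Qed.

Lemma is_newE n : ~~ cov (gseq n) (x n) -> is_new n = ~~ cov (gseq n) (gpos n).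
Proof.
move=> fx; apply/idP/idP; first exact: new_notin.
move=> fp; rewrite /is_new fx /=; have /andP[] := gposP fx; rewrite !le_eqVlt.
move=> /predU1P[e|->]; first by rewrite (lo_cov (gap_ends_seq n) e) in fp.
by move=> /predU1P[e|//]; rewrite (hi_cov (gap_ends_seq n) (esym e)) in fp.
Qed.

Section right_void.
Variable t : R.

Fixpoint void_right n := if n is m.+1 then void_right m && (is_new m ==> (gpos m <= t)) else true.

Lemma void_rightP n : void_right n = true <-> forall k, (k < n)%N -> is_new k -> gpos k <= t.
Proof.
elim: n => [|n [IH1 IH2]]; first by split.
split=> [/= /andP[/IH1 h /implyP hn] k|h /=]; first by rewrite ltnS leq_eqVlt => /predU1P[->//|/h].
by rewrite IH2 => [|k kn]; [apply/implyP; exact: h|apply: h; exact: ltnW].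
Qed.

(** The union has no hole to the right of t. A new interval lying wholly beyond t has its end p in
    the earlier union, as a new point there is excluded; by induction everything between t and p was
    covered, so x would have been covered if p were beyond it. *)
Lemma void_right_cov n y z : void_right n -> cov (gseq n) z -> t <= y <= z -> t < z -> cov (gseq n) y.
Proof.
elim: n y z => [//|n IH] y z /andP[/IH vn hn]; rewrite gseqS.
case: (boolP (cov (gseq n) (x n))) => [fx|fx]; first by rewrite /gstep fx; exact: vn.
rewrite {1}/gstep (negbTE fx) /= => /orP[cz|/andP[mz zM]] yz tz.
  by apply: cov_step; exact: vn cz yz tz.
have /andP[ty yz'] := yz; have [es gx] := (gap_ends_seq n, gposP fx).
have /andP[lx xh] := gap_itv es fx.
rewrite /gstep (negbTE fx) /=; have [my|ym] := leP (Num.min (x n) (gpos n)) y.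
  by rewrite (le_trans yz' zM) orbT.
have tm : t < Num.min (x n) (gpos n) by exact: le_lt_trans ym.
have tx : t < x n by apply: lt_le_trans tm _; rewrite ge_min lexx.
have tp : t < gpos n by apply: lt_le_trans tm _; rewrite ge_min lexx orbT.
have cp : cov (gseq n) (gpos n).
  by move: hn; rewrite is_newE// leNgt tp implybF negbK.
have [px|xp] := leP (gpos n) (x n).
  by rewrite (vn _ (gpos n))// ty ltW//; move: ym; rewrite min_r.
by move: fx; rewrite (vn _ (gpos n))// (ltW tx) ltW.
Qed.

End right_void.

Section left_void.
Variable t : R.

Fixpoint void_left n := if n is m.+1 then void_left m && (is_new m ==> (t <= gpos m)) else true.

Lemma void_leftP n : void_left n = true <-> forall k, (k < n)%N -> is_new k -> t <= gpos k.
Proof.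
elim: n => [|n [IH1 IH2]]; first by split.
split=> [/= /andP[/IH1 h /implyP hn] k|h /=]; first by rewrite ltnS leq_eqVlt => /predU1P[->//|/h].
by rewrite IH2 => [|k kn]; [apply/implyP; exact: h|apply: h; exact: ltnW].
Qed.

(** An interval extends down to its starting point or to its end, and this end is at least t if it
    is new and already covered if not. *)
Lemma void_left_low n r : void_left n -> r <= t -> (forall k, (k < n)%N -> r <= x k) ->
  (r%:E <= hi (gseq n) -oo)%E.
Proof.
elim: n => [|n IH]; first by move=> *; exact: leey.
move=> /andP[vn hn] rt rx; have {}IH := IH vn rt (fun k kn => rx k (ltnW kn)).
rewrite gseqS; case: (boolP (cov (gseq n) (x n))) => [fx|fx]; first by rewrite /gstep fx.
rewrite /gstep (negbTE fx) /= leNye le_min IH lee_fin le_min rx//=.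
case: (boolP (is_new n)) => [h|]; first by move: hn; rewrite h; exact: le_trans.
rewrite is_newE// negbK => cp; rewrite -lee_fin; apply: le_trans IH _.
by case: (gap_ends_seq n) => _ _ _; apply => //; exact: leNye.
Qed.

End left_void.

Section link.
Variables (b : nat -> R -> R) (zeta : nat -> \bar R).
Hypotheses (zeta0 : forall n, (0 <= zeta n)%E)
  (walk : forall n u v, (u < (x n)%:E < v)%E -> exists2 t,
  [/\ 0 <= t, forall s, 0 <= s -> s < t -> (u < (b n s)%:E < v)%E /\ (s%:E < zeta n)%E &
    [\/ (zeta n <= t%:E)%E, (b n t)%:E = u | (b n t)%:E = v]] & pos n u v = b n t).

(** The two descriptions of the run are matched through the set of new points and the union of the
    intervals, which determines all hitting times. *)
Lemma wilson_run n :
  (wilson x b zeta n).1 = [set gpos k | k in [set k | (k < n)%N && is_new k]] /\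
  \bigcup_(J in (wilson x b zeta n).2) J = [set z | cov (gseq n) z].
Proof.
elim: n => [|n [IH1 IH2]] /=.
  by split; apply/seteqP; split => z //= [].
have [es] := gap_ends_seq n; rewrite /wilson_step.
move: IH1 IH2; case: (wilson x b zeta n) => Y Js /= IH1 IH2; rewrite IH2.
case: ifPn => [|]; rewrite ?inE /= => fx.
  rewrite [gstep _ _ _](gseq_cov fx); split => //; rewrite IH1; apply/seteqP; split => z [k /= /andP[kn nk] <-].
    by exists k => //=; rewrite ltnS ltnW.
  exists k => //=; move: kn; rewrite ltnS leq_eqVlt => /predU1P[kn|->//].
  by move: nk; rewrite /is_new kn fx.
have {}fx : ~~ cov (gseq n) (x n) by apply/negP; move/negP: fx; rewrite inE.
have [t [t0 before at_t] pE] := walk (gap_itv (gap_ends_seq n) fx).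
set U := [set z | cov (gseq n) z].
(* Before t the walk is alive and inside its gap, hence off the union; at t it is killed or at an
   end of the gap, which is covered. *)
have TE : mine (zeta n) (hitting_time (b n) U) = t%:E.
  apply/eqP; rewrite eq_le; apply/andP; split.
    rewrite ge_min; case: at_t => [->//|h|h]; apply/orP; right; apply: ereal_inf_lbound; exists t => //; split => //.
      by apply: (lo_cov (gap_ends_seq n)); rewrite h.
    by apply: (hi_cov (gap_ends_seq n)); rewrite h.
  rewrite le_min; apply/andP; split.
    rewrite leNgt; apply/negP => zt.
    have zE : zeta n = (fine (zeta n))%:E by rewrite fineK// ge0_fin_numE// (lt_trans zt)// ltry.
    have := before (fine (zeta n)); rewrite -!lee_fin -lte_fin -zE zeta0 zt => /(_ isT isT)[_].
    by rewrite ltxx.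
  apply: le_ereal_inf_tmp => _ /= [s [s0 cs] <-]; rewrite lee_fin leNgt; apply/negP => st.
  have [k _] := before s s0 st.
  by move: (gap_free (gap_ends_seq n) fx k); rewrite [X in ~~ X](cs : _ = true).
rewrite TE /= -pE -/(gpos n).
have newE := is_newE fx.
have covS : [set z | cov (gseq n.+1) z] = U `|` seg (x n) (gpos n).
  have segE z : seg (x n) (gpos n) z = (Num.min (x n) (gpos n) <= z <= Num.max (x n) (gpos n)).
    by rewrite /seg /= in_itv.
  apply/seteqP; split => z; rewrite gseqS /gstep (negbTE fx) /=.
    by move=> /orP[h|h]; [left|right; rewrite segE].
  by case=> [h|]; [apply/orP; left|rewrite segE => h; apply/orP; right].
rewrite -[gstep _ _ _]/(gseq n.+1) covS.
case: ifPn => cp; rewrite ?inE /U /= in cp.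
  have nn : ~~ is_new n by rewrite newE cp.
  split => /=.
    rewrite IH1; apply/seteqP; split => z [k /= /andP[kn nk] <-].
      by exists k => //=; rewrite ltnS ltnW.
    exists k => //=; move: kn; rewrite ltnS leq_eqVlt => /predU1P[kn|->//].
    by move: nk; rewrite kn (negbTE nn).
  (* The default [set0] is not reached: p is covered, so some interval contains it. *)
  set J := xget set0 [set J | Js J /\ J (gpos n)].
  have [J0 J0s J0p] : (\bigcup_(J in Js) J) (gpos n) by rewrite IH2.
  have [Js_ Jp] : Js J /\ J (gpos n) by apply: (@xgetPex _ set0 [set J | Js J /\ J (gpos n)]); exists J0.
  rewrite bigcup_setU bigcup_set1 /U -IH2; apply/seteqP; split => z /=.
    by move=> [[J' [J's _] J'z]|[Jz|]]; [left; exists J'|left; exists J|right].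
  move=> [[J' J's J'z]|]; last by right; right.
  by have [E|E] := pselect (J' = J); [right; left; rewrite -E|left; exists J'].
have {}cp : ~~ cov (gseq n) (gpos n) by apply/negP; move/negP: cp; rewrite inE.
have nn : is_new n by rewrite newE.
split => /=; last by rewrite bigcup_setU bigcup_set1 IH2.
rewrite IH1; apply/seteqP; split => z /=.
  move=> [[k /= /andP[kn nk] <-]|->]; last by exists n => //=; rewrite ltnS leqnn.
  by exists k => //=; rewrite ltnS ltnW.
move=> [k /= /andP[kn nk] <-]; move: kn; rewrite ltnS leq_eqVlt => /predU1P[->|kn]; first by right.
by left; exists k => //=; rewrite kn.
Qed.

Lemma wilson_pointsE : wilson_points x b zeta = [set gpos k | k in [set k | is_new k]].
Proof.
apply/seteqP; split => z; rewrite /wilson_points /=.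
  by move=> [n _]; rewrite (wilson_run n).1 => -[k /= /andP[_ nk] <-]; exists k.
move=> [k nk <-]; exists k.+1 => //; rewrite (wilson_run k.+1).1; exists k => //=.
by rewrite ltnS leqnn.
Qed.

End link.

End wilson_run.

(** * Independence of a walk from the earlier ones *)

Section generated_independence.
Context {R : realType} {d : measure_display} {Om : measurableType d} (P : probability Om R).
Implicit Types (G H : set (set Om)) (A C : set Om).
Local Open Scope ereal_scope.

Lemma indep_generated_left G C : G `<=` measurable -> setI_closed G -> measurable C ->
  (forall A, G A -> P (A `&` C) = P A * P C) ->
  forall A, <<s G >> A -> P (A `&` C) = P A * P C.
Proof.
move=> GM GI mC GC; have sub A : <<s G >> A -> measurable A.
  by apply: smallest_sub => //; exact: sigma_algebra_measurable.
apply: (@dynkin_induction _ (g_sigma_algebraType G) G (fun A => P (A `&` C) = P A * P C)) => //.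
- by rewrite setTI probability_setT mul1e.
- move=> A /sub mA IH; rewrite setIC -setDE measureD//; last by rewrite ltey_eq fin_num_measure.
  have IH' : P (C `&` A) = P A * P C by rewrite setIC; exact: IH.
  transitivity (P C - P A * P C); first by congr (_ - _); exact: IH'.
  rewrite probability_setC//.
  have fA : P A \is a fin_num by rewrite fin_num_measure.
  have fC : P C \is a fin_num by rewrite fin_num_measure.
  by rewrite -(fineK fA) -(fineK fC) -EFinM -!EFinB -EFinM; congr EFin; ring.
move=> F mF tF IH; have mF' i := sub _ (mF i).
rewrite setI_bigcupl measure_bigcup//; last 2 first.
- by move=> i _; exact: measurableI.
- exact: trivIset_setIr.
rewrite [X in _ = X * _]measure_bigcup//.
have fC : P C \is a fin_num by rewrite fin_num_measure.
rewrite [RHS]muleC -[X in _ = X * _](fineK fC) -nneseriesZl//.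
by congr (limn _); apply/funext => n; apply: eq_bigr => i _; rewrite (fineK fC) muleC; exact: IH.
Qed.

(** Dynkin's lemma in one argument, then in the other. *)
Lemma indep_generated G H : G `<=` measurable -> H `<=` measurable ->
  setI_closed G -> setI_closed H ->
  (forall A C, G A -> H C -> P (A `&` C) = P A * P C) ->
  forall A C, <<s G >> A -> <<s H >> C -> P (A `&` C) = P A * P C.
Proof.
move=> GM HM GI HI GH A C sA sC.
have mA : measurable A by apply: smallest_sub sA => //; exact: sigma_algebra_measurable.
rewrite setIC muleC; apply: (indep_generated_left HM HI mA) sC => C' HC'.
rewrite setIC muleC; apply: (indep_generated_left GM GI (HM _ HC')) sA => A' GA'.
exact: GH.
Qed.

End generated_independence.

Section walk_independence.
Context {R : realType} {d : measure_display} {Om : measurableType d}.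
Variable P : probability Om R.
Variables (B : nat -> R -> Om -> R) (e : nat -> Om -> R).
Hypotheses (mB : forall n t, 0 <= t -> mfun (B n t))
  (me : forall n, mfun (e n))
  (Be_independent : mutually_independent P (fun i : nat + nat =>
  match i with
  | inl n => sigma_process (B n) `[0, +oo[
  | inr n => sigma_rv (e n)
  end)).
Local Notation sB n := (sigma_process (B n) `[0, +oo[).
Local Notation se n := (sigma_rv (e n)).

(** A family stable under intersection that generates the sigma-algebra of the first n walks and
    thresholds; [walk_gen] does the same for the n-th. States have to be measurable for the past,
    not merely for Om, in order to be frozen. *)
Definition past_gen n : set (set Om) := [set A | exists E F : nat -> set Om,
  [/\ forall k, sB k (E k), forall k, se k (F k) &
      A = \bigcap_(k in [set k | (k < n)%N]) (E k `&` F k)]].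

Definition walk_gen n : set (set Om) := [set A | exists E F : set Om,
  [/\ sB n E, se n F & A = E `&` F]].

Let sBT n : sB n setT.
Proof. exact: (@measurableT _ (g_sigma_algebraType (history (B n) `[0, +oo[))). Qed.

Let seT n : se n setT.
Proof. by exists setT => //; rewrite preimage_setT setTI. Qed.

Let sBI n E E' : sB n E -> sB n E' -> sB n (E `&` E').
Proof. exact: (@measurableI _ (g_sigma_algebraType (history (B n) `[0, +oo[))). Qed.

Let seI n F F' : se n F -> se n F' -> se n (F `&` F').
Proof.
move=> [A mA <-] [A' mA' <-]; exists (A `&` A'); first exact: measurableI.
by rewrite !setTI preimage_setI.
Qed.

Let sBm n E : sB n E -> measurable E.
Proof.
apply: smallest_sub; first exact: sigma_algebra_measurable.
move=> A [t]; rewrite /= in_itv/= andbT => t0 [C mC <-]; exact: mB.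
Qed.

Let sem n F : se n F -> measurable F.
Proof. by move=> [A mA <-]; exact: me. Qed.

Lemma walk_indep n E A : sB n E -> measurable A -> P (E `&` e n @^-1` A) = (P E * P (e n @^-1` A))%E.
Proof.
move=> sE mA; have seA : se n (e n @^-1` A) by exists A => //; rewrite setTI.
have := @Be_independent [:: inl n; inr n] (fun i => if i is inl _ then E else e n @^-1` A).
rewrite !big_cons big_nil mule1 => <-//; last first.
  by move=> i; rewrite !inE => /orP[/eqP ->|/eqP ->].
congr (P _); apply/seteqP; split => w /=; first by move=> [h1 h2] [k|k] _.
by move=> h; split; [apply: (h (inl n))|apply: (h (inr n))]; rewrite /= !inE eqxx ?orbT.
Qed.

(** All the events form one finite family indexed by [nat + nat], the earlier walks in [s1] and the
    n-th in [s2]; [Be_independent] is applied to the whole family and to both halves. *)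
Let past_walk n (E F : nat -> set Om) (C1 C2 : set Om) :
  (forall k, sB k (E k)) -> (forall k, se k (F k)) -> sB n C1 -> se n C2 ->
  P (\bigcap_(k in [set k | (k < n)%N]) (E k `&` F k) `&` (C1 `&` C2)) =
  (P (\bigcap_(k in [set k | (k < n)%N]) (E k `&` F k)) * P (C1 `&` C2))%E.
Proof.
move=> hE hF h1 h2.
pose ev (i : nat + nat) := match i with
  | inl k => if k == n then C1 else E k | inr k => if k == n then C2 else F k end.
pose s1 : seq (nat + nat) := map inl (iota 0 n) ++ map inr (iota 0 n).
pose s2 : seq (nat + nat) := [:: inl n; inr n].
have hev i : (match i with inl k => sB k | inr k => se k end) (ev i).
  by case: i => k; rewrite /ev; case: eqP => [->|].
have in1 i : (i \in s1) = (match i with inl k => k < n | inr k => k < n end)%N.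
  have il : injective (inl : nat -> nat + nat) by move=> ? ? [].
  have ir : injective (inr : nat -> nat + nat) by move=> ? ? [].
  rewrite mem_cat; case: i => k.
    rewrite (mem_map il) mem_iota add0n /=; case: (k < n)%N => //=.
    by apply/negP => /mapP[].
  rewrite (mem_map ir) mem_iota add0n /= orbC; case: (k < n)%N => //=.
  by apply/negP => /mapP[].
have u1 : uniq s1.
  rewrite cat_uniq !map_inj_uniq ?iota_uniq//=; try by move=> ? ? [].
  by rewrite andbT; apply/hasPn => i /mapP[k _ ->]; apply/negP => /mapP[].
have u2 : uniq s2 by [].
have u12 : uniq (s1 ++ s2).
  rewrite cat_uniq u1 u2 andbT; apply/hasPn => i.
  by rewrite /s2 !inE /= => /orP[/eqP ->|/eqP ->]; rewrite in1 ltnn.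
have E1 : \bigcap_(k in [set k | (k < n)%N]) (E k `&` F k) = \bigcap_(i in [set` s1]) ev i.
  apply/seteqP; split => w /= h.
    by case=> k /=; rewrite in1 => kn; have [] := h k kn; rewrite ltn_eqF.
  move=> k /= kn; split; [have := h (inl k)|have := h (inr k)]; rewrite /= in1 kn ltn_eqF//; exact.
have E2 : C1 `&` C2 = \bigcap_(i in [set` s2]) ev i.
  apply/seteqP; split => w /=.
    by move=> [k1 k2] i; rewrite /s2 /= !inE => /orP[/eqP ->|/eqP ->]; rewrite /ev eqxx.
  by move=> h; split; [have := h (inl n)|have := h (inr n)]; rewrite /= /s2 !inE !eqxx ?orbT; exact.
have E12 : \bigcap_(i in [set` s1]) ev i `&` \bigcap_(i in [set` s2]) ev i = \bigcap_(i in [set` s1 ++ s2]) ev i.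
  apply/seteqP; split => w /=.
    by move=> [k1 k2] i; rewrite /= mem_cat => /orP[]; [exact: k1|exact: k2].
  by move=> h; split => i /= hi; apply: h; rewrite /= mem_cat hi ?orbT.
rewrite E1 E2 E12 (Be_independent u12 (fun i _ => hev i)) (Be_independent u1 (fun i _ => hev i)).
by rewrite (Be_independent u2 (fun i _ => hev i)) big_cat.
Qed.

Lemma past_walk_indep n A C : <<s past_gen n >> A -> <<s walk_gen n >> C ->
  P (A `&` C) = (P A * P C)%E.
Proof.
apply: indep_generated.
- move=> _ [E [F [hE hF ->]]]; apply: fin_bigcap_measurable => [|k _]; first exact: finite_II.
  by apply: measurableI; [exact: (sBm (hE k))|exact: (sem (hF k))].
- by move=> _ [E [F [hE hF ->]]]; apply: measurableI; [exact: (sBm hE)|exact: (sem hF)].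
- move=> _ _ [E [F [hE hF ->]]] [E' [F' [hE' hF' ->]]].
  exists (fun k => E k `&` E' k), (fun k => F k `&` F' k); split => [k|k|].
  + exact: sBI.
  + exact: seI.
  apply/seteqP; split => w /=; first by move=> [h1 h2] k kn; have [? ?] := h1 k kn; have [? ?] := h2 k kn.
  by move=> h; split => k kn; have [[? ?] [? ?]] := h k kn.
- move=> _ _ [E [F [hE hF ->]]] [E' [F' [hE' hF' ->]]].
  by exists (E `&` E'), (F `&` F'); split; [exact: sBI|exact: seI|rewrite setIACA].
by move=> _ _ [E [F [hE hF ->]]] [E' [F' [hE' hF' ->]]]; exact: past_walk.
Qed.

Lemma past_gen_le n : past_gen n `<=` past_gen n.+1.
Proof.
move=> _ [E [F [hE hF ->]]].
exists (fun k => if (k < n)%N then E k else setT), (fun k => if (k < n)%N then F k else setT); split => [k|k|].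
- by case: ifP => _; [exact: hE|exact: sBT].
- by case: ifP => _; [exact: hF|exact: seT].
apply/seteqP; split => w /= h k kn; first by case: ifP => // kn'; exact: h.
by have := h k (ltnW kn); rewrite kn.
Qed.

Lemma past_gen_measurable n : past_gen n `<=` measurable.
Proof.
move=> _ [E [F [hE hF ->]]]; apply: fin_bigcap_measurable => [|k _]; first exact: finite_II.
by apply: measurableI; [exact: (sBm (hE k))|exact: (sem (hF k))].
Qed.

Lemma walk_gen_measurable n : walk_gen n `<=` measurable.
Proof. by move=> _ [E [F [hE hF ->]]]; apply: measurableI; [exact: (sBm hE)|exact: (sem hF)]. Qed.

Let sB_gen n t A : 0 <= t -> measurable A -> sB n (B n t @^-1` A).
Proof.
move=> t0 mA; apply: sub_sigma_algebra; exists t; first by rewrite /= in_itv/= andbT.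
by exists A => //; rewrite setTI.
Qed.

Let walk_past n (E F : set Om) : sB n E -> se n F -> past_gen n.+1 (E `&` F).
Proof.
move=> hE hF; exists (fun k => if k == n then E else setT), (fun k => if k == n then F else setT); split => [k|k|].
- by case: eqP => [->|_]; [exact: hE|exact: sBT].
- by case: eqP => [->|_]; [exact: hF|exact: seT].
apply/seteqP; split => w /=; first by move=> h k kn; case: eqP.
by move=> /(_ n (ltnSn n)); rewrite eqxx.
Qed.

Lemma measurable_past_B n t : 0 <= t ->
  measurable_fun (setT : set (g_sigma_algebraType (past_gen n.+1))) (B n t).
Proof.
move=> t0 _ A mA; apply: sub_sigma_algebra; rewrite setTI -[X in past_gen _ X]setIT.
by apply: walk_past; [exact: sB_gen|exact: seT].
Qed.

Lemma measurable_past_e n :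
  measurable_fun (setT : set (g_sigma_algebraType (past_gen n.+1))) (e n).
Proof.
move=> _ A mA; apply: sub_sigma_algebra; rewrite setTI -[X in past_gen _ X]setTI.
by apply: walk_past; [exact: sBT|exists A => //; rewrite setTI].
Qed.

Lemma measurable_walk_B n t : 0 <= t ->
  measurable_fun (setT : set (g_sigma_algebraType (walk_gen n))) (B n t).
Proof.
move=> t0 _ A mA; apply: sub_sigma_algebra; rewrite setTI.
by exists (B n t @^-1` A), setT; rewrite setIT; split => //; exact: sB_gen.
Qed.

Lemma measurable_walk_e n :
  measurable_fun (setT : set (g_sigma_algebraType (walk_gen n))) (e n).
Proof.
move=> _ A mA; apply: sub_sigma_algebra; rewrite setTI.
by exists setT, (e n @^-1` A); rewrite setTI; split => //; exists A => //; rewrite setTI.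
Qed.

(** The past and the n-th walk may be run on two samples w and w': with w fixed, the walk starts in
    a deterministic state. *)
Lemma past_walk_integral n
  (h : g_sigma_algebraType (past_gen n) * g_sigma_algebraType (walk_gen n) -> \bar R) :
  mfun h -> (forall z, 0 <= h z)%E ->
  (\int[P]_w h (w, w) = \int[P]_w \int[P]_w' h (w, w'))%E.
Proof.
have gm (G : set (set Om)) : G `<=` measurable -> mfun (id : Om -> g_sigma_algebraType G).
  move=> GM _ A mA; rewrite setTI preimage_id.
  by apply: smallest_sub mA => //; exact: sigma_algebra_measurable.
move=> mh h0; have mX := gm _ (@past_gen_measurable n); have mY := gm _ (@walk_gen_measurable n).
exact: (@indep_integral _ _ _ P _ _ _ _ _ _ h mX mY (fun A C mA mC => past_walk_indep mA mC) mh h0).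
Qed.

End walk_independence.

(** * Measurability of states and of Green's functions *)

Section measurable_states.
Context {R : realType} {d : measure_display} {T : measurableType d}.
Implicit Types (S : T -> @gstate R) (p : T -> R).

(** f / (f ^ 2 + 1 / (n + 1)) converges everywhere to the inverse, including where f = 0 and the
    inverse is 0 by convention. *)
Lemma measurable_inv (f : T -> R) : mfun f -> mfun (fun w => (f w)^-1).
Proof.
move=> mf; apply: (@measurable_fun_cvg _ _ _ setT (fun n w => f w * (f w ^+ 2 + n.+1%:R^-1)^-1)) => //.
  move=> n; apply: (@measurable_cts_comp R _ T (fun z => z * (z ^+ 2 + n.+1%:R^-1)^-1) f) => // z.
  apply: cvgM; first exact: cvg_id.
  apply: cvgV; first by rewrite gt_eqF// ltr_wpDl// sqr_ge0.
  apply: cvgD; last exact: cvg_cst.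
  exact: exprn_continuous.
move=> w _; have [f0|f0] := eqVneq (f w) 0.
  rewrite f0 invr0; under eq_fun do rewrite mul0r; exact: cvg_cst.
rewrite [X in _ --> X](_ : _ = f w * (f w ^+ 2 + 0)^-1); last first.
  by rewrite addr0 expr2 invfM mulrA divff// mul1r.
apply: cvgM; first exact: cvg_cst.
apply: cvgV; first by rewrite addr0 expf_neq0.
by apply: cvgD; [exact: cvg_cst|exact: cvg_harmonic].
Qed.

(** Measurability at fixed arguments only: states are evaluated at given starting points and levels
    and at the infinite ends, never at a random place. *)
Definition mstate S := [/\ forall z, mfun (fun w => cov (S w) z),
  forall v, mfun (fun w => lo (S w) v) &
  forall v, mfun (fun w => hi (S w) v)].

Lemma mstate_step S p x : mstate S -> mfun p ->
  mstate (fun w => gstep x (p w) (S w)).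
Proof.
move=> [mc ml mh] mp; have mcx := measurable_neg (mc x).
have mmin : mfun (fun w => Num.min x (p w)) by apply: measurable_minr.
have mmax : mfun (fun w => Num.max x (p w)) by apply: measurable_maxr.
have mmine : mfun (fun w => (Num.min x (p w))%:E) by apply/measurable_EFinP.
have mmaxe : mfun (fun w => (Num.max x (p w))%:E) by apply/measurable_EFinP.
split=> z.
- rewrite (_ : (fun w => _) = (fun w => cov (S w) z ||
    (~~ cov (S w) x && ((Num.min x (p w) <= z)%R && (z <= Num.max x (p w))%R)))); last first.
    by apply/funext => w; rewrite /gstep; case: (boolP (cov (S w) x)) => //=; rewrite orbF.
  apply: measurable_or => //; apply: measurable_and => //.
  by apply: measurable_and; exact: measurable_fun_ler.
- rewrite (_ : (fun w => _) = (fun w => if ~~ cov (S w) x && ((Num.max x (p w))%:E <= z)%E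
    then maxe (lo (S w) z) (Num.max x (p w))%:E else lo (S w) z)); last first.
    by apply/funext => w; rewrite /gstep; case: (boolP (cov (S w) x)).
  apply: measurable_fun_ifT => //; last exact: measurable_maxe.
  by apply: measurable_and => //; exact: measurable_fun_lee.
rewrite (_ : (fun w => _) = (fun w => if ~~ cov (S w) x && (z <= (Num.min x (p w))%:E)%E
  then mine (hi (S w) z) (Num.min x (p w))%:E else hi (S w) z)); last first.
  by apply/funext => w; rewrite /gstep; case: (boolP (cov (S w) x)).
apply: measurable_fun_ifT => //; last exact: measurable_mine.
by apply: measurable_and => //; exact: measurable_fun_lee.
Qed.

Variables U D : R -> R.
Hypotheses (cU : continuous U) (cD : continuous D) (U0 : forall y, 0 < U y)
  (D0 : forall y, 0 < D y).

Lemma measurable_rho (f : T -> \bar R) : mfun f -> mfun (fun w => rho_of U D (f w)).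
Proof.
move=> mf; apply: (measurable_real_case _ mf (g := fun u => U u / D u)); apply: continuous_measurable_fun => z.
by apply: cvgM; [exact: cU|apply: cvgV; [rewrite gt_eqF|exact: cD]].
Qed.

Lemma measurable_lam (f : T -> \bar R) : mfun f -> mfun (fun w => lam_of U D (f w)).
Proof.
move=> mf; apply: (measurable_real_case _ mf (g := fun u => D u / U u)); apply: continuous_measurable_fun => z.
by apply: cvgM; [exact: cD|apply: cvgV; [rewrite gt_eqF|exact: cU]].
Qed.

Lemma measurable_gap_green (a c : T -> \bar R) (p q : T -> R) : mfun a ->
  mfun c -> mfun p -> mfun q ->
  mfun (fun w => gap_green U D (rho_of U D (a w)) (lam_of U D (c w)) (p w) (q w)).
Proof.
move=> ma mc mp mq; have mr := measurable_rho ma; have ml := measurable_lam mc.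
have mmin : mfun (fun w => Num.min (p w) (q w)) by exact: measurable_minr.
have mmax : mfun (fun w => Num.max (p w) (q w)) by exact: measurable_maxr.
have mUm := measurable_cts_comp cU mmin; have mDm := measurable_cts_comp cD mmin.
have mUM := measurable_cts_comp cU mmax; have mDM := measurable_cts_comp cD mmax.
rewrite /gap_green /up /down; apply: measurable_funM; last first.
  by apply: measurable_inv; apply: measurable_funB => //; exact: measurable_funM.
by apply: measurable_funM; apply: measurable_funB => //; exact: measurable_funM.
Qed.

End measurable_states.

(** * One step of the conservation law for Green's function *)

Section gap_step.
Context {R : realType} {d : measure_display} {Om : measurableType d} (kappa : borel_measure R) (kR : radon kappa).
Variables U D : R -> R.
Hypotheses (U0 : forall y, 0 < U y) (D0 : forall y, 0 < D y)
  (U_nd : forall y z, y <= z -> U y <= U z) (D_ni : forall y z, y <= z -> D z <= D y)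
  (U_ode : killed_ode kappa U) (D_ode : killed_ode kappa D)
  (W : forall y, D y * rderive U y - U y * rderive D y = 2).
Implicit Types (y z : R) (s : @gstate R).

Definition gamma_of s y : R := if cov s y then 0 else diag_green U D (lo s y%:E) (hi s y%:E) y.

Definition gap_density s x y : R :=
  if ~~ cov s x && (lo s x%:E < y%:E < hi s x%:E)%E
  then gap_green U D (rho_of U D (lo s x%:E)) (lam_of U D (hi s x%:E)) x y else 0.

Lemma gamma_ge0 s y : gap_ends s -> 0 <= gamma_of s y.
Proof.
move=> es; rewrite /gamma_of; case: ifPn => // fy; have g := gap_itv es fy.
exact: (green_ge0 kR U0 D0 U_nd D_ni U_ode D_ode W g g g).
Qed.

Lemma gap_density_ge0 s x y : gap_ends s -> 0 <= gap_density s x y.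
Proof.
move=> es; rewrite /gap_density; case: ifPn => // /andP[fx yg]; have g := gap_itv es fx.
exact: (green_ge0 kR U0 D0 U_nd D_ni U_ode D_ode W g g yg).
Qed.

Variable P : probability Om R.
Variables (x : R) (B : R -> Om -> R) (L : R -> R -> Om -> R) (e : Om -> R).
Hypotheses (BB : brownian_motion P x B) (LL : local_time P B L)
  (ee : exponential_rv P 1 e)
  (Be : forall E A, sigma_process B `[0, +oo[ E -> measurable A ->
  P (E `&` e @^-1` A) = (P E * P (e @^-1` A))%E).
Local Notation gp a c w := (gap_position kappa a c ((ext B)^~ w) (e w)).

(** One null set serves all the gaps at once, as required for a gap that depends on the sample. *)
Lemma walk_positions : {ae P, forall w, (0 <= killing_time kappa (fun t y => L t y w) (e w))%E /\
  forall a c, (a < x%:E < c)%E ->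
  (exists2 t, [/\ 0 <= t, forall u : R, 0 <= u -> u < t -> (a < (B u w)%:E < c)%E /\
      (u%:E < killing_time kappa (fun t y => L t y w) (e w))%E &
     [\/ (killing_time kappa (fun t y => L t y w) (e w) <= t%:E)%E, (B t w)%:E = a | (B t w)%:E = c]] &
    gp a c w = B t w) /\ (a <= (gp a c w)%:E <= c)%E}.
Proof.
apply: filterS2 (walk_good_unbounded BB LL ee) (killing_time_fin kR U0 D0 U_nd D_ni U_ode D_ode W BB LL ee Be).
move=> w [[cb cl l0 occ w0] [ub q0]] zf; split.
  by apply: le_ereal_inf_tmp => _ /= [t [t0 _] <-]; rewrite lee_fin.
move=> a c axc; have b0 : (a < (ext B 0 w)%:E < c)%E by rewrite extE// w0.
have zf' : (killing_time kappa (fun t y => ext_time L t y w) (e w) < +oo)%E by rewrite killing_time_ext.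
have [t ht] := position_time_ex cb ub b0 zf' q0.
have gpE := gap_position_at kR cb cl l0 occ ub b0 q0 ht.
have gpI := position_in_gap cb ht b0.
split; last by rewrite gpE.
case: ht => t0 before at_t; rewrite killing_time_ext extE// in before at_t gpE.
exists t => //; split => // u u0 ut.
by have := before u u0 ut; rewrite extE.
Qed.

Variable s : @gstate R.
Hypothesis es : gap_ends s.
Local Notation pw w := (gp (lo s x%:E) (hi s x%:E) w).

(** Nothing changes if x or y is covered, or if y is in another gap. If y is in the gap of x, on
    either side, this is [green_step_right] or [green_step_left]; if y = x, it gets covered and the
    density is the whole value lost. *)
Lemma gamma_step y :
  (\int[P]_w (gamma_of (gstep x (pw w) s) y)%:E + (gap_density s x y)%:E = (gamma_of s y)%:E)%E.
Proof.
have cst_int := integral_cst_prob P.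
have [fx|fx] := boolP (cov s x).
  under eq_integral do rewrite /gstep fx.
  by rewrite cst_int /gap_density fx adde0.
have gx := gap_itv es fx.
have [cy|fy] := boolP (cov s y).
  under eq_integral do rewrite /gamma_of cov_step//.
  rewrite cst_int /gap_density /gamma_of cy fx /= add0e; case: ifPn => // /(gap_free es fx).
  by rewrite cy.
have [yg|ny] := boolP (lo s x%:E < y%:E < hi s x%:E)%E; last first.
  have ml : mfun (fun w => pw w) by exact: (measurable_gp kR BB ee).
  rewrite /gap_density (negbTE ny) andbF adde0 -[RHS]cst_int.
  have ms : mstate (fun _ : Om => s) by split.
  have [mc mlo mhi] := mstate_step x ms ml.
  have cU := continuous_U kR U0 U_ode; have cD := continuous_D kR D0 D_ode.
  apply: ge0_ae_eq_integral => //.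
  - apply/measurable_EFinP; apply: measurable_fun_ifT => //.
    exact: (measurable_gap_green cU cD U0 D0).
  - by move=> w _; rewrite lee_fin gamma_ge0//; exact: gap_ends_step.
  - by move=> w _; rewrite lee_fin gamma_ge0.
  apply: filterS walk_positions => w [_ /(_ _ _ gx)[_ pI]] _; congr EFin.
  have [k1 k2 k3] := gstep_other es fx fy pI ny.
  by rewrite /gamma_of (negbTE k1) (negbTE fy) k2 k3.
rewrite /gap_density fx yg /=.
have gamE : gamma_of s y = diag_green U D (lo s x%:E) (hi s x%:E) y.
  by rewrite /gamma_of (negbTE fy) (lo_gap es fx yg) (hi_gap es fx yg).
have /andP[ly yh] := yg.
case: (ltgtP x y) => [xy|yx|xy].
- under eq_integral.
    move=> w _; have [k1 k2 k3] := gstep_right es (pw w) fx xy yh.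
    rewrite (_ : gamma_of _ _ = if pw w < y then diag_green U D (Num.max x (pw w))%:E (hi s x%:E) y else 0); last first.
      by rewrite /gamma_of k1 k3 leNgt if_neg; case: ifPn => // /k2 ->.
    over.
  rewrite (green_step_right kR U0 D0 U_nd D_ni U_ode D_ode W BB LL ee Be gx)//.
  by rewrite gamE -EFinD subrK.
- under eq_integral.
    move=> w _; have [k1 k2 k3] := gstep_left es (pw w) fx yx ly.
    rewrite (_ : gamma_of _ _ = if y < pw w then diag_green U D (lo s x%:E) (Num.min x (pw w))%:E y else 0); last first.
      by rewrite /gamma_of k1 k3 leNgt if_neg; case: ifPn => // /k2 ->.
    over.
  rewrite (green_step_left kR U0 D0 U_nd D_ni U_ode D_ode W BB LL ee Be gx)//.
  by rewrite gamE -EFinD subrK.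
rewrite -xy; under eq_integral do rewrite /gamma_of cov_step_start.
by rewrite cst_int add0e /gamma_of (negbTE fx).
Qed.

Lemma new_mass (A : set (measurableTypeR R)) : measurable A ->
  (\int[P]_w ((~~ cov s x && (lo s x%:E < (pw w)%:E < hi s x%:E)%E && (pw w \in A))%:R : R)%:E =
   \int[kappa]_(y in A) (gap_density s x y)%:E)%E.
Proof.
move=> mA; have [fx|fx] := boolP (cov s x).
  by rewrite /gap_density fx /= !integral0_eq.
have gx := gap_itv es fx; have mg := measurable_gp kR BB ee (lo s x%:E) (hi s x%:E).
have mpwE : mfun (fun w => (pw w)%:E) by apply/measurable_EFinP.
have mE : measurable [set w | A (pw w) /\ (lo s x%:E < (pw w)%:E < hi s x%:E)%E].
  have -> : [set w | A (pw w) /\ (lo s x%:E < (pw w)%:E < hi s x%:E)%E] =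
     (fun w => pw w) @^-1` A `&` ((fun w => (lo s x%:E < (pw w)%:E)%E && ((pw w)%:E < hi s x%:E)%E) @^-1` [set true]).
    by apply/seteqP; split => w /= [].
  apply: measurableI; first by rewrite -[X in measurable X]setTI; exact: mg.
  rewrite -[X in measurable X]setTI; apply: measurable_and => //; exact: measurable_fun_lte.
transitivity (P [set w | A (pw w) /\ (lo s x%:E < (pw w)%:E < hi s x%:E)%E]).
  rewrite -[in RHS](setIT [set w | _]) -integral_indic//; apply: eq_integral => w _; congr EFin.
  rewrite indicE /=; congr (nat_of_bool _)%:R; apply/idP/idP.
    by move=> /andP[h1]; rewrite !inE.
  by rewrite !inE => -[h1 ->]; rewrite in_setE.
rewrite (gap_law kR U0 D0 U_nd D_ni U_ode D_ode W BB LL ee Be gx mA).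
rewrite [LHS]integral_mkcond [RHS]integral_mkcond; apply: eq_integral => y _.
rewrite /patch /gap_density fx in_setI /=; case: (y \in A) => //=.
have [h|h] := boolP (lo s x%:E < y%:E < hi s x%:E)%E; first by rewrite mem_set.
by rewrite memNset//; apply/negP.
Qed.

End gap_step.

Section kappa_sigma_finite.
Context {R : realType} (kappa : borel_measure R) (kR : radon kappa).

Lemma radon_sigma_finite : sigma_finite setT kappa.
Proof.
exists (fun n : nat => `]- n%:R, n%:R]%classic) => [|n]; last first.
  by split; [exact: measurable_itv|exact: radon_itv].
apply/esym/seteqP; split => // y _; exists (Num.bound `|y|).+1 => //=.
have := archi_boundP (normr_ge0 y); rewrite ltr_norml => /andP[h1 h2].
by rewrite in_itv/= -addn1 natrD; apply/andP; split; lra.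
Qed.

End kappa_sigma_finite.

Section radon_measure.
Context {R : realType}.
Variable kappa : borel_measure R.

(** An alias of kappa that carries the sigma-finite structure required by Tonelli's theorem. *)
Definition radon_measure (_ : radon kappa) : set (measurableTypeR R) -> \bar R := kappa.

Hypothesis kR : radon kappa.
HB.instance Definition _ := Measure.copy (radon_measure kR) kappa.
HB.instance Definition _ := @Measure_isSigmaFinite.Build _ _ _ (radon_measure kR) (radon_sigma_finite kR).

End radon_measure.

Section kappa_tonelli.
Context {R : realType} {d : measure_display} {Om : measurableType d} (P : probability Om R) (kappa : borel_measure R) (kR : radon kappa).

Lemma kappa_tonelli (h : Om * measurableTypeR R -> \bar R) (A : set (measurableTypeR R)) :
  measurable A -> mfun h -> (forall z, 0 <= h z)%E ->
  (\int[P]_w \int[kappa]_(y in A) h (w, y) = \int[kappa]_(y in A) \int[P]_w h (w, y))%E.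
Proof.
move=> mA mh h0.
pose k : {sigma_finite_measure set (measurableTypeR R) -> \bar R} := radon_measure kR.
pose h' (z : Om * measurableTypeR R) := (h z * (\1_A z.2)%:E)%E.
have mh' : mfun h'.
  apply: emeasurable_funM => //; apply/measurable_EFinP.
  by apply: measurableT_comp => //; exact: measurable_indic.
have h'0 z : (0 <= h' z)%E by rewrite mule_ge0// lee_fin.
have E1 w y : h' (w, y) = (if y \in A then h (w, y) else 0%E).
  by rewrite /h' /= indicE; case: (y \in A); rewrite ?mule1 ?mule0.
transitivity (\int[P]_w \int[k]_y h' (w, y))%E.
  apply: eq_integral => w _; rewrite integral_mkcond; apply: eq_integral => y _.
  by rewrite E1.
rewrite (@fubini_tonelli _ _ _ _ _ P k h' mh' h'0) [RHS]integral_mkcond; apply: eq_integral => y _.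
rewrite /patch; under eq_integral do rewrite E1.
by case: ifP => // _; rewrite integral0.
Qed.

End kappa_tonelli.

Lemma mstate_cst {R : realType} {d : measure_display} (T : measurableType d) (s : @gstate R) :
  mstate (fun _ : T => s).
Proof. by split=> v; exact: measurable_cst. Qed.

(** * The martingales along the whole run *)

Section walks.
Context {R : realType} {d : measure_display} {Om : measurableType d} (P : probability Om R) (kappa : borel_measure R) (kR : radon kappa).
Variables U D : R -> R.
Hypotheses (U0 : forall y, 0 < U y) (D0 : forall y, 0 < D y)
  (U_nd : forall y z, y <= z -> U y <= U z) (D_ni : forall y z, y <= z -> D z <= D y)
  (U_ode : killed_ode kappa U) (D_ode : killed_ode kappa D)
  (W : forall y, D y * rderive U y - U y * rderive D y = 2).
Variables (x : nat -> R) (B : nat -> R -> Om -> R) (L : nat -> R -> R -> Om -> R) (e : nat -> Om -> R).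
Hypotheses (x_dense : dense (range x)) (BB : forall n, brownian_motion P (x n) (B n))
  (LL : forall n, local_time P (B n) (L n)) (ee : forall n, exponential_rv P 1 (e n))
  (Be_independent : mutually_independent P (fun i : nat + nat =>
    match i with
    | inl n => sigma_process (B n) `[0, +oo[
    | inr n => sigma_rv (e n)
    end)).
Implicit Types (y z r t : R) (n k : nat) (A : set (measurableTypeR R)).

Definition bpos w n (a c : \bar R) : R := gap_position kappa a c ((ext (B n))^~ w) (e n w).
Definition wst n w := gseq x (bpos w) n.
Definition wpos n w := gpos x (bpos w) n.
Definition wnew n w := is_new x (bpos w) n.

Let mB n t : 0 <= t -> mfun (B n t). Proof. by case: (BB n) => + _ _ _ _; apply. Qed.
Let me n : mfun (e n). Proof. by case: (ee n). Qed.
Let Be n := @walk_indep _ _ _ P B e Be_independent n.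
Local Notation past n := (g_sigma_algebraType (past_gen B e n)).
Local Notation walkT n := (g_sigma_algebraType (walk_gen B e n)).

Lemma ends_wst n w : gap_ends (wst n w). Proof. exact: gap_ends_seq. Qed.

Lemma mstate_sub G H (S : Om -> @gstate R) : G `<=` H ->
  mstate (S : g_sigma_algebraType G -> _) -> mstate (S : g_sigma_algebraType H -> _).
Proof. by move=> GH [h1 h2 h3]; split=> v; [apply: (sub_generated GH (h1 v))|apply: (sub_generated GH (h2 v))|apply: (sub_generated GH (h3 v))]. Qed.

Lemma past_wpos n : mstate (wst n : past n -> _) -> measurable_fun (setT : set (past n.+1)) (wpos n).
Proof.
move=> ms; have [_ ml mh] := mstate_sub (@past_gen_le _ _ _ B e n) ms.
apply: (@measurable_gap_position _ _ (past n.+1) kappa kR (fun w => lo (wst n w) (x n)%:E) (fun w => hi (wst n w) (x n)%:E) (ext (B n))) => //.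
  by move=> s s0; apply: measurable_past_B; rewrite le_max lexx orbT.
exact: measurable_past_e.
Qed.

Lemma past_wst n : mstate (wst n : past n -> _).
Proof.
elim: n => [|n IH]; first by split.
apply: (@mstate_step _ _ (past n.+1) (wst n) (wpos n) (x n)); last exact: past_wpos.
exact: mstate_sub (@past_gen_le _ _ _ B e n) IH.
Qed.

Lemma measurable_wst n : mstate (wst n).
Proof.
have [h1 h2 h3] := past_wst n; have GM := past_gen_measurable mB me (n := n).
by split=> v; [apply: (measurable_generated GM (h1 v))|apply: (measurable_generated GM (h2 v))|apply: (measurable_generated GM (h3 v))].
Qed.

Lemma measurable_wpos n : mfun (wpos n).
Proof. exact: (measurable_generated (past_gen_measurable mB me (n := n.+1)) (past_wpos (past_wst n))). Qed.

(* The position of the n-th walk when the state is that of another sample. *)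
Definition mixpos n (z : past n * walkT n) : R :=
  gap_position kappa (lo (wst n z.1) (x n)%:E) (hi (wst n z.1) (x n)%:E) ((ext (B n))^~ z.2) (e n z.2).

Lemma mstate_fst n : mstate (fun z : past n * walkT n => wst n z.1).
Proof.
have [h1 h2 h3] := past_wst n.
by split=> v; [apply: (measurableT_comp (h1 v))|apply: (measurableT_comp (h2 v))|apply: (measurableT_comp (h3 v))]; exact: measurable_fst.
Qed.

Lemma measurable_mixpos n : mfun (@mixpos n).
Proof.
have [_ ml mh] := mstate_fst n.
apply: (measurable_gap_position kR (X := fun (s : R) (u : past n * walkT n) => ext (B n) s u.2)
  (q := fun u : past n * walkT n => e n u.2) (ml (x n)%:E) (mh (x n)%:E)).
  move=> s s0; have ms : measurable_fun (setT : set (walkT n)) (ext (B n) s).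
    by apply: measurable_walk_B; rewrite le_max lexx orbT.
  by apply: (measurableT_comp ms); exact: measurable_snd.
by apply: (measurableT_comp (@measurable_walk_e _ _ _ B e n)); exact: measurable_snd.
Qed.

Lemma mstate_mix n : mstate (fun z : past n * walkT n => gstep (x n) (mixpos z) (wst n z.1)).
Proof. by apply: mstate_step; [exact: mstate_fst|exact: measurable_mixpos]. Qed.

Let cU : continuous U := continuous_U kR U0 U_ode.
Let cD : continuous D := continuous_D kR D0 D_ode.

Lemma measurable_gamma d' (T : measurableType d') (S : T -> @gstate R) y : mstate S ->
  mfun (fun w => (gamma_of U D (S w) y)%:E).
Proof.
move=> [mc ml mh]; apply/measurable_EFinP; apply: measurable_fun_ifT => //.
exact: (measurable_gap_green cU cD U0 D0).
Qed.

Lemma measurable_density d' (T : measurableType d') (S : T -> @gstate R) (q : T -> R) z : mstate S ->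
  mfun q -> mfun (fun w => (gap_density U D (S w) z (q w))%:E).
Proof.
move=> [mc ml mh] mq; have mqe : mfun (fun w => (q w)%:E) by apply/measurable_EFinP.
apply/measurable_EFinP; apply: measurable_fun_ifT => //.
  apply: measurable_and; first exact: measurable_neg.
  by apply: measurable_and; exact: measurable_fun_lte.
by apply: (measurable_gap_green cU cD U0 D0).
Qed.

Definition mean_gamma n y : \bar R := (\int[P]_w (gamma_of U D (wst n w) y)%:E)%E.
Definition mean_density n y : \bar R := (\int[P]_w (gap_density U D (wst n w) (x n) y)%:E)%E.

Let g0 s y := @gamma_ge0 _ _ kR U D U0 D0 U_nd D_ni U_ode D_ode W s y.
Let d0 s z y := @gap_density_ge0 _ _ kR U D U0 D0 U_nd D_ni U_ode D_ode W s z y.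

(** [past_walk_integral] freezes the state left by the first n walks, and [gamma_step] applies to
    the n-th walk started in it. *)
Lemma gamma_recur n y : (mean_gamma n.+1 y + mean_density n y = mean_gamma n y)%E.
Proof.
have mw := measurable_wst.
rewrite /mean_gamma /mean_density -ge0_integralD//; last 4 first.
- by move=> w _; rewrite lee_fin g0//; exact: ends_wst.
- exact: measurable_gamma.
- by move=> w _; rewrite lee_fin d0//; exact: ends_wst.
- exact: measurable_density.
pose h (z : past n * walkT n) := ((gamma_of U D (gstep (x n) (mixpos z) (wst n z.1)) y)%:E +
  (gap_density U D (wst n z.1) (x n) y)%:E)%E.
have mh : mfun h.
  apply: emeasurable_funD; first exact: measurable_gamma (mstate_mix n).
  by apply: measurable_density; [exact: mstate_fst|].
have h0 (z : past n * walkT n) : (0 <= h z)%E.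
  by rewrite adde_ge0// lee_fin; [apply: g0; apply: gap_ends_step; exact: ends_wst|apply: d0; exact: ends_wst].
rewrite (past_walk_integral mB me Be_independent mh h0).
apply: eq_integral => w _; rewrite /h /=.
have es := ends_wst n w.
rewrite ge0_integralD//; last 3 first.
- by move=> w' _; rewrite lee_fin g0//; exact: gap_ends_step.
- have mg := measurable_gp kR (BB n) (ee n) (lo (wst n w) (x n)%:E) (hi (wst n w) (x n)%:E).
  have ms : mstate (fun _ : Om => wst n w) by split.
  exact: (measurable_gamma y (mstate_step (x n) ms mg)).
- by move=> w' _; rewrite lee_fin d0.
rewrite integral_cst// [X in (_ + _ * X)%E](probability_setT P : _ = _) mule1.
have gs := gamma_step kR U0 D0 U_nd D_ni U_ode D_ode W (BB n) (LL n) (ee n) (Be (n := n)) es y.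
exact: gs.
Qed.

(** Telescoping; in the empty state rho = lam = 0, and Green's function at (y, y) is U y * D y. *)
Lemma gamma_sum n y : (\sum_(k < n) mean_density k y + mean_gamma n y = (U y * D y)%:E)%E.
Proof.
elim: n => [|n IH]; last by rewrite big_ord_recr /= -addeA [X in (_ + X)%E]addeC gamma_recur.
rewrite big_ord0 add0e /mean_gamma (eq_integral (fun=> (U y * D y)%:E)); last first.
  move=> w _; rewrite /gamma_of /= /diag_green gap_green_le// /up /down /=.
  by rewrite !mul0r !subr0 invr1 mulr1.
exact: integral_cst_prob.
Qed.

(** Given the past, [new_mass] provides the density of a new point; averaging over the past is
    Tonelli's theorem. *)
Lemma new_mean n A : measurable A ->
  (\int[P]_w ((wnew n w && (wpos n w \in A))%:R : R)%:E = \int[kappa]_(y in A) mean_density n y)%E.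
Proof.
move=> mA.
pose h (z : past n * walkT n) := (((~~ cov (wst n z.1) (x n) && (lo (wst n z.1) (x n)%:E < (mixpos z)%:E < hi (wst n z.1) (x n)%:E)%E
  && (mixpos z \in A))%:R : R)%:E)%E.
have [mc ml mh] := mstate_fst n; have mp := @measurable_mixpos n.
have mpe : mfun (fun z : past n * walkT n => (@mixpos n z)%:E) by apply/measurable_EFinP.
have mh' : mfun h.
  apply/measurable_EFinP; rewrite (_ : (fun u => _) = (fun z : past n * walkT n => if (~~ cov (wst n z.1) (x n) && (lo (wst n z.1) (x n)%:E < (mixpos z)%:E < hi (wst n z.1) (x n)%:E)%E
  && (mixpos z \in A)) then 1 else 0)); last by apply/funext => u; case: ifP.
  apply: measurable_fun_ifT => //; apply: measurable_and.
    apply: measurable_and; first exact: measurable_neg.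
    by apply: measurable_and; exact: measurable_fun_lte.
  apply: (measurable_fun_bool true); rewrite setTI.
  rewrite (_ : _ @^-1` _ = @mixpos n @^-1` A); first by rewrite -[X in measurable X]setTI; exact: mp.
  by apply/seteqP; split => u /= k; [exact: set_mem|exact: mem_set].
have h0 (z : past n * walkT n) : (0 <= h z)%E by rewrite lee_fin.
have := past_walk_integral mB me Be_independent mh' h0; rewrite /h /= => ->.
transitivity (\int[P]_w \int[kappa]_(y in A) (gap_density U D (wst n w) (x n) y)%:E)%E.
  apply: eq_integral => w _.
  exact: (new_mass kR U0 D0 U_nd D_ni U_ode D_ode W (BB n) (LL n) (ee n) (Be (n := n)) (ends_wst n w) mA).
have [mc' ml' mh''] := measurable_wst n.
apply: (@kappa_tonelli _ _ _ P kappa kR (fun z : Om * measurableTypeR R => (gap_density U D (wst n z.1) (x n) z.2)%:E)) => //.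
  have ms : mstate (fun u : Om * measurableTypeR R => wst n u.1).
    by split=> v; [apply: (measurableT_comp (mc' v))|apply: (measurableT_comp (ml' v))|apply: (measurableT_comp (mh'' v))]; exact: measurable_fst.
  have mq : mfun (fun u : Om * measurableTypeR R => u.2 : R) by exact: measurable_snd.
  exact: (measurable_density (x n) ms mq).
by move=> u; rewrite lee_fin d0//; exact: ends_wst.
Qed.

(** Once x i is covered, the gap of an uncovered y starts at some r >= x i. The bound is the value
    at (y, y) for the larger gap ]x i, +oo[, and Green's function increases with the gap. *)
Lemma gamma_le n i y w : (i < n)%N -> x i < y ->
  gamma_of U D (wst n w) y <= (U y - U (x i) / D (x i) * D y) * D y.
Proof.
move=> ni xy; have UDle z z' : z <= z' -> U z / D z <= U z' / D z'.
  move=> zz; rewrite ler_pM ?invr_ge0 ?(ltW (U0 _)) ?(ltW (D0 _)) ?U_nd//.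
  by rewrite lef_pV2 ?posrE// D_ni.
rewrite /gamma_of; case: ifPn => fy.
  rewrite mulr_ge0 ?(ltW (D0 _))// subr_ge0 -ler_pdivlMr//; exact: UDle (ltW xy).
have es := ends_wst n w; have g := gap_itv es fy.
have Delta0 := ext_det_gt0 kR U0 D0 U_nd D_ni U_ode D_ode W g.
have [r loE ry] : exists2 r, lo (wst n w) y%:E = r%:E & x i <= r < y.
  have ci : cov (wst n w) (x i) by exact: cov_start.
  have xlo : ((x i)%:E <= lo (wst n w) y%:E)%E.
    by case: (es) => _ _ h _; apply: h => //; rewrite lee_fin ltW.
  case: (es) => /(_ y%:E)[e0|[r e0 [cr _]]] _ _ _; first by move: xlo; rewrite e0 leNgt ltNyr.
  exists r => //; rewrite -lee_fin -lte_fin -e0 xlo /=; by case/andP: g.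
rewrite /diag_green gap_green_le// /up /down; move: Delta0; rewrite loE /=.
have l0 := lam_of_ge0 U0 D0 (hi (wst n w) y%:E); move: (lam_of _ _ _) l0 => l l0 Delta0.
have /andP[xr ry'] := ry; have rhor := UDle _ _ xr; have rhoy := UDle _ _ (ltW ry').
move: (U r / D r) (U (x i) / D (x i)) rhor rhoy Delta0 => rho rx rhor rhoy Delta0.
have rhoD : rho * D y <= U y by rewrite -ler_pdivlMr.
rewrite ler_pdivrMr//.
have a1 : 0 <= U y - rho * D y by rewrite subr_ge0.
have a2 : U y - rho * D y <= U y - rx * D y by rewrite lerB// ler_wpM2r// ltW.
have a3 : D y - l * U y <= D y * (1 - rho * l).
  by have := ler_wpM2l l0 rhoD; lra.
have a4 : 0 <= D y * (1 - rho * l) by rewrite mulr_ge0// ltW.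
rewrite -mulrA; apply: (@le_trans _ _ ((U y - rho * D y) * (D y * (1 - rho * l)))).
  exact: ler_wpM2l.
exact: ler_wpM2r.
Qed.

Lemma dense_itv (u v : R) : u < v -> exists i, u < x i < v.
Proof.
move=> uv; have [z [/= zI [i _ xz]]] : (`]u, v[%classic `&` range x) !=set0.
  apply: x_dense; last exact: itv_open.
  by exists ((u + v) / 2); rewrite /= in_itv/= !midf_lt.
by exists i; move: zI; rewrite in_itv/= -xz.
Qed.

(** The bound of [gamma_le] is continuous in the starting point and vanishes at y; density provides
    a starting point just to the left of y. *)
Lemma mean_gamma_small y (eps : R) : 0 < eps -> exists N, forall n, (N <= n)%N -> (mean_gamma n y <= eps%:E)%E.
Proof.
move=> eps0; pose f z := (U y - U z / D z * D y) * D y.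
have cf : {for y, continuous f}.
  apply: cvgM; last exact: cvg_cst.
  apply: cvgB; first exact: cvg_cst.
  apply: cvgM; last exact: cvg_cst.
  by apply: cvgM; [exact: cU|apply: cvgV; [rewrite gt_eqF|exact: cD]].
have /cvgrPdist_lt /(_ _ eps0)[r /= r0 hr] := cf.
have fy : f y = 0 by rewrite /f divfK ?subrr ?mul0r// gt_eqF.
have [i /andP[i1 i2]] : exists i, y - r < x i < y by apply: dense_itv; rewrite gtrBl.
exists i.+1 => n ni; have fi : f (x i) <= eps.
  have := hr (x i); rewrite /ball_/= => /(_ _).
  rewrite ger0_norm ?subr_ge0 ?(ltW i2)// => /(_ _).
  have -> : y - x i < r by lra.
  by move=> /(_ isT); rewrite fy sub0r normrN => /ltW; apply: le_trans; exact: ler_norm.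
apply: (@le_trans _ _ (\int[P]_w eps%:E)%E); last first.
  by rewrite integral_cst_prob.
apply: ge0_le_integral => //.
- by move=> w _; rewrite lee_fin g0//; exact: ends_wst.
- exact: measurable_gamma (measurable_wst n).
by move=> w _; rewrite lee_fin; apply: le_trans fi; exact: gamma_le.
Qed.

Lemma mean_density_ge0 n y : (0 <= mean_density n y)%E.
Proof. by apply: integral_ge0 => w _; rewrite lee_fin d0//; exact: ends_wst. Qed.

Lemma density_series y : (\sum_(k <oo) mean_density k y = (U y * D y)%:E)%E.
Proof.
have mg0 n : (0 <= mean_gamma n y)%E.
  by apply: integral_ge0 => w _; rewrite lee_fin g0//; exact: ends_wst.
apply/eqP; rewrite eq_le; apply/andP; split.
  apply: lime_le; first by apply: is_cvg_nneseries => n _ _; exact: mean_density_ge0.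
  by apply: nearW => n; rewrite big_mkord -(gamma_sum n y) leeDl.
apply/lee_addgt0Pr => eps eps0; have [N hN] := mean_gamma_small y eps0.
rewrite -(gamma_sum N y); apply: leeD; last exact: hN.
rewrite -(big_mkord xpredT (fun k => mean_density k y)); apply: nneseries_lim_ge.
by move=> k _ _; exact: mean_density_ge0.
Qed.

Definition new_in A n w : \bar R := ((wnew n w && (wpos n w \in A))%:R : R)%:E.

Lemma measurable_new n : mfun (wnew n).
Proof.
have [mc ml mh] := measurable_wst n; have mp : mfun (fun w => (wpos n w)%:E) by apply/measurable_EFinP; exact: measurable_wpos.
apply: measurable_and; first exact: measurable_neg.
by apply: measurable_and; exact: measurable_fun_lte.
Qed.

Lemma measurable_new_in A n : measurable A -> mfun (new_in A n).
Proof.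
move=> mA; apply/measurable_EFinP.
rewrite (_ : (fun w => _) = (fun w => if wnew n w && (wpos n w \in A) then 1 else 0)); last by apply/funext => w; case: ifP.
apply: measurable_fun_ifT => //; apply: measurable_and; first exact: measurable_new.
apply: (measurable_fun_bool true); rewrite setTI.
rewrite (_ : _ @^-1` _ = wpos n @^-1` A); first by rewrite -[X in measurable X]setTI; exact: measurable_wpos.
by apply/seteqP; split => u /= k; [exact: set_mem|exact: mem_set].
Qed.

Lemma new_total A : measurable A ->
  (\int[P]_w \sum_(n <oo) new_in A n w = \int[kappa]_(y in A) (U y * D y)%:E)%E.
Proof.
move=> mA; rewrite integral_nneseries//; last 2 first.
- by move=> n; exact: measurable_new_in.
- by move=> n w _; rewrite lee_fin.
under [RHS]eq_integral do rewrite -density_series.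
rewrite integral_nneseries//; last 2 first.
- move=> n; apply: measurable_funTS.
  pose f (u : Om * measurableTypeR R) := (gap_density U D (wst n u.1) (x n) u.2)%:E.
  have mf : mfun f.
    have [mc ml mh] := measurable_wst n.
    have ms : mstate (fun u : Om * measurableTypeR R => wst n u.1).
      by split=> v; [apply: (measurableT_comp (mc v))|apply: (measurableT_comp (ml v))|apply: (measurableT_comp (mh v))]; exact: measurable_fst.
    have mq : mfun (fun u : Om * measurableTypeR R => u.2 : R) by exact: measurable_snd.
    exact: (measurable_density (x n) ms mq).
  have f0 u : (0 <= f u)%E by rewrite lee_fin d0//; exact: ends_wst.
  exact: (@measurable_fun_fubini_tonelli_G _ _ _ _ _ P f mf f0).
- by move=> n y _; exact: mean_density_ge0.
by congr (limn _); apply/funext => n; apply: eq_bigr => k _; exact: new_mean.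
Qed.

Lemma good_walks : {ae P, forall w,
  killing_points kappa x B L e w = [set wpos k w | k in [set k | wnew k w]] /\
  forall n (a c : \bar R), (a < (x n)%:E < c)%E -> (a <= (bpos w n a c)%:E <= c)%E}.
Proof.
have /ae_foralln hn : forall n, _ :=
  fun n => walk_positions kR U0 D0 U_nd D_ni U_ode D_ode W (BB n) (LL n) (ee n) (Be (n := n)).
apply: filterS hn => w hw; have posP n (a c : \bar R) : (a < (x n)%:E < c)%E -> (a <= (bpos w n a c)%:E <= c)%E.
  by have [_ h] := hw n; move=> /h[].
split => //; apply: (@wilson_pointsE _ x (bpos w) posP (fun n t => B n t w)) => n.
  by have [] := hw n.
by move=> a c axc; have [_ h] := hw n; have [] := h a c axc.
Qed.

(** By [new_inj] the singletons of the successful walks are disjoint, so the counting measure is the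
    number of these walks. *)
Lemma counting_points A : measurable A -> {ae P, forall w,
  counting (killing_points kappa x B L e w `&` A) = (\sum_(n <oo) new_in A n w)%E}.
Proof.
move=> mA; apply: filterS good_walks => w [-> _].
pose F n : set (measurableTypeR R) := if wnew n w && (wpos n w \in A) then [set wpos n w] else set0.
have -> : [set wpos k w | k in [set k | wnew k w]] `&` A = \bigcup_n F n.
  apply/seteqP; split => z /=.
    by move=> [[k nk <-] Ak]; exists k => //; rewrite /F nk mem_set.
  by move=> [k _]; rewrite /F; case: ifPn => // /andP[nk /set_mem Ak] ->; split => //; exists k.
rewrite (measure_bigcup counting)//; last 2 first.
- by move=> n _; rewrite /F; case: ifP.
- move=> n k _ _ [z []]; rewrite /F; case: ifPn => // /andP[n1 _] -> ; case: ifPn => // /andP[n2 _].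
  by move=> /(new_inj n1 n2).
congr (limn _); apply/funext => n; apply: eq_big => [k|k _]; first by rewrite in_setT.
rewrite /F /new_in /=; case: ifP => _; last exact: measure0.
by rewrite /counting asboolT// fset_set1 finmap.cardfs1.
Qed.

Lemma mix_measurable n (h : past n * walkT n -> \bar R) : mfun h ->
  (forall u, 0 <= h u)%E -> mfun (fun w : Om => \int[P]_w' h (w, w'))%E.
Proof.
move=> mh h0; have gm (G : set (set Om)) : G `<=` measurable -> mfun (id : Om -> g_sigma_algebraType G).
  move=> GM _ A mA; rewrite setTI preimage_id.
  by apply: smallest_sub mA => //; exact: sigma_algebra_measurable.
have m1 : mfun (fun u : Om * Om => (u.1 : past n)).
  by apply: (measurableT_comp (gm _ (past_gen_measurable mB me (n := n)))); exact: measurable_fst.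
have m2 : mfun (fun u : Om * Om => (u.2 : walkT n)).
  by apply: (measurableT_comp (gm _ (walk_gen_measurable mB me (n := n)))); exact: measurable_snd.
pose h2 (u : Om * Om) := h (u.1, u.2).
have mh2 : mfun h2 by apply: (measurableT_comp mh); exact: measurable_fun_pair.
exact: (@measurable_fun_fubini_tonelli_F _ _ _ _ _ P h2 mh2 (fun u => h0 _)).
Qed.

Lemma past_new n : @measurable_fun _ _ (past n.+1) bool setT (wnew n).
Proof.
have [mc ml mh] := mstate_sub (@past_gen_le _ _ _ B e n) (past_wst n).
have mp : measurable_fun (setT : set (past n.+1)) (fun w => (wpos n w)%:E) by apply/measurable_EFinP; exact: past_wpos (past_wst n).
apply: measurable_and; first exact: measurable_neg.
by apply: measurable_and; exact: measurable_fun_lte.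
Qed.

Definition mixnew n (u : past n * walkT n) : bool := ~~ cov (wst n u.1) (x n) &&
  (lo (wst n u.1) (x n)%:E < (mixpos u)%:E < hi (wst n u.1) (x n)%:E)%E.

Lemma measurable_mixnew n : mfun (@mixnew n).
Proof.
have [mc ml mh] := mstate_fst n.
have mp : mfun (fun u : past n * walkT n => (@mixpos n u)%:E) by apply/measurable_EFinP; exact: measurable_mixpos.
apply: measurable_and; first exact: measurable_neg.
by apply: measurable_and; exact: measurable_fun_lte.
Qed.

Let measurable_imply d' (T : measurableType d') (a b : T -> bool) : mfun a ->
  mfun b -> mfun (fun w => a w ==> b w).
Proof.
move=> ma mb; rewrite (_ : (fun w => _) = (fun w => ~~ a w || b w)); last by apply/funext => w; rewrite implybE.
by apply: measurable_or => //; exact: measurable_neg.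
Qed.

Section right.
Variable t : R.
Definition rvoid n w := void_right x (bpos w) t n.

Lemma past_rvoid n : @measurable_fun _ _ (past n) bool setT (rvoid n).
Proof.
elim: n => [|n IH]; first exact: measurable_cst.
have m1 : @measurable_fun _ _ (past n.+1) bool setT (rvoid n).
  exact: (sub_generated (@past_gen_le _ _ _ B e n) IH).
have m2 : @measurable_fun _ _ (past n.+1) bool setT (fun w => wnew n w ==> (wpos n w <= t)%R).
  apply: (measurable_imply (@past_new n)).
  by apply: measurable_fun_ler => //; exact: past_wpos (past_wst n).
exact: (measurable_and m1 m2).
Qed.

Lemma measurable_rvoid n : mfun (rvoid n).
Proof. exact: (measurable_generated (past_gen_measurable mB me (n := n)) (@past_rvoid n)). Qed.

Local Notation pot := (void_potential U D t).

Lemma pot_ge0 v : 0 <= pot v.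
Proof.
have Ule z : 0 <= rderive U z by exact: (U'_ge0 kR U0 U_nd U_ode).
have Dle z : rderive D z <= 0 by exact: (D'_le0 kR D0 D_ni D_ode).
case: v => [r| |] /=; [|by rewrite divr_ge0|by rewrite divr_ge0].
case: ifP => _; first by rewrite invr_ge0 ltW.
apply: divr_ge0; last exact: ltW.
apply: divr_ge0 => //; rewrite subr_ge0 (@le_trans _ _ 0)//.
  by rewrite mulr_le0_ge0// ltW.
by rewrite mulr_ge0// ltW.
Qed.

Lemma measurable_pot d' (T : measurableType d') (f : T -> \bar R) : mfun f ->
  mfun (fun w => pot (f w)).
Proof.
move=> mf; have -> : (fun w => pot (f w)) = (fun w => if f w is r%:E then
    (if t <= r then (D r)^-1 else void_fun U D t r / D r) else rderive U t / 2).
  by apply/funext => w; case: (f w).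
apply: (measurable_real_case (g := fun r => if t <= r then (D r)^-1 else void_fun U D t r / D r)) => //.
have mU : mfun U := continuous_measurable_fun cU.
have mD : mfun D := continuous_measurable_fun cD.
have mDi : mfun (fun r => (D r)^-1) := measurable_inv mD.
apply: measurable_fun_ifT => //; first exact: measurable_fun_ler.
apply: measurable_funM => //; apply: measurable_funM => //.
by apply: measurable_funB; exact: measurable_funM.
Qed.

(** The past being frozen, the potential is unchanged if the gap of x n has a finite upper end, by
    [right_void_step]; otherwise the step is [void_step]. The value of the constant is the potential
    of the empty state, whose end is -oo. *)
Lemma rvoid_martingale n :
  (\int[P]_w (if rvoid n w then pot (lo (wst n w) +oo) else 0)%:E = (rderive U t / 2)%:E)%E.
Proof.
elim: n => [|n <-].
  rewrite (eq_integral (fun=> (rderive U t / 2)%:E))//.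
  exact: integral_cst_prob.
pose h (u : past n * walkT n) := (if rvoid n u.1 && (mixnew u ==> (mixpos u <= t)) then
  pot (lo (gstep (x n) (mixpos u) (wst n u.1)) +oo) else 0)%:E.
have mp := @measurable_mixpos n.
have mh : mfun h.
  have [mc ml mhh] := mstate_mix n.
  apply/measurable_EFinP; apply: measurable_fun_ifT => //; last exact: measurable_pot.
  apply: measurable_and; first by apply: (measurableT_comp (@past_rvoid n)); exact: measurable_fst.
  by apply: measurable_imply; [exact: measurable_mixnew|exact: measurable_fun_ler].
have h0 u : (0 <= h u)%E by rewrite lee_fin; case: ifP => // _; exact: pot_ge0.
have := past_walk_integral mB me Be_independent mh h0; rewrite /h /= => ->.
have [mc ml mhh] := measurable_wst n.
apply: ge0_ae_eq_integral => //.
- exact: (mix_measurable mh h0).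
- by apply/measurable_EFinP; apply: measurable_fun_ifT => //; [exact: measurable_rvoid|exact: measurable_pot].
- by move=> w _; apply: integral_ge0 => w' _; exact: (h0 (w, w')).
- by move=> w _; rewrite lee_fin; case: ifP => // _; exact: pot_ge0.
apply: filterS good_walks => w [_ posP] _.
case: ifPn => [vw|nv] /=; last by rewrite integral0.
have es := ends_wst n w; have cst_int := integral_cst_prob P.
have [fx|fx] := boolP (cov (wst n w) (x n)).
  by rewrite /mixnew /= fx /=; under eq_integral do rewrite /gstep fx; rewrite cst_int.
have gx := gap_itv es fx.
have vc y z := @void_right_cov _ x (bpos w) posP t n y z vw.
pose g w' := gap_position kappa (lo (wst n w) (x n)%:E) (hi (wst n w) (x n)%:E) ((ext (B n))^~ w') (e n w').
have mg : mfun g := measurable_gp kR (BB n) (ee n) _ _.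
have mge : mfun (fun w' => (g w')%:E) by apply/measurable_EFinP.
have gI : {ae P, forall w', (lo (wst n w) (x n)%:E <= (g w')%:E <= hi (wst n w) (x n)%:E)%E}.
  apply: filterS (walk_positions kR U0 D0 U_nd D_ni U_ode D_ode W (BB n) (LL n) (ee n) (Be (n := n))) => w' [_ hw'].
  by have [] := hw' _ _ gx.
have ms := @mstate_cst _ _ Om (wst n w).
have [mc1 ml1 mh1] := mstate_step (x n) ms mg.
pose k w' : \bar R := (if (lo (wst n w) (x n)%:E < (g w')%:E < hi (wst n w) (x n)%:E)%E ==> (g w' <= t)
    then pot (lo (gstep (x n) (g w') (wst n w)) +oo) else 0)%:E.
have k0 w' : (0 <= k w')%E by rewrite lee_fin; case: ifP => // _; exact: pot_ge0.
rewrite (_ : (\int[P]_w' _)%E = (\int[P]_w' k w')%E); last first.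
  by apply: eq_integral => w' _; rewrite /k /mixnew /= fx.
have mk : mfun k.
  apply/measurable_EFinP; apply: measurable_fun_ifT => //; last exact: (measurable_pot (ml1 +oo%E)).
  apply: measurable_imply; last exact: (measurable_fun_ler mg (measurable_cst t)).
  exact: (measurable_and (measurable_fun_lte (measurable_cst _) mge) (measurable_fun_lte mge (measurable_cst _))).
have hoo' := void_step kR U0 D0 U_nd D_ni U_ode D_ode W (BB n) (LL n) (ee n) (Be (n := n)) t.
have [hoo|hr] := eqVneq (hi (wst n w) (x n)%:E) +oo%E.
  have ax : (lo (wst n w) (x n)%:E < (x n)%:E)%E by case/andP: gx.
  have loE : lo (wst n w) +oo%E = lo (wst n w) (x n)%:E.
    have xI : (lo (wst n w) (x n)%:E <= (x n)%:E <= hi (wst n w) (x n)%:E)%E by rewrite hoo leey (ltW ax).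
    by have := right_void_step es fx xI vc; rewrite {1}hoo eqxx => -[].
  rewrite loE -(hoo' _ ax) -hoo; apply: ge0_ae_eq_integral => //.
  - apply/measurable_EFinP; apply: measurable_fun_ifT => //.
      exact: (measurable_fun_lee mge (measurable_cst _)).
    apply: measurable_pot; apply/measurable_EFinP; exact: (measurable_maxr (measurable_cst (x n)) mg).
  - by move=> w' _; rewrite lee_fin; case: ifP => // _; exact: pot_ge0.
  apply: filterS gI => w' pI _; rewrite /k; congr EFin.
  have := right_void_step es fx pI vc; rewrite {1}hoo eqxx => -[_ -> ->].
  by [].
rewrite -[RHS]cst_int; apply: ge0_ae_eq_integral => //.
- by move=> w' _; rewrite lee_fin pot_ge0.
apply: filterS gI => w' pI _; rewrite /k; congr EFin.
by have := right_void_step es fx pI vc; rewrite (negbTE hr) => -[-> ->].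
Qed.

End right.

(** Once some x i > t is covered, the supremum r of the union is at least x i > t, and the potential
    there is 1 / D r. *)
Lemma rvoid_low t n i w : (i < n)%N -> t < x i -> (D (x i))^-1 <= void_potential U D t (lo (wst n w) +oo).
Proof.
move=> ni tx; have ci : cov (wst n w) (x i) by exact: cov_start.
case: (ends_wst n w) => /(_ +oo%E) + _ /(_ +oo%E (x i) isT ci (leey _)) + _.
case=> [->|[r -> _]]; first by rewrite leNgt ltNyr.
rewrite lee_fin /= => xr; rewrite (le_trans (ltW tx) xr) lef_pV2 ?posrE//; exact: D_ni.
Qed.

Lemma rvoid_high t n i w (l : R) : (i < n)%N -> t < x i -> 0 < l -> (forall y, l <= D y) ->
  void_potential U D t (lo (wst n w) +oo) <= l^-1.
Proof.
move=> ni tx l0 hl; have ci : cov (wst n w) (x i) by exact: cov_start.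
case: (ends_wst n w) => /(_ +oo%E) + _ /(_ +oo%E (x i) isT ci (leey _)) + _.
case=> [->|[r -> _]]; first by rewrite leNgt ltNyr.
by rewrite lee_fin /= => xr; rewrite (le_trans (ltW tx) xr) lef_pV2 ?posrE.
Qed.

Let bool_event (b : Om -> bool) : mfun b -> measurable [set w | b w].
Proof.
move=> mb; rewrite (_ : [set w | b w] = b @^-1` [set true]); first by rewrite -[X in measurable X]setTI; exact: mb.
by apply/seteqP; split => w.
Qed.

Let bool_integral (k : R) (b : Om -> bool) : mfun b -> 0 <= k ->
  (\int[P]_w (if b w then k else 0)%:E = k%:E * P [set w | b w])%E.
Proof.
move=> mb k0; have mE := bool_event mb.
rewrite (eq_integral (fun w => k%:E * (\1_[set w | b w] w)%:E)%E); last first.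
  by move=> w _; rewrite -EFinM indic_boolE; case: (b w); rewrite ?mulr1 ?mulr0.
by rewrite ge0_integralZl//= ?integral_indic ?setIT//; apply/measurable_EFinP; exact: measurable_indic.
Qed.

(** On the event the martingale is at least 1 / D (x i), and its mean is U' t / 2. *)
Lemma rvoid_le t n i : (i < n)%N -> t < x i -> (P [set w | rvoid t n w] <= (D (x i) * (rderive U t / 2))%:E)%E.
Proof.
move=> ni tx; have D0i : 0 < (D (x i))^-1 by rewrite invr_gt0.
have mv := @measurable_rvoid t n; have [_ ml _] := measurable_wst n.
have : (((D (x i))^-1)%:E * P [set w | rvoid t n w] <= (rderive U t / 2)%:E)%E.
  rewrite -bool_integral ?(ltW D0i)// -(rvoid_martingale t n); apply: ge0_le_integral => //.
  - by move=> w _; rewrite lee_fin; case: ifP => // _; exact: ltW.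
  - by apply/measurable_EFinP; exact: measurable_fun_ifT.
  - by apply/measurable_EFinP; apply: measurable_fun_ifT => //; exact: measurable_pot.
  by move=> w _; rewrite lee_fin; case: ifP => // _; exact: rvoid_low.
have f : P [set w | rvoid t n w] \is a fin_num by rewrite fin_num_measure//; exact: bool_event.
by rewrite -(fineK f) -EFinM !lee_fin ler_pdivrMl.
Qed.

Lemma rvoid_ge t n i (l : R) : (i < n)%N -> t < x i -> 0 < l -> (forall y, l <= D y) ->
  ((l * (rderive U t / 2))%:E <= P [set w | rvoid t n w])%E.
Proof.
move=> ni tx l0 hl; have l0i : 0 < l^-1 by rewrite invr_gt0.
have mv := @measurable_rvoid t n; have [_ ml _] := measurable_wst n.
have : ((rderive U t / 2)%:E <= (l^-1)%:E * P [set w | rvoid t n w])%E.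
  rewrite -bool_integral ?(ltW l0i)// -(rvoid_martingale t n); apply: ge0_le_integral => //.
  - by move=> w _; rewrite lee_fin; case: ifP => // _; exact: pot_ge0.
  - by apply/measurable_EFinP; apply: measurable_fun_ifT => //; exact: measurable_pot.
  - by apply/measurable_EFinP; exact: measurable_fun_ifT.
  by move=> w _; rewrite lee_fin; case: ifP => // _; exact: (rvoid_high w ni tx l0 hl).
have f : P [set w | rvoid t n w] \is a fin_num by rewrite fin_num_measure//; exact: bool_event.
by rewrite -(fineK f) -EFinM !lee_fin ler_pdivlMl.
Qed.

Lemma events_probability (F : nat -> Om -> bool) (v : R) :
  (forall n, mfun (F n)) -> (forall n w, F n.+1 w -> F n w) ->
  (forall eps : R, 0 < eps -> exists N, forall n, (N <= n)%N ->
    (P [set w | F n w] <= (v + eps)%:E)%E /\ ((v - eps)%:E <= P [set w | F n w])%E) ->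
  P (\bigcap_n [set w | F n w]) = v%:E.
Proof.
move=> mF dF hF; have mE n := bool_event (mF n).
have cP : P \o (fun n => [set w | F n w]) @ \oo --> P (\bigcap_n [set w | F n w]).
  apply: nonincreasing_cvg_mu => //.
  - by rewrite -ge0_fin_numE// fin_num_measure.
  - exact: bigcapT_measurable.
  by apply/nonincreasing_seqP => n; apply/subsetPset => w; exact: dF.
have mI : measurable (\bigcap_n [set w | F n w]) by exact: bigcapT_measurable.
have f : P (\bigcap_n [set w | F n w]) \is a fin_num by rewrite fin_num_measure.
rewrite -(fineK f) in cP *; congr EFin; apply/eqP; rewrite eq_le; apply/andP; split.
  apply/ler_addgt0Pr => eps eps0; have [N hN] := hF eps eps0.
  rewrite -lee_fin (fineK f); apply: le_trans (hN N (leqnn N)).1; apply: le_measure; rewrite ?inE//.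
  by move=> w /(_ N I).
apply/ler_addgt0Pl => eps eps0; have [N hN] := hF eps eps0.
rewrite addrC -lerBlDr -lee_fin; have <- := cvg_lim (@ereal_hausdorff R) cP.
apply: lime_ge; first by apply/cvg_ex; eexists; exact: cP.
by exists N => // n /= Nn; have [_] := hN n Nn.
Qed.

(** U' t / 2 lies between P / D (x i) and P / l, and D (x i) is close to l for a starting point far
    to the right. If l = 0 the upper bound alone gives the value 0. *)
Lemma rvoid_probability t (l : R) : 0 <= l -> (forall y, l <= D y) ->
  (forall eps : R, 0 < eps -> exists z, forall y, z <= y -> D y <= l + eps) ->
  P (\bigcap_n [set w | rvoid t n w]) = (l * (rderive U t / 2))%:E.
Proof.
move=> l0 hl happ; apply: events_probability => [n|n w|eps eps0].
- exact: measurable_rvoid.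
- by move=> /andP[].
have U'0 : 0 <= rderive U t / 2 by rewrite divr_ge0//; exact: (U'_ge0 kR U0 U_nd U_ode).
have [q q0 hq] := exists_mul_le U'0 eps0.
have [z hz] := happ q q0.
have [i /andP[i1 _]] : exists i, Num.max z t < x i < Num.max z t + 1 by apply: dense_itv; rewrite ltrDl.
move: i1; rewrite gt_max => /andP[zi ti].
exists i.+1 => n ni; split.
  apply: le_trans (rvoid_le ni ti) _; rewrite lee_fin.
  by apply: le_trans (_ : (l + q) * (rderive U t / 2) <= _); [rewrite ler_wpM2r// hz// ltW|rewrite mulrDl lerD2l].
move: l0; rewrite le_eqVlt => /predU1P[<-|lp]; last first.
  by apply: le_trans (rvoid_ge ni ti lp hl); rewrite lee_fin gerBl ltW.
by apply: le_trans (measure_ge0 _ _); rewrite lee_fin mul0r sub0r oppr_le0 ltW.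
Qed.

Section left.
Variable t : R.
Definition lvoid n w := void_left x (bpos w) t n.

Lemma past_lvoid n : @measurable_fun _ _ (past n) bool setT (lvoid n).
Proof.
elim: n => [|n IH]; first exact: measurable_cst.
have m1 : @measurable_fun _ _ (past n.+1) bool setT (lvoid n).
  exact: (sub_generated (@past_gen_le _ _ _ B e n) IH).
have m2 : @measurable_fun _ _ (past n.+1) bool setT (fun w => wnew n w ==> (t <= wpos n w)%R).
  apply: (measurable_imply (@past_new n)).
  by apply: measurable_fun_ler => //; exact: past_wpos (past_wst n).
exact: (measurable_and m1 m2).
Qed.

Lemma measurable_lvoid n : mfun (lvoid n).
Proof. exact: (measurable_generated (past_gen_measurable mB me (n := n)) (@past_lvoid n)). Qed.

(** The value at the infinite ends makes the functional of the empty state 0, so the supermartingale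
    property can only be expected once some starting point at most t is covered. *)
Definition inv_up (v : \bar R) : R := if v is r%:E then (U r)^-1 else 0.

Lemma inv_up_ge0 v : 0 <= inv_up v.
Proof. by case: v => [r| |] //=; rewrite invr_ge0 ltW. Qed.

Lemma measurable_inv_up d' (T : measurableType d') (f : T -> \bar R) : mfun f ->
  mfun (fun w => inv_up (f w)).
Proof.
move=> mf; apply: (measurable_real_case 0 mf (g := fun r => (U r)^-1)).
by apply: measurable_inv; exact: (continuous_measurable_fun cU).
Qed.

Definition lvoid_mean n : \bar R := (\int[P]_w (if lvoid n w then inv_up (hi (wst n w) -oo) else 0)%:E)%E.

(** Only a walk started below the union changes its infimum, from r to x n, and on the event it has
    to reach r. This has probability U (x n) / U r, which compensates the passage from 1 / U r to 1
    / U (x n). *)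
Lemma lvoid_supermartingale n i : (i < n)%N -> x i <= t -> (lvoid_mean n.+1 <= lvoid_mean n)%E.
Proof.
move=> ni xit.
pose h (u : past n * walkT n) := (if lvoid n u.1 && (mixnew u ==> (t <= mixpos u)) then
  inv_up (hi (gstep (x n) (mixpos u) (wst n u.1)) -oo) else 0)%:E.
have mp := @measurable_mixpos n.
have mh : mfun h.
  have [mc ml mhh] := mstate_mix n.
  apply/measurable_EFinP; apply: measurable_fun_ifT => //; last exact: measurable_inv_up.
  apply: measurable_and; first by apply: (measurableT_comp (@past_lvoid n)); exact: measurable_fst.
  by apply: measurable_imply; [exact: measurable_mixnew|exact: measurable_fun_ler].
have h0 u : (0 <= h u)%E by rewrite lee_fin; case: ifP => // _; exact: inv_up_ge0.
have := past_walk_integral mB me Be_independent mh h0; rewrite /lvoid_mean /h /= => ->.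
have [mc ml mhh] := measurable_wst n.
apply: ge0_le_integral => //.
- by move=> w _; apply: integral_ge0 => w' _; exact: (h0 (w, w')).
- exact: (mix_measurable mh h0).
- by apply/measurable_EFinP; apply: measurable_fun_ifT => //; [exact: measurable_lvoid|exact: measurable_inv_up].
move=> w _; case: ifPn => [vw|nv] /=; last by rewrite integral0.
have es := ends_wst n w; have cst_int := integral_cst_prob P.
have [fx|fx] := boolP (cov (wst n w) (x n)).
  by rewrite /mixnew /= fx /=; under eq_integral do rewrite /gstep fx; rewrite cst_int.
have gx := gap_itv es fx.
pose g w' := gap_position kappa (lo (wst n w) (x n)%:E) (hi (wst n w) (x n)%:E) ((ext (B n))^~ w') (e n w').
have mg : mfun g := measurable_gp kR (BB n) (ee n) _ _.
have mge : mfun (fun w' => (g w')%:E) by apply/measurable_EFinP.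
have gI : {ae P, forall w', (lo (wst n w) (x n)%:E <= (g w')%:E <= hi (wst n w) (x n)%:E)%E}.
  apply: filterS (walk_positions kR U0 D0 U_nd D_ni U_ode D_ode W (BB n) (LL n) (ee n) (Be (n := n))) => w' [_ hw'].
  by have [] := hw' _ _ gx.
have [mc1 ml1 mh1] := mstate_step (x n) (@mstate_cst _ _ Om (wst n w)) mg.
pose k w' : \bar R := (if (lo (wst n w) (x n)%:E < (g w')%:E < hi (wst n w) (x n)%:E)%E ==> (t <= g w')
    then inv_up (hi (gstep (x n) (g w') (wst n w)) -oo) else 0)%:E.
have k0 w' : (0 <= k w')%E by rewrite lee_fin; case: ifP => // _; exact: inv_up_ge0.
rewrite (_ : (\int[P]_w' _)%E = (\int[P]_w' k w')%E); last first.
  by apply: eq_integral => w' _; rewrite /k /mixnew /= fx.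
have mk : mfun k.
  apply/measurable_EFinP; apply: measurable_fun_ifT => //; last exact: (measurable_inv_up (mh1 -oo%E)).
  apply: measurable_imply; last exact: (measurable_fun_ler (measurable_cst t) mg).
  exact: (measurable_and (measurable_fun_lte (measurable_cst _) mge) (measurable_fun_lte mge (measurable_cst _))).
have It : (hi (wst n w) -oo <= t%:E)%E.
  have ci : cov (wst n w) (x i) by exact: cov_start.
  by case: es => _ _ _ /(_ -oo%E (x i) isT ci (leNye _)) /le_trans; apply; rewrite lee_fin.
have le_k f : mfun f -> (forall w', 0 <= f w')%E ->
    (forall w', (lo (wst n w) (x n)%:E <= (g w')%:E <= hi (wst n w) (x n)%:E)%E -> (k w' <= f w')%E) ->
    (\int[P]_w' k w' <= \int[P]_w' f w')%E.
  move=> mf f0 kf; apply: ae_ge0_le_integral => //.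
  by apply: filterS gI => w' pI _; exact: kf.
(* In a gap with a finite lower end the infimum of the union stays the same and the event can only
   shrink. *)
have [loo|hr] := eqVneq (lo (wst n w) (x n)%:E) -oo%E; last first.
  rewrite -[leRHS]cst_int; apply: le_k => //; first by move=> w'; rewrite lee_fin inv_up_ge0.
  move=> w' pI; have := left_void_step es fx pI It; rewrite (negbTE hr) /k => ->.
  by rewrite lee_fin; case: ifP => // _; exact: inv_up_ge0.
have [r hE] : exists r, hi (wst n w) (x n)%:E = r%:E.
  have xI : (lo (wst n w) (x n)%:E <= (x n)%:E <= hi (wst n w) (x n)%:E)%E by case/andP: gx => *; rewrite !ltW.
  have := left_void_step es fx xI It; rewrite {1}loo eqxx => -[e1 _].
  move: It; rewrite e1; case: (es) => _ /(_ (x n)%:E)[->|[r -> _]] _ _; last by exists r.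
  by rewrite leNgt ltry.
have hiE : hi (wst n w) -oo = r%:E.
  have xI : (lo (wst n w) (x n)%:E <= (x n)%:E <= hi (wst n w) (x n)%:E)%E by case/andP: gx => *; rewrite !ltW.
  by have := left_void_step es fx xI It; rewrite {1}loo eqxx => -[-> _].
have mrg : mfun (fun w' => r <= g w') by exact: (measurable_fun_ler (measurable_cst r) mg).
have Ux0 : 0 <= (U (x n))^-1 by rewrite invr_ge0 ltW.
apply: (@le_trans _ _ (\int[P]_w' (if (r <= g w')%R then (U (x n))^-1 else 0)%:E)%E).
  apply: le_k => //.
  - by apply/measurable_EFinP; exact: measurable_fun_ifT.
  - by move=> w'; rewrite lee_fin; case: ifP.
  move=> w' pI; have := left_void_step es fx pI It; rewrite {1}loo eqxx => -[_ hn].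
  rewrite /k lee_fin; case: ifPn => [/hn[+ ->]|_]; last by case: ifP.
  by rewrite hE lee_fin => ->.
rewrite bool_integral//.
rewrite [X in (_ * X)%E](cdf_upper_total kR U0 D0 U_nd D_ni U_ode D_ode W (BB n) (LL n) (ee n) (Be (n := n)) gx loo hE : _ = _).
by rewrite hiE /= -EFinM lee_fin mulrA mulVf ?mul1r// gt_eqF.
Qed.

(** At rank i + 1 the infimum of the union is at least r on the event, by [void_left_low]; from then
    on the mean does not increase. *)
Lemma lvoid_le n i r : (i < n)%N -> (forall k, (k <= i)%N -> r <= x k) -> r <= t -> x i <= t ->
  (lvoid_mean n <= ((U r)^-1)%:E)%E.
Proof.
move=> ni rx rt xit; have mean_i : (lvoid_mean i.+1 <= ((U r)^-1)%:E)%E.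
  rewrite -[leRHS](_ : (\int[P]_w ((U r)^-1)%:E)%E = _); last first.
    exact: integral_cst_prob.
  have [mc ml mh] := measurable_wst i.+1.
  apply: ae_ge0_le_integral => //.
  - by move=> w _; rewrite lee_fin; case: ifP => // _; exact: inv_up_ge0.
  - by apply/measurable_EFinP; apply: measurable_fun_ifT => //; [exact: measurable_lvoid|exact: measurable_inv_up].
  - by move=> w _; rewrite lee_fin invr_ge0 ltW.
  apply: filterS good_walks => w [_ posP] _; rewrite lee_fin; case: ifPn => [vw|_]; last by rewrite invr_ge0 ltW.
  have := void_left_low posP vw rt (fun k ki => rx k ki); rewrite -/(wst i.+1 w).
  have Ur0 : 0 <= (U r)^-1 by rewrite invr_ge0 ltW.
  case: (hi _ _) => [q| |] //=.
  by rewrite lee_fin => rq; rewrite lef_pV2 ?posrE// U_nd.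
move: ni => /subnKC <-; elim: (n - i.+1)%N => [|k IH]; first by rewrite addn0.
by rewrite addnS; apply: le_trans IH; apply: (lvoid_supermartingale (i := i)) => //; rewrite addSn ltnS leq_addr.
Qed.

(** On the event the infimum of the union is at most x j, so the mean is at least P / U (x j), while
    it is at most 1 / U r for a fixed r. Starting points far to the left make U (x j) / U r
    small. *)
Lemma lvoid_probability : (forall eps : R, 0 < eps -> exists z, forall y, y <= z -> U y <= eps) ->
  P (\bigcap_n [set w | lvoid n w]) = 0%:E.
Proof.
move=> hU; have [i /andP[_ it]] : exists i, t - 1 < x i < t by apply: dense_itv; rewrite gtrBl.
(* A lower bound of t and of the first i + 1 starting points. *)
pose r := \big[Num.min/t]_(k < i.+1) x k.
have rt : r <= t by exact: bigmin_le_id.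
have rx k : (k <= i)%N -> r <= x k.
  by rewrite -ltnS => ki; exact: (bigmin_le_cond t (fun k : 'I_i.+1 => x k) (j := Ordinal ki)).
apply: events_probability => [n|n w|eps eps0].
- exact: measurable_lvoid.
- by move=> /andP[].
(* Chosen so that U (x j) / U r is at most eps when x j < z. *)
have [z hz] := hU (eps * U r) (mulr_gt0 eps0 (U0 r)).
have [j /andP[_ jz]] : exists j, z - 1 < x j < z by apply: dense_itv; rewrite gtrBl.
exists (maxn i j).+1 => n; rewrite gtn_max => /andP[ni nj]; split; last first.
  by rewrite sub0r; apply: le_trans (measure_ge0 _ _); rewrite lee_fin oppr_le0 ltW.
have mv := @measurable_lvoid n; have [_ _ mh] := measurable_wst n.
have Uj0 : 0 <= (U (x j))^-1 by rewrite invr_ge0 ltW.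
have : (((U (x j))^-1)%:E * P [set w | lvoid n w] <= ((U r)^-1)%:E)%E.
  rewrite -bool_integral//; apply: le_trans (lvoid_le ni rx rt (ltW it)).
  have low : {ae P, forall w, setT w -> ((if lvoid n w then (U (x j))^-1 else 0)%:E <= (if lvoid n w then inv_up (hi (wst n w) -oo) else 0)%:E)%E}.
    apply: filterS good_walks => w [_ posP] _; rewrite lee_fin; case: ifPn => // vw.
    have ci : cov (wst n w) (x j) by exact: cov_start.
    pose r' := \big[Num.min/t]_(k < n) x k.
    have r'x k : (k < n)%N -> r' <= x k.
      by move=> kn; exact: (bigmin_le_cond t (fun k : 'I_n => x k) (j := Ordinal kn)).
    have := void_left_low posP vw (bigmin_le_id _ _ _ _ : r' <= t) r'x; rewrite -/(wst n w).
    case: (ends_wst n w) => _ _ _ /(_ -oo%E (x j) isT ci (leNye _)).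
    case: (hi _ _) => [q| |] //=.
    by rewrite lee_fin => qx _; rewrite lef_pV2 ?posrE// U_nd.
  apply: ae_ge0_le_integral low => //.
  - by move=> w _; rewrite lee_fin; case: ifP.
  - by apply/measurable_EFinP; exact: measurable_fun_ifT.
  - by move=> w _; rewrite lee_fin; case: ifP => // _; exact: inv_up_ge0.
  - by apply/measurable_EFinP; apply: measurable_fun_ifT => //; exact: measurable_inv_up.
have f : P [set w | lvoid n w] \is a fin_num by rewrite fin_num_measure//; exact: bool_event.
rewrite -(fineK f) -EFinM !lee_fin add0r ler_pdivrMl// => /le_trans; apply.
by rewrite ler_pdivrMr// hz// ltW.
Qed.

End left.

End walks.

(** * Limits at infinity and first moments of kappa *)

Section limits_at_infinity.
Context {R : realType} (kappa : borel_measure R) (kR : radon kappa).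
Variables U D : R -> R.
Hypotheses (U0 : forall y, 0 < U y) (D0 : forall y, 0 < D y)
  (U_nd : forall y z, y <= z -> U y <= U z) (D_ni : forall y z, y <= z -> D z <= D y)
  (U_ode : killed_ode kappa U) (D_ode : killed_ode kappa D)
  (W : forall y, D y * rderive U y - U y * rderive D y = 2).
Implicit Types (y z a : R).

Lemma positive_inf (f : R -> R) : (forall y, 0 < f y) ->
  [/\ 0 <= inf (range f), forall y, inf (range f) <= f y &
    forall eps, 0 < eps -> exists z, f z < inf (range f) + eps].
Proof.
move=> f0; have hi : has_inf (range f).
  by split; [exists (f 0), 0|exists 0 => _ [y _ <-]; exact: ltW].
split=> [|y|eps eps0].
- by apply: lb_le_inf; [exists (f 0), 0|move=> _ [y _ <-]; exact: ltW].
- by apply: ge_inf; [case: hi|exists y].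
by have [_ [z _ <-] hz] := inf_adherent eps0 hi; exists z.
Qed.

Lemma lim_down : lim (D y @[y --> +oo]) = inf (range D).
Proof.
have [_ h1 h2] := positive_inf D0; apply: cvg_lim => //.
apply/cvgrPdist_le => eps eps0; have [z hz] := h2 eps eps0.
exists z; split; first exact: num_real.
move=> y zy /=; rewrite distrC ger0_norm ?subr_ge0// lerBlDl.
by rewrite (le_trans (D_ni (ltW zy)))// ltW.
Qed.

Let nat_gt (y : R) : exists N : nat, forall n, (N <= n)%N -> `|y| < n%:R.
Proof.
exists (Num.bound `|y|) => n Nn; apply: lt_le_trans (archi_boundP (normr_ge0 y)) _.
by rewrite ler_nat.
Qed.

Lemma itg_cvg_left a (f : R -> R) : continuous f -> (forall y, y <= a -> 0 <= f y) ->
  (fun n : nat => (itg kappa (a - n%:R) a f)%:E) @ \oo --> (\int[kappa]_(y in `]-oo, a]) (f y)%:E)%E.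
Proof.
move=> cf f0; pose F (n : nat) : set (measurableTypeR R) := `]a - n%:R, a]%classic.
have nd : nondecreasing_seq F.
  move=> n m nm; apply/subsetPset => y; rewrite /F /= !in_itv/= => /andP[h ->]; rewrite andbT.
  by apply: le_lt_trans h; rewrite lerD2l lerN2 ler_nat.
have cap : \bigcup_n F n = `]-oo, a]%classic.
  apply/seteqP; split => y; first by move=> [n _]; rewrite /F /= !in_itv/= => /andP[].
  rewrite /= in_itv/= => ya; have [N hN] := nat_gt (a - y); exists N => //.
  rewrite /F /= in_itv/= ya andbT; have := hN N (leqnn N); rewrite ltr_norml => /andP[_]; lra.
have := @ge0_nondecreasing_set_cvg_integral _ _ _ F (fun y => (f y)%:E) kappa nd.
rewrite cap (_ : (fun n => _) = (fun n : nat => (itg kappa (a - n%:R) a f)%:E)); last by apply/funext => n; rewrite EFin_itg.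
apply.
- by move=> n; exact: measurable_itv.
- by move=> n; apply/measurable_EFinP; apply: measurable_funTS; exact: continuous_measurable_fun.
by move=> n y; rewrite /F /= in_itv/= lee_fin => /andP[_ /f0].
Qed.

Lemma itg_cvg_right a (f : R -> R) : continuous f -> (forall y, a < y -> 0 <= f y) ->
  (fun n : nat => (itg kappa a (a + n%:R) f)%:E) @ \oo --> (\int[kappa]_(y in `]a, +oo[) (f y)%:E)%E.
Proof.
move=> cf f0; pose F (n : nat) : set (measurableTypeR R) := `]a, a + n%:R]%classic.
have nd : nondecreasing_seq F.
  move=> n m nm; apply/subsetPset => y; rewrite /F /= !in_itv/= => /andP[-> h] /=.
  by apply: le_trans h _; rewrite lerD2l ler_nat.
have cap : \bigcup_n F n = `]a, +oo[%classic.
  apply/seteqP; split => y; first by move=> [n _]; rewrite /F /= !in_itv/= andbT => /andP[].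
  rewrite /= in_itv/= andbT => ya; have [N hN] := nat_gt (y - a); exists N => //.
  rewrite /F /= in_itv/= ya /=; have := hN N (leqnn N); rewrite ltr_norml => /andP[_]; lra.
have := @ge0_nondecreasing_set_cvg_integral _ _ _ F (fun y => (f y)%:E) kappa nd.
rewrite cap (_ : (fun n => _) = (fun n : nat => (itg kappa a (a + n%:R) f)%:E)); last by apply/funext => n; rewrite EFin_itg.
apply.
- by move=> n; exact: measurable_itv.
- by move=> n; apply/measurable_EFinP; apply: measurable_funTS; exact: continuous_measurable_fun.
by move=> n y; rewrite /F /= in_itv/= lee_fin => /andP[/f0].
Qed.

Let cU : continuous U := continuous_U kR U0 U_ode.
Let cD : continuous D := continuous_D kR D0 D_ode.
Let solU := sol_U kR U0 U_ode.
Let solD := sol_D kR D0 D_ode.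

(** The integral over ]a - n, a] is half the increment of U', and U' tends to 0 at -oo. *)
Lemma integral_up a : (\int[kappa]_(y in `]-oo, a]) (U y)%:E = (rderive U a / 2)%:E)%E.
Proof.
apply: (cvg_unique _ (itg_cvg_left cU (fun y _ => ltW (U0 y)))) => //.
apply: cvg_EFin; first exact: nearW.
apply/cvgrPdist_le => eps eps0; have [z za hz] := U'_to0 kR U0 U_ode a eps0.
have [N hN] := nat_gt (a - z); exists N => // n /= Nn.
have an : a - n%:R <= z by have := hN n Nn; rewrite ltr_norml => /andP[_]; lra.
have -> : itg kappa (a - n%:R) a U = (rderive U a - rderive U (a - n%:R)) / 2.
  by case: solU => _ _ h _; rewrite (h (a - n%:R) a) ?gerBl// [2 * _]mulrC mulfK.
have := hz _ an; have := U'_ge0 kR U0 U_nd U_ode (a - n%:R).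
move: (rderive U a) (rderive U (a - _)) => u v v0 ve.
by rewrite (_ : u / 2 - (u - v) / 2 = v / 2) ?ger0_norm ?divr_ge0//; [lra|field].
Qed.

(** The backward Taylor formula gives D 0 >= 2 times the integral of y D y over ]0, n], hence at
    least 2 (inf D) times that of y. A positive infimum would therefore bound the first moment by D
    0 / (2 inf D). *)
Lemma moment_right : (\int[kappa]_(y in `]0%R, +oo[) y%:E = +oo)%E -> inf (range D) = 0.
Proof.
have [l0 hl _] := positive_inf D0; move: l0; rewrite le_eqVlt => /predU1P[<-//|lp] moo.
exfalso; have cid : continuous (fun y : R => y) by move=> y; exact: cvg_id.
have cv := itg_cvg_right cid (a := 0) (fun y h => ltW h).
suff : (\int[kappa]_(y in `]0%R, +oo[) y%:E <= (D 0 / (2 * inf (range D)))%:E)%E by rewrite moo leNgt ltry.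
rewrite -(cvg_lim _ cv)//; apply: lime_le; first by apply/cvg_ex; eexists; exact: cv.
apply: nearW => n; rewrite lee_fin add0r ler_pdivlMr ?mulr_gt0//.
have n0 : 0 <= n%:R :> R by [].
have := sol_backward kR solD n0.
have D'0 : n%:R * rderive D n%:R <= 0 by rewrite mulr_ge0_le0//; exact: (D'_le0 kR D0 D_ni D_ode).
have le_ : inf (range D) * itg kappa 0 n%:R id <= itg kappa 0 n%:R (fun y => (y - 0) * D y).
  rewrite -itgZ//; apply: le_itg => //.
  - by move=> y; apply: cvgM; [exact: cvg_cst|exact: cvg_id].
  - move=> y; apply: cvgM; last exact: cD.
    by apply: cvgB; [exact: cvg_id|exact: cvg_cst].
  by move=> y /andP[y0 _]; rewrite subr0 mulrC ler_wpM2l// ltW.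
have := D0 n%:R; move: le_ D'0; rewrite subr0; lra.
Qed.

Lemma moment_left : (\int[kappa]_(y in `]-oo, 0%R]) `|y|%:E = +oo)%E -> inf (range U) = 0.
Proof.
have [l0 hl _] := positive_inf U0; move: l0; rewrite le_eqVlt => /predU1P[<-//|lp] moo.
exfalso; have cn : continuous (fun y : R => `|y|) by exact: norm_continuous.
have cv := itg_cvg_left (a := 0) cn (fun y _ => normr_ge0 y).
suff : (\int[kappa]_(y in `]-oo, 0%R]) `|y|%:E <= (U 0 / (2 * inf (range U)))%:E)%E by rewrite moo leNgt ltry.
rewrite -(cvg_lim _ cv)//; apply: lime_le; first by apply/cvg_ex; eexists; exact: cv.
apply: nearW => n; rewrite lee_fin sub0r ler_pdivlMr ?mulr_gt0//.
have n0 : - n%:R <= 0 :> R by rewrite oppr_le0.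
case: solU => _ _ _ /(_ _ _ n0).
have U'0 : 0 <= n%:R * rderive U (- n%:R) by rewrite mulr_ge0//; exact: (U'_ge0 kR U0 U_nd U_ode).
have le_ : inf (range U) * itg kappa (- n%:R) 0 (fun y => `|y|) <= itg kappa (- n%:R) 0 (fun y => (0 - y) * U y).
  rewrite -itgZ//; apply: le_itg => //.
  - by move=> y; apply: cvgM; [exact: cvg_cst|exact: norm_continuous].
  - move=> y; apply: cvgM; last exact: cU.
    by apply: cvgB; [exact: cvg_cst|exact: cvg_id].
  by move=> y /andP[_ y0]; rewrite ler0_norm// sub0r mulrC ler_wpM2l// oppr_ge0.
have := U0 (- n%:R); move: le_ U'0; rewrite sub0r opprK; lra.
Qed.

(** By [UD_growth] the integrand is at most C + 2 |y|. Outside [- 1, 1] the constant is absorbed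
    into C |y|, and [- 1, 1] has finite kappa-measure. *)
Lemma green_integrable (A : set (measurableTypeR R)) : measurable A ->
  (\int[kappa]_(y in A) `|y|%:E < +oo)%E -> (\int[kappa]_(y in A) (U y * D y)%:E < +oo)%E.
Proof.
move=> mA fin; pose C := U 0 * D 0; have C0 : 0 <= C by rewrite mulr_ge0// ltW.
pose J : set (measurableTypeR R) := `[-1, 1]%classic.
have mJ : measurable J by exact: measurable_itv.
have mU : measurable_fun A (fun y : measurableTypeR R => (U y * D y)%:E).
  apply/measurable_EFinP; apply: measurable_funTS.
  by apply: measurable_funM; exact: continuous_measurable_fun.
have mn : measurable_fun A (fun y : measurableTypeR R => `|y|%:E).
  by apply/measurable_EFinP; apply: measurable_funTS; exact: continuous_measurable_fun (@norm_continuous _ _).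
have mI : measurable_fun A (fun y : measurableTypeR R => (\1_J y : R)%:E).
  by apply/measurable_EFinP; apply: measurable_funTS; exact: measurable_indic.
apply: (@le_lt_trans _ _ (\int[kappa]_(y in A) (C%:E * (\1_J y : R)%:E + (C + 2)%:E * `|y|%:E))%E).
  apply: ge0_le_integral => //.
  - by move=> y _; rewrite lee_fin mulr_ge0// ltW.
  - by apply: emeasurable_funD; apply: measurable_funeM.
  move=> y _; rewrite -!EFinM -EFinD lee_fin.
  apply: le_trans (UD_growth kR U0 D0 U_nd D_ni U_ode D_ode W y) _; rewrite -/C.
  have n0 : 0 <= C * `|y| by rewrite mulr_ge0.
  rewrite indicE (mulrDl C 2); case: (boolP (y \in J)) => [_|].
    by rewrite mulr1 lerD2l lerDr.
  move=> /negP; rewrite inE /J /= in_itv/= -ler_norml => /negP; rewrite -ltNge => /ltW y1.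
  by rewrite mulr0 add0r lerD2r ler_peMr.
rewrite ge0_integralD//; last 4 first.
- by move=> y _; rewrite -EFinM lee_fin mulr_ge0.
- exact: measurable_funeM.
- by move=> y _; rewrite -EFinM lee_fin mulr_ge0// addr_ge0.
- exact: measurable_funeM.
rewrite !ge0_integralZl//; last by rewrite lee_fin addr_ge0.
rewrite integral_indic//; apply: lte_add_pinfty.
  apply: lte_mul_pinfty => //.
  apply: le_lt_trans _ (kR (@segment_compact R (-1) 1)).
  by apply: le_measure; rewrite ?inE//; exact: measurableI.
by apply: lte_mul_pinfty => //; rewrite lee_fin addr_ge0.
Qed.

End limits_at_infinity.

(** * Finite, void and infinite random sets *)

Lemma finite_bounded {R : realType} (A : set R) : finite_set A -> exists M, forall y, A y -> `|y| <= M.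
Proof.
move=> /finite_seqP[s ->]; exists (\big[Num.max/0]_(y <- s) `|y|) => y /= ys.
exact: (le_bigmax_seq 0 y xpredT (fun y => `|y|) ys isT).
Qed.

Lemma void_right_points {R : realType} (x : nat -> R) pos (t : R) :
  [set gpos x pos k | k in [set k | is_new x pos k]] `&` `]t, +oo[%classic = set0 <->
  forall n, void_right x pos t n.
Proof.
split=> [Y0 n|h].
  apply/void_rightP => k _ nk; rewrite leNgt; apply/negP => tk.
  suff : (set0 : set R) (gpos x pos k) by [].
  by rewrite -Y0; split; [exists k|rewrite /= in_itv/= tk].
apply/seteqP; split => // _ [[k nk <-]]; rewrite /= in_itv/= andbT ltNge.
by have /void_rightP/(_ k (ltnSn k) nk) -> := h k.+1.
Qed.

Lemma void_left_points {R : realType} (x : nat -> R) pos (t : R) :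
  [set gpos x pos k | k in [set k | is_new x pos k]] `&` `]-oo, t[%classic = set0 ->
  forall n, void_left x pos t n.
Proof.
move=> Y0 n; apply/void_leftP => k _ nk; rewrite leNgt; apply/negP => tk.
suff : (set0 : set R) (gpos x pos k) by [].
by rewrite -Y0; split; [exists k|rewrite /= in_itv/= tk].
Qed.

Section random_sets.
Context {R : realType} {d : measure_display} {Om : measurableType d}.
Variable P : probability Om R.
Implicit Types Y : Om -> set R.

(** An integrable series is finite almost surely, and the counting measure is finite on finite sets
    only. *)
Lemma expectation_counting Y (f : nat -> Om -> \bar R) v :
  (forall n w, (0 <= f n w)%E) -> (forall n, mfun (f n)) ->
  {ae P, forall w, counting (Y w) = (\sum_(0 <= n <oo) f n w)%E} ->
  (\int[P]_w (\sum_(0 <= n <oo) f n w) = v)%E -> (v < +oo)%E ->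
  [/\ {ae P, forall w, finite_set (Y w)},
    completed_expectation P (fun w => counting (Y w)) v & (v < +oo)%E].
Proof.
move=> f0 mf ae_ fv voo; set g := fun w => (\sum_(0 <= n <oo) f n w)%E.
have mg : mfun g by exact: ge0_emeasurable_sum.
have g0 w : (0 <= g w)%E by exact: nneseries_ge0.
split=> //; last by exists g.
have : P.-integrable setT g.
  by apply/integrableP; split => //; under eq_integral do rewrite gee0_abs//; rewrite fv.
move=> /(integrable_ae measurableT); apply: filterS2 ae_ => w hw /(_ I); rewrite /g -hw /counting.
by case: asboolP.
Qed.

Lemma void_ae_nonempty Y (A : set R) (F : set Om) :
  {ae P, forall w, Y w `&` A = set0 -> F w} -> measurable F -> P F = 0%E ->
  {ae P, forall w, Y w `&` A !=set0}.
Proof.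
move=> YF mF PF; have : P.-negligible F by apply/negligibleP.
move=> [N [mN N0 FN]]; have aeF : {ae P, forall w, ~ F w}.
  by exists N; split => // w /= nF; apply: FN; exact: contrapT.
apply: filterS2 YF aeF => w YF nF; apply/set0P/eqP => /YF; exact: nF.
Qed.

(** A finite set is bounded, whereas almost surely Y has points beyond every integer. *)
Lemma infinite_right Y :
  (forall m : nat, {ae P, forall w, Y w `&` `]m%:R, +oo[%classic !=set0}) ->
  {ae P, forall w, infinite_set (Y w `&` `]0, +oo[%classic)}.
Proof.
move=> h; have /ae_foralln := h; apply: filterS => w hw /finite_bounded[M hM].
have [y [Yy]] := hw (Num.bound M); rewrite /= in_itv/= andbT => my.
have y0 : 0 < y by apply: le_lt_trans my.
have /hM : (Y w `&` `]0, +oo[%classic) y by split => //; rewrite /= in_itv/= y0.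
rewrite leNgt (gtr0_norm y0) => /negP; apply.
exact: lt_trans (unstable.ltr_bound M) my.
Qed.

Lemma infinite_left Y :
  (forall m : nat, {ae P, forall w, Y w `&` `]-oo, - m%:R[%classic !=set0}) ->
  {ae P, forall w, infinite_set (Y w)}.
Proof.
move=> h; have /ae_foralln := h; apply: filterS => w hw /finite_bounded[M hM].
have [y [Yy]] := hw (Num.bound M); rewrite /= in_itv/= ltrNr => my.
have /hM := Yy; rewrite leNgt -normrN => /negP; apply.
by apply: lt_trans (unstable.ltr_bound M) _; rewrite (lt_le_trans my)// ler_norm.
Qed.

End random_sets.
Theorem proposition6p9 (R : realType)
  (kappa : {measure set (measurableTypeR R) -> \bar R})
  (kappa_radon : radon kappa)
  (kappa_neq0 : kappa setT <> 0%E)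
  (u_up u_down : R -> R)
  (u_up_gt0 : forall y, 0 < u_up y)
  (u_down_gt0 : forall y, 0 < u_down y)
  (u_up_nondecreasing : forall y z, y <= z -> u_up y <= u_up z)
  (u_down_nonincreasing : forall y z, y <= z -> u_down z <= u_down y)
  (u_up_ode : killed_ode kappa u_up)
  (u_down_ode : killed_ode kappa u_down)
  (wronskian : forall y,
    u_down y * rderive u_up y - u_up y * rderive u_down y = 2)
  (x : nat -> R) (x_inj : injective x) (x_dense : dense (range x))
  (d : measure_display) (Om : measurableType d) (P : probability Om R)
  (B : nat -> R -> Om -> R) (L : nat -> R -> R -> Om -> R)
  (e : nat -> Om -> R)
  (B_brownian : forall n, brownian_motion P (x n) (B n))
  (L_local_time : forall n, local_time P (B n) (L n))
  (e_exponential : forall n, exponential_rv P 1 (e n))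
  (Be_independent : mutually_independent P (fun i : nat + nat =>
    match i with
    | inl n => sigma_process (B n) `[0, +oo[
    | inr n => sigma_rv (e n)
    end)) :
  let Y := killing_points kappa x B L e in
  let G := green u_up u_down in
  [/\ (\int[kappa]_(y in `]0%R, +oo[) y%:E < +oo)%E ->
      [/\ {ae P, forall w, finite_set (Y w `&` `]0, +oo[)},
          completed_expectation P (fun w => counting (Y w `&` `]0, +oo[))
            (\int[kappa]_(y in `]0%R, +oo[) (G y y)%:E)%E &
          (\int[kappa]_(y in `]0%R, +oo[) (G y y)%:E < +oo)%E],
      (\int[kappa]_(y in `]0%R, +oo[) y%:E = +oo)%E ->
      {ae P, forall w, infinite_set (Y w `&` `]0, +oo[)},
      forall a : R,
        completed_probability P [set w | Y w `&` `]a, +oo[ = set0]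
          ((lim (u_down y @[y --> +oo]))%:E *
           \int[kappa]_(y in `]-oo, a]) (u_up y)%:E)%E,
      (\int[kappa]_y `|y|%:E < +oo)%E ->
      [/\ {ae P, forall w, finite_set (Y w)},
          completed_expectation P (fun w => counting (Y w))
            (\int[kappa]_y (G y y)%:E)%E &
          (\int[kappa]_y (G y y)%:E < +oo)%E] &
      (\int[kappa]_y `|y|%:E = +oo)%E ->
      {ae P, forall w, infinite_set (Y w)}].
Proof.
move: kappa_radon u_up_gt0 u_down_gt0 u_up_nondecreasing u_down_nonincreasing u_up_ode
  u_down_ode wronskian B_brownian L_local_time e_exponential Be_independent =>
  kR U0 D0 U_nd D_ni U_ode D_ode W BB LL ee Be Y G.
have gw : {ae P, forall w, Y w =
    [set wpos kappa x B e k w | k in [set k | wnew kappa x B e k w]]}.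
  apply: filterS (good_walks kR U0 D0 U_nd D_ni U_ode D_ode W BB LL ee Be) => w [].
  by [].
have Ge y : G y y = u_up y * u_down y by rewrite /G /green minxx maxxx.
(* For an arbitrary Borel set, so as to serve both ]0, +oo[ and the whole line. *)
have expectation (A : set (measurableTypeR R)) : measurable A ->
    (\int[kappa]_(y in A) `|y|%:E < +oo)%E ->
    [/\ {ae P, forall w, finite_set (Y w `&` A)},
      completed_expectation P (fun w => counting (Y w `&` A))
        (\int[kappa]_(y in A) (G y y)%:E)%E &
      (\int[kappa]_(y in A) (G y y)%:E < +oo)%E].
  move=> mA fin; under eq_integral do rewrite Ge.
  apply: (expectation_counting (f := new_in kappa x B e A)).
  - by move=> n w; rewrite lee_fin.
  - by move=> n; exact: (measurable_new_in kR BB ee).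
  - exact: (counting_points kR U0 D0 U_nd D_ni U_ode D_ode W BB LL ee Be).
  - exact: (new_total kR U0 D0 U_nd D_ni U_ode D_ode W x_dense BB LL ee Be).
  - exact: (green_integrable kR U0 D0 U_nd D_ni U_ode D_ode W mA fin).
have mright t : measurable (\bigcap_n [set w | rvoid kappa x B e t n w]).
  apply: bigcapT_measurable => n; rewrite -[X in measurable X]setTI.
  exact: (measurable_rvoid kR BB ee t n measurableT (Y := [set true])).
have right t : P (\bigcap_n [set w | rvoid kappa x B e t n w]) =
    (inf (range u_down) * (rderive u_up t / 2))%:E.
  have [l0 hl hz] := positive_inf D0.
  apply: (rvoid_probability kR U0 D0 U_nd D_ni U_ode D_ode W x_dense BB LL ee Be t l0 hl) => eps /hz[z hz'].
  by exists z => y zy; exact: le_trans (D_ni _ _ zy) (ltW hz').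
have infr : (\int[kappa]_(y in `]0%R, +oo[) y%:E = +oo)%E ->
    {ae P, forall w, infinite_set (Y w `&` `]0, +oo[)}.
  move=> moo; apply: infinite_right => m.
  apply: (void_ae_nonempty (F := \bigcap_n [set w | rvoid kappa x B e m%:R n w])) => //.
    by apply: filterS gw => w ->; rewrite void_right_points => h n _; exact: h.
  rewrite right (moment_right kR D0 D_ni D_ode moo).
  by rewrite mul0r.
have infl : (\int[kappa]_(y in `]-oo, 0%R]) `|y|%:E = +oo)%E ->
    {ae P, forall w, infinite_set (Y w)}.
  move=> moo; apply: infinite_left => m.
  apply: (void_ae_nonempty (F := \bigcap_n [set w | lvoid kappa x B e (- m%:R) n w])).
  - by apply: filterS gw => w -> /void_left_points h n _; exact: h.
  - apply: bigcapT_measurable => n; rewrite -[X in measurable X]setTI.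
    exact: (measurable_lvoid kR BB ee _ n measurableT (Y := [set true])).
  apply: (lvoid_probability kR U0 D0 U_nd D_ni U_ode D_ode W x_dense BB LL ee Be) => eps eps0.
  have [_ _ /(_ _ eps0)[z]] := positive_inf U0.
  rewrite (moment_left kR U0 U_nd U_ode moo) add0r => hz.
  by exists z => y yz; exact: le_trans (U_nd _ _ yz) (ltW hz).
have absr : (\int[kappa]_(y in `]0%R, +oo[) `|y|%:E = \int[kappa]_(y in `]0%R, +oo[) y%:E)%E.
  by apply: eq_integral => y; rewrite inE /= in_itv/= andbT => y0; rewrite gtr0_norm.
split=> //.
- by rewrite -absr => fin; apply: expectation => //; exact: measurable_itv.
- move=> a; exists (\bigcap_n [set w | rvoid kappa x B e a n w]); first exact: mright.
  split; last by rewrite right (lim_down D0 D_ni)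
    (integral_up kR U0 U_nd U_ode) EFinM.
  apply: filterS gw => w Yw /=; rewrite Yw void_right_points.
  by split=> [h n _|h n]; [exact: h|exact: (h n I)].
- move=> fin; have := expectation setT measurableT fin.
  by under [X in completed_expectation P X]eq_fun do rewrite setIT; move=> [+ ? ?];
    under eq_near do rewrite setIT.
have mn : measurable_fun setT (fun y : measurableTypeR R => `|y|%:E).
  by apply/measurable_EFinP; exact: continuous_measurable_fun (@norm_continuous _ _).
(* If the first absolute moment is infinite on the line, it is infinite on one of the two
   half-lines. *)
have -> : [set: measurableTypeR R] = `]-oo, 0%R]%classic `|` `]0%R, +oo[%classic.
  by apply/seteqP; split => y // _; case: (leP y 0) => y0; [left|right]; rewrite /= in_itv/= y0.
rewrite ge0_integral_setU//; last 2 first.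
- exact: measurable_funTS.
- by apply/disj_setPS => y []; rewrite /= !in_itv/= andbT => y0; rewrite ltNge y0.
rewrite absr => oo; have [/infr|fr] := eqVneq (\int[kappa]_(y in `]0%R, +oo[) y%:E)%E +oo%E.
  by apply: filterS => w h Yf; apply: h; exact: finite_setIl.
apply: infl; apply/eqP; apply: contraNT fr; rewrite -ltey => lfin.
by apply: contraT; rewrite -ltey => rfin; have := lte_add_pinfty lfin rfin; rewrite oo.
Qed.
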